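(* Let $\alpha>\frac12$, $\nu>0$, let $N_n(k)$ denote the number of vertices of degree exactly $k$ in the KPKVB random graph $G(n;\alpha,\nu)$, put $\xi=\frac{4\alpha\nu}{\pi(2\alpha-1)}$, and consider a sequence of integers $(k_n)_n$ with $0\le k_n\le n-1$. \begin{enumerate} \item If $k_n\ll n^{\frac1{2\alpha+1}}$ as $n\to\infty$, then a.a.s. $N_n(k_n)=(1+o(1))\,n\,\pi(k_n)$, where $\pi(k)=2\alpha\xi^{2\alpha}\,\Gamma^+(k-2\alpha,\xi)/k!$; that is, $N_n(k_n)/(n\pi(k_n))\to1$ in probability. \item If $k_n=(1+o(1))\,c\,n^{\frac1{2\alpha+1}}$ for some fixed $c>0$, then $N_n(k_n)$ converges in distribution, as $n\to\infty$, to a Poisson random variable with mean $2\alpha\xi^{2\alpha}c^{-(2\alpha+1)}$. \item If $k_n\gg n^{\frac1{2\alpha+1}}$, then a.a.s. $N_n(k_n)=0$. \end{enumerate}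
   Context: KPKVB model. Points of the hyperbolic plane $\mathbb H$ (curvature $-1$) are written in hyperbolic polar coordinates $(r,\theta)$ with respect to an origin $O$. Given $n$ and fixed $\alpha>\frac12,\nu>0$, put $R=2\log(n/\nu)$. The random graph $G(n;\alpha,\nu)$ has as vertices $n$ i.i.d. points $u_i=(r_i,\theta_i)$, where $\theta_i$ is uniform on $(-\pi,\pi]$ and, independently, $r_i$ has distribution function $F(r)=\frac{\cosh(\alpha r)-1}{\cosh(\alpha R)-1}$ on $[0,R]$ ($0$ for $r<0$, $1$ for $r>R$). Two distinct vertices $u_i,u_j$ are adjacent iff their hyperbolic distance is at most $R$, equivalently $\cosh r_i\cosh r_j-\sinh r_i\sinh r_j\cos(|\theta_i-\theta_j|_{2\pi})\le\cosh R$, where $|a|_b=\min(|a|,b-|a|)$ for $-b\le a\le b$. $\Gamma^+(a,b)=\int_b^\infty t^{a-1}e^{-t}dt$ is the upper incomplete gamma function. For positive sequences, $a_n\ll b_n$ means $a_n/b_n\to0$ and $a_n\gg b_n$ means $b_n\ll a_n$. A sequence of events holds a.a.s. (asymptotically almost surely) if their probabilities tend to $1$ as $n\to\infty$. *)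

(* Defs.v *)
From HB Require Import structures.
From mathcomp Require Import all_boot all_order all_algebra.
From mathcomp Require Import all_classical all_reals all_analysis.
From mathcomp Require Import measurable_realfun.

Set Implicit Arguments.
Unset Strict Implicit.
Unset Printing Implicit Defensive.

Import Order.TTheory GRing.Theory Num.Theory.
Import numFieldTopology.Exports numFieldNormedType.Exports.

Local Open Scope classical_set_scope.
Local Open Scope ring_scope.

Section asymptotics.
Context {R : realType}.

(* [a n / b n --> 0] alone would be wrong: since [x / 0 = 0], it would hold
   trivially where [b] vanishes. *)
Definition much_less (a b : nat -> R) : Prop :=
  (\forall n \near \oo, 0 < b n) /\ (a n / b n @[n --> \oo] --> 0).

End asymptotics.

Section probability_notions.
Context {R : realType}.

Definition independent2 d d1 d2 (T : measurableType d)
    (T1 : measurableType d1) (T2 : measurableType d2) (P : probability T R)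
    (X : T -> T1) (Y : T -> T2) : Prop :=
  forall (A : set T1) (B : set T2), measurable A -> measurable B ->
    P (X @^-1` A `&` Y @^-1` B) = (P (X @^-1` A) * P (Y @^-1` B))%E.

Definition mutually_independent d d' (T : measurableType d)
    (T' : measurableType d') (P : probability T R) (I : finType)
    (X : I -> T -> T') : Prop :=
  forall (J : {set I}) (A : I -> set T'), (forall i, measurable (A i)) ->
    P (\bigcap_(i in [set` J]) (X i @^-1` A i))
    = (\prod_(i in J) fine (P (X i @^-1` A i)))%:E.

Context (d : nat -> measure_display) (T : forall n, measurableType (d n))
  (P : forall n, probability (T n) R).

Definition aas (E : forall n, set (T n)) : Prop :=
  P n (E n) @[n --> \oo] --> 1%E.

Definition cvg_in_probability (X : forall n, T n -> R) (l : R) : Prop :=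
  forall eps : R, 0 < eps ->
    P n [set w | eps < `|X n w - l|] @[n --> \oo] --> 0%E.

Definition cvg_in_distribution (X : forall n, {RV (P n) >-> R})
    d' (T' : measurableType d') (Q : probability T' R) (Y : {RV Q >-> R}) :
    Prop :=
  forall x : R, {for x, continuous (cdf Y)} ->
    cdf (X n) x @[n --> \oo] --> cdf Y x.

End probability_notions.

Section poisson.
Context {R : realType}.

(* The library's [poisson_prob] takes a second, unused, argument. *)
Definition poisson_law (lambda : R) : probability nat R :=
  poisson_prob lambda 0%N.

Definition nat_to_real (j : nat) : R := j%:R.

Lemma measurable_nat_to_real : measurable_fun setT nat_to_real.
Proof. by []. Qed.

HB.instance Definition _ := isMeasurableFun.Build _ _ _ _ nat_to_real
  measurable_nat_to_real.

(* A Poisson variable with mean [lambda], on the probability space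
   [(nat, poisson_law lambda)]. *)
Definition poisson_rv (lambda : R) : {RV (poisson_law lambda) >-> R} :=
  nat_to_real.

End poisson.

Section kpkvb.
Context {R : realType}.
Implicit Types (alpha nu x : R) (n : nat).

Definition cosh x : R := (expR x + expR (- x)) / 2.
Definition sinh x : R := (expR x - expR (- x)) / 2.

Lemma measurable_cosh : measurable_fun setT cosh.
Proof.
apply: measurable_funM => //; apply: measurable_funD => //.
exact: measurableT_comp.
Qed.

Lemma measurable_sinh : measurable_fun setT sinh.
Proof.
apply: measurable_funM => //; apply: measurable_funB => //.
exact: measurableT_comp.
Qed.

Definition circ_abs (b a : R) : R := Num.min `|a| (b - `|a|).

Definition disk_radius nu n : R := 2 * ln (n%:R / nu).

Definition radial_cdf alpha nu n x : R :=
  let Rn := disk_radius nu n in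
  if x < 0 then 0
  else if x <= Rn then (cosh (alpha * x) - 1) / (cosh (alpha * Rn) - 1)
  else 1.

Lemma ltNpi_pi : - pi < pi :> R.
Proof. by rewrite gtrN// pi_gt0. Qed.

Definition kpkvb_sample alpha nu n d (T : measurableType d)
    (P : probability T R) (r theta : 'I_n -> {RV P >-> R}) : Prop :=
  [/\ mutually_independent P (fun i w => (r i w, theta i w)),
      (forall i, independent2 P (r i) (theta i)),
      (forall i x, cdf (r i) x = (radial_cdf alpha nu n x)%:E) &
      (forall i A, measurable A ->
         distribution P (theta i) A = uniform_prob ltNpi_pi A)].

(* By the hyperbolic law of cosines, the left-hand side of the inequality is
   [cosh] of the hyperbolic distance between [(ri, ti)] and [(rj, tj)]. *)
Definition within_distance (rho ri ti rj tj : R) : bool :=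
  cosh ri * cosh rj - sinh ri * sinh rj * cos (circ_abs (2 * pi) `|ti - tj|)
  <= cosh rho.

Section graph.
Context (nu : R) n d (T : measurableType d) (P : probability T R).
Variables (r theta : 'I_n -> {RV P >-> R}).

Definition kpkvb_adj (w : T) (i j : 'I_n) : bool :=
  (i != j) &&
  within_distance (disk_radius nu n) (r i w) (theta i w) (r j w) (theta j w).

Definition kpkvb_degree (w : T) (i : 'I_n) : nat :=
  #|[pred j | kpkvb_adj w i j]|.

Definition nb_degree (k : nat) (w : T) : nat :=
  #|[pred i | kpkvb_degree w i == k]|.

Definition nb_degree_real (k : nat) (w : T) : R := (nb_degree k w)%:R.

Lemma measurable_kpkvb_adj i j :
  measurable_fun setT (fun w => kpkvb_adj w i j).
Proof.
rewrite /kpkvb_adj; case: (i != j) => /=; last exact: measurable_cst.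
apply: measurable_fun_ler => //.
have mch (X : {RV P >-> R}) : measurable_fun setT (fun w => cosh (X w)).
  by apply: (measurableT_comp measurable_cosh).
have msh (X : {RV P >-> R}) : measurable_fun setT (fun w => sinh (X w)).
  by apply: (measurableT_comp measurable_sinh).
apply: measurable_funB; first exact: measurable_funM.
apply: measurable_funM; first exact: measurable_funM.
apply: (measurableT_comp (f := cos)).
  by apply: continuous_measurable_fun => x; exact: continuous_cos.
have mn : measurable_fun setT (fun w => `| `|theta i w - theta j w| |).
  do 2 apply: measurableT_comp => //.
  exact: measurable_funB.
exact: measurable_minr mn (measurable_funB (measurable_cst _) mn).
Qed.

Let measurable_natr_bool (b : T -> bool) : measurable_fun setT b ->
  measurable_fun setT (fun w => (b w)%:R : R).
Proof.
move=> mb; have mR : measurable_fun setT (fun c : bool => c%:R : R) by [].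
exact: measurableT_comp mR mb.
Qed.

Let measurable_card (b : 'I_n -> T -> bool) :
  (forall i, measurable_fun setT (b i)) ->
  measurable_fun setT (fun w => #|[pred i | b i w]|%:R : R).
Proof.
move=> mb; under eq_fun do rewrite -sum1_card natr_sum big_mkcond/=.
apply: measurable_sum => i; under eq_fun do rewrite inE/= -mulrb.
exact: measurable_natr_bool.
Qed.

Lemma measurable_nb_degree_real k :
  measurable_fun setT (nb_degree_real k).
Proof.
apply: measurable_card => i.
under eq_fun do rewrite -(eqr_nat R).
apply: measurable_fun_eqr => //.
by apply: measurable_card => j; exact: measurable_kpkvb_adj.
Qed.

HB.instance Definition _ k := isMeasurableFun.Build _ _ _ _ (nb_degree_real k)
  (measurable_nb_degree_real k).

End graph.
End kpkvb.

Section limiting_degree.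
Context {R : realType}.
Implicit Types alpha nu xi : R.

(* Upper incomplete gamma function; [a] may be nonpositive. *)
Definition upper_gamma (a b : R) : R :=
  \int[lebesgue_measure]_(t in `[b, +oo[) (t `^ (a - 1) * expR (- t)).

Definition kpkvb_xi alpha nu : R :=
  4 * alpha * nu / (pi * (2 * alpha - 1)).

Definition limit_degree_pmf alpha nu (k : nat) : R :=
  let xi := kpkvb_xi alpha nu in
  2 * alpha * xi `^ (2 * alpha) * upper_gamma (k%:R - 2 * alpha) xi / k`!%:R.

End limiting_degree.

(* Main.v *)
(** Away from the boundary of the disk, a vertex at radius [r] has a binomial number of neighbours
    with mean close to [t = xi * exp ((R - r) / 2)], and the density of [t] tends to
    [2 alpha xi^(2 alpha) t^(- 2 alpha - 1)] on [[xi, +oo[]; hence [pi] is a mixed Poisson law and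
    [pi k ~ 2 alpha xi^(2 alpha) k^(- 2 alpha - 1)].

    The [m]-th factorial moment of [N_n(k)] is [n (n - 1) ... (n - m + 1)] times the probability that
    [m] given vertices all have degree [k].  For large [k] this probability is compared with an
    exchangeable rank event: by convexity of the distance, a point [y] is adjacent to a vertex of angle
    [th] exactly when the radius of the vertex is at most a threshold [thr th y], so degree [k] means
    that the radius falls between two consecutive order statistics of the thresholds of the other
    points.  If the radius had the law of a threshold itself, the probability would be [1 / n] by
    symmetry; the ratio of the two laws is [n pi k] asymptotically.  This gives, without any local
    limit theorem, a joint probability [(1 + o(1)) pi(k)^m] uniformly in [k -> oo] with [k^2 << n].
    For bounded [k] dominated convergence suffices.

    In the first regime [n pi(k_n) -> oo] and Chebyshev's inequality applies; in the second all
    factorial moments converge to those of a Poisson variable, which Bonferroni's inequalities turn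
    into convergence in law; in the third [n P(deg = k_n) -> 0], where degrees beyond the range of the
    rank comparison are handled with Chernoff bounds. *)

From HB Require Import structures.
Require Import Defs.
From mathcomp Require Import all_boot all_order all_algebra.
From mathcomp Require Import all_classical all_reals all_analysis.
From mathcomp Require Import measurable_realfun ring lra.

Set Implicit Arguments.
Unset Strict Implicit.
Unset Printing Implicit Defensive.

Import Order.TTheory GRing.Theory Num.Theory.
Import numFieldTopology.Exports numFieldNormedType.Exports.

Local Open Scope classical_set_scope.
Local Open Scope ring_scope.

(** * Independent samples and ranks *)

(** The obstacle is the dependence between [m] degrees: a point near the origin has a large
    threshold for every angle, so the threshold orders of different vertices interleave. The upper
    bound therefore compares the radial law only with thresholds of points in the outer half of the
    disk. These carry asymptotically all of the expected degree, yet they reach a vertex only within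
    a narrow sector, so vertices with separated angles do not compete for the same ranks; close
    angles have small probability and cost a factor depending on [m] alone. For the lower bound
    Jensen's inequality reduces to [m = 1], where all points are used. The condition [k^2 << n] says
    that a vertex of expected degree of order [k] lies itself well inside the outer half; the
    critical scale [n^(1/(2 alpha + 1))] meets it precisely because [alpha > 1/2]. Ranks are
    compared on arbitrarily short radius intervals, so relative errors must hold for increments and
    not only for values; this is why the geometric estimates perturb exponents rather than
    constants. *)

Section tuple_law.
Context d (E : measurableType d) (R : realType).
Implicit Type mu : probability E R.

Definition rect n (A : 'I_n -> set E) : set (n.-tuple E) :=
  [set z | forall i, A i (tnth z i)].

Lemma measurable_rect n (A : 'I_n -> set E) :
  (forall i, measurable (A i)) -> measurable (rect A).
Proof.
move=> mA.
rewrite (_ : rect A = \bigcap_(i in [set` 'I_n]) (fun z => tnth z i) @^-1` A i).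
  apply: fin_bigcap_measurable; first exact: finite_finset.
  by move=> i _; rewrite -[X in measurable X]setTI; exact: measurable_tnth.
by apply/seteqP; split => z /= Az i => [_|]; exact: Az.
Qed.

(** Rectangles are stable under intersection and generate the product sigma-algebra, so uniqueness
    on a pi-system applies. *)
Lemma prob_rect_unique n (m1 m2 : probability (n.-tuple E) R) :
  (forall A, (forall i, measurable (A i)) -> m1 (rect A) = m2 (rect A)) ->
  forall D, measurable D -> m1 D = m2 D.
Proof.
move=> m12 D mD.
pose G := [set B : set (n.-tuple E) |
  exists2 A, (forall i, measurable (A i)) & B = rect A].
have rT : @rect n (fun=> setT) = setT by apply/seteqP; split.
apply: (measure_unique G (fun=> setT)) => //.
- apply/seteqP; split.
    apply: smallest_sub; first exact: (@smallest_sigma_algebra _ setT G).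
    rewrite -bigcup_seq; apply: bigcup_sub => i _ _ [B mB <-].
    (* A coordinate cylinder is the rectangle whose other sides are [setT]. *)
    apply: sub_sigma_algebra; exists (fun j => if j == i then B else setT).
      by move=> j; case: ifP.
    rewrite setTI; apply/seteqP; split => z /=.
      by move=> Bz j /=; case: eqP => // ->.
    by move=> /(_ i); rewrite /= eqxx.
  apply: smallest_sub; first exact: sigma_algebra_measurable.
  by move=> _ [A mA ->]; exact: measurable_rect.
- move=> _ _ [A mA ->] [B mB ->]; exists (fun i => A i `&` B i).
    by move=> i; exact: measurableI.
  apply/seteqP; split => [z [h1 h2] i|z h]; first by split; [exact: h1|exact: h2].
  by split => i; have [] := h i.
- by move=> _; exists (fun=> setT) => //.
- by rewrite bigcup_const.
- by move=> _ [A mA ->]; exact: m12.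
- by move=> _; apply: (le_lt_trans (probability_le1 m1 measurableT)); rewrite ltry.
Qed.

(** Induction on [n]: the law of [n.+1] points is the image of [mu \x Q] under consing the first
    point. *)
Lemma prodn_exists mu n : exists Q : probability (n.-tuple E) R,
  forall A, (forall i, measurable (A i)) ->
    Q (rect A) = (\prod_i fine (mu (A i)))%:E.
Proof.
elim: n => [|n [Q IH]].
  exists (dirac ([tuple] : 0.-tuple E) : probability _ R) => A mA.
  by rewrite big_ord0 /= diracE mem_set//; case.
have mc : measurable_fun setT
    (fun p : E * n.-tuple E => [the n.+1.-tuple E of p.1 :: p.2]).
  by apply: measurable_cons; [exact: measurable_fst|exact: measurable_snd].
pose c : {mfun (E * n.-tuple E)%type >-> n.+1.-tuple E} :=
  HB.pack (fun p : E * n.-tuple E => [the n.+1.-tuple E of p.1 :: p.2])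
    (isMeasurableFun.Build _ _ _ _ _ mc).
pose PP : probability (E * n.-tuple E)%type R := (mu \x Q)%E.
exists (distribution PP c) => A mA.
rewrite /distribution /pushforward /=.
have -> : c @^-1` rect A = A ord0 `*` rect (fun i : 'I_n => A (lift ord0 i)).
  apply/seteqP; split => -[x z] /=.
    move=> Az; split; first exact: (Az ord0).
    by move=> i /=; have := Az (lift ord0 i); rewrite tnthS.
  move=> [Ax Az] i; case: (unliftP ord0 i) => [j|] ->; last by [].
  by rewrite tnthS; exact: Az.
rewrite product_measure1E//; last by apply: measurable_rect.
rewrite big_ord_recl EFinM fineK; last exact: fin_num_measure.
by congr (_ * _)%E; exact: IH.
Qed.

Definition prodn mu n : probability (n.-tuple E) R := sval (cid (prodn_exists mu n)).

Lemma prodn_rect mu n A : (forall i, measurable (A i)) ->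
  prodn mu n (rect A) = (\prod_i fine (mu (A i)))%:E.
Proof. exact: (svalP (cid (prodn_exists mu n))). Qed.

(** A single product formula over all coordinates; subfamilies are recovered by taking the remaining
    sides to be [setT]. *)
Definition iid dT (T : measurableType dT) (P : probability T R) mu n
    (X : 'I_n -> T -> E) :=
  (forall i, measurable_fun setT (X i)) /\
  forall A, (forall i, measurable (A i)) ->
    P [set w | forall i, A i (X i w)] = (\prod_i fine (mu (A i)))%:E.

Lemma iid_tnth mu n : iid (prodn mu n) mu (fun (i : 'I_n) z => tnth z i).
Proof.
by split=> [i|A mA]; [exact: measurable_tnth|exact: prodn_rect].
Qed.

Section iid_theory.
Context dT (T : measurableType dT) (P : probability T R) mu.

Lemma measurable_mktuple n (X : 'I_n -> T -> E) :
  (forall i, measurable_fun setT (X i)) ->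
  measurable_fun setT (fun w => [tuple X i w | i < n]).
Proof.
move=> mX; apply/measurable_fun_tnthP => i.
by rewrite (_ : _ \o _ = X i)//; apply/funext => w /=; rewrite tnth_mktuple.
Qed.

(** Both laws agree on rectangles. Any question about a sample can thus be moved to the canonical
    space [prodn mu n]. *)
Lemma iid_law n (X : 'I_n -> T -> E) D : iid P mu X -> measurable D ->
  P [set w | D [tuple X i w | i < n]] = prodn mu n D.
Proof.
move=> [mX iX] mD.
pose c : {mfun T >-> n.-tuple E} :=
  HB.pack (fun w : T => [tuple X i w | i < n])
    (isMeasurableFun.Build _ _ _ _ _ (measurable_mktuple mX)).
apply: (prob_rect_unique (m1 := distribution P c)) => // A mA.
rewrite prodn_rect// -iX// /distribution /pushforward/=; congr (P _).
by apply/seteqP; split => w /= h i; have := h i; rewrite /= tnth_mktuple.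
Qed.

Lemma iid_integral n (X : 'I_n -> T -> E) (f : n.-tuple E -> \bar R) :
  iid P mu X -> measurable_fun setT f -> (forall z, 0 <= f z)%E ->
  (\int[P]_w f [tuple X i w | i < n] = \int[prodn mu n]_z f z)%E.
Proof.
move=> iX mf f0; have [mX _] := iX.
pose c : {mfun T >-> n.-tuple E} :=
  HB.pack (fun w : T => [tuple X i w | i < n])
    (isMeasurableFun.Build _ _ _ _ _ (measurable_mktuple mX)).
rewrite -(ge0_integral_distribution (P := P) c)//.
apply: eq_measure_integral => D mD _.
exact: (iid_law iX).
Qed.

Lemma iid_reindex m n (X : 'I_n -> T -> E) (h : 'I_m -> 'I_n) :
  injective h -> iid P mu X -> iid P mu (fun i => X (h i)).
Proof.
move=> hI [mX iX]; split => // A mA.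
(* Coordinates outside the image of [h] get the side [setT] and contribute the factor 1. *)
pose A' j := if [pick i | h i == j] is Some i then A i else setT.
have mA' j : measurable (A' j) by rewrite /A'; case: pickP.
have A'h i : A' (h i) = A i.
  by rewrite /A'; case: pickP => [i' /eqP/hI ->//|/(_ i)]; rewrite eqxx.
have A'T j : j \notin codom h -> A' j = setT.
  by rewrite /A'; case: pickP => // i /eqP <-; rewrite codom_f.
rewrite (_ : [set w | _] = [set w | forall j, A' j (X j w)]).
  rewrite iX// (bigID (mem (codom h)))/= [X in _ * X]big1 ?mulr1; last first.
    by move=> j jh; rewrite A'T// probability_setT.
  congr (_%:E); rewrite -big_uniq/=; last by rewrite map_inj_uniq ?enum_uniq.
  rewrite big_map big_enum_cond/=.
  by apply: eq_big => // i _; rewrite A'h.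
apply/seteqP; split => w /= Aw i; last by rewrite -A'h.
have [/codomP[j ->]|/A'T -> //] := boolP (i \in codom h).
by rewrite A'h.
Qed.

End iid_theory.

Lemma measurable_cat_tuple m n : measurable_fun setT
  (fun p : m.-tuple E * n.-tuple E => [tuple of p.1 ++ p.2]).
Proof.
apply/measurable_fun_tnthP => i; case: (split_ordP i) => j -> /=.
  rewrite (_ : _ \o _ = (fun z => tnth z j) \o fst).
    by apply: measurableT_comp => //; exact: measurable_tnth.
  by apply/funext => -[v w] /=; rewrite tnth_lshift.
rewrite (_ : _ \o _ = (fun z => tnth z j) \o snd).
  by apply: measurableT_comp => //; exact: measurable_tnth.
by apply/funext => -[v w] /=; rewrite tnth_rshift.
Qed.

Lemma iid_cat mu m n :
  iid (prodn mu m \x prodn mu n)%E mu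
    (fun i (p : m.-tuple E * n.-tuple E) => tnth [tuple of p.1 ++ p.2] i).
Proof.
split => [i|A mA].
  by apply: (measurableT_comp (measurable_tnth i)); exact: measurable_cat_tuple.
rewrite (_ : [set w | _] = rect (fun i => A (lshift n i)) `*`
                           rect (fun i => A (rshift m i))).
  rewrite /= product_measure1E//=; try exact: measurable_rect.
  by rewrite !prodn_rect// big_split_ord EFinM.
apply/seteqP; split => -[v w] /=.
  move=> h; split => i; first by have := h (lshift n i); rewrite /= tnth_lshift.
  by have := h (rshift m i); rewrite /= tnth_rshift.
move=> [h1 h2] i; case: (split_ordP i) => j ->.
  by rewrite tnth_lshift; exact: h1.
by rewrite tnth_rshift; exact: h2.
Qed.

(** Disjoint blocks of a sample are independent: the joint law of the [m + n] selected points is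
    also realised on [prodn mu m \x prodn mu n], where Tonelli applies. *)
Lemma iid_split dT (T : measurableType dT) (P : probability T R) mu m n N
    (X : 'I_N -> T -> E) (s : 'I_m -> 'I_N) (t : 'I_n -> 'I_N)
    (f : m.-tuple E * n.-tuple E -> \bar R) :
  injective s -> injective t -> (forall i j, s i != t j) ->
  iid P mu X -> measurable_fun setT f -> (forall z, 0 <= f z)%E ->
  (\int[P]_w f ([tuple X (s i) w | i < m], [tuple X (t j) w | j < n])
   = \int[prodn mu m]_v \int[prodn mu n]_w f (v, w))%E.
Proof.
move=> sI tI st iX mf f0.
pose h i := match fintype.split i with inl j => s j | inr j => t j end.
have hl i : h (lshift n i) = s i by rewrite /h; case: split_ordP => j /eqP;
  rewrite ?eq_lshift ?eq_lrshift// => /eqP ->.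
have hr i : h (rshift m i) = t i by rewrite /h; case: split_ordP => j /eqP;
  rewrite ?eq_rshift ?eq_rlshift// => /eqP ->.
have hI : injective h.
  move=> i j; case: (split_ordP i) => i' ->; case: (split_ordP j) => j' ->;
  rewrite ?hl ?hr; do ?[by move/sI->|by move/tI->|by move/eqP; rewrite (negbTE (st _ _))].
  by move/esym/eqP; rewrite (negbTE (st _ _)).
pose g (z : (m + n).-tuple E) := f
  ([tuple tnth z (lshift n i) | i < m], [tuple tnth z (rshift m j) | j < n]).
have mg : measurable_fun setT g.
  apply: measurableT_comp => //; apply/measurable_fun_pairP; split => /=;
  by apply: measurable_mktuple => i; exact: measurable_tnth.
transitivity (\int[P]_w g [tuple X (h i) w | i < m + n])%E.
  apply: eq_integral => w _; rewrite /g; congr (f (_, _)); apply/eq_from_tnth => i;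
  by rewrite !tnth_mktuple ?hl ?hr.
have g0 z : (0 <= g z)%E by exact: f0.
rewrite (iid_integral (iid_reindex hI iX) mg g0).
have /esym eg := iid_integral (iid_cat mu m n) mg g0.
apply: etrans eg _; rewrite -(fubini_tonelli1 (m1 := prodn mu m) (m2 := prodn mu n))//.
apply: eq_integral => -[v w] _; rewrite /g /=; congr (f (_, _)); apply/eq_from_tnth => i;
by rewrite !tnth_mktuple ?tnth_lshift ?tnth_rshift.
Qed.

End tuple_law.

(** * Order statistics of finitely many thresholds *)

Section ranks.
Context {R : realType} (n : nat).
Implicit Types (t : 'I_n -> R) (k l c : nat).

(** Let [v] and [u] have the largest and the smallest value among the counted indices. The indices
    strictly above [v], at least [l] of them, are disjoint from the counted ones, and both kinds lie
    weakly above [u], where there is room for only [l + c]. *)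
Lemma card_rank_window t l c :
  (#|[pred v | (l <= #|[pred j | (t v < t j)%R]|)%N &&
               (#|[pred j | (t v <= t j)%R]| <= l + c)%N]| <= c)%N.
Proof.
set S := [pred v | _].
have [v0 Sv0|S0] := pickP S; last by rewrite eq_card0.
case: (Order.TotalTheory.arg_maxP t Sv0) => v Sv vmax.
case: (Order.TotalTheory.arg_minP t Sv0) => u Su umin.
have /andP[lv _] := Sv; have /andP[_ uc] := Su.
rewrite -(leq_add2l l); apply: leq_trans uc.
apply: (@leq_trans (#|[pred j | (t v < t j)%R]| + #|S|)); first by rewrite leq_add2r.
rewrite -cardUI [X in (_ + X)%N]eq_card0 ?addn0; last first.
  move=> j; rewrite !inE; apply/negP => /andP[vj Sj].
  by have := vmax j Sj; rewrite /= leNgt vj.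
apply: subset_leq_card; apply/fintype.subsetP => j; rewrite !inE => /orP[vj|Sj].
  by apply: (le_trans (vmax _ Su)); exact: ltW.
exact: umin.
Qed.

(** [x] and [y] are the consecutive order statistics between which exactly [k] values lie above,
    clipped to [a] and [b]; with ties the interval may be empty. The fourth conclusion, which
    catches every position of rank [k], serves the lower rank bound; the fifth, the absence of
    values inside, serves the upper one. *)
Lemma level_interval t (a b : R) k : (k <= n)%N -> exists x y,
  [/\ a <= x, y <= b,
      forall r, (a < r <= b) && (#|[pred j | (r <= t j)%R]| == k) = (x < r <= y),
      forall s, a <= s <= b -> (#|[pred j | (s < t j)%R]| <= k)%N ->
        (k <= #|[pred j | (s <= t j)%R]|)%N -> x <= s <= y &
      forall s, x < s < y -> forall j, t j != s].
Proof.
move=> kn.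
pose P j := (k < #|[pred i | (t j <= t i)%R]|)%N.
pose Q j := (#|[pred i | (t j < t i)%R]| < k)%N.
exists (\big[Order.max/a]_(j | P j) t j), (\big[Order.min/b]_(j | Q j) t j).
set x := \big[_/_]_(_ | _) _; set y := \big[_/_]_(_ | _) _.
have ax : a <= x by exact: bigmax_ge_id.
have yb : y <= b by exact: bigmin_le_id.
have lvl r : (a < r <= b) && (#|[pred j | (r <= t j)%R]| == k) = (x < r <= y).
  apply/idP/idP => [/andP[/andP[ar rb] /eqP Dr]|/andP[xr ry]].
    apply/andP; split.
      apply/bigmax_ltP; split => // j Pj; rewrite ltNge; apply/negP => rj.
      suff : (k < k)%N by rewrite ltnn.
      apply: (leq_trans Pj); rewrite -[X in (_ <= X)%N]Dr; apply: subset_leq_card.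
      by apply/fintype.subsetP => i; rewrite !inE; exact: le_trans.
    apply/bigmin_geP; split => // j Qj; rewrite leNgt; apply/negP => rj.
    suff : (k < k)%N by rewrite ltnn.
    apply: leq_ltn_trans Qj; rewrite -[X in (X <= _)%N]Dr; apply: subset_leq_card.
    by apply/fintype.subsetP => i; rewrite !inE; exact: lt_le_trans.
  have {}ar := le_lt_trans ax xr; have {}rb := le_trans ry yb.
  rewrite ar rb /= eqn_leq; apply/andP; split; rewrite leqNgt; apply/negP => kD.
    have [j0 rj0] : exists j, r <= t j.
      have : (0 < #|[pred j | (r <= t j)%R]|)%N by exact: leq_ltn_trans kD.
      by case/card_gt0P => j; rewrite inE; exists j.
    case: (Order.TotalTheory.arg_minP (P := fun j => r <= t j) t rj0) => j rj jmin.
    have Pj : P j.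
      apply: (leq_trans kD); apply: subset_leq_card; apply/fintype.subsetP => i.
      by rewrite !inE; exact: jmin.
    have : t j < r by move/bigmax_ltP: xr => [_]; apply.
    by rewrite ltNge rj.
  have [j0 rj0] : exists j, t j < r.
    have : (#|[pred j | (r <= t j)%R]| < #|'I_n|)%N.
      by rewrite card_ord; exact: leq_trans kn.
    rewrite -[#|'I_n|](cardC [pred j | (r <= t j)%R]) -[X in (X < _)%N]addn0 ltn_add2l.
    by case/card_gt0P => j; rewrite !inE -ltNge; exists j.
  case: (Order.TotalTheory.arg_maxP (P := fun j => t j < r) t rj0) => j rj jmax.
  have Qj : Q j.
    apply: leq_ltn_trans kD; apply: subset_leq_card; apply/fintype.subsetP => i.
    rewrite !inE => ji; rewrite leNgt; apply/negP => /jmax.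
    by move=> /(lt_le_trans ji); rewrite ltxx.
  have : r <= t j by move/bigmin_geP: ry => [_]; apply.
  by rewrite leNgt rj.
split => // s.
  move=> /andP[as_ sb] k1 k2; apply/andP; split.
    apply/bigmax_leP; split => // j Pj; rewrite leNgt; apply/negP => sj.
    suff : (k < k)%N by rewrite ltnn.
    apply: leq_trans k1; apply: (leq_trans Pj); apply: subset_leq_card.
    by apply/fintype.subsetP => i; rewrite !inE; exact: lt_le_trans.
  apply/bigmin_geP; split => // j Qj; rewrite leNgt; apply/negP => js.
  suff : (k < k)%N by rewrite ltnn.
  apply: (leq_ltn_trans k2); apply: leq_ltn_trans Qj; apply: subset_leq_card.
  by apply/fintype.subsetP => i; rewrite !inE; exact: lt_le_trans.
move=> /andP[xs sy] j; apply/eqP => js.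
have nP : ~~ P j.
  apply/negP => Pj; have : t j < s by move/bigmax_ltP: xs => [_]; apply.
  by rewrite js ltxx.
have nQ : ~~ Q j.
  apply/negP => Qj; have : s < t j by move/bigmin_gtP: sy => [_]; apply.
  by rewrite js ltxx.
move: nP nQ; rewrite /P /Q -!leqNgt => nP nQ.
suff : (k < k)%N by rewrite ltnn.
apply: leq_trans nP; apply: (leq_ltn_trans nQ).
apply: proper_card; apply/properP; split.
  by apply/fintype.subsetP => i; rewrite !inE; exact: ltW.
by exists j; rewrite !inE ?lexx ?ltxx.
Qed.

(** The witness is the largest value that more than [k] values reach. The smallest value above [a]
    qualifies, so the witness is at least [a]; a witness above [b] would be reached by at most [k]
    values. *)
Lemma exists_rank t (a b : R) k :
  (#|[pred j | (b < t j)%R]| <= k)%N -> (k < #|[pred j | (a <= t j)%R]|)%N ->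
  exists v, [/\ a <= t v <= b, (#|[pred j | (t v < t j)%R]| <= k)%N &
                (k < #|[pred j | (t v <= t j)%R]|)%N].
Proof.
move=> kb ka.
pose P j := (k < #|[pred i | (t j <= t i)%R]|)%N.
have [j0 aj0] : exists j, a <= t j.
  have : (0 < #|[pred j | (a <= t j)%R]|)%N by exact: leq_ltn_trans ka.
  by case/card_gt0P => j; rewrite inE; exists j.
case: (Order.TotalTheory.arg_minP (P := fun j => a <= t j) t aj0) => m am mmin.
have Pm : P m.
  apply: (leq_trans ka); apply: subset_leq_card; apply/fintype.subsetP => i.
  by rewrite !inE; exact: mmin.
case: (Order.TotalTheory.arg_maxP (P := P) t Pm) => v Pv vmax.
exists v; split => //.
  rewrite (le_trans am (vmax _ Pm)) /= leNgt; apply/negP => bv.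
  suff : (k < k)%N by rewrite ltnn.
  apply: leq_trans kb; apply: (leq_trans Pv); apply: subset_leq_card.
  by apply/fintype.subsetP => i; rewrite !inE; exact: lt_le_trans.
rewrite leqNgt; apply/negP => kv.
have [w0 vw0] : exists j, t v < t j.
  have : (0 < #|[pred j | (t v < t j)%R]|)%N by exact: leq_ltn_trans kv.
  by case/card_gt0P => j; rewrite inE; exists j.
case: (Order.TotalTheory.arg_minP (P := fun j => t v < t j) t vw0) => w vw wmin.
have Pw : P w.
  apply: (leq_trans kv); apply: subset_leq_card; apply/fintype.subsetP => i.
  by rewrite !inE; exact: wmin.
by have := vmax _ Pw; rewrite /= leNgt vw.
Qed.

End ranks.

Section measurable_events.
Context d (T : measurableType d) (R : realType).

Lemma measurable_event (b : T -> bool) :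
  measurable_fun setT b -> measurable [set x | b x].
Proof.
move=> mb; have := mb measurableT [set true]; rewrite setTI => h.
by rewrite (_ : [set x | b x] = b @^-1` [set true]) //; exact: h.
Qed.

(** The count is measurable as a real sum of indicators, and a set of naturals is a countable union
    of level events. *)
Lemma measurable_fun_card (I : finType) (b : I -> T -> bool) :
  (forall i, measurable_fun setT (b i)) ->
  measurable_fun setT (fun x => #|[pred i | b i x]|).
Proof.
move=> mb.
have mr : measurable_fun setT (fun x => #|[pred i | b i x]|%:R : R).
  under eq_fun do rewrite -sum1_card natr_sum big_mkcond/=.
  apply: measurable_sum => i; under eq_fun do rewrite inE/= -mulrb.
  have mR : measurable_fun setT (fun c : bool => c%:R : R) by [].
  exact: measurableT_comp mR (mb i).
move=> _ Y _; rewrite setTI.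
rewrite (_ : _ @^-1` Y =
  \bigcup_(k in Y) [set x | #|[pred i | b i x]|%:R == k%:R :> R]).
  apply: bigcup_measurable => k _; apply: measurable_event.
  exact: measurable_fun_eqr.
apply/seteqP; split => [x Yx|x [k Yk]] /=.
  by exists #|[pred i | b i x]| => //=.
by rewrite eqr_nat => /eqP ->.
Qed.

Lemma measurable_natcomp dT' (T' : measurableType dT') (g : nat -> T') (f : T -> nat) :
  measurable_fun setT f -> measurable_fun setT (fun x => g (f x)).
Proof. by move=> mf; apply: (measurableT_comp (f := g)). Qed.

(** All members satisfy [b] exactly when the count is full, so measurability of counts suffices. *)
Lemma measurable_forallb (I : finType) (b : I -> T -> bool) :
  (forall i, measurable_fun setT (b i)) ->
  measurable_fun setT (fun x => [forall i, b i x]).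
Proof.
move=> mb.
rewrite (_ : (fun x => _) = fun x => #|[pred i | b i x]| == #|I|).
  by apply: (measurable_natcomp (fun k => k == #|I|)); exact: measurable_fun_card.
apply/funext => x; apply/forallP/eqP => [h|h i]; first exact: eq_card.
have := subset_cardP (A := mem [pred i | b i x]) (B := mem I) h (fintype.subset_predT _) i.
by rewrite !inE.
Qed.

End measurable_events.

Section event_probability.
Context d (T : measurableType d) (R : realType) (P : probability T R).

Lemma integral_event (b : T -> bool) : measurable_fun setT b ->
  (\int[P]_x ((b x)%:R)%:E = P [set x | b x])%E.
Proof.
move=> mb; rewrite -[X in _ = P X]setIT -integral_indic//; last exact: measurable_event.
apply: eq_integral => x _; congr (_%:E); rewrite indicE.
by case: (boolP (b x)) => bx; [rewrite mem_set|rewrite memNset//; apply/negP].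
Qed.

End event_probability.

Lemma measurable_fun_eventE d (T : measurableType d) (R : realType) (b : T -> bool) :
  measurable_fun setT b -> measurable_fun setT (fun x => ((b x)%:R)%:E : \bar R).
Proof.
move=> mb; apply/measurable_EFinP.
exact: (measurableT_comp (f := fun c : bool => c%:R : R)).
Qed.

Lemma measurable_integral_event1 d1 d2 (T1 : measurableType d1) (T2 : measurableType d2)
    (R : realType) (P : probability T1 R) (b : T1 * T2 -> bool) :
  measurable_fun setT b ->
  measurable_fun setT (fun y => \int[P]_x ((b (x, y))%:R)%:E)%E.
Proof.
move=> mb; have b0 z : (0 <= ((b z)%:R)%:E :> \bar R)%E by rewrite lee_fin.
exact: (measurable_fun_fubini_tonelli_G (m1 := P) (fun z => ((b z)%:R)%:E) (measurable_fun_eventE mb) b0).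
Qed.

Lemma fubini_event d1 d2 (T1 : measurableType d1) (T2 : measurableType d2)
    (R : realType) (P : probability T1 R) (Q : probability T2 R) (b : T1 * T2 -> bool) :
  measurable_fun setT b ->
  (\int[P]_x \int[Q]_y ((b (x, y))%:R)%:E = \int[Q]_y \int[P]_x ((b (x, y))%:R)%:E)%E.
Proof.
move=> mb; have b0 z : (0 <= ((b z)%:R)%:E :> \bar R)%E by rewrite lee_fin.
exact: (fubini_tonelli (fun z => ((b z)%:R)%:E) (measurable_fun_eventE mb) b0).
Qed.

Lemma integral_prob_le d (T : measurableType d) (R : realType) (P : probability T R)
    (f : T -> \bar R) (c : R) :
  measurable_fun setT f -> (forall x, 0 <= f x)%E -> (forall x, f x <= c%:E)%E ->
  (\int[P]_x f x <= c%:E)%E.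
Proof.
move=> mf f0 fc; apply: (@le_trans _ _ (\int[P]_x c%:E)%E).
  by apply: ge0_le_integral => //= x _; exact: fc.
have -> : (\int[P]_x c%:E = c%:E * P setT)%E by exact: integral_cst.
by rewrite [P setT]probability_setT mule1.
Qed.

(** * Exchangeability of the sample *)

Section exchange.
Context d (E : measurableType d) (R : realType) (mu : probability E R).
Context (m n N : nat) (Nmn : N = (m + n)%N).
Implicit Type s : {ffun 'I_m -> 'I_N}.

Lemma compl_inj s : injective s -> exists t : 'I_n -> 'I_N,
  injective t /\ forall i, (i \in codom t) = (i \notin codom s).
Proof.
move=> sI; pose A := [predC codom s].
have cA : #|A| = n.
  have := cardC (mem (codom s)); rewrite (card_codom sI) card_ord.
  by move=> h; apply: (@addnI m); rewrite h card_ord -Nmn.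
pose t (j : 'I_n) : 'I_N := enum_val (cast_ord (esym cA) j).
have tI : injective t by move=> i j /enum_val_inj/cast_ord_inj.
exists t; split => // i; apply/codomP/idP => [[j ->]|iA].
  exact: (enum_valP (cast_ord (esym cA) j)).
by exists (cast_ord cA (enum_rank_in (A := mem A) iA i)); rewrite /t cast_ordK enum_rankK_in.
Qed.

(** Enumerates the complement of the image of [s]. The default off the injective functions keeps it
    total, so that it can stand under [injectiveb s &&]. *)
Definition cotuple s : 'I_n -> 'I_N :=
  if pselect (injective s) is left sI then sval (cid (compl_inj sI))
  else fun j => cast_ord (esym Nmn) (rshift m j).

Lemma cotuple_inj s : injective s -> injective (cotuple s).
Proof.
by move=> sI; rewrite /cotuple; case: pselect => // h; case: (svalP (cid (compl_inj h))).
Qed.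

Lemma codom_cotuple s i : injective s ->
  (i \in codom (cotuple s)) = (i \notin codom s).
Proof.
by move=> sI; rewrite /cotuple; case: pselect => // h; case: (svalP (cid (compl_inj h))).
Qed.

Lemma card_cotuple s (p : pred 'I_N) : injective s ->
  #|[pred j | p (cotuple s j)]| = #|[pred i | (i \notin codom s) && p i]|.
Proof.
move=> sI; rewrite -(fintype.card_image (cotuple_inj sI)) /=; apply: eq_card => i.
rewrite !inE -codom_cotuple//; apply/fintype.imageP/andP => [[j]|[/codomP[j ->] pj]].
  by rewrite inE => pj ->; rewrite codom_f.
by exists j.
Qed.

Lemma card_split_cotuple s (p : pred 'I_N) : injective s ->
  #|[pred i | p i]| = (#|[pred j | p (cotuple s j)]| + #|[pred j | p (s j)]|)%N.
Proof.
move=> sI; rewrite (card_cotuple p sI) -(fintype.card_image sI [pred j | p (s j)]) -cardUI.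
rewrite [X in (_ = _ + X)%N]eq_card0 ?addn0; last first.
  move=> i; rewrite !inE; apply/negP => /andP[/andP[si _] /fintype.imageP[j _ ij]].
  by move: si; rewrite ij codom_f.
apply: eq_card => i; rewrite !inE; have [/codomP[j ->]|is_] := boolP (i \in codom s).
  apply/idP/fintype.imageP => [pj|[j' + ->]]; first by exists j.
  by rewrite inE.
rewrite /= orb_idr// => /fintype.imageP[j _ ij].
by move: is_; rewrite ij codom_f.
Qed.

(* Double counting: averaging over all injective choices of the first block. *)
Lemma exchange dT (T : measurableType dT) (P : probability T R)
    (X : 'I_N -> T -> E) (G : m.-tuple E * n.-tuple E -> bool) :
  iid P mu X -> measurable_fun setT G ->
  ((N ^_ m)%:R%:E * \int[prodn mu m]_v \int[prodn mu n]_w ((G (v, w))%:R)%:E =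
   \int[P]_x (#|[pred s : {ffun 'I_m -> 'I_N} | injectiveb s &&
      G ([tuple X (s i) x | i < m], [tuple X (cotuple s j) x | j < n])]|%:R)%:E)%E.
Proof.
move=> iX mG; have [mX _] := iX.
have mGX s : measurable_fun setT
    (fun x => G ([tuple X (s i) x | i < m], [tuple X (cotuple s j) x | j < n])).
  apply: measurableT_comp => //; apply/measurable_fun_pairP; split => /=;
  exact: measurable_mktuple.
transitivity (\int[P]_x (\sum_(s <- [seq s <- index_enum {ffun 'I_m -> 'I_N} | injectiveb (s : {ffun 'I_m -> 'I_N})])
    ((G ([tuple X (s i) x | i < m], [tuple X (cotuple s j) x | j < n]))%:R)%:E)%E)%E;
  last first.
  apply: eq_integral => x _; rewrite big_filter sumEFin; congr (_%:E).
  rewrite -sum1_card natr_sum big_mkcondr/= [RHS]big_mkcond/= [LHS]big_mkcond/=.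
  apply: eq_bigr => s _; case: (injectiveb s) => //=.
  by case: (G _).
rewrite ge0_integral_sum//; last first.
  by move=> s; apply/measurable_EFinP; exact: (measurableT_comp (f := fun b : bool => b%:R : R)).
rewrite big_filter.
(* By [iid_split] each of the [N ^_ m] injective choices contributes the same integral. *)
rewrite (eq_bigr (fun=> \int[prodn mu m]_v \int[prodn mu n]_w ((G (v, w))%:R)%:E))%E.
  rewrite big_const_seq; set c := (\int[_]_v _)%E.
  have -> : count (fun s : {ffun 'I_m -> 'I_N} => injectiveb s)
      (index_enum {ffun 'I_m -> 'I_N}) = (N ^_ m)%N.
    rewrite -[in RHS](card_ord N) -[m in RHS](card_ord m) -card_inj_ffuns.
    by rewrite -sum1_card -sum1_count; apply: eq_bigl => s; rewrite inE.
  elim: (N ^_ m)%N => [|k IH]; first by rewrite mul0e.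
  by rewrite /= -IH -addn1 natrD EFinD ge0_muleDl ?lee_fin// mul1e addeC.
move=> s /injectiveP sI.
have st i j : s i != cotuple s j.
  by apply/eqP => sij; have := codom_cotuple (s i) sI; rewrite codom_f {1}sij codom_f.
have mGE : measurable_fun setT (fun z => (G z)%:R%:E : \bar R).
  by apply/measurable_EFinP; exact: (measurableT_comp (f := fun b : bool => b%:R : R)).
exact: (iid_split sI (cotuple_inj sI) st iX mGE).
Qed.

End exchange.

(** * Comparison of level events with rank events *)

Section rank_bounds.
Context d (E : measurableType d) (R : realType).
Context (mu : probability E R) (F : probability R R).

(* [n'] further points leave the radii [r_i] free; replacing [F] by the law of the threshold [t i] of
   a fresh point turns the level-set event into one about ranks. *)
Section upper.
Context (m n N : nat) (Nmn : N = (m + n)%N).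
Context (t : 'I_m -> E -> R) (low : E -> bool) (l : 'I_m -> nat) (a b W : R) (c : nat).
Hypothesis mt : forall i, measurable_fun setT (t i).
Hypothesis mlow : measurable_fun setT low.
Hypothesis W0 : 0 <= W.
(** The interval is open on the side of [mu], so that a fresh threshold falling in it is tied with
    none of the order statistics that bound it. *)
Hypothesis FW : forall i x y, a <= x -> x < y -> y <= b ->
  (F [set r | (x < r <= y)%R] <= W%:E * mu [set v | low v && (x < t i v < y)%R])%E.
(** At most [c] of the [m] chosen points compete in the order of [t i]: [c = m] always works, and
    [c = 1] when the sectors of the vertices are disjoint. *)
Hypothesis sep : forall (s : 'I_m -> E) i, (forall j, low (s j) && (a < t j (s j))) ->
  (#|[pred j | (t i (s i) <= t i (s j))%R]| <= c)%N.

Let ev i (w : n.-tuple E) v := [&& low v, a < t i v < b,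
  #|[pred j | (t i v <= t i (tnth w j))%R]| == l i &
  [forall j, t i (tnth w j) != t i v]].

Let G (p : m.-tuple E * n.-tuple E) := [forall i, ev i p.2 (tnth p.1 i)].

Let mevG i : measurable_fun setT (fun p : m.-tuple E * n.-tuple E => ev i p.2 (tnth p.1 i)).
Proof.
have m1 : measurable_fun setT (fun p : m.-tuple E * n.-tuple E => tnth p.1 i).
  by apply: (measurableT_comp (measurable_tnth i)).
have m2 j : measurable_fun setT (fun p : m.-tuple E * n.-tuple E => tnth p.2 j).
  by apply: (measurableT_comp (measurable_tnth j)).
have mt1 := measurableT_comp (mt i) m1.
have mt2 j := measurableT_comp (mt i) (m2 j).
apply: measurable_and; first exact: measurableT_comp mlow m1.
apply: measurable_and.
  by apply: measurable_and; apply: measurable_fun_ltr.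
apply: measurable_and.
  apply: (measurable_natcomp (fun k => k == l i)).
  by apply: (measurable_fun_card R) => j; exact: (measurable_fun_ler mt1 (mt2 j)).
apply: (measurable_forallb R) => j.
by apply: measurable_neg; exact: (measurable_fun_eqr (mt2 j) mt1).
Qed.

Let mG : measurable_fun setT G.
Proof. by apply: (measurable_forallb R) => i; exact: mevG. Qed.

Let mev i w : measurable_fun setT (ev i w).
Proof.
rewrite /ev; apply: measurable_and => //.
apply: measurable_and; first by apply: measurable_and; apply: measurable_fun_ltr.
apply: measurable_and.
  apply: (measurable_natcomp (fun k => k == l i)).
  by apply: (measurable_fun_card R) => j; exact: measurable_fun_ler.
apply: (measurable_forallb R) => j.
by apply: measurable_neg; exact: measurable_fun_eqr.
Qed.

(** For a counted [s], the point [s i] has between [l i] and [l i + c] points above it in the order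
    of [t i]: exactly [l i] from the complementary block and at most [c] from the chosen one. By
    [card_rank_window] there are at most [c] candidates for each [s i]. *)
Let card_G (z : N.-tuple E) :
  (#|[pred s : {ffun 'I_m -> 'I_N} | injectiveb s && G ([tuple tnth z (s i) | i < m],
     [tuple tnth z (cotuple Nmn s j) | j < n])]| <= c ^ m)%N.
Proof.
pose S i := [pred v : 'I_N |
  (l i <= #|[pred j | (t i (tnth z v) < t i (tnth z j))%R]|)%N &&
  (#|[pred j | (t i (tnth z v) <= t i (tnth z j))%R]| <= l i + c)%N].
apply: (@leq_trans #|family S|); last first.
  have card_S (e : seq 'I_m) :
      (foldr muln 1 [seq #|S x| | x <- e] <= c ^ size e)%N.
    elim: e => //= i e IH; rewrite expnS leq_mul//.
    exact: (card_rank_window (fun j => t i (tnth z j))).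
  by rewrite card_family; apply: (leq_trans (card_S _)); rewrite size_enum_ord.
apply: subset_leq_card; apply/fintype.subsetP => s; rewrite !inE.
move=> /andP[/injectiveP sI /forallP Gs]; apply/familyP => i.
have low_s j : low (tnth z (s j)) && (a < t j (tnth z (s j))).
  by have := Gs j; rewrite /= tnth_mktuple => /and4P[-> /andP[->]].
have /and4P[_ _ /eqP le_i /forallP ne_i] := Gs i.
rewrite /= tnth_mktuple in le_i ne_i.
rewrite inE !(card_split_cotuple Nmn _ sI); apply/andP; split.
  apply: leq_trans (leq_addr _ _); rewrite -le_i; apply: eq_leq; apply: eq_card => j.
  rewrite !inE tnth_mktuple lt_neqAle; have := ne_i j.
  by rewrite tnth_mktuple eq_sym => ->.
apply: leq_add; last exact: (sep (s := fun j => tnth z (s j))).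
by rewrite -le_i; apply: eq_leq; apply: eq_card => j; rewrite !inE tnth_mktuple.
Qed.

(** Given [w], each radius falls into an interval between order statistics, whose [F]-mass is at
    most [W] times the probability that a fresh threshold falls there. The product over [i] is then
    an event about ranks within [N] points, and exchangeability bounds its probability by a
    count. *)
Lemma rank_upper :
  (\int[prodn mu n]_w prodn F m [set r : m.-tuple R | [forall i, (a < tnth r i <= b)%R &&
      (#|[pred j | (tnth r i <= t i (tnth w j))%R]| == l i)]]
   <= (W ^+ m * (c ^ m)%:R / (N ^_ m)%:R)%:E)%E.
Proof.
have mI i (w : n.-tuple E) : measurable_fun setT (fun r => (a < r <= b) &&
    (#|[pred j | (r <= t i (tnth w j))%R]| == l i)).
  apply: measurable_and.
    by apply: measurable_and; [apply: measurable_fun_ltr|apply: measurable_fun_ler].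
  apply: (measurable_natcomp (fun k => k == l i)).
  by apply: (measurable_fun_card R) => j; exact: measurable_fun_ler.
have Fev i (w : n.-tuple E) :
   (F [set r | ((a < r <= b) && (#|[pred j | (r <= t i (tnth w j))%R]| == l i))%R]
     <= W%:E * mu [set v | ev i w v])%E.
  (* If [l i > n], no radius can have [l i] thresholds above it. *)
  have [ln|nl] := leqP (l i) n; last first.
    rewrite [X in F X](_ : _ = set0) ?measure0; first by rewrite mule_ge0 ?lee_fin.
    apply/seteqP; split => // r /= /andP[_ /eqP lr].
    by have := max_card [pred j | (r <= t i (tnth w j))%R]; rewrite lr card_ord leqNgt nl.
  have [x [y [ax yb lvl _ ne]]] := level_interval (fun j => t i (tnth w j)) a b ln.
  rewrite [X in F X](_ : _ = [set r | (x < r <= y)%R]); last first.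
    by apply/seteqP; split => r /=; rewrite -lvl.
  have [xy|yx] := ltP x y; last first.
    rewrite [X in F X](_ : _ = set0) ?measure0 ?mule_ge0 ?lee_fin//.
    apply/seteqP; split => // r /= /andP[xr ry].
    by have := lt_le_trans xr (le_trans ry yx); rewrite ltxx.
  apply: (le_trans (FW i ax xy yb)); apply: lee_wpmul2l; first by rewrite lee_fin.
  apply: le_measure; rewrite ?inE.
  - apply: measurable_event; apply: measurable_and => //.
    by apply: measurable_and; apply: measurable_fun_ltr.
  - exact: measurable_event.
  - move=> v /= /andP[lv xvy]; have /andP[xv vy] := xvy.
    rewrite /ev lv (le_lt_trans ax xv) (lt_le_trans vy yb) /=.
    have := lvl (t i v); rewrite xv (ltW vy) /= => /andP[_ ->] /=.
    by apply/forallP => j; exact: ne.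
have step w : (prodn F m [set r : m.-tuple R | [forall i, (a < tnth r i <= b)%R &&
      (#|[pred j | (tnth r i <= t i (tnth w j))%R]| == l i)]]
    <= (W ^+ m)%:E * prodn mu m [set v : m.-tuple E | G (v, w)])%E.
  rewrite (_ : [set r : m.-tuple R | _] = rect (fun i => [set r | ((a < r <= b) &&
     (#|[pred j | (r <= t i (tnth w j))%R]| == l i))%R])); last first.
    by apply/seteqP; split => r /= => [/forallP|h]//; apply/forallP.
  rewrite (_ : [set v : m.-tuple E | _] = rect (fun i => [set v | ev i w v])); last first.
    by apply/seteqP; split => r /= => [/forallP|h]//; apply/forallP.
  rewrite !prodn_rect; try by move=> i; exact: measurable_event.
  rewrite -EFinM lee_fin -[in W ^+ m](card_ord m) -prodr_const -big_split/=.
  apply: ler_prod => i _; rewrite fine_ge0//= -lee_fin EFinM !fineK ?Fev//;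
  by apply: fin_num_measure; exact: measurable_event.
pose H (p : m.-tuple R * n.-tuple E) := [forall i, (a < tnth p.1 i <= b) &&
      (#|[pred j | (tnth p.1 i <= t i (tnth p.2 j))%R]| == l i)].
have mH : measurable_fun setT H.
  apply: (measurable_forallb R) => i.
  have m1 : measurable_fun setT (fun p : m.-tuple R * n.-tuple E => tnth p.1 i).
    by apply: (measurableT_comp (measurable_tnth i)).
  have m2 j : measurable_fun setT (fun p : m.-tuple R * n.-tuple E => t i (tnth p.2 j)).
    apply: measurableT_comp => //.
    by apply: (measurableT_comp (measurable_tnth j)).
  apply: measurable_and.
    by apply: measurable_and; [apply: measurable_fun_ltr|apply: measurable_fun_ler].
  apply: (measurable_natcomp (fun k => k == l i)).
  by apply: (measurable_fun_card R) => j; exact: measurable_fun_ler.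
have mG2 : measurable_fun setT (fun w => \int[prodn mu m]_v ((G (v, w))%:R)%:E)%E.
  exact: (measurable_integral_event1 (prodn mu m) mG).
apply: (@le_trans _ _ (\int[prodn mu n]_w
    ((W ^+ m)%:E * \int[prodn mu m]_v ((G (v, w))%:R)%:E))%E).
  rewrite (eq_integral (fun w => \int[prodn F m]_r ((H (r, w))%:R)%:E)%E); last first.
    move=> w _; rewrite integral_event//.
    by apply: (measurableT_comp mH); exact: measurable_pair2.
  apply: ge0_le_integral => //=.
  - by move=> w _; apply: integral_ge0.
  - exact: (measurable_integral_event1 (prodn F m) mH).
  - exact: measurable_funeM.
  - move=> w _; rewrite !integral_event ?step//.
      by apply: (measurableT_comp mG); exact: measurable_pair2.
    by apply: (measurableT_comp mH); exact: measurable_pair2.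
rewrite ge0_integralZl//; last 2 first.
  by move=> w _; apply: integral_ge0.
  by rewrite lee_fin exprn_ge0.
rewrite -mulrA EFinM; apply: lee_wpmul2l; first by rewrite lee_fin exprn_ge0.
rewrite -(fubini_event _ _ mG).
have N0 : (0 : R) < (N ^_ m)%:R by rewrite ltr0n ffact_gt0 Nmn leq_addr.
rewrite -(@lee_pmul2l _ (N ^_ m)%:R%:E) ?fin_numE// ?lte_fin//.
(* Averaging over all positions of the block turns the double integral into an expected number of
   admissible choices, at most [c ^ m]. *)
rewrite (exchange Nmn (iid_tnth mu N) mG) -EFinM mulrCA divff ?gt_eqF// mulr1.
apply: integral_prob_le => [|z|z]; last 2 first.
- by rewrite lee_fin.
- by rewrite lee_fin ler_nat card_G.
apply: (measurable_natcomp (fun k : nat => k%:R%:E : \bar R)).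
apply: (measurable_fun_card R) => s; apply: measurable_and => //.
apply: measurableT_comp => //; apply/measurable_fun_pairP; split => /=;
by apply: measurable_mktuple => i; exact: measurable_tnth.
Qed.

End upper.
Section lower.
Context (n k : nat) (kn : (k <= n)%N) (t : E -> R) (a b W : R).
Hypothesis mt : measurable_fun setT t.
Hypothesis W0 : 0 <= W.
(** The interval is closed on the side of [mu], so that thresholds tied with an endpoint are still
    covered. *)
Hypothesis FW : forall x y, a <= x -> x <= y -> y <= b ->
  (W%:E * mu [set v | (x <= t v <= y)%R] <= F [set r | (x < r <= y)%R])%E.

Let ev (w : n.-tuple E) v := [&& a <= t v <= b,
  (#|[pred j | (t v < t (tnth w j))%R]| <= k)%N &
  (k <= #|[pred j | (t v <= t (tnth w j))%R]|)%N].

Let G (p : 1.-tuple E * n.-tuple E) := ev p.2 (tnth p.1 ord0).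

Let mG : measurable_fun setT G.
Proof.
have m1 : measurable_fun setT (fun p : 1.-tuple E * n.-tuple E => t (tnth p.1 ord0)).
  apply: measurableT_comp => //.
  by apply: (measurableT_comp (measurable_tnth ord0)).
have m2 j : measurable_fun setT (fun p : 1.-tuple E * n.-tuple E => t (tnth p.2 j)).
  apply: measurableT_comp => //.
  by apply: (measurableT_comp (measurable_tnth j)).
apply: measurable_and.
  by apply: measurable_and; apply: measurable_fun_ler.
apply: measurable_and.
  apply: (measurable_natcomp (fun j => j <= k)%N).
  by apply: (measurable_fun_card R) => j; exact: measurable_fun_ltr.
apply: (measurable_natcomp (fun j => k <= j)%N).
by apply: (measurable_fun_card R) => j; exact: measurable_fun_ler.
Qed.

Let mev w : measurable_fun setT (ev w).
Proof.
rewrite /ev; apply: measurable_and; first by apply: measurable_and; apply: measurable_fun_ler.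
apply: measurable_and.
  apply: (measurable_natcomp (fun j => j <= k)%N).
  by apply: (measurable_fun_card R) => j; exact: measurable_fun_ltr.
apply: (measurable_natcomp (fun j => k <= j)%N).
by apply: (measurable_fun_card R) => j; exact: measurable_fun_ler.
Qed.

(** By exchangeability the probability that the last of [n.+1] points has rank [k] and threshold in
    the window is the expected number of such points divided by [n.+1]; [exists_rank] provides at
    least one on the event of the left-hand side. *)
Lemma rank_lower :
  ((W / n.+1%:R)%:E * prodn mu n.+1 [set z | ((#|[pred j | (b < t (tnth z j))%R]| <= k) &&
      (k < #|[pred j | (a <= t (tnth z j))%R]|))%N]
   <= \int[prodn mu n]_w F [set r | (a < r <= b)%R &&
      (#|[pred j | (r <= t (tnth w j))%R]| == k)])%E.
Proof.
have Fev w : (W%:E * mu [set v | ev w v]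
     <= F [set r | ((a < r <= b)%R && (#|[pred j | (r <= t (tnth w j))%R]| == k))])%E.
  have [x [y [ax yb lvl ends _]]] := level_interval (fun j => t (tnth w j)) a b kn.
  rewrite [X in F X](_ : _ = [set r | (x < r <= y)%R]); last first.
    by apply/seteqP; split => r /=; rewrite -lvl.
  have [xy|yx] := leP x y; last first.
    rewrite [X in mu X](_ : _ = set0) ?measure0 ?mule0//.
    apply/seteqP; split => // v /= /and3P[atb h1 h2].
    have /andP[xr ry] := ends _ atb h1 h2.
    by have := le_lt_trans (le_trans xr ry) yx; rewrite ltxx.
  apply: le_trans (FW ax xy yb); apply: lee_wpmul2l; first by rewrite lee_fin.
  apply: le_measure; rewrite ?inE.
  - exact: measurable_event.
  - apply: measurable_event.
    by apply: measurable_and; apply: measurable_fun_ler.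
  - by move=> v /= /and3P[atb h1 h2]; exact: ends.
pose H (p : R * n.-tuple E) := (a < p.1 <= b) && (#|[pred j | (p.1 <= t (tnth p.2 j))%R]| == k).
have mH : measurable_fun setT H.
  have m2 j : measurable_fun setT (fun p : R * n.-tuple E => t (tnth p.2 j)).
    apply: measurableT_comp => //.
    by apply: (measurableT_comp (measurable_tnth j)).
  apply: measurable_and.
    by apply: measurable_and; [apply: measurable_fun_ltr|apply: measurable_fun_ler].
  apply: (measurable_natcomp (fun j => j == k)).
  by apply: (measurable_fun_card R) => j; exact: measurable_fun_ler.
have mG2 : measurable_fun setT (fun w => \int[prodn mu 1]_v ((G (v, w))%:R)%:E)%E.
  exact: (measurable_integral_event1 (prodn mu 1) mG).
apply: (@le_trans _ _ (\int[prodn mu n]_w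
    (W%:E * \int[prodn mu 1]_v ((G (v, w))%:R)%:E))%E); last first.
  rewrite [leRHS](eq_integral (fun w => \int[F]_r ((H (r, w))%:R)%:E)%E); last first.
    move=> w _; rewrite integral_event//.
    by apply: (measurableT_comp mH); exact: measurable_pair2.
  apply: ge0_le_integral => //=.
  - by move=> w _; rewrite mule_ge0 ?lee_fin ?integral_ge0.
  - exact: measurable_funeM.
  - exact: (measurable_integral_event1 F mH).
  - move=> w _; rewrite !integral_event//; last 2 first.
      by apply: (measurableT_comp mH); exact: measurable_pair2.
      by apply: (measurableT_comp mG); exact: measurable_pair2.
    apply: le_trans (Fev w); apply: lee_wpmul2l; first by rewrite lee_fin.
    rewrite (_ : [set x | _] = rect (fun i : 'I_1 => [set v | ev w v])); last first.
      by apply/seteqP; split => r /= => [h i|h]; [rewrite ord1|exact: h].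
    rewrite prodn_rect; last by move=> i; exact: measurable_event.
    by rewrite big_ord1 fineK//; apply: fin_num_measure; exact: measurable_event.
rewrite ge0_integralZl//; last by move=> w _; exact: integral_ge0.
rewrite EFinM -muleA; apply: lee_wpmul2l; first by rewrite lee_fin.
rewrite -(fubini_event _ _ mG).
have N0 : (0 : R) < n.+1%:R by [].
rewrite -(@lee_pmul2l _ n.+1%:R%:E) ?fin_numE// ?lte_fin//.
rewrite muleA -EFinM divff ?gt_eqF// mul1e.
have := exchange (erefl (1 + n)%N : n.+1 = (1 + n)%N) (iid_tnth mu n.+1) mG.
rewrite ffactn1 => ->.
rewrite -integral_event; last first.
  apply: measurable_and.
    apply: (measurable_natcomp (fun j => j <= k)%N).
    apply: (measurable_fun_card R) => j; apply: measurable_fun_ltr => //.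
    by apply: measurableT_comp => //; exact: measurable_tnth.
  apply: (measurable_natcomp (fun j => k < j)%N).
  apply: (measurable_fun_card R) => j; apply: measurable_fun_ler => //.
  by apply: measurableT_comp => //; exact: measurable_tnth.
apply: ge0_le_integral => //=.
- apply: measurable_fun_eventE; apply: measurable_and.
    apply: (measurable_natcomp (fun j => j <= k)%N).
    apply: (measurable_fun_card R) => j; apply: measurable_fun_ltr => //.
    by apply: measurableT_comp => //; exact: measurable_tnth.
  apply: (measurable_natcomp (fun j => k < j)%N).
  apply: (measurable_fun_card R) => j; apply: measurable_fun_ler => //.
  by apply: measurableT_comp => //; exact: measurable_tnth.
- apply: (measurable_natcomp (fun k : nat => k%:R%:E : \bar R)).
  apply: (measurable_fun_card R) => s; apply: measurable_and => //.
  apply: measurableT_comp => //; apply/measurable_fun_pairP; split => /=;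
  by apply: measurable_mktuple => i; exact: measurable_tnth.
- move=> z _; rewrite lee_fin ler_nat.
  have [/andP[kb ka]|//] := boolP (_ && _).
  have [v [atb h1 h2]] := exists_rank (t := fun j => t (tnth z j)) kb ka.
  apply/card_gt0P; exists [ffun=> v]; rewrite inE.
  have vI : injective (([ffun=> v] : {ffun 'I_1 -> 'I_n.+1}) : 'I_1 -> 'I_n.+1).
    by move=> i j _; rewrite (ord1 i) (ord1 j).
  apply/andP; split; first exact/injectiveP.
  rewrite /G /ev /= !tnth_mktuple !ffunE atb /=.
  move: h1 h2; rewrite !(card_split_cotuple (erefl (1 + n)%N : n.+1 = (1 + n)%N) _ vI).
  move=> h1 h2; apply/andP; split.
    apply: leq_trans h1; apply: leq_trans (leq_addr _ _); apply: eq_leq.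
    by apply: eq_card => j; rewrite !inE tnth_mktuple.
  (* The point itself is among the more than [k] points whose threshold reaches its own, so the
     other [n] account for at least [k]. *)
  rewrite -ltnS; apply: (leq_trans h2); rewrite -[leqRHS]addn1; apply: leq_add; last first.
    by apply: (leq_trans (max_card _)); rewrite card_ord.
  by apply: eq_leq; apply: eq_card => j; rewrite !inE tnth_mktuple.
Qed.

End lower.
End rank_bounds.

Section prodn_cons.
Context d (E : measurableType d) (R : realType) (mu : probability E R).

Lemma prodn_cons n (f : n.+1.-tuple E -> \bar R) :
  measurable_fun setT f -> (forall z, 0 <= f z)%E ->
  (\int[prodn mu n.+1]_z f z =
   \int[mu]_x \int[prodn mu n]_z f [the n.+1.-tuple E of x :: z])%E.
Proof.
move=> mf f0.
have mc : measurable_fun setT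
    (fun p : E * n.-tuple E => [the n.+1.-tuple E of p.1 :: p.2]).
  by apply: measurable_cons; [exact: measurable_fst|exact: measurable_snd].
have ic : iid (mu \x prodn mu n)%E mu
    (fun i (p : E * n.-tuple E) => tnth [the n.+1.-tuple E of p.1 :: p.2] i).
  split => [i|A mA]; first exact: (measurableT_comp (measurable_tnth i)).
  rewrite (_ : [set w | _] = A ord0 `*` rect (fun i : 'I_n => A (lift ord0 i))).
    rewrite /= product_measure1E//; last exact: measurable_rect.
    rewrite big_ord_recl EFinM fineK; last exact: fin_num_measure.
    by congr (_ * _)%E; exact: prodn_rect.
  apply/seteqP; split => -[x z] /=.
    move=> Az; split; first exact: (Az ord0).
    by move=> i /=; have := Az (lift ord0 i); rewrite tnthS.
  move=> [Ax Az] i; case: (unliftP ord0 i) => [j|] ->; last by [].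
  by rewrite tnthS; exact: Az.
have e := iid_integral ic mf f0; apply: etrans (esym e) _.
rewrite (@fubini_tonelli1 _ _ _ _ _ mu (prodn mu n)
  (fun p => f [tuple tnth [the n.+1.-tuple E of p.1 :: p.2] i | i < n.+1])).
- apply: eq_integral => x _; apply: eq_integral => z _.
  by congr f; apply/eq_from_tnth => i; rewrite tnth_mktuple.
- apply: measurableT_comp => //.
  by apply: measurable_mktuple => i; exact: (measurableT_comp (measurable_tnth i)).
- by move=> p.
Qed.

End prodn_cons.

Lemma cvg_expR {R : realType} {T : Type} (F : set_system T) {FF : Filter F} (f : T -> R) (l : R) :
  f x @[x --> F] --> l -> expR (f x) @[x --> F] --> expR l.
Proof. by move=> fl; apply: (cvg_comp f expR fl); exact: continuous_expR. Qed.

(** * Binomial counts *)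

Section counts.
Context {R : realType}.
Implicit Types (p q c s : R) (n k : nat).

(* Expectation of [h] under the law of the number of successes among [n] trials. *)
Fixpoint bin_exp p n (h : nat -> R) : R :=
  if n is n'.+1 then p * bin_exp p n' (fun a => h a.+1) + (1 - p) * bin_exp p n' h
  else h 0%N.

(* The same for two correlated successes: [q] is the probability that both occur. *)
Fixpoint bin_exp2 p1 p2 q n (h : nat -> nat -> R) : R :=
  if n is n'.+1 then
    q * bin_exp2 p1 p2 q n' (fun a b => h a.+1 b.+1) +
    (p1 - q) * bin_exp2 p1 p2 q n' (fun a b => h a.+1 b) +
    (p2 - q) * bin_exp2 p1 p2 q n' (fun a b => h a b.+1) +
    (1 - p1 - p2 + q) * bin_exp2 p1 p2 q n' h
  else h 0%N 0%N.

Lemma bin_exp2_prod p1 p2 n h1 h2 :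
  bin_exp2 p1 p2 (p1 * p2) n (fun a b => h1 a * h2 b) = bin_exp p1 n h1 * bin_exp p2 n h2.
Proof. by elim: n h1 h2 => //= n IH h1 h2; rewrite !IH; ring. Qed.

Lemma bin_exp2_bound p1 p2 q n h : 0 <= q -> q <= p1 -> q <= p2 -> 0 <= 1 - p1 - p2 + q ->
  (forall a b, 0 <= h a b <= 1) -> 0 <= bin_exp2 p1 p2 q n h <= 1.
Proof.
move=> q0 q1 q2 q3; elim: n h => [|n IH] h h01 /=; first exact: h01.
have /andP[a1 a2] := IH (fun a b => h a.+1 b.+1) (fun a b => h01 _ _).
have /andP[b1 b2] := IH (fun a b => h a.+1 b) (fun a b => h01 _ _).
have /andP[c1 c2] := IH (fun a b => h a b.+1) (fun a b => h01 _ _).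
have /andP[d1 d2] := IH h h01.
by apply/andP; split; nra.
Qed.

(** Exchange [q] for [q'] one trial at a time: [q] enters the four weights of a trial with signs
    [+ - - +], so each exchange costs at most [|q - q'|] times a signed sum of four values in
    [[0, 1]]. *)
Lemma bin_exp2_dist p1 p2 q q' n h :
  0 <= q -> q <= p1 -> q <= p2 -> 0 <= 1 - p1 - p2 + q ->
  0 <= q' -> q' <= p1 -> q' <= p2 -> 0 <= 1 - p1 - p2 + q' ->
  (forall a b, 0 <= h a b <= 1) ->
  `|bin_exp2 p1 p2 q n h - bin_exp2 p1 p2 q' n h| <= n%:R * (4 * `|q - q'|).
Proof.
move=> q0 q1 q2 q3 q0' q1' q2' q3'.
elim: n h => [|n IH] h h01 /=; first by rewrite subrr normr0 mul0r.
set e := 4 * _; set x1 := bin_exp2 _ _ q _ _; set x1' := bin_exp2 _ _ q' _ _ in IH *.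
have e1 := IH (fun a b => h a.+1 b.+1) (fun a b => h01 _ _).
have e2 := IH (fun a b => h a.+1 b) (fun a b => h01 _ _).
have e3 := IH (fun a b => h a b.+1) (fun a b => h01 _ _).
have e4 := IH h h01.
have B h' := @bin_exp2_bound p1 p2 q' n h' q0' q1' q2' q3'.
have /andP[a1 a2] := B (fun a b => h a.+1 b.+1) (fun a b => h01 _ _).
have /andP[b1 b2] := B (fun a b => h a.+1 b) (fun a b => h01 _ _).
have /andP[c1 c2] := B (fun a b => h a b.+1) (fun a b => h01 _ _).
have /andP[d1 d2] := B h h01.
move: e1 e2 e3 e4 a1 a2 b1 b2 c1 c2 d1 d2; rewrite -/e.
set y1 := bin_exp2 _ _ q _ _; set y1' := bin_exp2 _ _ q' _ _.
set y2 := bin_exp2 _ _ q _ _; set y2' := bin_exp2 _ _ q' _ _.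
set y3 := bin_exp2 _ _ q _ _; set y3' := bin_exp2 _ _ q' _ _.
set y4 := bin_exp2 _ _ q _ _; set y4' := bin_exp2 _ _ q' _ _.
move=> e1 e2 e3 e4 a1 a2 b1 b2 c1 c2 d1 d2.
rewrite -/x1 -/x1'.
have -> : q * y1 + (p1 - q) * y2 + (p2 - q) * y3 + (1 - p1 - p2 + q) * y4 -
  (q' * y1' + (p1 - q') * y2' + (p2 - q') * y3' + (1 - p1 - p2 + q') * y4') =
  (q * (y1 - y1') + (p1 - q) * (y2 - y2') + (p2 - q) * (y3 - y3') +
  (1 - p1 - p2 + q) * (y4 - y4')) + (q - q') * (y1' - y2' - y3' + y4') by ring.
apply: (le_trans (ler_normD _ _)).
have -> : n.+1%:R * e = n%:R * e + e by rewrite -natr1; ring.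
apply: lerD.
  move: e1 e2 e3 e4; rewrite !ler_norml => /andP[? ?] /andP[? ?] /andP[? ?] /andP[? ?].
  by apply/andP; split; nra.
rewrite normrM /e mulrC ler_wpM2r// ler_norml; apply/andP; split; lra.
Qed.

Lemma bin_exp_ge0 p n h : 0 <= p <= 1 -> (forall a, 0 <= h a) -> 0 <= bin_exp p n h.
Proof.
move=> /andP[p0 p1]; elim: n h => //= n IH h h0.
by rewrite addr_ge0// mulr_ge0 ?IH// subr_ge0.
Qed.

Lemma ler_bin_exp p n h h' : 0 <= p <= 1 -> (forall a, h a <= h' a) ->
  bin_exp p n h <= bin_exp p n h'.
Proof.
move=> /andP[p0 p1]; elim: n h h' => //= n IH h h' hh'.
by rewrite lerD// ler_wpM2l ?subr_ge0// IH.
Qed.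

Lemma bin_expZ p n c h : bin_exp p n (fun a => c * h a) = c * bin_exp p n h.
Proof. by elim: n h => //= n IH h; rewrite !IH; ring. Qed.

Lemma bin_exp_geometric p n s : bin_exp p n (fun a => s ^+ a) = (1 + p * (s - 1)) ^+ n.
Proof.
elim: n => [|n IH]; rewrite ?expr0//=.
rewrite (_ : (fun a => s ^+ a.+1) = fun a => s * s ^+ a); last first.
  by apply/funext => a; rewrite exprS.
by rewrite bin_expZ IH exprS; ring.
Qed.

Lemma bin_exp_cst p n c : bin_exp p n (fun=> c) = c.
Proof. by elim: n => //= n ->; ring. Qed.

(* Chernoff: [1_A <= c s^a] pointwise, and [1 + x <= exp x]. *)
Lemma bin_exp_chernoff p n s c h : 0 <= p <= 1 -> 0 <= s -> 0 <= c ->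
  (forall a, h a <= c * s ^+ a) ->
  bin_exp p n h <= c * expR (n%:R * p * (s - 1)).
Proof.
move=> p01 s0 c0 hs; apply: (le_trans (ler_bin_exp n p01 hs)).
rewrite bin_expZ bin_exp_geometric ler_wpM2l//.
have /andP[p0 p1] := p01.
rewrite -mulrA expRM_natl; apply: lerXn2r; rewrite ?nnegrE ?expR_ge0//; first nra.
exact: expR_ge1Dx.
Qed.

Lemma bin_exp_eq p n k : bin_exp p n (fun a => (a == k)%:R) =
  'C(n, k)%:R * p ^+ k * (1 - p) ^+ (n - k).
Proof.
elim: n k => [|n IH] [|k] /=.
- by rewrite bin0 !expr0 !mulr1.
- by rewrite bin0n /= !mul0r.
- by rewrite IH bin_exp_cst !bin0 !subn0 !expr0 exprS; ring.
- under eq_fun do rewrite eqSS.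
  rewrite !IH binS natrD subSS; have [kn|nk] := ltnP k n.
    by rewrite -(subnSK kn) !exprS; ring.
  rewrite (bin_small (m := k.+1)) ?ltnS// (_ : (n - k = 0)%N); last by apply/eqP; rewrite subn_eq0.
  by rewrite !expr0 exprS; ring.
Qed.

(** For [k = 0] the power [(1 - p)^n] is squeezed between [exp (- n p / (1 - p))] and [exp (- n p)].
    The ratio of consecutive binomial probabilities tends to [lam / k.+1], which gives the
    induction. *)
Lemma bin_exp_poisson (p : nat -> R) (n : nat -> nat) (lam : R) k :
  (forall i, 0 <= p i <= 1) -> n i @[i --> \oo] --> \oo ->
  ((n i)%:R * p i @[i --> \oo] --> lam) ->
  bin_exp (p i) (n i) (fun a => (a == k)%:R) @[i --> \oo] -->
  lam ^+ k / k`!%:R * expR (- lam).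
Proof.
move=> p01 noo npl.
have ngt K : \forall i \near \oo, (K < n i)%N := noo _ (nbhs_infty_gt K).
have nRoo : ((n i)%:R : R) @[i --> \oo] --> +oo.
  by apply: (cvg_comp _ (fun j : nat => j%:R : R) noo); exact: cvgr_idn.
have invn : ((n i)%:R^-1 : R) @[i --> \oo] --> 0.
  apply: (gtr0_cvgV0 (f := fun i => (n i)%:R) _).2 => //.
  have := ngt 0%N.
  by apply: filterS => i; rewrite ltr0n.
have p0 : p i @[i --> \oo] --> (0 : R).
  rewrite -[X in _ --> X](mulr0 lam).
  apply: (cvg_trans _ (cvgM npl invn)); apply: near_eq_cvg.
  have := ngt 0%N.
  apply: filterS => i ni; rewrite /= mulrAC divff ?mul1r// pnatr_eq0 -lt0n//.
under eq_fun do rewrite bin_exp_eq.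
elim: k => [|k IH].
  under eq_fun do rewrite bin0 expr0 !mul1r subn0.
  rewrite expr0 fact0 divr1 mul1r.
  have lo : expR (- ((n i)%:R * p i / (1 - p i))) @[i --> \oo] --> expR (- lam).
    apply: cvg_expR.
    rewrite (_ : - lam = - (lam / (1 - 0))); last by rewrite subr0 divr1.
    apply: cvgN; apply: cvgM => //; apply: cvgV; first by rewrite subr0 oner_neq0.
    by apply: cvgB => //; exact: cvg_cst.
  have hi : expR (- ((n i)%:R * p i)) @[i --> \oo] --> expR (- lam).
    by apply: cvg_expR; exact: cvgN.
  apply: squeeze_cvgr lo hi.
  have : \forall i \near \oo, p i < 1.
    by move/cvgrPdist_lt : p0 => /(_ 1 ltr01); apply: filterS => i;
      rewrite sub0r normrN; exact: le_lt_trans (ler_norm _).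
  apply: filterS => i pi1; have /andP[pi0 _] := p01 i.
  have q0 : 0 < 1 - p i by rewrite subr_gt0.
  apply/andP; split; rewrite -?mulrA -mulrN expRM_natl.
    apply: lerXn2r; rewrite ?nnegrE ?expR_ge0 ?(ltW q0)//.
    rewrite expRN -[leRHS]invrK lef_pV2 ?posrE ?expR_gt0 ?invr_gt0//.
    apply: le_trans (expR_ge1Dx _); rewrite le_eqVlt; apply/orP; left; apply/eqP.
    by field; rewrite gt_eqF.
  apply: lerXn2r; rewrite ?nnegrE ?expR_ge0 ?(ltW q0)//.
  by apply: le_trans (expR_ge1Dx _).
have c1 : (((n i)%:R * p i - k%:R * p i) / (k.+1%:R * (1 - p i)))
    @[i --> \oo] --> (lam - k%:R * 0) / (k.+1%:R * (1 - 0)).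
  apply: cvgM.
    by apply: cvgB => //; apply: cvgM => //; exact: cvg_cst.
  apply: cvgV; first by rewrite subr0 mulr1 pnatr_eq0.
  by apply: cvgM; [exact: cvg_cst|apply: cvgB => //; exact: cvg_cst].
rewrite (_ : lam ^+ k.+1 / k.+1`!%:R * expR (- lam) = lam ^+ k / k`!%:R * expR (- lam) *
  ((lam - k%:R * 0) / (k.+1%:R * (1 - 0)))); last first.
  rewrite factS natrM exprS mulr0 !subr0 mulr1; field.
  by rewrite nat1r !pnatr_eq0 /= -lt0n fact_gt0.
apply: (cvg_trans _ (cvgM IH c1)); apply: near_eq_cvg.
have : \forall i \near \oo, p i < 1.
  by move/cvgrPdist_lt : p0 => /(_ 1 ltr01); apply: filterS => i;
    rewrite sub0r normrN; exact: le_lt_trans (ler_norm _).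
have := ngt k.
apply: filterS2 => i kn pi1 /=.
have := mul_bin_left (n i) k => /(congr1 (fun x => x%:R : R)).
rewrite !natrM natrB ?(ltnW kn)// => e.
have k0 : k.+1%:R != 0 :> R by [].
have q0 : 1 - p i != 0 by rewrite subr_eq0 gt_eqF.
apply: (mulfI k0); rewrite mulrA -mulrBl !mulrA e.
rewrite -(subnSK kn) (exprS (p i)) (exprS (1 - p i)).
by field; rewrite q0 nat1r k0.
Qed.

End counts.

Section count_law.
Context d (E : measurableType d) (R : realType) (mu : probability E R).

(** Real-valued, so that probabilities can be handled by the arithmetic of an ordered field. *)
Definition pr dT (T : measurableType dT) (P : probability T R) (b : T -> bool) : R :=
  fine (P [set x | b x]).

Section pr_theory.
Context dT (T : measurableType dT) (P : probability T R).
Implicit Types b : T -> bool.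

Lemma prE b : measurable_fun setT b -> P [set x | b x] = (pr P b)%:E.
Proof. by move=> mb; rewrite fineK//; apply: fin_num_measure; exact: measurable_event. Qed.

Lemma pr_ge0 b : 0 <= pr P b.
Proof. exact: fine_ge0. Qed.

Lemma pr_le1 b : measurable_fun setT b -> pr P b <= 1.
Proof.
by move=> mb; rewrite -lee_fin -prE//; apply: probability_le1; exact: measurable_event.
Qed.

Lemma le_pr b1 b2 : measurable_fun setT b1 -> measurable_fun setT b2 ->
  (forall x, b1 x -> b2 x) -> pr P b1 <= pr P b2.
Proof.
move=> m1 m2 b12; rewrite -lee_fin -!prE//; apply: le_measure => //; rewrite inE;
exact: measurable_event.
Qed.

Lemma pr_split b c : measurable_fun setT b -> measurable_fun setT c ->
  pr P b = pr P (fun x => b x && c x) + pr P (fun x => b x && ~~ c x).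
Proof.
move=> mb mc.
have m1 : measurable_fun setT (fun x => b x && c x) by exact: measurable_and.
have m2 : measurable_fun setT (fun x => b x && ~~ c x).
  by apply: measurable_and => //; exact: measurable_neg.
apply: EFin_inj; rewrite EFinD -!prE// -measureU; last 3 first.
- exact: measurable_event.
- exact: measurable_event.
- by apply/seteqP; split => // x /= [/andP[_ ->] /andP[_ ]].
congr (P _); apply/seteqP; split => x /=; last by case=> /andP[].
by case: (c x) => ->; [left|right].
Qed.

Lemma pr_or b c : measurable_fun setT b -> measurable_fun setT c ->
  pr P (fun x => b x || c x) <= pr P b + pr P c.
Proof.
move=> mb mc; have mbc : measurable_fun setT (fun x => b x || c x) by exact: measurable_or.
rewrite (pr_split mbc mb) lerD// le_pr//.
- by apply: measurable_and.
- by move=> x /andP[].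
- by apply: measurable_and => //; exact: measurable_neg.
- by move=> x /andP[/orP[->|//]].
Qed.

Lemma pr_neg b : measurable_fun setT b -> pr P (fun x => ~~ b x) = 1 - pr P b.
Proof.
move=> mb; have := @pr_split (fun=> true) b (measurable_cst _) mb.
have -> : pr P (fun=> true) = 1.
  rewrite /pr (_ : [set x | _] = setT) ?probability_setT//.
  by apply/seteqP; split.
by move=> /= ->; rewrite addrAC subrr add0r.
Qed.

Lemma pr_or_le (I : finType) (b : I -> T -> bool) (c : T -> bool) :
  measurable_fun setT c -> (forall i, measurable_fun setT (b i)) ->
  (forall x, c x -> exists i, b i x) -> pr P c <= \sum_i pr P (b i).
Proof.
move=> mc mb cb.
apply: (@le_trans _ _ (pr P (fun x => [exists i, b i x]))).
  apply: le_pr => //; last by move=> x /cb [i bi]; apply/existsP; exists i.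
  rewrite (_ : (fun x => _) = fun x => (0 < #|[pred i | b i x]|)%N).
    apply: (measurable_natcomp (fun k => (0 < k)%N)).
    exact: (measurable_fun_card R).
  by apply/funext => x; apply/existsP/card_gt0P => -[i]; exists i.
have -> : (fun x => [exists i, b i x]) = fun x => has (b^~ x) (enum I).
  apply/funext => x; apply/existsP/hasP => [[i bi]|[i _ bi]]; exists i => //.
  by rewrite mem_enum.
rewrite -big_enum/=; elim: (enum I) => [|i s IH] /=.
  by rewrite big_nil /pr (_ : [set x | _] = set0) ?measure0//; apply/seteqP; split.
have ms : measurable_fun setT (fun x => has (b^~ x) s).
  by elim: (s) => [|j s' IH']; [exact: measurable_cst|exact: measurable_or].
by rewrite big_cons; apply: (le_trans (pr_or (mb i) ms)); rewrite lerD2l.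
Qed.

End pr_theory.

Lemma measurable_fun_nat2 dT (T : measurableType dT) (f g : T -> nat) (h : nat -> nat -> R) :
  measurable_fun setT f -> measurable_fun setT g ->
  measurable_fun setT (fun x => h (f x) (g x)).
Proof.
move=> mf mg _ Y mY; rewrite setTI.
rewrite (_ : _ @^-1` Y = \bigcup_a \bigcup_b
   (if `[< Y (h a b) >] then (f @^-1` [set a] `&` g @^-1` [set b]) else set0)).
  apply: bigcupT_measurable => a; apply: bigcupT_measurable => b.
  case: ifP => // _; apply: measurableI.
    by have := mf measurableT [set a]; rewrite setTI; apply.
  by have := mg measurableT [set b]; rewrite setTI; apply.
apply/seteqP; split => [x /= Yx|x [a _ [b _]]].
  by exists (f x) => //; exists (g x) => //; rewrite asboolT.
by case: ifPn => // /asboolP + [/= fx gx]; rewrite -fx -gx.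
Qed.

Variables (A B : E -> bool).
Hypotheses (mA : measurable_fun setT A) (mB : measurable_fun setT B).

Let N (C : E -> bool) n (z : n.-tuple E) := #|[pred j | C (tnth z j)]|.

Let mN (C : E -> bool) n : measurable_fun setT C -> measurable_fun setT (@N C n).
Proof.
move=> mC; apply: (measurable_fun_card R) => j.
by apply: measurableT_comp => //; exact: measurable_tnth.
Qed.

Let N_cons (C : E -> bool) n x (z : n.-tuple E) :
  N C [the n.+1.-tuple E of x :: z] = (C x + N C z)%N.
Proof.
have NE m (y : m.-tuple E) : N C y = count C y.
  by rewrite -sum1_count big_tuple sum1_card.
by rewrite !NE.
Qed.

(** Condition on the first point: it falls into one of the four cells cut out by [A] and [B], with
    the weights of one step of [bin_exp2]. *)
Lemma count_law2 n h : (forall a b, 0 <= h a b) ->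
  (\int[prodn mu n]_z (h #|[pred j | A (tnth z j)]| #|[pred j | B (tnth z j)]|)%:E =
  (bin_exp2 (pr mu A) (pr mu B) (pr mu (fun x => A x && B x)) n h)%:E)%E.
Proof.
elim: n h => [|n IH] h h0.
  rewrite (eq_integral (fun=> (h 0%N 0%N)%:E))%E; last first.
    by move=> z _; rewrite !eq_card0// => -[].
  have -> : (\int[prodn mu 0]__ (h 0%N 0%N)%:E = (h 0%N 0%N)%:E * prodn mu 0 setT)%E.
    exact: integral_cst.
  by rewrite [prodn mu 0 setT]probability_setT mule1.
rewrite prodn_cons; last 2 first.
- by apply/measurable_EFinP; apply: measurable_fun_nat2; exact: mN.
- by move=> z; rewrite lee_fin.
set p1 := pr mu A; set p2 := pr mu B; set q := pr mu _.
(* [c i j] is the conditional expectation once the first point has added [i] and [j] to the two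
   counts. *)
pose c i j := bin_exp2 p1 p2 q n (fun a b => h (i + a)%N (j + b)%N).
have mAB : measurable_fun setT (fun x => A x && B x) by exact: measurable_and.
have mnA : measurable_fun setT (fun x => ~~ A x) by exact: measurable_neg.
have mnB : measurable_fun setT (fun x => ~~ B x) by exact: measurable_neg.
have q0 : 0 <= q by exact: pr_ge0.
have c0 i j : 0 <= c i j.
  rewrite -lee_fin -IH; first by apply: integral_ge0 => z _; rewrite lee_fin.
  by move=> a b; exact: h0.
rewrite (eq_integral (fun x => (c 1%N 1%N * (A x && B x)%:R)%:E +
  (c 1%N 0%N * (A x && ~~ B x)%:R)%:E + (c 0%N 1%N * (~~ A x && B x)%:R)%:E +
  (c 0%N 0%N * (~~ A x && ~~ B x)%:R)%:E))%E; last first.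
  move=> x _.
  rewrite (eq_integral (fun z => (h (A x + N A z)%N (B x + N B z)%N)%:E))%E; last first.
    by move=> z _; rewrite -!N_cons.
  rewrite (IH (fun a b => h (A x + a)%N (B x + b)%N)) ?(fun=> h0)// -/p1 -/p2 -/q -/(c _ _).
  by case: (A x); case: (B x); rewrite /= ?mulr0 ?mulr1 ?addr0 ?add0r.
have me (b : E -> bool) i j : measurable_fun setT b ->
    measurable_fun setT (fun x : E => ((c i j * (b x)%:R)%:E : \bar R)).
  move=> mb; apply/measurable_EFinP; apply: measurable_funM => //.
  exact: (measurableT_comp (f := fun b : bool => b%:R : R)).
have ge i j (b : bool) : (0 <= ((c i j * b%:R)%:E : \bar R))%E.
  by rewrite lee_fin mulr_ge0.
have ie i j (b : E -> bool) : measurable_fun setT b ->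
    (\int[mu]_x (c i j * (b x)%:R)%:E = (c i j * pr mu b)%:E)%E.
  move=> mb; under eq_integral do rewrite EFinM.
  rewrite ge0_integralZl_EFin//; last exact: measurable_fun_eventE.
  by rewrite integral_event// prE.
rewrite !ge0_integralD//; do ?[by move=> *; rewrite ?adde_ge0];
  do ?[by apply: me; exact: measurable_and];
  do ?[by apply: emeasurable_funD; apply: me; exact: measurable_and];
  last by do 2 (apply: emeasurable_funD; last by apply: me; exact: measurable_and);
    apply: me; exact: measurable_and.
rewrite !ie; do ?[exact: measurable_and].
have e1 := pr_split mu mA mB.
have e2 : p2 = q + pr mu (fun x => ~~ A x && B x).
  rewrite /p2 (pr_split mu mB mA) /q; congr (pr mu _ + pr mu _);
  by apply/funext => x; rewrite andbC.
have e3 := pr_split mu mnA mB.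
rewrite pr_neg// -/p1 -/p2 -/q in e1 e3.
rewrite -!EFinD /=; congr (_%:E); rewrite -/(c 1%N 1%N) -/(c 1%N 0%N) -/(c 0%N 1%N) -/(c 0%N 0%N).
have -> : pr mu (fun x => A x && ~~ B x) = p1 - q by rewrite e1; ring.
have e2' : pr mu (fun x => ~~ A x && B x) = p2 - q by rewrite e2; ring.
have -> : pr mu (fun x => ~~ A x && ~~ B x) = 1 - p1 - p2 + q.
  by apply: (addrI (pr mu (fun x => ~~ A x && B x))); rewrite -e3 e2'; ring.
by rewrite e2' -/q; ring.
Qed.

End count_law.

(** The two-event law with an empty second event, for which the joint probability is a product. *)
Lemma count_law d (E : measurableType d) (R : realType) (mu : probability E R)
    (A : E -> bool) n h : measurable_fun setT A -> (forall a, 0 <= h a) ->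
  (\int[prodn mu n]_z (h #|[pred j | A (tnth z j)]|)%:E = (bin_exp (pr mu A) n h)%:E)%E.
Proof.
move=> mA h0; pose B : E -> bool := fun=> false.
rewrite (eq_integral (fun z => (h #|[pred j | A (tnth z j)]| *
  (fun=> 1) #|[pred j | B (tnth z j)]|)%:E))%E; last by move=> z _; rewrite mulr1.
rewrite (@count_law2 _ _ _ mu A B mA (measurable_cst _) n (fun a b => h a * (fun=> 1) b));
  last by move=> a b; rewrite mulr1.
have B0 : pr mu B = 0 by rewrite /pr (_ : [set x | _] = set0) ?measure0//; apply/seteqP; split.
have -> : pr mu (fun x => A x && B x) = pr mu A * pr mu B.
  by rewrite B0 mulr0 /pr (_ : [set x | _] = set0) ?measure0//; apply/seteqP; split => x //=; rewrite andbF.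
by rewrite bin_exp2_prod bin_exp_cst mulr1.
Qed.

(* Bonferroni: the alternating sum of [C(N, j + i)] truncated at [M] terms. *)
Lemma alt_bin_sum {R : realType} (a M : nat) :
  \sum_(i < M) (-1) ^+ i * 'C(a.+1, i)%:R = (if M is M'.+1 then (-1) ^+ M' * 'C(a, M')%:R else 0) :> R.
Proof.
elim: M => [|M IH]; first by rewrite big_ord0.
rewrite big_ord_recr /= IH; case: M {IH} => [|M]; first by rewrite add0r !bin0.
by rewrite binS natrD exprS; ring.
Qed.

(** Since [C(j + i, j) C(N, j + i) = C(N, j) C(N - j, i)], only a truncated alternating row sum
    remains. For [N > j] it equals, up to sign, [C(N - j - 1, M - 1)], which the first omitted term
    dominates; for [N = j] only [i = 0] survives. *)
Lemma bonferroni {R : realType} (N j M : nat) : (0 < M)%N ->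
  `| (N == j)%:R - \sum_(i < M) (-1) ^+ i * ('C(j + i, j) * 'C(N, j + i))%:R |
  <= ('C(j + M, j) * 'C(N, j + M))%:R :> R.
Proof.
move=> M0.
have binCM i : ('C(j + i, j) * 'C(N, j + i) = 'C(N, j) * 'C(N - j, i))%N.
  have [jiN|] := leqP (j + i) N; last first.
    move=> Nji; rewrite (bin_small Nji) muln0.
    have [jN|/bin_small ->//] := leqP j N.
    by rewrite (bin_small (m := i)) ?muln0// ltn_subLR.
  have jN : (j <= N)%N by exact: leq_trans (leq_addr _ _) jiN.
  have iNj : (i <= N - j)%N by rewrite leq_subRL.
  have f0 : (0 < (j`! * i`! * (N - j - i)`!))%N by rewrite !muln_gt0 !fact_gt0.
  apply/eqP; rewrite -(eqn_pmul2r f0); apply/eqP.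
  have e1 := bin_fact (leq_addr i j); rewrite addKn in e1.
  have e2 := bin_fact jiN; rewrite subnDA in e2.
  have e3 := bin_fact jN; have e4 := bin_fact iNj.
  transitivity N`!.
    by rewrite -e2 -e1; ring.
  by rewrite -e3 -e4; ring.
rewrite (eq_bigr (fun i : 'I_M => 'C(N, j)%:R * ((-1) ^+ i * 'C(N - j, i)%:R))); last first.
  by move=> i _; rewrite binCM natrM mulrCA.
rewrite -mulr_sumr binCM natrM.
have [Nj|jN|->] := ltngtP N j.
- by rewrite (bin_small Nj) !mul0r subr0 normr0.
- rewrite sub0r normrN normrM ger0_norm// ler_wpM2l//.
  rewrite -(subnSK jN) alt_bin_sum; case: M M0 => // M _.
  rewrite normrM normrX normrN1 expr1n mul1r normr_nat ler_nat.
  by rewrite binS leq_addl.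
- rewrite binn mul1r subnn; case: M M0 => // M _.
  rewrite big_ord_recl /= bin0 expr0 mulr1 big1 ?addr0 ?subrr ?normr0//.
  by move=> i _; rewrite bin0n mulr0.
Qed.

Lemma cvg_sumr {R : realType} {T : Type} (F : set_system T) {FF : Filter F} (I : Type)
    (r : seq I) (f : I -> T -> R) (l : I -> R) :
  (forall i, f i x @[x --> F] --> l i) ->
  \sum_(i <- r) f i x @[x --> F] --> \sum_(i <- r) l i.
Proof.
move=> fl; elim: r => [|i r IH].
  by rewrite big_nil; under eq_fun do rewrite big_nil; exact: cvg_cst.
by rewrite big_cons; under eq_fun do rewrite big_cons; exact: cvgD.
Qed.

(** * Factorial moments and the Poisson limit *)

Section poisson_limit.
Context {R : realType} (d : nat -> measure_display) (T : forall n, measurableType (d n))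
  (P : forall n, probability (T n) R) (N : forall n, T n -> nat).
Hypothesis mN : forall n, measurable_fun setT (@N n).
Variables (M : nat -> nat -> R) (lam : R).
Hypothesis M0 : forall m n, 0 <= M m n.
Hypothesis NM : forall m n, (\int[P n]_x (((N x) ^_ m)%:R)%:E = (M m n)%:E)%E.
Hypothesis Mlam : forall m, M m n @[n --> \oo] --> lam ^+ m.

Let mNf n (f : nat -> R) : measurable_fun setT (fun x : T n => f (N x)).
Proof. exact: (measurable_natcomp f). Qed.

Let bin_int m n j : (j <= m)%N ->
  (\int[P n]_x ((('C(m, j) * 'C(N x, m))%:R)%:E) = (('C(m, j))%:R * (M m n / m`!%:R))%:E)%E.
Proof.
move=> jm.
rewrite (eq_integral (fun x => (('C(m, j)%:R / m`!%:R)%:E * (((N x) ^_ m)%:R)%:E)))%E; last first.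
  move=> x _; rewrite -EFinM; congr (_%:E).
  rewrite -bin_ffact !natrM; field.
  by rewrite pnatr_eq0 -lt0n fact_gt0.
rewrite ge0_integralZl_EFin//; last exact: (measurable_natcomp (fun k => ((k ^_ m)%:R)%:E : \bar R) (@mN n)).
by rewrite NM -EFinM; congr (_%:E); ring.
Qed.

Lemma factorial_moments_bonferroni n j L : (0 < L)%N ->
  `| pr (P n) (fun x => N x == j) -
     \sum_(i < L) (-1) ^+ i * ('C(j + i, j)%:R * (M (j + i) n / (j + i)`!%:R)) |
   <= 'C(j + L, j)%:R * (M (j + L) n / (j + L)`!%:R).
Proof.
move=> L0.
pose f x : R := (N x == j)%:R.
pose g x : R := \sum_(i < L) (-1) ^+ i * ('C(j + i, j) * 'C(N x, j + i))%:R.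
have intN (h : nat -> R) : (forall k, 0 <= h k) -> (\int[P n]_x (h (N x))%:E < +oo)%E ->
    (P n).-integrable setT (fun x => (h (N x))%:E).
  move=> h0 hoo; apply/integrableP; split.
    by apply/measurable_EFinP; exact: mNf.
  by rewrite (eq_integral (fun x => (h (N x))%:E))%E// => x _; rewrite gee0_abs ?lee_fin.
have intC i : (P n).-integrable setT (fun x => (('C(j + i, j) * 'C(N x, j + i))%:R)%:E).
  apply: (intN (fun k => ('C(j + i, j) * 'C(k, j + i))%:R)) => //.
  by rewrite bin_int ?leq_addr// ltry.
have RC i : (\int[P n]_x (('C(j + i, j) * 'C(N x, j + i))%:R) =
    'C(j + i, j)%:R * (M (j + i) n / (j + i)`!%:R))%R.
  by rewrite /Rintegral bin_int ?leq_addr.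
have Rg K : (P n).-integrable setT (EFin \o (fun x =>
      \sum_(i < K) (-1) ^+ i * ('C(j + i, j) * 'C(N x, j + i))%:R)) /\
    (\int[P n]_x (\sum_(i < K) (-1) ^+ i * ('C(j + i, j) * 'C(N x, j + i))%:R) =
     \sum_(i < K) (-1) ^+ i * ('C(j + i, j)%:R * (M (j + i) n / (j + i)`!%:R)))%R.
  elim: K => [|K [IH1 IH2]].
    rewrite big_ord0 (_ : (fun x => _) = fun=> 0); last by apply/funext => x; rewrite big_ord0.
    by rewrite Rintegral_cst// mul0r; split => //; exact: integrable0.
  have iK : (P n).-integrable setT
      (EFin \o (fun x => (-1) ^+ K * ('C(j + K, j) * 'C(N x, j + K))%:R)).
    exact: (integrableZl measurableT ((-1) ^+ K) (intC K)).
  rewrite (_ : (fun x => _) = fun x => \sum_(i < K) (-1) ^+ i *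
      ('C(j + i, j) * 'C(N x, j + i))%:R + (-1) ^+ K * ('C(j + K, j) * 'C(N x, j + K))%:R);
    last by apply/funext => x; rewrite big_ord_recr.
  rewrite big_ord_recr; split; last first.
    rewrite RintegralD//= IH2; congr (_ + _).
    by rewrite RintegralZl// ?RC//; exact: intC.
  exact: (integrableD measurableT IH1 iK).
have [ig eg] := Rg L.
have iF : (P n).-integrable setT (EFin \o f n).
  apply: (intN (fun k => (k == j)%:R)) => //.
  by rewrite integral_event ?prE ?ltry//; apply: (measurable_natcomp (fun k => k == j)).
have ef : (\int[P n]_x f n x = pr (P n) (fun x => N x == j))%R.
  by rewrite /Rintegral integral_event//; apply: (measurable_natcomp (fun k => k == j)).
rewrite -ef -eg -RintegralB// -RC.
apply: le_trans (le_normr_Rintegral measurableT _) _.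
  exact: (integrableB measurableT iF ig).
apply: le_Rintegral => //; last by move=> x _; exact: bonferroni.

  exact: (integrable_norm (integrableB measurableT iF ig)).
exact: intC.
Qed.

(** The truncation [L] is fixed before [n] grows: at fixed [L] both sides of Bonferroni's inequality
    converge, and the limits are a partial exponential series and one of its terms, small for large
    [L]. *)
Lemma factorial_moments_poisson j :
  pr (P n) (fun x => N x == j) @[n --> \oo] --> lam ^+ j / j`!%:R * expR (- lam).
Proof.
have S_cvg L : \sum_(i < L) (-1) ^+ i * ('C(j + i, j)%:R * (M (j + i) n / (j + i)`!%:R))
    @[n --> \oo] --> lam ^+ j / j`!%:R * series (exp_coeff (- lam)) L.
  rewrite /series /= big_mkord mulr_sumr; apply: cvg_sumr => i.
  rewrite (_ : lam ^+ j / _ * _ = (-1) ^+ i * ('C(j + i, j)%:R * (lam ^+ (j + i) / (j + i)`!%:R))).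
    apply: cvgM; first exact: cvg_cst.
    by apply: cvgM; [exact: cvg_cst|apply: cvgM => //; exact: cvg_cst].
  have := bin_fact (leq_addr i j); rewrite addKn => /(congr1 (fun k => k%:R : R)).
  rewrite !natrM => <-; rewrite /exp_coeff /= (exprNn lam) exprD.
  have : 'C(j + i, j)%:R != 0 :> R by rewrite pnatr_eq0 -lt0n bin_gt0 leq_addr.
  have : j`!%:R != 0 :> R by rewrite pnatr_eq0 -lt0n fact_gt0.
  have : i`!%:R != 0 :> R by rewrite pnatr_eq0 -lt0n fact_gt0.
  move: ('C(j + i, j)%:R) (j`!%:R) (i`!%:R) ((-1) ^+ i) => c f1 f2 a f20 f10 c0.
  by field; rewrite f20 f10 c0.
have B_cvg L : 'C(j + L, j)%:R * (M (j + L) n / (j + L)`!%:R)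
    @[n --> \oo] --> lam ^+ j / j`!%:R * exp_coeff lam L.
  rewrite (_ : lam ^+ j / _ * _ = 'C(j + L, j)%:R * (lam ^+ (j + L) / (j + L)`!%:R)).
    by apply: cvgM; [exact: cvg_cst|apply: cvgM => //; exact: cvg_cst].
  have := bin_fact (leq_addr L j); rewrite addKn => /(congr1 (fun k => k%:R : R)).
  rewrite !natrM => <-; rewrite /exp_coeff /= exprD.
  have : 'C(j + L, j)%:R != 0 :> R by rewrite pnatr_eq0 -lt0n bin_gt0 leq_addr.
  have : j`!%:R != 0 :> R by rewrite pnatr_eq0 -lt0n fact_gt0.
  have : L`!%:R != 0 :> R by rewrite pnatr_eq0 -lt0n fact_gt0.
  move: ('C(j + L, j)%:R) (j`!%:R) (L`!%:R) => c f1 f2 f20 f10 c0.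
  by field; rewrite f20 f10 c0.
apply/cvgrPdist_le => e e0.
have e4 : 0 < e / 4 by rewrite divr_gt0.
have T1 : lam ^+ j / j`!%:R * series (exp_coeff (- lam)) L @[L --> \oo] -->
    lam ^+ j / j`!%:R * expR (- lam).
  by apply: cvgM; [exact: cvg_cst|exact: is_cvg_series_exp_coeff].
have T2 : lam ^+ j / j`!%:R * exp_coeff lam L @[L --> \oo] --> lam ^+ j / j`!%:R * 0.
  apply: cvgM; first exact: cvg_cst.
  by apply: cvg_series_cvg_0; exact: is_cvg_series_exp_coeff.
move/cvgrPdist_le : T1 => /(_ _ e4) T1; move/cvgrPdist_le : T2 => /(_ _ e4) T2.
have [L0 _ hL] := filterI T1 T2.
(* The maximum with 1 ensures a nonempty truncated sum. *)
have := hL (maxn L0 1) (leq_maxl _ _); set L := maxn L0 1 => -[{}T1 {}T2].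
have Lpos : (0 < L)%N by rewrite leq_max orbT.
move/cvgrPdist_le : (S_cvg L) => /(_ _ e4) S1; move/cvgrPdist_le : (B_cvg L) => /(_ _ e4).
apply: filterS2 S1 => n S1 B1.
have := factorial_moments_bonferroni n j Lpos.
move: S1 B1 T1 T2; rewrite mulr0 sub0r normrN.
set p := pr _ _; set sn := \sum_(i < L) _; set bn := 'C(_, _)%:R * _.
set s := _ * series _ L; set b := _ * exp_coeff _ L; set t := _ * expR _.
rewrite !ler_norml => /andP[? ?] /andP[? ?] /andP[? ?] /andP[? ?] /andP[? ?].
by apply/andP; split; lra.
Qed.

End poisson_limit.

(** * Hyperbolic geometry *)

Section hyperbolic.
Context {R : realType}.
Implicit Types (a b r s c D x : R).

Lemma coshN a : cosh (- a) = cosh a.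
Proof. by rewrite /cosh opprK addrC. Qed.

Lemma sinhN a : sinh (- a) = - sinh a.
Proof. by rewrite /sinh opprK -mulNr opprB. Qed.

Lemma cosh0 : cosh 0 = 1 :> R.
Proof. by rewrite /cosh oppr0 expR0; field. Qed.

Lemma coshD a b : cosh (a + b) = cosh a * cosh b + sinh a * sinh b.
Proof.
rewrite /cosh /sinh opprD !expRD !expRN; field.
by rewrite !gt_eqF// expR_gt0.
Qed.

Lemma sinhD a b : sinh (a + b) = sinh a * cosh b + cosh a * sinh b.
Proof.
rewrite /cosh /sinh opprD !expRD !expRN; field.
by rewrite !gt_eqF// expR_gt0.
Qed.

Lemma coshB a b : cosh (a - b) = cosh a * cosh b - sinh a * sinh b.
Proof. by rewrite coshD coshN sinhN mulrN. Qed.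

Lemma sinhB a b : sinh (a - b) = sinh a * cosh b - cosh a * sinh b.
Proof. by rewrite sinhD coshN sinhN mulrN. Qed.

Lemma cosh2_sinh2 a : cosh a ^+ 2 = 1 + sinh a ^+ 2.
Proof. by have := coshB a a; rewrite subrr cosh0 => ->; ring. Qed.

Lemma expR_sub_cosh a : cosh a = sinh a + expR (- a).
Proof. by rewrite /cosh /sinh; field. Qed.

Lemma sinh_ge0 a : 0 <= a -> 0 <= sinh a.
Proof. by move=> a0; rewrite divr_ge0// subr_ge0 ler_expR ge0_cp. Qed.

Lemma sinh_gt0 a : 0 < a -> 0 < sinh a.
Proof. by move=> a0; rewrite divr_gt0// subr_gt0 ltr_expR gt0_cp. Qed.

Lemma cosh_ge1 a : 1 <= cosh a.
Proof.
by have := expR_ge1Dx a; have := expR_ge1Dx (- a); rewrite /cosh; lra.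
Qed.

Lemma cosh_gt0 a : 0 < cosh a.
Proof. exact: lt_le_trans (cosh_ge1 a). Qed.

Lemma cosh_le_exp a : 0 <= a -> cosh a <= expR a.
Proof.
by move=> a0; have : expR (- a) <= expR a by [rewrite ler_expR ge0_cp]; rewrite /cosh; lra.
Qed.

Lemma exp_le_cosh a : expR a / 2 <= cosh a.
Proof. by have := expR_ge0 (- a); rewrite /cosh; lra. Qed.

Lemma sinh_le_exp a : sinh a <= expR a / 2.
Proof. by have := expR_ge0 (- a); rewrite /sinh; lra. Qed.

Lemma exp_le_sinh a : 1 <= a -> expR a / 4 <= sinh a.
Proof.
move=> a1; have e1 : expR (- a) <= 1 by rewrite -expR0 ler_expR; lra.
have := expR_ge1Dx a; rewrite /sinh; lra.
Qed.

Lemma ler_sinh a b : a <= b -> sinh a <= sinh b.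
Proof.
move=> ab; have : expR a <= expR b by rewrite ler_expR.
have : expR (- b) <= expR (- a) by rewrite ler_expR lerN2.
by rewrite /sinh; lra.
Qed.

Lemma ler_cosh a b : `|a| <= b -> cosh a <= cosh b.
Proof.
move=> ab; have b0 : 0 <= b by exact: le_trans ab.
have -> : cosh a = cosh `|a| by case: ger0P; rewrite ?coshN.
set c := `|a| in ab *; have c0 : 0 <= c by exact: normr_ge0.
have -> : b = c + (b - c) by ring.
rewrite coshD; have := cosh_ge1 c; have := cosh_ge1 (b - c).
have : 0 <= sinh c * sinh (b - c) by rewrite mulr_ge0// sinh_ge0// subr_ge0.
nra.
Qed.

Lemma ltr_cosh a b : `|a| < b -> cosh a < cosh b.
Proof.
move=> ab; have b0 : 0 < b by exact: le_lt_trans ab.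
have -> : cosh a = cosh `|a| by case: ger0P; rewrite ?coshN.
set c := `|a| in ab *; have c0 : 0 <= c by exact: normr_ge0.
have -> : b = c + (b - c) by ring.
rewrite coshD; have := cosh_ge1 c.
have : 0 <= sinh c * sinh (b - c) by rewrite mulr_ge0// sinh_ge0// subr_ge0 ltW.
have : 1 < cosh (b - c).
  rewrite -(expr_gt1 (n := 2))// ?(ltW (cosh_gt0 _))// cosh2_sinh2 ltrDl.
  by rewrite exprn_gt0// sinh_gt0// subr_gt0.
nra.
Qed.

Lemma is_derive_cosh x : is_derive x 1 (@cosh R) (sinh x).
Proof.
rewrite /cosh /sinh; apply: is_derive_eq.
by rewrite /GRing.scale/=; ring.
Qed.

Lemma is_derive_sinh x : is_derive x 1 (@sinh R) (cosh x).
Proof.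
rewrite /cosh /sinh; apply: is_derive_eq.
by rewrite /GRing.scale/=; ring.
Qed.

Lemma continuous_cosh : continuous (@cosh R).
Proof.
move=> x; apply: differentiable_continuous; apply/derivable1_diffP.
by apply: ex_derive; exact: is_derive_cosh.
Qed.

Lemma continuous_sinh : continuous (@sinh R).
Proof.
move=> x; apply: differentiable_continuous; apply/derivable1_diffP.
by apply: ex_derive; exact: is_derive_sinh.
Qed.

(* [c] stands for the cosine of the angle at the origin. *)
Definition ball_rel D r s c : bool := cosh r * cosh s - sinh r * sinh s * c <= cosh D.

(** The reduction of the angle difference modulo [2 pi] is invisible to the even, periodic
    cosine. *)
Lemma within_distanceE D r u s v : within_distance D r u s v = ball_rel D r s (cos (u - v)).
Proof.
rewrite /within_distance /ball_rel; congr (_ - _ * _ <= _).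
rewrite /circ_abs normr_id /Num.min; case: ifP => _.
  by case: ger0P; rewrite ?cosN.
have -> : 2 * pi = pi *+ 2 :> R by rewrite mulr_natl.
rewrite addrC cosD2pi cosN.
by case: ger0P; rewrite ?cosN.
Qed.

Lemma ball_relC D r s c : ball_rel D r s c = ball_rel D s r c.
Proof. by rewrite /ball_rel (mulrC (cosh r)) (mulrC (sinh r)). Qed.

(** The triangle inequality through the origin: the worst case is [c = -1], where the left side is
    [cosh (r + s)]. *)
Lemma ball_rel_small D r s c : -1 <= c -> 0 <= r -> 0 <= s -> r + s <= D -> ball_rel D r s c.
Proof.
move=> c1 r0 s0 rsD; rewrite /ball_rel.
apply: (@le_trans _ _ (cosh (r + s))); last by rewrite ler_cosh// ger0_norm// addr_ge0.
rewrite coshD; have := mulr_ge0 (sinh_ge0 r0) (sinh_ge0 s0); nra.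
Qed.

Lemma sinh_superadd a b : 0 <= a -> 0 <= b -> sinh a + sinh b <= sinh (a + b).
Proof.
move=> a0 b0; rewrite sinhD; have := sinh_ge0 a0; have := sinh_ge0 b0.
by have := cosh_ge1 a; have := cosh_ge1 b; nra.
Qed.

(* Convexity of the distance to a point along a ray, through [sinh r cosh x = sinh (r - x) + sinh x cosh r]. *)
Lemma ball_rel_le D r x s c : 0 <= x -> x <= r -> 0 <= s -> s <= D ->
  ball_rel D r s c -> ball_rel D x s c.
Proof.
move=> x0 xr s0 sD; rewrite /ball_rel => h.
have [r0|] := ltP 0 r; last first.
  by move=> r0; have -> : x = r; [apply/eqP; rewrite eq_le xr; exact: le_trans r0 x0|].
have sr := sinh_gt0 r0.
rewrite -(ler_pM2l sr).
have e1 : sinh r * cosh x = sinh (r - x) + sinh x * cosh r by rewrite sinhB; ring.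
have -> : sinh r * (cosh x * cosh s - sinh x * sinh s * c) =
  sinh (r - x) * cosh s + sinh x * (cosh r * cosh s - sinh r * sinh s * c).
  by rewrite mulrBr mulrA e1; ring.
have h1 := sinh_superadd (a := r - x) (b := x); rewrite subrK subr_ge0 in h1.
have {}h1 := h1 xr x0.
have cs : cosh s <= cosh D by rewrite ler_cosh// ger0_norm.
have a0 : 0 <= sinh (r - x) by rewrite sinh_ge0// subr_ge0.
have b0 := sinh_ge0 x0; have := cosh_gt0 D; nra.
Qed.

(* Radii lie in [[0, D]] almost surely; clamping makes this hold pointwise. *)
Definition clamp D r : R := Num.max 0 (Num.min r D).

Lemma clamp_ge0 D r : 0 <= clamp D r.
Proof. by rewrite /clamp le_max lexx. Qed.

Lemma clamp_le D r : 0 <= D -> clamp D r <= D.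
Proof. by move=> D0; rewrite /clamp ge_max D0 ge_min lexx orbT. Qed.

Lemma clamp_id D r : 0 <= r <= D -> clamp D r = r.
Proof.
by move=> /andP[r0 rD]; rewrite /clamp (min_l rD) (max_r r0).
Qed.

(** Adjacency of points given as pairs of radius and angle; with clamped radii the monotonicity of
    [ball_rel_le] is always available. *)
Definition adj D (x y : R * R) : bool := ball_rel D (clamp D x.1) (clamp D y.1) (cos (x.2 - y.2)).

Lemma adjC D (u v : R * R) : adj D u v = adj D v u.
Proof. by rewrite /adj ball_relC -cosN opprB. Qed.

(* The largest radius at which a vertex of angle [th] is still adjacent to [y]. *)
Definition thr D th (y : R * R) : R := sup [set r | 0 <= r <= D /\ adj D (r, th) y].

(** The admissible radii form a closed initial segment of [[0, D]]: it contains 0 by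
    [ball_rel_small] and is downward closed by [ball_rel_le]. *)
Lemma thrP D th y r : 0 <= D -> 0 <= r <= D -> (r <= thr D th y) = adj D (r, th) y.
Proof.
move=> D0 rD; set S := [set r | 0 <= r <= D /\ adj D (r, th) y].
have ubS : ubound S D by move=> x [/andP[]].
have S0 : S 0.
  split; first by rewrite lexx.
  apply: ball_rel_small => //=; rewrite ?clamp_ge0 ?cos_geN1//.
  by rewrite clamp_id ?lexx// add0r clamp_le.
have hS : has_sup S by split; [exists 0|exists D].
have downS x z : S z -> 0 <= x -> x <= z -> S x.
  move=> [/andP[z0 zD] az] x0 xz; have xD := le_trans xz zD; split; first by rewrite x0.
  move: az; rewrite /adj /= (@clamp_id D z) ?z0// (@clamp_id D x) ?x0//.
  by apply: ball_rel_le; rewrite ?clamp_ge0 ?clamp_le.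
have t0 : 0 <= sup S by apply: ub_le_sup => //; exists D.
have tD : sup S <= D by apply: ge_sup => //; exists 0.
(* The supremum is attained: otherwise adjacency would fail on a neighbourhood of it by
   continuity. *)
have tS : S (sup S).
  split; first by rewrite t0.
  rewrite /adj /= clamp_id ?t0// /ball_rel leNgt; apply/negP => gt.
  pose g x := cosh x * cosh (clamp D y.1) - sinh x * sinh (clamp D y.1) * cos (th - y.2).
  have cg : {for sup S, continuous g}.
    by apply: cvgB; apply: cvgM; try exact: cvg_cst; [exact: continuous_cosh|
      apply: cvgM; [exact: continuous_sinh|exact: cvg_cst]].
  have /cvgrPdist_lt/(_ (g (sup S) - cosh D)) := cg; rewrite subr_gt0 => /(_ gt).
  move=> /nbhs_ballP[e /= e0 he].
  have [x Sx xe] := sup_adherent e0 hS.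
  have xs : x <= sup S by apply: ub_le_sup => //; exists D.
  have := he x; rewrite /ball /= ger0_norm ?subr_ge0// => /(_ _).
  have -> : sup S - x < e by lra.
  move=> /(_ isT); have [xD ax] := Sx.
  move: ax; rewrite /adj /= clamp_id// /ball_rel -/(g x) => gx.
  move=> /(le_lt_trans (ler_norm _)); lra.
apply/idP/idP => [rt|ar]; last by apply: ub_le_sup; [exists D|].
by have /andP[r0 _] := rD; case: (downS _ _ tS r0 rt).
Qed.

Lemma thr_ge0 D th y : 0 <= D -> 0 <= thr D th y.
Proof.
move=> D0; rewrite thrP ?lexx//; apply: ball_rel_small => //=; rewrite ?clamp_ge0 ?cos_geN1//.
by rewrite clamp_id ?lexx// add0r clamp_le.
Qed.

Lemma thr_le D th y : 0 <= D -> thr D th y <= D.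
Proof.
move=> D0; apply: ge_sup; last by move=> x [/andP[]].
exists 0; split; first by rewrite lexx.
apply: ball_rel_small => //=; rewrite ?clamp_ge0 ?cos_geN1//.
by rewrite clamp_id ?lexx// add0r clamp_le.
Qed.

Lemma measurable_clamp D : measurable_fun setT (clamp D).
Proof. by apply: measurable_maxr => //; exact: measurable_minr. Qed.

Lemma measurable_adj2 d (T : measurableType d) D (r u s v : T -> R) :
  measurable_fun setT r -> measurable_fun setT u ->
  measurable_fun setT s -> measurable_fun setT v ->
  measurable_fun setT (fun w => adj D (r w, u w) (s w, v w)).
Proof.
move=> mr mu ms mv; apply: measurable_fun_ler => //=.
have mch X : measurable_fun setT X -> measurable_fun setT (fun w : T => cosh (clamp D (X w))).
  move=> mX; apply: (measurableT_comp measurable_cosh).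
  exact: (measurableT_comp (measurable_clamp D)).
have msh X : measurable_fun setT X -> measurable_fun setT (fun w : T => sinh (clamp D (X w))).
  move=> mX; apply: (measurableT_comp measurable_sinh).
  exact: (measurableT_comp (measurable_clamp D)).
apply: measurable_funB; first by apply: measurable_funM; [exact: mch|exact: mch].
apply: measurable_funM; first by apply: measurable_funM; [exact: msh|exact: msh].
apply: (measurableT_comp (f := cos)).
  by apply: continuous_measurable_fun => x; exact: continuous_cos.
exact: measurable_funB.
Qed.

(** By [thrP] the set where the threshold is at least [x] is an adjacency event. *)
Lemma measurable_thr D : 0 <= D ->
  measurable_fun setT (fun p : R * (R * R) => thr D p.1 p.2).
Proof.
move=> D0; apply: (measurability _ (RGenCInfty.measurableE R)).
move=> _ [_ [x ->] <-]; rewrite setTI.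
have [x0|x0] := ltP x 0.
  rewrite (_ : _ @^-1` _ = setT)//; apply/seteqP; split => // p _ /=.
  by rewrite in_itv /= andbT (le_trans (ltW x0)) ?thr_ge0.
have [Dx|xD] := ltP D x.
  rewrite (_ : _ @^-1` _ = set0)//; apply/seteqP; split => // p /=.
  by rewrite in_itv /= andbT leNgt (le_lt_trans (thr_le _ _ D0)).
rewrite (_ : _ @^-1` _ = [set p : R * (R * R) | adj D (x, p.1) (p.2.1, p.2.2)]).
  apply: measurable_event; apply: measurable_adj2 => //.
    exact: measurableT_comp.
  exact: measurableT_comp.
apply/seteqP; split => -[th [s v]] /=; by rewrite in_itv /= andbT thrP ?x0.
Qed.

End hyperbolic.

(** * Uniform angles *)

Section uniform_angle.
Context {R : realType}.
Local Notation leb := (@lebesgue_measure R).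
Implicit Types (a b c x u w : R).

Context (unif : probability R R).
Hypothesis unifU : forall A, measurable A -> unif A = uniform_prob (@ltNpi_pi R) A.

(** Translation invariance, from the uniqueness of Lebesgue measure on half-open intervals. *)
Lemma lebesgue_shift (A : set R) c : measurable A ->
  leb A = leb [set x | A (x + c)].
Proof.
move=> mA.
have mc0 : measurable_fun setT (fun x : R => x + c) by exact: measurable_funD.
have mc : measurable_fun (T := measurableTypeR R) (U := measurableTypeR R) setT
  (fun x => x + c) := mc0.
pose f : {mfun (measurableTypeR R) >-> (measurableTypeR R)} :=
  HB.pack (fun x : measurableTypeR R => x + c) (isMeasurableFun.Build _ _ _ _ _ mc).
have -> : leb [set x | A (x + c)] = pushforward leb f A by [].
apply: lebesgue_measure_unique => //= _ [[p q]] _ <-.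
rewrite /pushforward.
rewrite (_ : _ @^-1` _ = `]p - c, q - c]%classic).
  rewrite !lebesgue_measure_itv /= !lte_fin ltrBlDr subrK; case: ifP => // _.
  by rewrite -!EFinB; congr (_%:E); ring.
by apply/seteqP; split => x /=; rewrite !in_itv /= ltrBlDr lerBrDr.
Qed.

Lemma unifE (A : set R) : measurable A ->
  unif A = (((pi *+ 2)^-1)%:E * leb (A `&` [set x | - pi <= x <= pi]%R))%E.
Proof.
move=> mA; rewrite unifU// /uniform_prob.
have mI : measurable [set x : R | - pi <= x <= pi].
  by rewrite (_ : [set x | _] = `[-pi, pi]%classic)//; apply/seteqP; split => x /=; rewrite in_itv.
transitivity (\int[leb]_(x in A)
    (((pi *+ 2)^-1)%:E * (\1_[set x : R | - pi <= x <= pi] x)%:E))%E.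
  apply: eq_integral => x _; rewrite /uniform_pdf indicE -EFinM; congr (_%:E).
  rewrite opprK -mulr2n; case: ifPn => xp; first by rewrite mem_set// mulr1.
  by rewrite memNset ?mulr0//; exact/negP.
rewrite ge0_integralZl_EFin//; last first.
- by rewrite invr_ge0 mulrn_wge0// pi_ge0.
- exact/measurable_EFinP/measurable_indic.
by rewrite integral_indic// setIC.
Qed.

Let mitv b0 b1 : measurable [set x : R | b0 < x <= b1].
Proof.
by rewrite (_ : [set x | _] = `]b0, b1]%classic)//; apply/seteqP; split => x /=; rewrite in_itv.
Qed.

(** Half-open intervals of length [2 pi] tile under translation; dropping one endpoint loses a null
    set. *)
Let leb_oc (A : set R) : measurable A ->
  leb (A `&` [set x | - pi <= x <= pi]%R) = leb [set x | A x /\ - pi < x <= pi].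
Proof.
move=> mA.
have m1 : measurable [set x | A x /\ - pi < x <= pi] by exact: (measurableI _ _ mA (mitv _ _)).
rewrite (_ : _ `&` _ = [set x | A x /\ - pi < x <= pi] `|` (A `&` [set - pi])); last first.
  apply/seteqP; split => x /=.
    move=> [Ax /andP[]]; rewrite le_eqVlt => /orP[/eqP xp|x1] x2; [right|left].
      by split => //; rewrite xp.
    by rewrite x1 x2.
  case=> [[Ax /andP[x1 x2]]|[Ax xp]]; first by rewrite (ltW x1).
  by split => //; rewrite xp lexx /=; have := pi_ge0 R; lra.
have m2 : measurable (A `&` [set - pi]) by apply: measurableI => //; exact: measurable_set1.
rewrite measureU//; last first.
  by apply/seteqP; split => // x /= [[_ /andP[x1 _]] [_ xp]]; move: x1; rewrite xp ltxx.
have : (leb (A `&` [set - pi]%R) <= leb [set - pi]%R)%E.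
  by apply: le_measure; rewrite ?inE//; exact: measurable_set1.
rewrite lebesgue_measure_set1 measure_le0 => /eqP ->.
by rewrite adde0.
Qed.

Let leb_split (A : set R) b0 b1 b2 : measurable A -> b0 <= b1 -> b1 <= b2 ->
  leb [set x | A x /\ b0 < x <= b2] =
  (leb [set x | A x /\ (b0 < x <= b1)%R] + leb [set x | A x /\ (b1 < x <= b2)%R])%E.
Proof.
move=> mA b01 b12; rewrite -measureU; last 3 first.
- exact: (measurableI _ _ mA (mitv _ _)).
- exact: (measurableI _ _ mA (mitv _ _)).
- apply/seteqP; split => // x /= [[_ /andP[_ x1]] [_ /andP[x2 _]]].
  by have := lt_le_trans x2 x1; rewrite ltxx.
congr (leb _); apply/seteqP; split => x /=.
  move=> [Ax /andP[x0 x2]]; have [x1|x1] := leP x b1; [left|right];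
  by rewrite ?x0 ?x1 ?x2.
by case=> -[Ax /andP[x0 x1]]; split => //; apply/andP; split => //;
  [exact: le_trans b12|exact: le_lt_trans x0].
Qed.

(** Evenness turns [u - x] into a translate of [x], and a periodic function has the same integral
    over every interval of one period. *)
Lemma unif_periodic (h : R -> bool) u : measurable_fun setT h ->
  (forall x, h (x + pi *+ 2) = h x) -> (forall x, h (- x) = h x) -> - pi <= u <= pi ->
  pr unif (fun x => h (u - x)) = pr unif h.
Proof.
move=> mh hp hN /andP[u1 u2].
have mu : measurable_fun setT (fun x => h (u - x)).
  by apply: measurableT_comp => //; exact: measurable_funB.
have mH := measurable_event mh; have mHu := measurable_event mu.
rewrite /pr !unifE//; congr (fine (_ * _)); rewrite !leb_oc//.
have [T [TE hT]] : exists T : R, T = pi + pi /\ forall x, h (x + T) = h x.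
  by exists (pi *+ 2); split; [exact: mulr2n|].
have pi0 := pi_ge0 R; move: (pi : R) u1 u2 pi0 TE => p u1 u2 pi0 TE.
have shift2 b0 b1 : leb [set x | h x /\ b0 + T < x <= b1 + T] =
    leb [set x | h x /\ b0 < x <= b1].
  rewrite (lebesgue_shift T); last exact: (measurableI _ _ mH (mitv _ _)).
  by congr (leb _); apply/seteqP; split => x /=; rewrite hT ltrD2r lerD2r.
have per s : 0 <= s -> s <= T ->
    leb [set x | h x /\ - p + s < x <= p + s] = leb [set x | h x /\ - p < x <= p].
  move=> s0 s2.
  have e1 := @leb_split [set x | h x] (- p + s) p (p + s) mH.
  have e2 := @leb_split [set x | h x] (- p) (- p + s) p mH.
  rewrite e1 ?e2; [|lra|lra|lra|lra].
  rewrite addeC; congr (_ + _)%E.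
  have := shift2 (- p) (- p + s).
  rewrite (_ : - p + T = p); last by rewrite TE; ring.
  by rewrite (_ : - p + s + T = p + s); last by rewrite TE; ring.
have -> : leb [set x | h (u - x) /\ - p < x <= p] = leb [set x | h x /\ - p - u < x <= p - u].
  rewrite (lebesgue_shift u); last exact: (measurableI _ _ mHu (mitv _ _)).
  congr (leb _); apply/seteqP; split => x /=;
  by rewrite (_ : u - (x + u) = - x) ?hN ?ltrBlDr ?lerBrDr//; ring.
(* [per] takes shifts between 0 and one period; a positive [u] is first moved by a full period. *)
have [u0|u0] := leP u 0; first by rewrite per//; lra.
have := per (T - u); rewrite -(shift2 (- p - u) (p - u)).
rewrite (_ : - p - u + T = - p + (T - u)); last by ring.
rewrite (_ : p - u + T = p + (T - u)); last by ring.
by apply; lra.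
Qed.

Lemma unif_cos u w : - pi <= u <= pi -> 0 <= w <= pi ->
  pr unif (fun x => cos w <= cos (u - x)) = w / pi.
Proof.
move=> hu /andP[w0 wpi].
have mcos : measurable_fun setT (@cos R).
  by apply: continuous_measurable_fun => x; exact: continuous_cos.
rewrite (unif_periodic (h := fun x => cos w <= cos x))//; last 3 first.
- exact: measurable_fun_ler.
- by move=> x; rewrite cosD2pi.
- by move=> x; rewrite cosN.
rewrite /pr unifE; last by apply: measurable_event; exact: measurable_fun_ler.
have piR : 0 < pi :> R := pi_gt0 R.
rewrite (_ : _ `&` _ = `[- w, w]%classic); last first.
  apply/seteqP; split => x /=; rewrite in_itv /= => h.
  - move: h => [cx /andP[x1 x2]]; rewrite -ler_norml leNgt; apply/negP => wx.
    have : cos `|x| < cos w.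
      rewrite ltr_cos// in_itv/= ?normr_ge0 ?w0 ?wpi//=.
      by rewrite ler_norml x1.
    by rewrite (_ : cos `|x| = cos x) ?ltNge ?cx//; case: ger0P; rewrite ?cosN.
  - have xw : `|x| <= w by rewrite ler_norml.
    have xpi := le_trans xw wpi; split; last by rewrite -ler_norml.
    rewrite (_ : cos x = cos `|x|); last by case: ger0P; rewrite ?cosN.
    rewrite leNgt ltr_cos ?in_itv/= ?w0 ?normr_ge0//.
    by rewrite -leNgt.
rewrite lebesgue_measure_itv /= lte_fin.
case: ifPn => [_|].
  rewrite (_ : w%:E + (- - w)%:E = (w + w)%:E)%E; last by rewrite opprK EFinD.
  have pn : pi != 0 :> R by rewrite gt_eqF.
  rewrite -EFinM /= -mulr2n -(mulr_natl pi) -(mulr_natl w) invfM mulrACA mulVf ?pnatr_eq0//.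
  by rewrite mul1r mulrC.
rewrite -leNgt => ww; have -> : w = 0 by lra.
by rewrite mule0 mul0r.
Qed.

End uniform_angle.

Section angle.
Context {R : realType}.
Implicit Types (a b c x y u v w r s t D M S : R).

Lemma sin_increment u v : 0 <= v -> v <= u -> u <= pi / 2 ->
  (u - v) * cos u <= sin u - sin v <= u - v.
Proof.
move=> v0 vu u2; move: vu; rewrite le_eqVlt => /orP[/eqP ->|vu].
  by rewrite !subrr mul0r lexx.
have [c] := @MVT _ (@sin R) (@cos R) v u vu (fun x _ => is_derive_sin x) (continuous_subspaceT (@continuous_sin R)).
rewrite in_itv /= => /andP[vc cu] ->.
have uv : 0 <= u - v by lra.
apply/andP; split; last by rewrite ler_piMl// cos_le1.
rewrite mulrC ler_wpM2r// leNgt ltr_cos// ?in_itv/=.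
- by rewrite -leNgt ltW.
- have := pi_gt0 R; lra.
- have := pi_gt0 R; lra.
Qed.

(** Probability that a uniform angle has haversine [(1 - cos) / 2], the squared sine of its half, at
    most [S]; beyond [S = 1] every angle qualifies. *)
Definition ang S : R := 2 / pi * asin (Num.sqrt (Num.min S 1)).

Lemma ang_asin S : 0 <= S -> let a := asin (Num.sqrt (Num.min S 1)) in
  [/\ 0 <= a, a <= pi / 2, sin a = Num.sqrt (Num.min S 1), sin a ^+ 2 = Num.min S 1 & ang S * pi = 2 * a].
Proof.
move=> S0 a.
have m0 : 0 <= Num.min S 1 by rewrite le_min S0 ler01.
have m1 : Num.min S 1 <= 1 by rewrite ge_min lexx orbT.
have sq0 := sqrtr_ge0 (Num.min S 1).
have sq1 : Num.sqrt (Num.min S 1) <= 1 by rewrite -[leRHS]sqrtr1 ler_wsqrtr.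
have sq : -1 <= Num.sqrt (Num.min S 1) <= 1 by rewrite sq1 (le_trans _ sq0)// lerN10.
have pi0 := pi_gt0 R.
have sa : sin a = Num.sqrt (Num.min S 1) by rewrite /a asinK// in_itv.
split => //.
- rewrite leNgt; apply/negP => a0.
  have : sin a < 0.
    rewrite -[X in X < _]opprK oppr_lt0 -sinN; apply: sin_gt0_pihalf.
    rewrite oppr_gt0 a0 /=; have := asin_geNpi2 sq; rewrite -/a le_eqVlt => /orP[/eqP e|]; last by lra.
    by move: sq0; rewrite -sa -e sinN sin_pihalf; lra.
  by rewrite sa ltNge sq0.
- exact: asin_lepi2.
- by rewrite sa sqr_sqrtr.
- by rewrite /ang -/a mulrAC mulrVK// unitfE gt_eqF.
Qed.

Lemma ang_le1 S : 0 <= S -> ang S <= 1.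
Proof.
move=> S0; have [a0 a1 _ _ e] := ang_asin S0; have pi0 := pi_gt0 R.
by rewrite -(ler_pM2r pi0) e mul1r; lra.
Qed.

(** The mean value theorem for the sine, read backwards. The constant comes from
    [cos b >= cos b ^ 2 = 1 - S2 >= 1 - s] at the larger angle [b]. *)
Lemma ang_increment S1 S2 s : 0 <= S1 -> S1 <= S2 -> S2 <= s -> s < 1 ->
  2 / pi * (Num.sqrt S2 - Num.sqrt S1) <= ang S2 - ang S1 <=
  2 / pi * (Num.sqrt S2 - Num.sqrt S1) / (1 - s).
Proof.
move=> S10 S12 S2s s1; have S20 := le_trans S10 S12.
have [a0 a2 sa _ _] := ang_asin S10; have [b0 b2 sb sb2 _] := ang_asin S20.
have e1 : Num.min S1 1 = S1 by rewrite min_l//; lra.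
have e2 : Num.min S2 1 = S2 by rewrite min_l//; lra.
rewrite /ang; move: a0 a2 sa b0 b2 sb sb2; rewrite e1 e2.
set a := asin _; set b := asin _ => a0 a2 sa b0 b2 sb sb2.
rewrite -mulrBr -[X in _ <= _ <= X]mulrA.
have pi0 := pi_gt0 R; have pp : 0 <= 2 / pi :> R by rewrite divr_ge0// ltW.
have ab : a <= b.
  rewrite leNgt; apply/negP => ba; have h := ltr_sin (x := b) (y := a).
  move: ba; rewrite -h ?sa ?sb ?in_itv /=; [|by apply/andP; split; lra|by apply/andP; split; lra].
  by rewrite ltNge ler_wsqrtr.
have /andP[h1 h2] := sin_increment a0 ab b2.
rewrite -sa -sb; apply/andP; split; first exact: ler_wpM2l.
apply: ler_wpM2l => //; rewrite ler_pdivlMr ?subr_gt0//.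
apply: le_trans h1; apply: ler_wpM2l; first by rewrite subr_ge0.
have c0 : 0 <= cos b by apply: cos_ge0_pihalf; apply/andP; split; lra.
have c1 := cos_le1 b.
have := cos2_tan2; have := sin2cos2 b; rewrite sb2; nra.
Qed.

Lemma ang0 : ang 0 = 0.
Proof. rewrite /ang min_l// sqrtr0 -[X in asin X]sin0 sinK ?mulr0// in_itv /=.
by have := pi_gt0 R; lra. Qed.

(** Up to [S = 1/2] the increment bound has constant [(2 / pi) / (1 - 1/2) <= 2]; beyond, the right
    side already exceeds 1. *)
Lemma ang_le_sqrt S : 0 <= S -> ang S <= 2 * Num.sqrt S.
Proof.
move=> S0; have [h|h] := leP S (1/2).
  have /andP[_] := ang_increment (lexx 0) S0 h ltac:(lra).
  rewrite ang0 sqrtr0 !subr0 => /le_trans; apply.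
  have pi2 : 2 <= pi :> R := pi_ge2 R.
  have : 2 / pi <= 1 :> R by rewrite ler_pdivrMr ?mul1r//; lra.
  have := sqrtr_ge0 S; move: (2 / pi) (Num.sqrt S) => p q; rewrite (_ : 1 - 1/2 = 2^-1); last by field.
  by rewrite invrK; nra.
apply: (le_trans (ang_le1 S0)).
have : Num.sqrt (1/4) <= Num.sqrt S by rewrite ler_wsqrtr//; lra.
by rewrite (_ : 1/4 = (1/2)^+2); [rewrite sqrtr_sqr ger0_norm//; lra|field].
Qed.

Context (unif : probability R R).
Hypothesis unifU : forall A, measurable A -> unif A = uniform_prob (@ltNpi_pi R) A.

Lemma unif_ang u S : - pi <= u <= pi -> 0 <= S ->
  pr unif (fun x => (1 - cos (u - x)) / 2 <= S) = ang S.
Proof.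
move=> hu S0; have [a0 a2 sa sa2 e] := ang_asin S0.
move: a0 a2 sa sa2 e; set a := asin _ => a0 a2 sa sa2 e.
have pi0 := pi_gt0 R.
rewrite (_ : ang S = 2 * a / pi); last by rewrite -e mulfK// gt_eqF.
rewrite -(unif_cos unifU hu); last by apply/andP; split; lra.
congr (pr unif _); apply/funext => x.
rewrite (_ : 2 * a = a *+ 2) ?mulr_natl// cos_mulr2n mulrC.
have := sin2cos2 a; rewrite sa2 => h.
have -> : cos a ^+ 2 = 1 - Num.min S 1 by lra.
have c1 := cos_geN1 (u - x).
have [S1|S1] := leP S 1.
- by apply/idP/idP; lra.
- by apply/idP/idP; lra.
Qed.

End angle.

(** * Estimates for the haversine at distance [D] *)

Section haversine.
Context {R : realType}.
Implicit Types (a b c x y u v w r s t D M S : R).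

(* The squared sine of half the largest angle between points of radii [r] and [s] at distance at most [D]. *)
Definition hav D r s : R := (cosh D - cosh (r - s)) / (2 * sinh r * sinh s).

Lemma havC D r s : hav D r s = hav D s r.
Proof. by rewrite /hav -(coshN (r - s)) opprB mulrAC. Qed.

Lemma ball_rel_hav D r s c : 0 < r -> 0 < s -> ball_rel D r s c = ((1 - c) / 2 <= hav D r s).
Proof.
move=> /sinh_gt0 r0 /sinh_gt0 s0; rewrite /hav coshB ler_pdivlMr ?(mulr_gt0 (mulr_gt0 _ r0) s0)// /ball_rel.
have -> : (1 - c) / 2 * (2 * sinh r * sinh s) = sinh r * sinh s - sinh r * sinh s * c by field.
by apply/idP/idP; lra.
Qed.

Lemma hav_ge0 D r s : 0 <= r -> 0 <= s -> `|r - s| <= D -> 0 <= hav D r s.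
Proof.
move=> r0 s0 rs; rewrite divr_ge0 ?subr_ge0 ?ler_cosh//.
by rewrite mulr_ge0 ?sinh_ge0// mulr_ge0 ?sinh_ge0.
Qed.

Lemma sinh_ratio_ge x t : 0 <= x -> 0 <= t -> expR t * sinh x <= sinh (x + t).
Proof.
move=> x0 t0; rewrite sinhD (expR_sub_cosh x).
have -> : sinh x * cosh t + (sinh x + expR (- x)) * sinh t =
  sinh x * (cosh t + sinh t) + expR (- x) * sinh t by ring.
have -> : cosh t + sinh t = expR t by rewrite /cosh /sinh; field.
by rewrite mulrC lerDl mulr_ge0 ?expR_ge0 ?sinh_ge0.
Qed.

Lemma sinh_le_mul t : 0 <= t -> sinh t <= t * expR t.
Proof.
move=> t0; have : 1 - 2 * t <= expR (- (2 * t)) by have := expR_ge1Dx (- (2 * t)); lra.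
have e : expR (- t) = expR t * expR (- (2 * t)) by rewrite -expRD; congr expR; ring.
by rewrite /sinh e; have := expR_gt0 t; nra.
Qed.

(** The correction [exp (- x) sinh t] is relative to [sinh x >= 1 / 4], whence the factor 4; keeping
    it in the exponent makes the bound exact at [t = 0]. *)
Lemma sinh_ratio_le x t M : 1 <= M -> M <= x -> 0 <= t ->
  sinh (x + t) <= expR ((1 + 4 * expR (- M)) * t) * sinh x.
Proof.
move=> M1 Mx t0; rewrite sinhD (expR_sub_cosh x).
have -> : sinh x * cosh t + (sinh x + expR (- x)) * sinh t =
  sinh x * (cosh t + sinh t) + expR (- x) * sinh t by ring.
have -> : cosh t + sinh t = expR t by rewrite /cosh /sinh; field.
rewrite mulrDl mul1r expRD.
have e1 := expR_ge1Dx (4 * expR (- M) * t).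
have sx := exp_le_sinh (le_trans M1 Mx).
have ex : expR (- x) <= expR (- M) by rewrite ler_expR lerN2.
have e1x : 1 <= expR x by rewrite -expR0 ler_expR; lra.
have st := sinh_le_mul t0; have et := expR_gt0 t.
have eM := expR_gt0 (- M); have enx := expR_gt0 (- x).
have h1 : expR (- x) * sinh t <= expR (- M) * (t * expR t).
  by apply: ler_pM => //; exact: sinh_ge0.
have h2 : expR (- M) * (t * expR t) <= 4 * expR (- M) * t * expR t * sinh x.
  have : 0 <= expR (- M) * (t * expR t) by rewrite !mulr_ge0 ?expR_ge0.
  nra.
have h3 : (1 + 4 * expR (- M) * t) * (expR t * sinh x) <= expR (4 * expR (- M) * t) * (expR t * sinh x).
  by apply: ler_wpM2r => //; rewrite mulr_ge0 ?expR_ge0//; lra.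
nra.
Qed.

Lemma cosh_increment a b m : `|a| <= m -> `|b| <= m -> `|cosh a - cosh b| <= `|a - b| * sinh m.
Proof.
wlog ab : a b / a <= b.
  move=> H am bm; have [ab|ba] := leP a b; first exact: H.
  by rewrite distrC (distrC a); apply: H => //; exact: ltW.
move=> am bm; move: ab; rewrite le_eqVlt => /orP[/eqP ->|ab].
  by rewrite !subrr normr0 mul0r.
have [c] := @MVT _ (@cosh R) (@sinh R) a b ab (fun x _ => is_derive_cosh x) (continuous_subspaceT (@continuous_cosh R)).
rewrite in_itv /= => /andP[ac cb] e.
rewrite distrC e normrM mulrC (distrC a) ler_wpM2l//.
move: am bm; rewrite !ler_norml => /andP[a1 a2] /andP[b1 b2].
by rewrite -sinhN !ler_sinh//; lra.
Qed.

Section regime.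
Context (M D : R).
Local Notation e := (expR (- M)).
(** [M] is a safety margin: when radii and their differences stay [M] away from the degenerate
    cases, all relative errors are of order [e]. *)
Hypothesis MDr : [/\ 1 <= M, e <= 1 / 16 & M <= D].

Let reg : [/\ 1 <= M, e <= 1 / 16, M <= D, 0 < e & expR (D - M) = expR D * e].
Proof. by case: MDr => M1 eM MD; split; rewrite ?expRD ?expR_gt0. Qed.

Lemma cosh_gap_ge a : `|a| <= D - M -> expR D / 2 * (1 - 2 * e) <= cosh D - cosh a.
Proof.
have [M1 eM MD e0 eDM] := reg.
move=> aM; have c1 : cosh a <= cosh (D - M) by exact: ler_cosh.
have c2 : cosh (D - M) <= expR D * e by rewrite -eDM cosh_le_exp// subr_ge0.
by have := exp_le_cosh D; lra.
Qed.

Lemma cosh_gap_ratio a b : `|a| <= D - M -> `|b| <= D - M ->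
  cosh D - cosh a <= expR (2 * e * `|a - b|) * (cosh D - cosh b).
Proof.
have [M1 eM MD e0 eDM] := reg.
move=> aM bM; have g := cosh_gap_ge bM.
have i := cosh_increment aM bM.
have sM : sinh (D - M) <= expR D * e / 2 by rewrite -eDM sinh_le_exp.
have ab0 := normr_ge0 (a - b); have ED := expR_gt0 D.
have h1 : cosh b - cosh a <= `|a - b| * (expR D * e / 2).
  apply: (le_trans (ler_norm _)); rewrite distrC; apply: (le_trans i).
  exact: ler_wpM2l.
have h2 := expR_ge1Dx (2 * e * `|a - b|).
have g0 : expR D / 4 <= cosh D - cosh b by apply: le_trans g; rewrite -(mulr1 (_ / 4)); nra.
have h3 : (1 + 2 * e * `|a - b|) * (cosh D - cosh b) <= expR (2 * e * `|a - b|) * (cosh D - cosh b).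
  by apply: ler_wpM2r => //; lra.
have h4 : 2 * e * `|a - b| * (expR D / 4) <= 2 * e * `|a - b| * (cosh D - cosh b).
  by apply: ler_wpM2l => //; rewrite !mulr_ge0// ltW.
nra.
Qed.

(** The denominator of [hav] grows by at least [exp (y - x)], while its numerator changes by a
    factor at most [exp (2 e (y - x))]. With the error in the exponent the bound stays sharp as
    [y - x] tends to 0. *)
Lemma hav_ratio_ge x y s : 0 < x -> x <= y -> 0 < s -> `|x - s| <= D - M -> `|y - s| <= D - M ->
  expR ((1 - 2 * e) * (y - x)) * hav D y s <= hav D x s.
Proof.
have [M1 eM MD e0 eDM] := reg.
move=> x0 xy s0 xs ys.
have t0 : 0 <= y - x by lra.
have g := cosh_gap_ratio ys xs.
rewrite (_ : y - s - (x - s) = y - x) in g; last by ring.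
rewrite (ger0_norm t0) in g.
have h := sinh_ratio_ge (ltW x0) t0; rewrite (addrC x) subrK in h.
have sx := sinh_gt0 x0; have ss := sinh_gt0 s0; have sy : 0 < sinh y by apply: sinh_gt0; lra.
rewrite /hav mulrA ler_pdivrMr ?(mulr_gt0 (mulr_gt0 _ sy) ss)// [leRHS]mulrAC ler_pdivlMr ?(mulr_gt0 (mulr_gt0 _ sx) ss)// -mulrA.
have -> : (1 - 2 * e) * (y - x) = - (2 * e * (y - x)) + (y - x) by ring.
rewrite expRD expRN.
set E := expR (2 * e * (y - x)) in g *.
have E0 : 0 < E := expR_gt0 _.
have g' : E^-1 * (cosh D - cosh (y - s)) <= cosh D - cosh (x - s) by rewrite mulrC ler_pdivrMr// mulrC.
have et := expR_gt0 (y - x).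
have gy := cosh_gap_ge ys.
have gy0 : 0 <= cosh D - cosh (y - s) by apply: le_trans gy; have := expR_gt0 D; nra.
have h1 : (E^-1 * (cosh D - cosh (y - s))) * (expR (y - x) * sinh x) <= (cosh D - cosh (x - s)) * sinh y.
  by apply: ler_pM => //; rewrite mulr_ge0// ?invr_ge0 ltW.
have -> : E^-1 * expR (y - x) * (cosh D - cosh (y - s)) * (2 * (sinh x * sinh s)) =
  2 * sinh s * ((E^-1 * (cosh D - cosh (y - s))) * (expR (y - x) * sinh x)) by ring.
have -> : (cosh D - cosh (x - s)) * (2 * sinh y * sinh s) = 2 * sinh s * ((cosh D - cosh (x - s)) * sinh y) by ring.
by apply: ler_wpM2l => //; rewrite mulr_ge0// ltW.
Qed.

(** In [1 + 6 e], the part [2 e] comes from the numerator and [4 e] from the growth of [sinh]. *)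
Lemma hav_ratio_le x y s : M <= x -> x <= y -> 0 < s -> `|x - s| <= D - M -> `|y - s| <= D - M ->
  hav D x s <= expR ((1 + 6 * e) * (y - x)) * hav D y s.
Proof.
have [M1 eM MD e0 eDM] := reg.
move=> Mx xy s0 xs ys.
have x0 : 0 < x by lra.
have t0 : 0 <= y - x by lra.
have g := cosh_gap_ratio xs ys.
rewrite (_ : x - s - (y - s) = - (y - x)) in g; last by ring.
rewrite normrN (ger0_norm t0) in g.
have h := sinh_ratio_le M1 Mx t0; rewrite (addrC x) subrK in h.
have sx := sinh_gt0 x0; have ss := sinh_gt0 s0; have sy : 0 < sinh y by apply: sinh_gt0; lra.
rewrite /hav mulrA ler_pdivlMr ?(mulr_gt0 (mulr_gt0 _ sy) ss)// [leLHS]mulrAC.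
rewrite ler_pdivrMr ?(mulr_gt0 (mulr_gt0 _ sx) ss)//.
have -> : (1 + 6 * e) * (y - x) = (2 * e * (y - x)) + (1 + 4 * e) * (y - x) by ring.
rewrite expRD.
have gx := cosh_gap_ge xs.
have gx0 : 0 <= cosh D - cosh (x - s) by apply: le_trans gx; have := expR_gt0 D; nra.
have h1 := ler_pM gx0 (ltW sy) g h.
set E := expR (2 * e * (y - x)) in h1 *; set E' := expR ((1 + 4 * e) * _) in h1 *.
have -> : (cosh D - cosh (x - s)) * (2 * sinh y * sinh s) = 2 * sinh s * ((cosh D - cosh (x - s)) * sinh y) by ring.
have -> : E * E' * (cosh D - cosh (y - s)) * (2 * sinh x * sinh s) =
  2 * sinh s * (E * (cosh D - cosh (y - s)) * (E' * sinh x)) by ring.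
by apply: ler_wpM2l => //; rewrite mulr_ge0// ltW.
Qed.

Lemma sinh_sandwich r : M <= r -> expR r / 2 * (1 - e) <= sinh r <= expR r / 2.
Proof.
have [M1 eM MD e0 eDM] := reg.
move=> Mr; rewrite sinh_le_exp andbT /sinh.
have -> : expR (- r) = expR r * expR (- r) ^+ 2 by rewrite expr2 mulrA -expRD subrr expR0 mul1r.
have h : expR (- r) <= e by rewrite ler_expR lerN2.
have h0 := expR_gt0 (- r).
have : expR (- r) ^+ 2 <= e by nra.
by have := expR_gt0 r; nra.
Qed.

(** The numerator is about [exp D / 2] and the denominator about [exp (r + s) / 2]. *)
Lemma hav_value r s : M <= r -> M <= s -> `|r - s| <= D - M ->
  (1 - 4 * e) * expR (D - r - s) <= hav D r s <= (1 + 4 * e) * expR (D - r - s).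
Proof.
have [M1 eM MD e0 eDM] := reg.
move=> Mr Ms rs; have /andP[r1 r2] := sinh_sandwich Mr; have /andP[s1 s2] := sinh_sandwich Ms.
have g := cosh_gap_ge rs.
have r0 : 0 < sinh r by apply: sinh_gt0; lra.
have s0 : 0 < sinh s by apply: sinh_gt0; lra.
have -> : expR (D - r - s) = expR D / (expR r * expR s) by rewrite !expRD !expRN invfM mulrA.
set Er := expR r in r1 r2 *; set Es := expR s in s1 s2 *; set ED := expR D.
have Er0 : 0 < Er := expR_gt0 _; have Es0 : 0 < Es := expR_gt0 _; have ED0 : 0 < ED := expR_gt0 _.
rewrite [(1 - 4 * e) * _]mulrA [(1 + 4 * e) * _]mulrA /hav; apply/andP; split.
  rewrite ler_pdivrMr ?(mulr_gt0 Er0 Es0)// [leRHS]mulrAC ler_pdivlMr ?(mulr_gt0 (mulr_gt0 _ r0) s0)//.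
  have hp : sinh r * sinh s <= Er / 2 * (Es / 2) by apply: ler_pM => //; exact: ltW.
  have h1 : (1 - 4 * e) * ED * (2 * (sinh r * sinh s)) <= (1 - 4 * e) * ED * (2 * (Er / 2 * (Es / 2))).
    by apply: ler_wpM2l; [rewrite mulr_ge0//; lra|apply: ler_wpM2l].
  have h2 : ED / 2 * (1 - 2 * e) * (Er * Es) <= (cosh D - cosh (r - s)) * (Er * Es).
    by apply: ler_wpM2r => //; rewrite mulr_ge0// ltW.
  have P0 : 0 <= e * (ED * (Er * Es)) by rewrite !mulr_ge0 ?expR_ge0.
  rewrite -[2 * sinh r * sinh s]mulrA; lra.
rewrite ler_pdivlMr ?(mulr_gt0 Er0 Es0)// [leLHS]mulrAC ler_pdivrMr ?(mulr_gt0 (mulr_gt0 _ r0) s0)//.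
have D1 := le_trans M1 MD.
have c1 := cosh_ge1 (r - s).
have cD : cosh D <= ED / 2 + 1 / 2 by rewrite /cosh -/ED; have : expR (- D) <= 1; [rewrite -expR0 ler_expR|]; lra.
have h0 : cosh D - cosh (r - s) <= ED / 2 by lra.
have hp : Er / 2 * (1 - e) * (Es / 2 * (1 - e)) <= sinh r * sinh s.
  by apply: ler_pM => //; rewrite !mulr_ge0 ?invr_ge0//; lra.
have h1 : (cosh D - cosh (r - s)) * (Er * Es) <= ED / 2 * (Er * Es).
  by apply: ler_wpM2r => //; rewrite mulr_ge0// ltW.
have h2 : (1 + 4 * e) * ED * (2 * (Er / 2 * (1 - e) * (Es / 2 * (1 - e)))) <= (1 + 4 * e) * ED * (2 * (sinh r * sinh s)).
  by apply: ler_wpM2l; [rewrite mulr_ge0//; lra|apply: ler_wpM2l].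
have P0 : 0 <= ED * (Er * Es) by rewrite !mulr_ge0 ?expR_ge0.
have h3 : 1 <= (1 + 4 * e) * ((1 - e) * (1 - e)) by nra.
have h4 : ED * (Er * Es) <= ED * (Er * Es) * ((1 + 4 * e) * ((1 - e) * (1 - e))) by rewrite ler_peMr.
rewrite -[2 * sinh r * sinh s]mulrA; lra.
Qed.

(* Moving outwards by [t] and lowering the other point by [2t] preserves adjacency. *)
Lemma ball_rel_shift r s t c : M <= r -> 0 <= t -> r + t <= D - M -> 2 * t < s -> s <= D - M ->
  ball_rel D r s c -> ball_rel D (r + t) (s - 2 * t) c.
Proof.
have [M1 eM MD e0 eDM] := reg.
move=> Mr t0 rD ts sD; rewrite !ball_rel_hav; try lra.
move/le_trans; apply.
have h1 : hav D r s <= expR ((1 + 6 * e) * t) * hav D (r + t) s.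
  have := @hav_ratio_le r (r + t) s Mr; rewrite (_ : r + t - r = t); last by ring.
  by apply; rewrite ?ler_norml; try apply/andP; try split; lra.
have h2 : expR ((1 - 2 * e) * (2 * t)) * hav D s (r + t) <= hav D (s - 2 * t) (r + t).
  have := @hav_ratio_ge (s - 2 * t) s (r + t); rewrite (_ : s - (s - 2 * t) = 2 * t); last by ring.
  by apply; rewrite ?ler_norml; try apply/andP; try split; lra.
rewrite havC (havC _ (r + t)); apply: (le_trans _ h2); rewrite havC.
apply: (le_trans h1); rewrite havC; apply: ler_wpM2r.
  by apply: hav_ge0; [lra|lra|rewrite ler_norml; apply/andP; split; lra].
(* As [e <= 1/16], the loss [(1 + 6 e) t] is covered by the gain [2 (1 - 2 e) t]; this is why the
   other point is lowered by [2 t]. *)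
by rewrite ler_expR; nra.
Qed.

End regime.

(** Concavity of [1 - exp (- a u)] in [a], which vanishes at [a = 0]. It turns a perturbed exponent
    into a factor multiplying an increment. *)
Lemma convex_expN a u : 0 <= a -> a <= 1 -> a * (1 - expR (- u)) <= 1 - expR (- (a * u)).
Proof.
move=> a0 a1; have E0 := expR_gt0 (- (a * u)).
have e1 : expR (- u) = expR (- (a * u)) * expR (- ((1 - a) * u)) by rewrite -expRD; congr expR; ring.
have e2 : 1 = expR (- (a * u)) * expR (a * u) by rewrite -expRD addNr expR0.
have h1 := expR_ge1Dx (- ((1 - a) * u)); have h2 := expR_ge1Dx (a * u).
have h3 := ler_wpM2l (ltW E0) h1; have h4 := ler_wpM2l (ltW E0) h2.
rewrite -e1 in h3; rewrite -e2 in h4.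
by have h5 := ler_wpM2l a0 h3; have h6 : (1 - a) * (expR (- (a * u)) * (1 + a * u)) <= (1 - a) * 1; [apply: ler_wpM2l => //; lra|lra].
Qed.

End haversine.

Section angle_increments.
Context {R : realType}.
Implicit Types (a b c x y u v w r s t D M S : R).

Context (M D : R).
Local Notation e := (expR (- M)).
Hypothesis MDr : [/\ 1 <= M, e <= 1 / 16 & M <= D].

Let reg : [/\ 1 <= M, e <= 1 / 16, M <= D & 0 < e].
Proof. by case: MDr => M1 eM MD; split; rewrite ?expR_gt0. Qed.

(** The approximate value of [sqrt (hav D r s)]. It factorises in [r] and [s], and so expected
    degrees become proportional to [weight D r]. *)
Let V r s := expR ((D - r - s) / 2).

Let V2 r s : V r s ^+ 2 = expR (D - r - s).
Proof. by rewrite expr2 -expRD; congr expR; field. Qed.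

Lemma sqrt_hav_value r s : M <= r -> M <= s -> `|r - s| <= D - M ->
  (1 - 4 * e) * V r s <= Num.sqrt (hav D r s) <= (1 + 4 * e) * V r s.
Proof.
move=> Mr Ms rs; have [M1 eM MD e0] := reg.
have /andP[] := hav_value MDr Mr Ms rs; rewrite -V2 => h1 h2.
have V0 : 0 < V r s := expR_gt0 _.
have hp : 0 <= hav D r s by apply: hav_ge0; lra.
have q0 := sqrtr_ge0 (hav D r s).
apply/andP; split.
  rewrite -(@ler_pXn2r _ 2) ?nnegrE//; last by rewrite mulr_ge0//; lra.
  rewrite sqr_sqrtr// exprMn; apply: le_trans h1; apply: ler_wpM2r; first exact: sqr_ge0.
  by nra.
rewrite -(@ler_pXn2r _ 2) ?nnegrE//; last by rewrite mulr_ge0//; lra.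
rewrite sqr_sqrtr// exprMn; apply: (le_trans h2); apply: ler_wpM2r; first exact: sqr_ge0.
by nra.
Qed.

Lemma hav_small r s : M <= r -> M <= s -> `|r - s| <= D - M -> D + M <= r + s -> hav D r s <= 2 * e.
Proof.
move=> Mr Ms rs rsD; have [M1 eM MD e0] := reg.
have /andP[_ h2] := hav_value MDr Mr Ms rs.
apply: (le_trans h2); have : expR (D - r - s) <= e by rewrite ler_expR; lra.
have := expR_gt0 (D - r - s); nra.
Qed.

Lemma V_split x y s : V y s = V x s * expR (- ((y - x) / 2)).
Proof. by rewrite -expRD; congr expR; field. Qed.

(** Both ratio bounds for [hav] give exponential bounds on its square root, hence bounds on the
    increment that vanish with [y - x]. Since [hav <= 2 e], the passage from sine to angle costs
    only a factor [1 / (1 - 2 e)]. *)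
Lemma ang_hav_increment x y s : M <= x -> x <= y -> M <= s ->
  `|x - s| <= D - M -> `|y - s| <= D - M -> D + M <= x + s ->
  2 / pi * (1 - 8 * e) * (V x s - V y s) <= ang (hav D x s) - ang (hav D y s) <=
  2 / pi * (1 + 20 * e) * (V x s - V y s).
Proof.
move=> Mx xy Ms xs ys xsD; have [M1 eM MD e0] := reg.
have My := le_trans Mx xy.
have x0 : 0 < x by lra. have y0 : 0 < y by lra. have s0 : 0 < s by lra.
have hx := hav_small Mx Ms xs xsD.
have hy0 : 0 <= hav D y s by apply: hav_ge0; lra.
have hx0 : 0 <= hav D x s by apply: hav_ge0; lra.
have r1 := hav_ratio_ge MDr x0 xy s0 xs ys.
have r2 := hav_ratio_le MDr Mx xy s0 xs ys.
have t0 : 0 <= y - x by lra.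
have hxy : hav D y s <= hav D x s.
  apply: le_trans r1; rewrite ler_peMl// -[leLHS]expR0 ler_expR mulr_ge0//; lra.
have s1 : 2 * e < 1 by lra.
have /andP[i1 i2] := ang_increment hy0 hxy hx s1.
have /andP[q1 q2] := sqrt_hav_value Mx Ms xs.
have pi0 : 0 <= 2 / pi :> R by rewrite divr_ge0// pi_ge0.
have V0 : 0 < V x s := expR_gt0 _.
have qx0 := sqrtr_ge0 (hav D x s).
pose u := (y - x) / 2; have u0 : 0 <= u by rewrite divr_ge0.
have eu : 0 <= 1 - expR (- u) by rewrite subr_ge0 -expR0 ler_expR; lra.
have dV : V x s - V y s = V x s * (1 - expR (- u)) by rewrite (V_split x y) mulrBr mulr1.
have sqE c (S : R) : 0 <= S -> expR (c / 2) * Num.sqrt S = Num.sqrt (expR c * S).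
  move=> S0; rewrite sqrtrM ?expR_ge0//; congr (_ * _).
  rewrite -[LHS]ger0_norm ?expR_ge0// -sqrtr_sqr; congr Num.sqrt.
  by rewrite expr2 -expRD; congr expR; field.
have l1 : Num.sqrt (hav D y s) <= expR (- ((1 - 2 * e) * u)) * Num.sqrt (hav D x s).
  have -> : - ((1 - 2 * e) * u) = - ((1 - 2 * e) * (y - x)) / 2 by rewrite /u; field.
  rewrite sqE// ler_wsqrtr// [X in _ <= X * _]expRN [leRHS]mulrC ler_pdivlMr ?expR_gt0// [leLHS]mulrC.
  exact: r1.
have l2 : expR (- ((1 + 6 * e) * u)) * Num.sqrt (hav D x s) <= Num.sqrt (hav D y s).
  have -> : - ((1 + 6 * e) * u) = - ((1 + 6 * e) * (y - x)) / 2 by rewrite /u; field.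
  rewrite sqE// ler_wsqrtr// [X in X * _ <= _]expRN [leLHS]mulrC ler_pdivrMr ?expR_gt0// [leRHS]mulrC.
  exact: r2.
(* Here the errors in the exponents become multiplicative errors on the increment. *)
have c1 : (1 - 2 * e) * (1 - expR (- u)) <= 1 - expR (- ((1 - 2 * e) * u)).
  by apply: convex_expN; lra.
have c2 : 1 - expR (- ((1 + 6 * e) * u)) <= (1 + 6 * e) * (1 - expR (- u)).
  have h : 0 < 1 + 6 * e by lra.
  have := @convex_expN _ (1 + 6 * e)^-1 ((1 + 6 * e) * u).
  rewrite mulKf ?gt_eqF// ler_pdivrMl// invr_ge0 (ltW h); apply => //.
  by rewrite invf_le1//; lra.
have b1 : (1 - 8 * e) * (V x s - V y s) <= Num.sqrt (hav D x s) - Num.sqrt (hav D y s).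
  have k1 : (1 - 4 * e) * V x s * ((1 - 2 * e) * (1 - expR (- u))) <=
      Num.sqrt (hav D x s) * (1 - expR (- ((1 - 2 * e) * u))).
    by apply: ler_pM => //; rewrite mulr_ge0//; lra.
  have P0 : 0 <= V x s * (1 - expR (- u)) by rewrite mulr_ge0// ltW.
  have k2 : (1 - 8 * e) * (V x s * (1 - expR (- u))) <= ((1 - 4 * e) * (1 - 2 * e)) * (V x s * (1 - expR (- u))).
    by apply: ler_wpM2r => //; nra.
  rewrite dV; lra.
have b2 : Num.sqrt (hav D x s) - Num.sqrt (hav D y s) <= (1 + 20 * e) * (1 - 2 * e) * (V x s - V y s).
  have k1 : Num.sqrt (hav D x s) * (1 - expR (- ((1 + 6 * e) * u))) <=
      (1 + 4 * e) * V x s * ((1 + 6 * e) * (1 - expR (- u))).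
    by apply: ler_pM => //; rewrite subr_ge0 -expR0 ler_expR oppr_le0 mulr_ge0//; lra.
  have P0 : 0 <= V x s * (1 - expR (- u)) by rewrite mulr_ge0// ltW.
  have k2 : ((1 + 4 * e) * (1 + 6 * e)) * (V x s * (1 - expR (- u))) <= ((1 + 20 * e) * (1 - 2 * e)) * (V x s * (1 - expR (- u))).
    by apply: ler_wpM2r => //; nra.
  rewrite dV; lra.
apply/andP; split.
  by apply: le_trans i1; rewrite -mulrA; exact: ler_wpM2l.
apply: (le_trans i2); rewrite -[X in _ <= X]mulrA -[X in X <= _]mulrA; apply: ler_wpM2l => //.
by rewrite ler_pdivrMr; lra.
Qed.

Lemma ang_hav_value x s : M <= x -> M <= s ->
  `|x - s| <= D - M -> D + M <= x + s ->
  2 / pi * (1 - 8 * e) * V x s <= ang (hav D x s) <= 2 / pi * (1 + 20 * e) * V x s.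
Proof.
move=> Mx Ms xs xsD; have [M1 eM MD e0] := reg.
have hx := hav_small Mx Ms xs xsD.
have hx0 : 0 <= hav D x s by apply: hav_ge0; lra.
have s1 : 2 * e < 1 by lra.
have /andP[] := ang_increment (lexx 0) hx0 hx s1.
have /andP[q1 q2] := sqrt_hav_value Mx Ms xs.
have pi0 : 0 <= 2 / pi :> R by rewrite divr_ge0// pi_ge0.
have V0 : 0 < V x s := expR_gt0 _.
rewrite ang0 sqrtr0 !subr0 => i1 i2; apply/andP; split.
  by apply: le_trans i1; rewrite -mulrA; apply: ler_wpM2l => //; nra.
apply: (le_trans i2); rewrite -[X in _ <= X]mulrA -[X in X <= _]mulrA; apply: ler_wpM2l => //.
rewrite ler_pdivrMr; last by lra.
apply: (le_trans q2); rewrite mulrAC; apply: ler_wpM2r; [exact: ltW|nra].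
Qed.

End angle_increments.

Section unif_ball.
Context {R : realType}.
Implicit Types (u r s D : R).
Context (unif : probability R R).
Hypothesis unifU : forall A, measurable A -> unif A = uniform_prob (@ltNpi_pi R) A.

Lemma unif_ball D r s u : 0 < r -> r <= D -> 0 < s -> s <= D -> - pi <= u <= pi ->
  pr unif (fun x => ball_rel D r s (cos (u - x))) = ang (hav D r s).
Proof.
move=> r0 rD s0 sD hu; rewrite -(unif_ang unifU hu); last first.
  by apply: hav_ge0; [lra|lra|rewrite ler_norml; apply/andP; split; lra].
by congr (pr unif _); apply/funext => x; rewrite ball_rel_hav.
Qed.

(** A crude bound valid at all radii. If one radius is below 1, the exponent exceeds [-1] and the
    right side is at least 1; otherwise [sinh] is at least a quarter of the exponential. *)
Lemma unif_ball_le D r s u : 0 <= r -> r <= D -> 0 <= s -> s <= D -> - pi <= u <= pi ->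
  pr unif (fun x => ball_rel D r s (cos (u - x))) <= 6 * expR ((D - r - s) / 2).
Proof.
move=> r0 rD s0 sD hu.
have [/andP[r1 s1]|h] := boolP ((1 <= r) && (1 <= s)); last first.
  have mb : measurable_fun setT (fun x : R => ball_rel D r s (cos (u - x))).
    apply: measurable_fun_ler => //; apply: measurable_funB => //; apply: measurable_funM => //.
    apply: (measurableT_comp (f := cos)); last exact: measurable_funB.
    by apply: continuous_measurable_fun => x; exact: continuous_cos.
  apply: (le_trans (pr_le1 _ mb)).
  have : expR (- 1) <= expR ((D - r - s) / 2).
    by rewrite ler_expR; move: h; rewrite negb_and -!ltNge => /orP[]; lra.
  have h1 := expR_ge1Dx (- (1/2) : R).
  have : expR (- 1) = expR (- (1 / 2)) ^+ 2 :> R by rewrite expr2 -expRD; congr expR; field.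
  by move=> e2 e3; move: e3; rewrite e2; have {}h1 : 1 / 2 <= expR (- (1 / 2)) :> R; [lra|nra].
rewrite unif_ball//; try lra.
have V0 := expR_gt0 ((D - r - s) / 2).
have hp : 0 <= hav D r s by apply: hav_ge0; [lra|lra|rewrite ler_norml; apply/andP; split; lra].
apply: (le_trans (ang_le_sqrt hp)).
suff : Num.sqrt (hav D r s) <= 3 * expR ((D - r - s) / 2) by lra.
rewrite -(@ler_pXn2r _ 2) ?nnegrE ?sqrtr_ge0 ?(mulr_ge0 _ (ltW V0))//.
rewrite sqr_sqrtr// exprMn.
have -> : expR ((D - r - s) / 2) ^+ 2 = expR (D - r - s) by rewrite expr2 -expRD; congr expR; field.
have -> : expR (D - r - s) = expR D / (expR r * expR s) by rewrite !expRD !expRN invfM mulrA.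
have sr := exp_le_sinh r1; have ss := exp_le_sinh s1.
have er := expR_gt0 r; have es := expR_gt0 s.
have sr0 : 0 < sinh r by lra. have ss0 : 0 < sinh s by lra.
have c1 := cosh_ge1 (r - s); have D0 : 0 <= D by lra.
have cD := cosh_le_exp D0.
rewrite mulrA ler_pdivlMr ?(mulr_gt0 er es)// mulrAC ler_pdivrMr ?(mulr_gt0 (mulr_gt0 _ sr0) ss0)//.
have h1 : expR r / 4 * (expR s / 4) <= sinh r * sinh s by apply: ler_pM => //; lra.
have h2 : (cosh D - cosh (r - s)) * (expR r * expR s) <= expR D * (expR r * expR s).
  by apply: ler_wpM2r; [rewrite mulr_ge0// ltW|lra].
have h3 : expR D * (expR r * expR s) <= expR D * (16 * (sinh r * sinh s)).
  by apply: ler_wpM2l; [exact: expR_ge0|lra].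
have h4 : 0 <= expR D * (sinh r * sinh s) by apply: mulr_ge0; [exact: expR_ge0|apply: mulr_ge0; exact: ltW].
rewrite -[2 * sinh r * sinh s]mulrA; lra.
Qed.

End unif_ball.

(** * The radial law *)

Section density.
Context {R : realType}.
Local Notation leb := (@lebesgue_measure R).
Context (mu : probability R R) (f : R -> R).
Hypothesis mf : measurable_fun setT f.
Hypothesis f0 : forall x, 0 <= f x.
Hypothesis muf : forall x, mu `[x, +oo[%classic = (\int[leb]_(t in `[x, +oo[) (f t)%:E)%E.

(** Right half-lines form a pi-system generating the Borel sets, and both measures agree on them. *)
Lemma density_set A : measurable A -> mu A = (\int[leb]_(t in A) (f t)%:E)%E.
Proof.
move=> mA; pose nu0 (B : set R) : \bar R := (\int[leb]_(t in B) (f t)%:E)%E.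
have nu00 : nu0 set0 = 0%E by rewrite /nu0 integral_set0.
have nu0_ge0 B : (0 <= nu0 B)%E by apply: integral_ge0 => x _; rewrite lee_fin.
have nu0_add : semi_sigma_additive nu0.
  move=> /= G mG tG mUG; rewrite /nu0; apply: cvg_toP.
    apply: ereal_nondecreasing_is_cvgn => m n mn.
    apply: lee_sum_nneg_natr => // k _ _.
    by apply: integral_ge0 => /= x Gkx; rewrite lee_fin.
  rewrite ge0_integral_bigcup//=.
  - by apply: measurable_funTS; exact: measurableT_comp.
  - by move=> x _; rewrite lee_fin.
pose nu : {measure set R -> \bar R} := HB.pack nu0 (isMeasure.Build _ _ _ nu0 nu00 nu0_ge0 nu0_add).
have -> : (\int[leb]_(t in A) (f t)%:E)%E = nu A by [].
apply: (measure_unique (@RGenCInfty.G R) (fun n : nat => `[- n%:R, +oo[%classic)) => //.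
- exact: (RGenCInfty.measurableE R).
- move=> _ _ [x ->] [y ->]; exists (Num.max x y).
  apply/seteqP; split => z /=; rewrite !in_itv /= !andbT ge_max; first by move=> [-> ->].
  by move=> /andP[].
- by move=> n; exists (- n%:R).
- apply/seteqP; split => // x _; exists (Num.bound `|x|) => //=; rewrite in_itv /= andbT lerNl.
  apply: (le_trans (ler_norm _)); rewrite normrN; apply: ltW.
  exact: archi_boundP (normr_ge0 x).
- by move=> _ [x ->]; exact: muf.
- by move=> n; apply: (le_lt_trans (probability_le1 mu _)); rewrite ?ltry.
Qed.

Import HBNNSimple.

Let density_nnsfun (h : {nnsfun R >-> R}) :
  (\int[mu]_x (h x)%:E = \int[leb]_x ((h x)%:E * (f x)%:E))%E.
Proof.
have mfE : measurable_fun setT (fun x => (f x)%:E) by exact: measurableT_comp.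
under [LHS]eq_integral do rewrite fimfunE -fsumEFin//.
rewrite [LHS]ge0_integral_fsum//; last 2 first.
  - by move=> r; exact/measurable_EFinP/measurableT_comp.
  - by move=> n x _; rewrite EFinM nnfun_muleindic_ge0.
under [RHS]eq_integral.
  move=> x xD; rewrite fimfunE -fsumEFin// muleC ge0_mule_fsumr; last first.
    by move=> r; rewrite EFinM nnfun_muleindic_ge0.
  over.
rewrite [RHS]ge0_integral_fsum//; last 2 first.
  - move=> r; have h1 : measurable_fun setT (fun x => (f x)%:E * (r * \1_(h @^-1` [set r]) x)%:E)%E.
      apply: emeasurable_funM => //; apply/measurable_EFinP; apply: measurable_funM => //.
    exact: h1.
  - by move=> n x _; apply: mule_ge0; [rewrite lee_fin|rewrite EFinM nnfun_muleindic_ge0].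
apply: eq_fsbigr => r _.
have mr : measurable (h @^-1` [set r]) by [].
have [r0|r0] := leP 0 r; last first.
  rewrite !integral0_eq// => x _; rewrite preimage_nnfun0// indic0 !mulr0// ?mule0//.
transitivity (r%:E * \int[leb]_x ((f x)%:E * (\1_(h @^-1` [set r]) x)%:E))%E; last first.
  rewrite -ge0_integralZl//; last 2 first.
  - have h1 : measurable_fun setT (fun x => (f x)%:E * (\1_(h @^-1` [set r]) x)%:E)%E.
      by apply: emeasurable_funM => //; exact/measurable_EFinP/measurable_indic.
    exact: h1.
  - by move=> x _; rewrite mule_ge0 ?lee_fin.
  by apply: eq_integral => x _; rewrite EFinM muleCA.
under eq_integral do rewrite EFinM.
rewrite ge0_integralZl//; last by exact/measurable_EFinP/measurable_indic.
congr (_ * _)%E; transitivity (mu (h @^-1` [set r])); first by rewrite integral_indic// setIT.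
rewrite density_set//.
rewrite [LHS]integral_mkcond; apply: eq_integral => x _; rewrite patchE indicE.
by case: ifP; rewrite ?mule1 ?mule0.
Qed.

(** Simple functions first, then monotone limits. *)
Lemma density_integral (g : R -> \bar R) : measurable_fun setT g -> (forall x, 0 <= g x)%E ->
  (\int[mu]_x g x = \int[leb]_x (g x * (f x)%:E))%E.
Proof.
move=> mg g0; pose g_ := nnsfun_approx measurableT mg.
have mfE : measurable_fun setT (fun x => (f x)%:E) by exact: measurableT_comp.
have cg x : ((g_ n x)%:E @[n --> \oo] --> g x)%E by exact: cvg_nnsfun_approx.
transitivity (limn (fun n => \int[mu]_x (g_ n x)%:E))%E.
  rewrite -monotone_convergence//=.
  - by apply: eq_integral => x _; apply/esym/cvg_lim => //; exact: cg.
  - by move=> n; exact/measurable_EFinP/measurable_funTS.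
  - by move=> n x _; rewrite lee_fin.
  - by move=> x _ m n mn; rewrite lee_fin; exact/lefP/nd_nnsfun_approx.
transitivity (limn (fun n => \int[leb]_x ((g_ n x)%:E * (f x)%:E)))%E.
  by apply: congr_lim; apply/funext => n; exact: density_nnsfun.
rewrite -monotone_convergence//=.
- apply: eq_integral => x _; apply/cvg_lim => //; apply: cvgeZr => //; exact: cg.
- move=> n; have h1 : measurable_fun setT (fun x => (g_ n x)%:E * (f x)%:E)%E.
    by apply: emeasurable_funM => //; exact/measurable_EFinP.
  exact: h1.
- by move=> n x _; rewrite mule_ge0 ?lee_fin.
- move=> x _ m n mn; rewrite -!EFinM lee_fin; apply: ler_wpM2r => //.
  by have /lefP := nd_nnsfun_approx measurableT mg mn; apply.
Qed.

End density.

Section radial_law.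
Context {R : realType}.
Local Notation leb := (@lebesgue_measure R).
Implicit Types (x y t r s a b D xi alpha : R).

(** [radial_cdf] with the disk radius as a free parameter. *)
Definition rcdf alpha D x : R :=
  if x < 0 then 0
  else if x <= D then (cosh (alpha * x) - 1) / (cosh (alpha * D) - 1) else 1.

(* [rad] inverts [r |-> xi * weight D r], the limiting expected degree at radius [r]; [rdens] is the
   density of [xi * weight D r] when [r] has distribution function [rcdf]. *)
Definition rad D xi t : R := D - 2 * (ln t - ln xi).

Definition rdens alpha xi D t : R :=
  if xi <= t <= xi * expR (D / 2)
  then 2 * alpha / t * (sinh (alpha * rad D xi t) / (cosh (alpha * D) - 1)) else 0.

Definition weight D r : R := expR ((D - r) / 2).

Lemma rad_weight D xi r : 0 < xi -> rad D xi (xi * weight D r) = r.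
Proof.
move=> xi0; by rewrite /rad lnM ?posrE ?expR_gt0// expRK; field.
Qed.

Lemma weight_rad D xi t : 0 < xi -> 0 < t -> xi * weight D (rad D xi t) = t.
Proof.
move=> xi0 t0; rewrite /weight /rad (_ : _ / 2 = ln t - ln xi); last by field.
by rewrite expRD expRN !lnK// mulrCA divff ?mulr1// gt_eqF.
Qed.

Lemma rad_xi D xi : rad D xi xi = D.
Proof. by rewrite /rad subrr mulr0 subr0. Qed.

Lemma rad_max D xi : 0 < xi -> rad D xi (xi * expR (D / 2)) = 0.
Proof.
by move=> xi0; by rewrite /rad lnM ?posrE ?expR_gt0// expRK; field.
Qed.

Lemma ler_rad D xi s t : 0 < s -> 0 < t -> (rad D xi t <= rad D xi s) = (s <= t).
Proof. by move=> s0 t0; rewrite -(ler_ln s0 t0) /rad; apply/idP/idP; lra. Qed.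

Context (alpha xi D : R) (F : probability R R).
Hypothesis hp : [/\ 1 / 2 < alpha, 0 < xi & 0 < D].
Hypothesis FE : forall x, F `]-oo, x]%classic = (rcdf alpha D x)%:E.

Let cD : 0 < cosh (alpha * D) - 1.
Proof.
have [a0 _ D0] := hp; rewrite subr_gt0 -cosh0; apply: ltr_cosh; rewrite normr0 mulr_gt0//; lra.
Qed.

Lemma rdens_ge0 t : 0 <= rdens alpha xi D t.
Proof.
have [a0 xi0 D0] := hp; rewrite /rdens; case: ifPn => // /andP[t1 t2].
have t0 : 0 < t by exact: lt_le_trans t1.
apply: mulr_ge0; first by rewrite divr_ge0 ?(ltW t0)//; lra.
apply: divr_ge0; last exact: ltW cD.
apply: sinh_ge0; apply: mulr_ge0; first by lra.
by rewrite -(rad_max D xi0) ler_rad// mulr_gt0// expR_gt0.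
Qed.

Lemma measurable_rad : measurable_fun setT (rad D xi).
Proof.
apply: measurable_funB => //; apply: measurable_funM => //.
by apply: measurable_funB => //; exact: measurable_ln.
Qed.

Lemma measurable_rdens : measurable_fun setT (rdens alpha xi D).
Proof.
have [_ xi0 _] := hp.
rewrite (_ : rdens _ _ _ = fun t => if xi <= t <= xi * expR (D / 2)
  then 2 * alpha * t `^ (-1) * (sinh (alpha * rad D xi t) / (cosh (alpha * D) - 1)) else 0); last first.
  apply/funext => t; rewrite /rdens; case: ifPn => // /andP[t1 _].
  by rewrite powR_inv1// (le_trans (ltW xi0)).
apply: measurable_fun_ifT => //.
- by apply: measurable_and; exact: measurable_fun_ler.
- apply: measurable_funM; last first.
    apply: measurable_funM => //; apply: (measurableT_comp measurable_sinh).
    by apply: measurable_funM => //; exact: measurable_rad.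
  apply: measurable_funM => //.
Qed.

Let G t : R := - ((cosh (alpha * rad D xi t) - 1) / (cosh (alpha * D) - 1)).
Let g t : R := 2 * alpha / t * (sinh (alpha * rad D xi t) / (cosh (alpha * D) - 1)).

Let dG t : 0 < t -> is_derive t 1 G (g t).
Proof.
move=> t0; have h1 := is_derive1_ln t0.
have h2 : is_derive t 1 (fun t => alpha * rad D xi t) (- (2 * alpha / t)).
  rewrite /rad; apply: is_derive_eq.
  by rewrite /GRing.scale /=; field; rewrite gt_eqF.
have h3 := is_derive1_comp (f := @cosh R) (g := fun t => alpha * rad D xi t) (is_derive_cosh (alpha * rad D xi t)) h2.
rewrite /G; apply: is_derive_eq; rewrite /g /GRing.scale/=.
by field; rewrite (gt_eqF t0) gt_eqF.
Qed.

(** [- (cdf o rad)] is an antiderivative of the density. As [rad] is decreasing, tails in [t]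
    correspond to the radial distribution function. *)
Lemma integral_rdens a : (\int[leb]_(t in `[a, +oo[) (rdens alpha xi D t)%:E)%E =
  (if a <= xi then 1 else if a <= xi * expR (D / 2)
   then (cosh (alpha * rad D xi a) - 1) / (cosh (alpha * D) - 1) else 0)%:E.
Proof.
have [a0 xi0 D0] := hp; pose b := xi * expR (D / 2); pose a' := Num.max a xi.
have xib : xi < b by rewrite /b ltr_pMr// -expR0 ltr_expR divr_gt0.
transitivity (\int[leb]_(t in `[a', b]) (g t)%:E)%E.
  rewrite integral_mkcond [RHS]integral_mkcond; apply: eq_integral => t _.
  rewrite !patchE /rdens /a' -/b -/(g t) !mem_setE !in_itv /= andbT ge_max.
  by case: (a <= t); case: (xi <= t); case: (t <= b).
have [ba|ab] := leP b a.
  have axi : (a <= xi) = false by rewrite leNgt (lt_le_trans xib).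
  have -> : a' = a by rewrite /a' max_l//; move/negbT: axi; rewrite -ltNge => /ltW.
  rewrite axi; have [e|ne] := eqVneq a b; last first.
    have ab : b < a by rewrite lt_neqAle eq_sym ne.
    by rewrite (leNgt a) ab /= set_itv_ge ?integral_set0// bnd_simp -ltNge.
  rewrite e lexx rad_max// mulr0 cosh0 subrr mul0r.
  by rewrite set_itv1 integral_set1.
have a'b : a' < b by rewrite /a' gt_max ab xib.
have a'0 : 0 < a' by rewrite /a' lt_max xi0 orbT.
have pos t : t \in `[a', b] -> 0 < t by rewrite in_itv /= => /andP[/(lt_le_trans a'0)].
have cG t : 0 < t -> {for t, continuous G}.
  move=> t0; apply: differentiable_continuous; apply/derivable1_diffP.
  by have [] := dG t0.
rewrite (continuous_FTC2 (F := G) a'b).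
- have -> : G b = 0 by rewrite /G /b rad_max// mulr0 cosh0 subrr mul0r oppr0.
  rewrite -EFinB; congr (_%:E); rewrite sub0r opprK /a'; have [axi|axi] := leP a xi.
    by rewrite rad_xi divff// gt_eqF.
  by rewrite (ltW ab).
- apply: derivable_within_continuous => t /pos t0; rewrite /g.
  have h1 := is_derive1_ln t0.
  have h2 : is_derive t 1 (fun t => alpha * rad D xi t) (- (2 * alpha / t)).
    rewrite /rad; apply: is_derive_eq.
    by rewrite /GRing.scale /=; field; rewrite gt_eqF.
  have h3 := is_derive1_comp (f := @sinh R) (g := fun t => alpha * rad D xi t) (is_derive_sinh (alpha * rad D xi t)) h2.
  apply: derivableM; last by apply: derivableM => //; have [] := h3.
  by apply: derivableM => //; apply: derivableV => //; rewrite gt_eqF.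
- split.
  + move=> t ht; have t0 : 0 < t by apply: pos; exact: subset_itv_oo_cc ht.
    by have [] := dG t0.
  + by apply: cvg_at_right_filter; exact: cG.
  + by apply: cvg_at_left_filter; apply: cG; exact: lt_trans a'b.
- move=> t ht; have t0 : 0 < t by apply: pos; exact: subset_itv_oo_cc ht.
  by rewrite derive1E; have [_ ->] := dG t0.
Qed.

(** Change of variable: the image of [F] under the map from radius to expected degree has tails
    given by [integral_rdens], hence density [rdens]. *)
Lemma radial_integral (h : R -> \bar R) : measurable_fun setT h -> (forall x, 0 <= h x)%E ->
  (\int[F]_r h r = \int[leb]_t (h (rad D xi t) * (rdens alpha xi D t)%:E))%E.
Proof.
move=> mh h0; have [a0 xi0 D0] := hp.
have mT : measurable_fun setT (fun r => xi * weight D r).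
  apply: measurable_funM => //; apply: measurableT_comp => //; apply: measurable_funM => //.
  exact: measurable_funB.
pose T : {mfun R >-> R} := HB.pack (fun r : R => xi * weight D r) (isMeasurableFun.Build _ _ _ _ _ mT).
pose nu := distribution F T.
have nuE a : nu `[a, +oo[%classic = (\int[leb]_(t in `[a, +oo[) (rdens alpha xi D t)%:E)%E.
  rewrite integral_rdens /nu /distribution /pushforward.
  have [a0'|ap] := leP a 0.
    rewrite (_ : _ @^-1` _ = setT); last first.
      apply/seteqP; split => // r _ /=; rewrite in_itv /= andbT (le_trans a0')// mulr_ge0 ?expR_ge0//.
      exact: ltW.
    by rewrite [LHS]probability_setT (le_trans a0' (ltW xi0)).
  rewrite (_ : _ @^-1` _ = `]-oo, rad D xi a]%classic); last first.
    have E r : (a <= xi * weight D r) = (r <= rad D xi a).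
      by rewrite -(ler_rad D xi) ?rad_weight// mulr_gt0 ?expR_gt0.
    by apply/seteqP; split => r /=; rewrite !in_itv /= andbT E.
  rewrite FE; congr (_%:E); rewrite /rcdf.
  have E1 : (rad D xi a < 0) = (xi * expR (D / 2) < a).
    by rewrite -(rad_max D xi0) !ltNge ler_rad// mulr_gt0// expR_gt0.
  have E2 : (rad D xi a <= D) = (xi <= a) by rewrite -{2}(rad_xi D xi) ler_rad.
  have xib : xi < xi * expR (D / 2) by rewrite ltr_pMr// -expR0 ltr_expR divr_gt0.
  rewrite E1 E2; have [ax|ax] := leP a xi.
    rewrite ltNge (le_trans ax (ltW xib)) /=; have [e|ne] := eqVneq a xi.
      by rewrite e lexx rad_xi divff// gt_eqF.
    by rewrite leNgt lt_neqAle ne ax.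
  by rewrite (ltW ax) ltNge; case: (a <= _).
have := density_integral measurable_rdens rdens_ge0 nuE.
move=> /(_ (fun t => h (rad D xi t))); rewrite /nu ge0_integral_distribution//; last first.
  exact: measurableT_comp measurable_rad.
move=> <- //; last exact: measurableT_comp measurable_rad.
by apply: eq_integral => r _ /=; rewrite rad_weight.
Qed.

End radial_law.

(** * The limiting Pareto law *)

Section radial_limit.
Context {R : realType}.
Local Notation leb := (@lebesgue_measure R).
Implicit Types (x y t r s a b D xi alpha : R).

(* The limit of [rdens]; also the asymptotic value of the degree probability at a large degree [t]. *)
Definition pdens alpha xi t : R := 2 * alpha * xi `^ (2 * alpha) * t `^ (- (2 * alpha + 1)).

Lemma cvg_lny : ln x @[x --> +oo] --> (+oo : set_system R).
Proof.
apply/cvgryPge => A; near=> x.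
rewrite -[A]expRK ler_ln ?posrE ?expR_gt0//.
Unshelve. all: by end_near. Qed.

Lemma powR_cvgy p : p < 0 -> x `^ p @[x --> +oo] --> (0 : R).
Proof.
move=> p0; apply: (@cvg_trans _ ((expR (- (ln a * - p))) @[a --> +oo])).
  by apply: near_eq_cvg; near=> a; rewrite /powR gt_eqF// mulrN opprK mulrC.
apply: (@cvg_comp _ _ _ (fun a => ln a * - p) (fun x => expR (- x)) _ (@pinfty_nbhs R)).
  by apply: gt0_cvgMly; [rewrite oppr_gt0|exact: cvg_lny].
exact: cvgr_expR.
Unshelve. all: by end_near. Qed.

Context (alpha xi : R).
Hypothesis hp : 1 / 2 < alpha /\ 0 < xi.

Lemma pdens_ge0 t : 0 <= pdens alpha xi t.
Proof.
have [a0 _] := hp; rewrite mulr_ge0 ?powR_ge0// mulr_ge0 ?powR_ge0//; lra.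
Qed.

Lemma measurable_pdens : measurable_fun setT (pdens alpha xi).
Proof. by apply: measurable_funM => //; exact: measurable_powR. Qed.

Lemma mul_pdens t : 0 < t -> t * pdens alpha xi t = 2 * alpha * xi `^ (2 * alpha) * t `^ (- (2 * alpha)).
Proof.
move=> t0; rewrite /pdens mulrCA; congr (_ * _).
rewrite -{1}(powRr1 (ltW t0)) -powRD; last by rewrite (gt_eqF t0) implybT.
by congr (_ `^ _); ring.
Qed.

(** The mean is finite because [2 alpha > 1]; the integrand [t * pdens] later serves as the
    dominating function. *)
Lemma integral_pareto_mean :
  (\int[leb]_(t in `[xi, +oo[) (t * pdens alpha xi t)%:E)%E = (2 * alpha * xi / (2 * alpha - 1))%:E.
Proof.
have [a0 xi0] := hp; have c0 : 0 < 2 * alpha - 1 by lra.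
pose c := 2 * alpha * xi `^ (2 * alpha).
have c_ge0 : 0 <= c by rewrite mulr_ge0 ?powR_ge0//; lra.
pose G t : R := - (c / (2 * alpha - 1)) * t `^ (1 - 2 * alpha).
pose g t : R := c * t `^ (- (2 * alpha)).
have dG t : 0 < t -> is_derive t 1 G (g t).
  move=> t0; have h1 := is_derive1_powR (1 - 2 * alpha) t0; apply: is_derive_eq.
  rewrite /GRing.scale/= /g (_ : 1 - 2 * alpha - 1 = - (2 * alpha)); last by ring.
  by rewrite /c; move: (t `^ _) => q; field; rewrite gt_eqF.
have cG t : 0 < t -> {for t, continuous G}.
  move=> t0; apply: differentiable_continuous; apply/derivable1_diffP.
  by have [] := dG t t0.
transitivity (\int[leb]_(t in `[xi, +oo[) (g t)%:E)%E.
  apply: eq_integral => t; rewrite inE /= in_itv /= andbT => tx.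
  by rewrite mul_pdens// (lt_le_trans xi0).
rewrite (@ge0_continuous_FTC2y _ g G xi 0).
- rewrite sub0e -EFinN; congr (_%:E); rewrite /G mulNr opprK.
  rewrite powRB; last by rewrite (gt_eqF xi0) implybT.
  rewrite powRr1 ?(ltW xi0)// /c; field.
  by rewrite (gt_eqF (powR_gt0 _ xi0)) gt_eqF.
- by move=> t _; rewrite mulr_ge0// powR_ge0.
- apply: derivable_within_continuous => t; rewrite in_itv /= andbT => /(lt_le_trans xi0) t0.
  by apply: derivableM => //; apply: derivable_powR; rewrite in_itv /= andbT.
- rewrite -(mulr0 (- (c / (2 * alpha - 1)))); apply: cvgMr; apply: powR_cvgy; lra.
- by move=> t /(lt_trans xi0) t0; have [] := dG t t0.
- by apply: cvg_at_right_filter; exact: cG.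
- move=> t; rewrite in_itv /= andbT => /(lt_trans xi0) t0.
  by rewrite derive1E; have [_ ->] := dG t t0.
Qed.

(** [D >= 6] gives [alpha D >= 3] and [exp (alpha D) >= 4], so [cosh (alpha D) - 1] is at least a
    quarter of the exponential. *)
Lemma rdens_le D t : 6 <= D -> xi <= t -> rdens alpha xi D t <= 2 * pdens alpha xi t.
Proof.
have [a0 xi0] := hp; move=> D6 xt; rewrite /rdens; case: ifPn => [/andP[_ tD]|_]; last first.
  by rewrite mulr_ge0// pdens_ge0.
have t0 : 0 < t by exact: lt_le_trans xt.
have E4 : 4 <= expR (alpha * D).
  have := expR_ge1Dx (alpha * D); have : 3 <= alpha * D by nra.
  lra.
have h1 : expR (alpha * D) / 4 <= cosh (alpha * D) - 1.
  by have := exp_le_cosh (alpha * D); lra.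
have h2 := sinh_le_exp (alpha * rad D xi t).
have e1 : expR (alpha * rad D xi t) = expR (alpha * D) * (xi `^ (2 * alpha) * t `^ (- (2 * alpha))).
  rewrite /powR !gt_eqF// -!expRD; congr expR; rewrite /rad; ring.
have e2 : pdens alpha xi t = 2 * alpha / t * (xi `^ (2 * alpha) * t `^ (- (2 * alpha))).
  have := mul_pdens t0 => /(congr1 (fun z => z / t)); rewrite mulrAC divff ?gt_eqF// mul1r => ->.
  by ring.
rewrite e2 [leRHS]mulrCA; apply: ler_wpM2l; first by rewrite divr_ge0 ?(ltW t0)//; lra.
have E0 := expR_gt0 (alpha * D).
rewrite ler_pdivrMr; last by lra.
move: h2; rewrite e1; set q := xi `^ _ * _ => h2.
have q0 : 0 <= q by rewrite mulr_ge0 ?powR_ge0.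
apply: (le_trans h2).
have : q * (expR (alpha * D) / 4) <= q * (cosh (alpha * D) - 1) by exact: ler_wpM2l.
lra.
Qed.

Lemma cvg_rdens (D : nat -> R) t : D n @[n --> \oo] --> +oo -> xi <= t ->
  rdens alpha xi (D n) t @[n --> \oo] --> pdens alpha xi t.
Proof.
have [a0 xi0] := hp; move=> Dy xt; have t0 : 0 < t by exact: lt_le_trans xt.
pose q := xi `^ (2 * alpha) * t `^ (- (2 * alpha)).
have q0 : 0 < q by rewrite mulr_gt0 ?powR_gt0.
pose E n := expR (- (D n * alpha)).
have E0 : E n @[n --> \oo] --> (0 : R).
  rewrite /E; apply: (@cvg_comp _ _ _ (fun n => D n * alpha) (fun x => expR (- x)) _ (@pinfty_nbhs R)).
    have al0 : 0 < alpha by lra.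
    apply/cvgryPge => A; near=> n; rewrite -ler_pdivrMr//; near: n.
    by move/cvgryPge: Dy; apply.
  exact: cvgr_expR.
have e2 : pdens alpha xi t = 2 * alpha / t * q.
  have := mul_pdens t0 => /(congr1 (fun z => z / t)); rewrite mulrAC divff ?gt_eqF// mul1r => ->.
  by rewrite /q; ring.
pose f n := 2 * alpha / t * ((q - E n ^+ 2 / q) / (1 + E n ^+ 2 - 2 * E n)).
have cf : f n @[n --> \oo] --> 2 * alpha / t * ((q - 0 ^+ 2 / q) / (1 + 0 ^+ 2 - 2 * 0)).
  apply: cvgMr; apply: cvgM.
    apply: cvgB; first exact: cvg_cst.
    by apply: cvgMl; rewrite expr2; apply: cvgM.
  apply: cvgV; first by rewrite expr0n /= addr0 mulr0 subr0 oner_neq0.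
  apply: cvgB; last exact: cvgMr.
  by apply: cvgD; [exact: cvg_cst|rewrite expr2; apply: cvgM].
rewrite e2; move: cf; rewrite expr0n /= mul0r mulr0 addr0 !subr0 invr1 mulr1.
apply: cvg_trans; apply: near_eq_cvg.
near=> n.
have Dn : 2 * (ln t - ln xi) <= D n by near: n; by move/cvgryPge: Dy; apply.
have D1 : 1 <= D n by near: n; by move/cvgryPge: Dy; apply.
rewrite /f /rdens xt /= ifT; last first.
  rewrite -(weight_rad 0 xi0 t0) /weight ler_pM2l// ler_expR /rad; lra.
congr (_ * _).
have e1 : expR (alpha * rad (D n) xi t) = q / E n.
  rewrite /q /E /powR !gt_eqF// -expRN opprK -!expRD; congr expR; rewrite /rad; ring.
have En0 : 0 < E n := expR_gt0 _.
have E1 : E n < 1 by rewrite -expR0 ltr_expR; nra.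
rewrite /sinh /cosh expRN e1 [expR (alpha * D n)](_ : _ = (E n)^-1); last by rewrite /E expRN invrK mulrC.
rewrite (_ : expR (- (alpha * D n)) = E n); last by rewrite /E mulrC.
field.
by rewrite !gt_eqF//; nra.
Unshelve. all: by end_near. Qed.

(** Dominated convergence in the variable [t]: as [weight (rad t) = t / xi], the growth condition
    allows exactly one power of [t], which the Pareto law integrates. *)
Lemma radial_limit (D : nat -> R) (F : nat -> probability R R) (h : nat -> R -> R) (g : R -> R) C :
  D n @[n --> \oo] --> +oo ->
  (\forall n \near \oo, forall x, F n `]-oo, x]%classic = (rcdf alpha (D n) x)%:E) ->
  (forall n, measurable_fun setT (h n)) -> (forall n r, 0 <= h n r) ->
  (\forall n \near \oo, forall r, 0 <= r <= D n -> h n r <= C * weight (D n) r) ->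
  (forall t, xi <= t -> h n (rad (D n) xi t) @[n --> \oo] --> g t) ->
  (\int[F n]_r (h n r)%:E)%E @[n --> \oo] -->
    (\int[leb]_(t in `[xi, +oo[) (g t * pdens alpha xi t)%:E)%E.
Proof.
have [a0 xi0] := hp; move=> Dy FE mh h0 hC hg.
(* [good] sets aside the finitely many [n] where the domination may fail, so that it holds along the
   whole sequence. *)
pose good n := `[< 6 <= D n /\ forall r, 0 <= r <= D n -> h n r <= C * weight (D n) r >].
have ngood : \forall n \near \oo, good n.
  near=> n; apply/asboolP; split; last by near: n.
  by near: n; by move/cvgryPge: Dy; apply.
pose f n t : R := if good n then h n (rad (D n) xi t) * rdens alpha xi (D n) t else 0.
have mf n : measurable_fun setT (f n).
  rewrite /f; case: (boolP (good n)) => // /asboolP[D6 _]; apply: measurable_funM; last first.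
    by apply: measurable_rdens; split => //; lra.
  by apply: measurableT_comp => //; exact: measurable_rad.
have C0 : 0 <= C.
  have [n gn] : exists n, good n by have [N _ hN] := ngood; exists N; apply: hN => /=.
  have /asboolP[D6 /(_ (D n))] := gn; rewrite lexx andbT /weight subrr mul0r expR0 mulr1 => h1.
  by apply: (le_trans (h0 n (D n))); apply: h1; lra.
pose K t : R := 2 * C / xi * (t * pdens alpha xi t).
have fK n t : xi <= t -> 0 <= f n t <= K t.
  move=> xt; have t0 : 0 < t by exact: lt_le_trans xt.
  have p0 := pdens_ge0 t; have K0 : 0 <= K t.
    apply: mulr_ge0; last exact: (mulr_ge0 (ltW t0) p0).
    by apply: divr_ge0; [apply: mulr_ge0|exact: ltW].
  rewrite /f; case: ifPn => [/asboolP[D6 hn]|_]; last by rewrite lexx K0.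
  have D0 : 0 < D n by lra.
  have r0 : 0 <= rdens alpha xi (D n) t by apply: rdens_ge0; split.
  rewrite (mulr_ge0 (h0 _ _) r0) /=.
  have [tD|tD] := leP t (xi * expR (D n / 2)); last first.
    by rewrite /rdens (lt_geF tD) andbF mulr0.
  have h1 : h n (rad (D n) xi t) <= C * (t / xi).
    apply: le_trans (hn _ _) _.
      rewrite -[X in X <= _ <= _](rad_max (D n) xi0) -[X in _ <= _ <= X](rad_xi (D n) xi).
      by rewrite !ler_rad ?tD ?xt// mulr_gt0// expR_gt0.
    by rewrite -[X in _ <= _ * (X / _)](weight_rad (D n) xi0 t0) [xi * _]mulrC mulfK// gt_eqF.
  have h2 := rdens_le D6 xt.
  apply: (@le_trans _ _ (C * (t / xi) * (2 * pdens alpha xi t))).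
    exact: ler_pM.
  by rewrite /K le_eqVlt; apply/orP; left; apply/eqP; ring.
have mK : measurable_fun setT K.
  by apply: measurable_funM => //; apply: measurable_funM => //; exact: measurable_pdens.
have mI : measurable (`[xi, +oo[%classic : set R) by [].
have iK : leb.-integrable `[xi, +oo[%classic (fun t => (K t)%:E).
  apply/integrableP; split; first by apply/measurable_EFinP; exact: measurable_funTS.
  have -> : (\int[leb]_(t in `[xi, +oo[) `|(K t)%:E| =
      \int[leb]_(t in `[xi, +oo[) ((2 * C / xi)%:E * (t * pdens alpha xi t)%:E))%E.
    apply: eq_integral => t; rewrite inE /= in_itv /= andbT => xt.
    rewrite ger0_norm; first by rewrite /K EFinM.
    have /andP[f0 fK0] := fK 0%N t xt; exact: le_trans f0 fK0.
  rewrite ge0_integralZl//.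
  - by rewrite integral_pareto_mean -EFinM ltry.
  - apply/measurable_EFinP; apply: measurable_funTS.
    by apply: measurable_funM => //; exact: measurable_pdens.
  - move=> t; rewrite /= in_itv /= andbT => xt; rewrite lee_fin mulr_ge0 ?pdens_ge0//.
    by rewrite (le_trans (ltW xi0)).
  - by rewrite lee_fin; apply: divr_ge0; [apply: mulr_ge0|exact: ltW].
have cf : (\int[leb]_(t in `[xi, +oo[) (f n t)%:E)%E @[n --> \oo] -->
    (\int[leb]_(t in `[xi, +oo[) (g t * pdens alpha xi t)%:E)%E.
  apply: (@dominated_cvg _ _ _ leb _ mI (fun n t => (f n t)%:E) _ (fun t => (K t)%:E)) => //.
  - move=> n; have h1 : measurable_fun `[xi, +oo[%classic (fun t => (f n t)%:E).
      by apply/measurable_EFinP; exact: measurable_funTS.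
    exact: h1.
  - move=> t /=; rewrite in_itv /= andbT => xt; apply: cvg_EFin.
      by apply: nearW.
    apply: (@cvg_trans _ ((fun n => h n (rad (D n) xi t) * rdens alpha xi (D n) t) @ \oo)).
      by apply: near_eq_cvg; near=> n; rewrite /= /f ifT//; near: n.
    by apply: cvgM; [exact: hg|exact: cvg_rdens].
  - move=> n t /=; rewrite in_itv /= andbT => xt.
    by have /andP[f0 fK0] := fK n t xt; rewrite lee_fin ger0_norm.
apply: cvg_trans cf; apply: near_eq_cvg; near=> n.
have gn : good n by near: n.
have /asboolP[D6 _] := gn; have D0 : 0 < D n by lra.
rewrite (@radial_integral _ alpha xi (D n) (F n))//.
- rewrite [LHS]integral_mkcond /=; apply: eq_integral => t _; rewrite patchE /f gn mem_setE in_itv /= andbT.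
  case: ifPn => xt; first by rewrite EFinM.
  by rewrite /rdens (negbTE xt) mule0.
- by near: n.
- exact/measurable_EFinP.
- by move=> r; rewrite lee_fin.
Unshelve. all: by end_near. Qed.

End radial_limit.

(** * Adjacency probabilities and degrees *)

Section mean.
Context {R : realType}.

(** Bounded measurable functions: stable under the algebraic operations and integrable for every
    probability. *)
Definition bmeas d (T : measurableType d) (f : T -> R) : Prop :=
  measurable_fun setT f /\ exists B, forall x, `|f x| <= B.

Definition mean d (T : measurableType d) (P : probability T R) (f : T -> R) : R :=
  fine (\int[P]_x (f x)%:E).

Section bmeas.
Context d (T : measurableType d).
Implicit Types f g : T -> R.

Lemma bmeas_cst c : bmeas (fun _ : T => c).
Proof. by split; [exact: measurable_cst|exists `|c|]. Qed.

Lemma bmeasD f g : bmeas f -> bmeas g -> bmeas (fun x => f x + g x).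
Proof.
move=> [mf [B fB]] [mg [B' gB]]; split; first exact: measurable_funD.
by exists (B + B') => x; apply: (le_trans (ler_normD _ _)); exact: lerD.
Qed.

Lemma bmeasN f : bmeas f -> bmeas (fun x => - f x).
Proof.
move=> [mf [B fB]]; split; first exact: measurableT_comp.
by exists B => x; rewrite normrN.
Qed.

Lemma bmeasM f g : bmeas f -> bmeas g -> bmeas (fun x => f x * g x).
Proof.
move=> [mf [B fB]] [mg [B' gB]]; split; first exact: measurable_funM.
by exists (B * B') => x; rewrite normrM; exact: ler_pM.
Qed.

Lemma bmeas_bool (b : T -> bool) : measurable_fun setT b -> bmeas (fun x => (b x)%:R).
Proof.
move=> mb; split.
  have mR : measurable_fun setT (fun c : bool => c%:R : R) by [].
  exact: measurableT_comp mR mb.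
by exists 1 => x; case: (b x); rewrite ?normr1 ?normr0.
Qed.

Lemma bmeasX f n : bmeas f -> bmeas (fun x => f x ^+ n).
Proof.
move=> bf; elim: n => [|n IH]; first by under eq_fun do rewrite expr0; exact: bmeas_cst.
by under eq_fun do rewrite exprS; exact: bmeasM.
Qed.

Context (P : probability T R).

Lemma bmeas_integrable f : bmeas f -> P.-integrable setT (EFin \o f).
Proof.
move=> [mf [B fB]]; apply: measurable_bounded_integrable => //.
- by apply: (le_lt_trans (probability_le1 P measurableT)); rewrite ltry.
- by exists B; split; rewrite ?num_real// => y By x _; apply: (le_trans (fB x)); exact: ltW.
Qed.

Lemma meanE f : bmeas f -> (\int[P]_x (f x)%:E)%E = (mean P f)%:E.
Proof. by move=> bf; rewrite fineK//; apply: integrable_fin_num => //; exact: (bmeas_integrable bf). Qed.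

Lemma meanD f g : bmeas f -> bmeas g -> mean P (fun x => f x + g x) = mean P f + mean P g.
Proof. by move=> bf bg; apply: RintegralD => //; exact: bmeas_integrable. Qed.

Lemma meanZ c f : bmeas f -> mean P (fun x => c * f x) = c * mean P f.
Proof. by move=> bf; apply: RintegralZl => //; exact: bmeas_integrable. Qed.

Lemma meanB f g : bmeas f -> bmeas g -> mean P (fun x => f x - g x) = mean P f - mean P g.
Proof. by move=> bf bg; apply: RintegralB => //; exact: bmeas_integrable. Qed.

Lemma mean_cst c : mean P (fun=> c) = c.
Proof. by rewrite /mean integral_cst// [X in (_ * X)%E]probability_setT mule1. Qed.

Lemma mean_ge0 f : (forall x, 0 <= f x) -> 0 <= mean P f.
Proof. by move=> f0; rewrite fine_ge0// integral_ge0// => x _; rewrite lee_fin. Qed.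

Lemma mean_le f g : bmeas f -> bmeas g -> (forall x, f x <= g x) -> mean P f <= mean P g.
Proof. by move=> bf bg fg; apply: le_Rintegral => //; exact: bmeas_integrable. Qed.

Lemma mean_bool (b : T -> bool) : measurable_fun setT b -> mean P (fun x => (b x)%:R) = pr P b.
Proof. by move=> mb; rewrite /mean integral_event. Qed.

Lemma mean_eq_ae f g (b : T -> bool) : measurable_fun setT b -> pr P b = 1 ->
  measurable_fun setT f -> measurable_fun setT g ->
  (forall x, b x -> f x = g x) -> mean P f = mean P g.
Proof.
move=> mb b1 mf mg fg; congr fine; apply: ae_eq_integral => //.
- exact: measurableT_comp.
- exact: measurableT_comp.
exists [set x | ~~ b x]; split.
- by apply: measurable_event; apply: measurable_neg.
- have := prE P (measurable_neg mb); rewrite pr_neg// b1 subrr; exact.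
- move=> x /= nfg; apply/negP => bx; apply: nfg => _; by rewrite fg.
Qed.

(** Replacing [f] by [g] off the event [b] of probability 1 leaves its mean unchanged and makes the
    inequality hold everywhere. *)
Lemma mean_le_ae f g (b : T -> bool) : measurable_fun setT b -> pr P b = 1 ->
  bmeas f -> bmeas g -> (forall x, b x -> f x <= g x) -> mean P f <= mean P g.
Proof.
move=> mb b1 bf bg fg.
have bb := bmeas_bool mb.
have bh : bmeas (fun x => (b x)%:R * f x + (1 - (b x)%:R) * g x).
  apply: bmeasD; apply: bmeasM => //; apply: bmeasD; [exact: bmeas_cst|exact: bmeasN].
rewrite (@mean_eq_ae f (fun x => (b x)%:R * f x + (1 - (b x)%:R) * g x) b)//; last 3 first.
- by case: bf.
- by case: bh.
- by move=> x ->; rewrite mul1r subrr mul0r addr0.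
apply: mean_le => // x; case: (boolP (b x)) => bx.
  by rewrite mul1r subrr mul0r addr0 fg.
by rewrite mul0r add0r subr0 mul1r.
Qed.

End bmeas.

Section product.
Context d1 d2 (T1 : measurableType d1) (T2 : measurableType d2).
Context (P : probability T1 R) (Q : probability T2 R).

Lemma bmeas_pr (b : T1 * T2 -> bool) : measurable_fun setT b ->
  bmeas (fun x => pr Q (fun y => b (x, y))).
Proof.
move=> mb; have mx x : measurable_fun setT (fun y => b (x, y)).
  exact: (measurableT_comp mb (pair1_measurable x)).
split; last by exists 1 => x; rewrite ger0_norm ?pr_ge0// pr_le1.
apply/measurable_EFinP.
have b0 z : (0 <= ((b z)%:R)%:E :> \bar R)%E by rewrite lee_fin.
have h := measurable_fun_fubini_tonelli_F (m2 := Q) (fun z => ((b z)%:R)%:E) (measurable_fun_eventE mb) b0.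
rewrite (_ : _ \o _ = fun x => \int[Q]_y ((b (x, y))%:R)%:E)%E //.
by apply/funext => x /=; rewrite integral_event// prE.
Qed.

Lemma pr_prod (b : T1 * T2 -> bool) : measurable_fun setT b ->
  pr (P \x Q)%E b = mean P (fun x => pr Q (fun y => b (x, y))).
Proof.
move=> mb; have mx x : measurable_fun setT (fun y => b (x, y)).
  exact: (measurableT_comp mb (pair1_measurable x)).
rewrite -(mean_bool _ mb) /mean; congr fine.
have b0 z : (0 <= ((b z)%:R)%:E :> \bar R)%E by rewrite lee_fin.
rewrite (fubini_tonelli1 (fun z => ((b z)%:R)%:E) (measurable_fun_eventE mb) b0).
by apply: eq_integral => x _; rewrite /fubini_F integral_event// prE.
Qed.

End product.

Lemma pr_prodC d1 d2 (T1 : measurableType d1) (T2 : measurableType d2)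
    (P : probability T1 R) (Q : probability T2 R) (b : T1 * T2 -> bool) :
  measurable_fun setT b ->
  mean P (fun x => pr Q (fun y => b (x, y))) = mean Q (fun y => pr P (fun x => b (x, y))).
Proof.
move=> mb; have mx x : measurable_fun setT (fun y => b (x, y)).
  exact: (measurableT_comp mb (pair1_measurable x)).
have my y : measurable_fun setT (fun x => b (x, y)).
  exact: (measurableT_comp mb (pair2_measurable y)).
rewrite /mean; congr fine; have := fubini_event P Q mb.
under eq_integral do rewrite integral_event// prE//.
by under [X in _ = X -> _]eq_integral do rewrite integral_event// prE//.
Qed.

End mean.

(** * Increments of the radial distribution function *)

Section radial_cdf_bounds.
Context {R : realType}.
Implicit Types (x y t r s a b D alpha : R).

Lemma cosh_sub_le a b : 0 <= a -> a <= b -> cosh b - cosh a <= (b - a) * sinh b.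
Proof.
move=> a0 ab; have h := @cosh_increment _ b a b.
have := h; rewrite !ger0_norm ?subr_ge0 ?(le_trans a0 ab)//; last first.
  by rewrite ler_cosh// ger0_norm.
by apply.
Qed.

Lemma sinh_le_cosh_sub1 b : 1 / 2 <= b -> sinh b <= 6 * (cosh b - 1).
Proof.
move=> b2; have b0 : 0 < b by lra.
have h1 := expR_ge1Dx b; rewrite /sinh /cosh expRN.
set q := expR b in h1 *; have q0 : 0 < q by lra.
have qq : q * q^-1 = 1 by rewrite divff// gt_eqF.
have i0 : 0 < q^-1 by rewrite invr_gt0.
have hq : 3 / 2 <= q by lra.
(* The quadratic is [(q - 1) (5 q - 7)], nonnegative for [q >= 3/2]. *)
suff : 0 <= q^-1 * (5 * q ^+ 2 - 12 * q + 7).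
  have -> : q^-1 * (5 * q ^+ 2 - 12 * q + 7) = 5 * (q * q^-1) * q - 12 * (q * q^-1) + 7 * q^-1 by ring.
  by rewrite qq; lra.
by rewrite mulr_ge0 ?(ltW i0)//; nra.
Qed.

Context (alpha D : R).
Hypothesis hp : 1 / 2 < alpha /\ 0 < D.
Local Notation G := (rcdf alpha D).

Let cD : 0 < cosh (alpha * D) - 1.
Proof.
have [a0 D0] := hp; rewrite subr_gt0 -cosh0; apply: ltr_cosh; rewrite normr0 mulr_gt0//; lra.
Qed.

Lemma rcdf_le0 x : x <= 0 -> G x = 0.
Proof.
have [_ D0] := hp; rewrite le_eqVlt => /orP[/eqP ->|x0]; last by rewrite /rcdf x0.
by rewrite /rcdf ltxx (ltW D0) mulr0 cosh0 subrr mul0r.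
Qed.

Lemma rcdf_in x : 0 <= x -> x <= D -> G x = (cosh (alpha * x) - 1) / (cosh (alpha * D) - 1).
Proof. by move=> x0 xD; rewrite /rcdf ltNge x0 xD. Qed.

Lemma rcdf_geD x : D <= x -> G x = 1.
Proof.
have [_ D0] := hp; rewrite le_eqVlt => /orP[/eqP <-|Dx].
  by rewrite rcdf_in// ?(ltW D0)// divff// gt_eqF.
by rewrite /rcdf ltNge (ltW (lt_trans D0 Dx)) /= leNgt Dx.
Qed.

(** The size of the constant is immaterial: the bound lets open and closed endpoints of radius
    intervals be exchanged at an arbitrarily small cost. *)
Lemma rcdf_lipschitz x y : 0 <= x -> x <= y -> y <= D ->
  G y - G x <= alpha * sinh (alpha * D) / (cosh (alpha * D) - 1) * (y - x).
Proof.
have [a0 D0] := hp; move=> x0 xy yD.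
rewrite !rcdf_in//; try lra.
rewrite -mulrBl mulrAC ler_pdivrMr ?cD// mulfVK ?gt_eqF ?cD//.
have ax : 0 <= alpha * x by rewrite mulr_ge0//; lra.
have axy : alpha * x <= alpha * y by rewrite ler_wpM2l//; lra.
have h := cosh_sub_le ax axy.
have s1 : sinh (alpha * y) <= sinh (alpha * D) by apply: ler_sinh; rewrite ler_wpM2l//; lra.
have s2 : (alpha * y - alpha * x) * sinh (alpha * y) <= (alpha * y - alpha * x) * sinh (alpha * D).
  by apply: ler_wpM2l => //; lra.
lra.
Qed.

(* The relative loss of mass from lowering the radius by [2t]. *)
Lemma rcdf_shift a t : 1 <= a -> a <= D -> 0 <= t -> G a - G (a - 2 * t) <= 12 * alpha * t * G a.
Proof.
have [a0 D0] := hp; move=> a1 aD t0; have cD0 := cD.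
have aa : 1 / 2 <= alpha * a by nra.
have s6 := sinh_le_cosh_sub1 aa.
have Ga : 0 <= G a.
  rewrite rcdf_in//; last by lra.
  by rewrite divr_ge0 ?(ltW cD)// subr_ge0 cosh_ge1.
have [ta|ta] := leP (a - 2 * t) 0.
  rewrite (rcdf_le0 ta) subr0 ler_peMl//; nra.
have l1 : 0 <= a - 2 * t by exact: ltW.
rewrite !rcdf_in//; try lra.
rewrite -mulrBl mulrA; apply: ler_wpM2r; first by rewrite invr_ge0 ltW.
have ax : 0 <= alpha * (a - 2 * t) by rewrite mulr_ge0//; lra.
have axy : alpha * (a - 2 * t) <= alpha * a by rewrite ler_wpM2l//; lra.
have h := cosh_sub_le ax axy.
have at0 : 0 <= 2 * alpha * t by rewrite !mulr_ge0//; lra.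
have := ler_wpM2l at0 s6; lra.
Qed.

Let Ew t : expR (alpha * (t - D)) = expR (alpha * t) / expR (alpha * D).
Proof. by rewrite mulrBr expRD expRN. Qed.

Let E t := expR (alpha * (t - D)).

(** Increments of the law are compared with increments of [weight] through [1 - exp (- alpha t) <= 2
    alpha (1 - exp (- t / 2))], an instance of [convex_expN] since [2 alpha >= 1]. The factor on the
    left accounts for the [- 1] in [cosh (alpha D) - 1]. *)
Lemma rcdf_increment_le x y : 0 <= x -> x <= y -> y <= D ->
  (1 - 2 * expR (- (alpha * D))) * (G y - G x) <=
  2 * alpha * E y / weight D x * (weight D x - weight D y).
Proof.
have [a0 D0] := hp; move=> x0 xy yD; have cD0 := cD.
rewrite !rcdf_in//; try lra.
rewrite -mulrBl.
rewrite (_ : cosh (alpha * y) - 1 - (cosh (alpha * x) - 1) = cosh (alpha * y) - cosh (alpha * x)); last by ring.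
have wx : 0 < weight D x := expR_gt0 _.
have wy : weight D y = weight D x * expR (- ((y - x) / 2)) by rewrite -expRD; congr expR; field.
have -> : 2 * alpha * E y / weight D x * (weight D x - weight D y) = 2 * alpha * E y * (1 - expR (- ((y - x) / 2))).
  by rewrite wy; field; rewrite gt_eqF.
have D1 : cosh (alpha * D) - 1 >= expR (alpha * D) / 2 * (1 - 2 * expR (- (alpha * D))).
  have -> : expR (alpha * D) / 2 * (1 - 2 * expR (- (alpha * D))) = expR (alpha * D) / 2 - expR (alpha * D) * expR (- (alpha * D)) by field.
  by rewrite -expRD subrr expR0; have := exp_le_cosh (alpha * D); lra.
have EY : expR (alpha * y) = E y * expR (alpha * D) by rewrite /E Ew divfK// gt_eqF// expR_gt0.
have EX : expR (alpha * x) = expR (alpha * y) * expR (- (alpha * (y - x))) by rewrite -expRD; congr expR; ring.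
have N1 : cosh (alpha * y) - cosh (alpha * x) <= (expR (alpha * y) - expR (alpha * x)) / 2.
  have : expR (- (alpha * y)) <= expR (- (alpha * x)) by rewrite ler_expR lerN2 ler_wpM2l//; lra.
  by rewrite /cosh; lra.
have C1 : 1 - expR (- (alpha * (y - x))) <= 2 * alpha * (1 - expR (- ((y - x) / 2))).
  have h : 0 < 2 * alpha by lra.
  have := @convex_expN _ (2 * alpha)^-1 (alpha * (y - x)).
  have -> : (2 * alpha)^-1 * (alpha * (y - x)) = (y - x) / 2 by field; rewrite gt_eqF//; lra.
  rewrite ler_pdivrMl// invr_ge0 (ltW h); apply => //.
  by rewrite invf_le1//; lra.
have ED := expR_gt0 (alpha * D); have EY0 : 0 < E y := expR_gt0 _.
have [neg|pos] := leP (1 - 2 * expR (- (alpha * D))) 0.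
  apply: (@le_trans _ _ 0).
    rewrite mulr_le0_ge0// divr_ge0 ?(ltW cD0)// subr_ge0 ler_cosh// ger0_norm; last by rewrite mulr_ge0//; lra.
    by rewrite ler_wpM2l//; lra.
  rewrite !mulr_ge0 ?(ltW EY0)//; try lra.
  by rewrite subr_ge0 -[leRHS]expR0 ler_expR; lra.
rewrite mulrA ler_pdivrMr//.
have N2 : cosh (alpha * y) - cosh (alpha * x) <= E y * expR (alpha * D) / 2 * (2 * alpha * (1 - expR (- ((y - x) / 2)))).
  apply: (le_trans N1); rewrite EX EY.
  have := ler_wpM2l (mulr_ge0 (ltW EY0) (ltW ED)) C1; lra.
have N3 := ler_wpM2l (ltW pos) N2.
have P0 : 0 <= 2 * alpha * E y * (1 - expR (- ((y - x) / 2))).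
  rewrite !mulr_ge0 ?(ltW EY0)//; try lra.
  by rewrite subr_ge0 -[leRHS]expR0 ler_expR; lra.
have N4 := ler_wpM2l P0 D1.
lra.
Qed.

(** The companion inequality is [2 alpha (exp (t / 2) - 1) <= exp (alpha t) - 1]; the first factor
    accounts for the decaying half of [cosh], felt near the origin only. *)
Lemma rcdf_increment_ge x y : 0 <= x -> x <= y -> y <= D ->
  (1 - expR (- (2 * alpha * x))) * (2 * alpha * E x / weight D y * (weight D x - weight D y)) <= G y - G x.
Proof.
have [a0 D0] := hp; move=> x0 xy yD; have cD0 := cD.
rewrite !rcdf_in//; try lra.
rewrite -mulrBl.
rewrite (_ : cosh (alpha * y) - 1 - (cosh (alpha * x) - 1) = cosh (alpha * y) - cosh (alpha * x)); last by ring.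
have wy : 0 < weight D y := expR_gt0 _.
have wx : weight D x = weight D y * expR ((y - x) / 2) by rewrite -expRD; congr expR; field.
have -> : 2 * alpha * E x / weight D y * (weight D x - weight D y) = 2 * alpha * E x * (expR ((y - x) / 2) - 1).
  by rewrite wx; field; rewrite gt_eqF.
have D1 : cosh (alpha * D) - 1 <= expR (alpha * D) / 2.
  by have h : expR (- (alpha * D)) <= 1; [rewrite -[leRHS]expR0 ler_expR oppr_le0 mulr_ge0//; lra|rewrite /cosh; lra].
have EX : expR (alpha * x) = E x * expR (alpha * D) by rewrite /E Ew divfK// gt_eqF// expR_gt0.
have EY : expR (alpha * y) = expR (alpha * x) * expR (alpha * (y - x)) by rewrite -expRD; congr expR; ring.
have C1 : 2 * alpha * (expR ((y - x) / 2) - 1) <= expR (alpha * (y - x)) - 1.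
  have h : 0 < 2 * alpha by lra.
  have := @convex_expN _ (2 * alpha)^-1 (- (alpha * (y - x))).
  have -> : - ((2 * alpha)^-1 * - (alpha * (y - x))) = (y - x) / 2 by field; rewrite gt_eqF//; lra.
  rewrite opprK ler_pdivrMl// invr_ge0 (ltW h) => /(_ isT) h1.
  have := h1; rewrite invf_le1//; lra.
have N1 : (1 - expR (- (2 * alpha * x))) * ((expR (alpha * y) - expR (alpha * x)) / 2) <= cosh (alpha * y) - cosh (alpha * x).
  have e1 : expR (- (alpha * x)) - expR (- (alpha * y)) = expR (- (alpha * (x + y))) * (expR (alpha * y) - expR (alpha * x)).
    by rewrite mulrBr -!expRD; congr (expR _ - expR _); ring.
  have e2 : expR (- (alpha * (x + y))) <= expR (- (2 * alpha * x)) by rewrite ler_expR; nra.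
  have e3 : 0 <= expR (alpha * y) - expR (alpha * x) by rewrite subr_ge0 ler_expR ler_wpM2l//; lra.
  have := ler_wpM2r e3 e2; rewrite -e1 /cosh; lra.
have ED := expR_gt0 (alpha * D); have EX0 : 0 < E x := expR_gt0 _.
have q0 : 0 <= 1 - expR (- (2 * alpha * x)).
  by rewrite subr_ge0 -[leRHS]expR0 ler_expR oppr_le0 !mulr_ge0//; lra.
rewrite ler_pdivlMr//; apply: le_trans N1; rewrite -[leLHS]mulrA; apply: ler_wpM2l => //.
have P0 : 0 <= 2 * alpha * E x * (expR ((y - x) / 2) - 1).
  rewrite !mulr_ge0 ?(ltW EX0)//; try lra.
  by rewrite subr_ge0 -[leLHS]expR0 ler_expR; lra.
apply: (le_trans (ler_wpM2l P0 D1)).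
rewrite EY EX; have := ler_wpM2l (mulr_ge0 (ltW EX0) (ltW ED)) C1; lra.
Qed.

Context (F : probability R R).
Hypothesis FE : forall x, F `]-oo, x]%classic = (G x)%:E.

Let mle x : measurable_fun setT (fun s : R => s <= x).
Proof. exact: measurable_fun_ler. Qed.

Let mlt x : measurable_fun setT (fun s : R => s < x).
Proof. exact: measurable_fun_ltr. Qed.

Let mgt x : measurable_fun setT (fun s : R => x < s).
Proof. exact: measurable_fun_ltr. Qed.

Lemma pr_radius_le x : pr F (fun s => s <= x) = G x.
Proof.
by rewrite /pr (_ : [set s | s <= x] = `]-oo, x]%classic) ?FE.
Qed.

Lemma pr_radius_oc x y : x <= y -> pr F (fun s => x < s <= y) = G y - G x.
Proof.
move=> xy; rewrite -!pr_radius_le; apply/eqP; rewrite eq_sym subr_eq; apply/eqP.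
rewrite (pr_split F (mle y) (mle x)) addrC; congr (_ + _).
  by congr (pr F _); apply/funext => s; rewrite -ltNge andbC.
by congr (pr F _); apply/funext => s; case: (leP s x) => sx; rewrite ?andbF ?andbT// (le_trans sx).
Qed.

Lemma pr_radius_support : pr F (fun s => 0 < s <= D) = 1.
Proof. by have [_ D0] := hp; rewrite pr_radius_oc ?(ltW D0)// rcdf_geD// rcdf_le0// subr0. Qed.

(** The radial law has no atom, by the Lipschitz bound. *)
Lemma pr_radius_lt x : 0 < x -> x <= D -> pr F (fun s => s < x) = G x.
Proof.
have [a0 D0] := hp; move=> x0 xD; apply/eqP; rewrite eq_le -{1}pr_radius_le le_pr//=; last by move=> s /ltW.
pose L := alpha * sinh (alpha * D) / (cosh (alpha * D) - 1).
have L0 : 0 <= L by rewrite divr_ge0 ?(ltW cD)// mulr_ge0 ?sinh_ge0 ?mulr_ge0//; lra.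
apply/ler_addgt0Pr => e e0.
pose t := Num.min x (e / (L + 1)).
have L1 : 0 < L + 1 by lra.
have t0 : 0 < t by rewrite lt_min x0 divr_gt0.
have tx : t <= x by rewrite ge_min lexx.
have tL : L * t <= e.
  have : t <= e / (L + 1) by rewrite ge_min lexx orbT.
  by rewrite ler_pdivlMr//; nra.
have h1 : pr F (fun s => s <= x - t) <= pr F (fun s => s < x) by apply: le_pr => // s; lra.
rewrite pr_radius_le in h1.
have := @rcdf_lipschitz (x - t) x; rewrite -/L (_ : x - (x - t) = t); last by ring.
move=> h2; have : G x - G (x - t) <= L * t by apply: h2; lra.
lra.
Qed.

End radial_cdf_bounds.

(** * Connection probabilities as functions of the radius *)

Section connection.
Context {R : realType}.
Implicit Types (x y t r s u v h a b : R).

Context (alpha D : R) (F unif : probability R R).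
Hypothesis hp : 1 / 2 < alpha /\ 0 < D.
Hypothesis FE : forall x, F `]-oo, x]%classic = (rcdf alpha D x)%:E.
Hypothesis unifU : forall A, measurable A -> unif A = uniform_prob (@ltNpi_pi R) A.
Local Notation mu := (F \x unif)%E.

(** Clamping the radius makes the weight bounded, hence [bmeas]. *)
Definition cwt s : R := weight D (clamp D s).

Let D0 : 0 <= D. Proof. by have [_ /ltW] := hp. Qed.

Lemma bmeas_cwt : bmeas cwt.
Proof.
split.
  apply: (measurableT_comp (f := @expR R)) => //; apply: measurable_funM => //.
  by apply: measurable_funB => //; exact: measurable_clamp.
exists (expR (D / 2)) => s; rewrite ger0_norm ?expR_ge0// ler_expR.
by have := clamp_ge0 D s; have := D0; lra.
Qed.

Lemma cwt_ge0 s : 0 <= cwt s. Proof. exact: expR_ge0. Qed.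

Lemma cwt_id s : 0 <= s -> s <= D -> cwt s = weight D s.
Proof. by move=> s0 sD; rewrite /cwt clamp_id// s0. Qed.

Definition conn r s : R := pr unif (fun v => adj D (r, 0) (s, v)).

Lemma unif_adj u r s : - pi <= u <= pi -> pr unif (fun v => adj D (r, u) (s, v)) = conn r s.
Proof.
move=> hu; pose h x := ball_rel D (clamp D r) (clamp D s) (cos x).
have mh : measurable_fun setT h.
  apply: measurable_fun_ler => //; apply: measurable_funB => //; apply: measurable_funM => //.
  by apply: continuous_measurable_fun => x; exact: continuous_cos.
have hp2 x : h (x + pi *+ 2) = h x by rewrite /h cosD2pi.
have hN x : h (- x) = h x by rewrite /h cosN.
rewrite /conn /adj /= (unif_periodic unifU mh hp2 hN hu) -(unif_periodic unifU mh hp2 hN (u := 0))//.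
by rewrite oppr_le0 pi_ge0.
Qed.

Lemma conn_hav r s : 0 < r -> r <= D -> 0 < s -> s <= D -> conn r s = ang (hav D r s).
Proof.
move=> r0 rD s0 sD; rewrite /conn /adj /= !clamp_id ?(ltW r0) ?(ltW s0)//.
by rewrite (unif_ball unifU)// oppr_le0 pi_ge0.
Qed.

Lemma conn_le r s : 0 <= r -> r <= D -> 0 <= s -> s <= D ->
  conn r s <= 6 * (weight D r * weight D s * expR (- (D / 2))).
Proof.
move=> r0 rD s0 sD; rewrite /conn /adj /= !clamp_id ?r0 ?s0//.
have -> : weight D r * weight D s * expR (- (D / 2)) = expR ((D - r - s) / 2).
  by rewrite -!expRD; congr expR; field.
by apply: unif_ball_le => //; rewrite oppr_le0 pi_ge0.
Qed.

Let msup : measurable_fun setT (fun s : R => 0 < s <= D).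
Proof. by apply: measurable_and; [exact: measurable_fun_ltr|exact: measurable_fun_ler]. Qed.

Section low.
Context (L : R -> bool).
Hypothesis mL : measurable_fun setT L.

(** Probability that a random point with radius in [L] is adjacent to a vertex of radius [r]. The
    angle 0 is representative by rotation invariance, see [nbr_angle0]. *)
Definition nbr r : R := pr mu (fun y : R * R => L y.1 && adj D (r, 0) y).

Definition lweight : R := mean F (fun s => (L s)%:R * cwt s).

Let bmeas_adj r u : measurable_fun setT (fun y : R * R => adj D (r, u) (y.1, y.2)).
Proof. exact: measurable_adj2. Qed.

Lemma measurable_nbr r u : measurable_fun setT (fun y : R * R => L y.1 && adj D (r, u) y).
Proof.
apply: measurable_and; first exact: measurableT_comp.
rewrite (_ : adj D (r, u) = fun y : R * R => adj D (r, u) (y.1, y.2)); first exact: bmeas_adj.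
by apply/funext => -[].
Qed.

Lemma bmeas_conn r : bmeas (fun s => conn r s).
Proof.
have := @bmeas_pr _ _ _ _ _ unif (fun p => adj D (r, 0) (p.1, p.2)) (bmeas_adj r 0).
exact.
Qed.

Let bmeas_Lconn r : bmeas (fun s => (L s)%:R * conn r s).
Proof. by apply: bmeasM; [exact: bmeas_bool|exact: bmeas_conn]. Qed.

Let bmeas_Lcwt : bmeas (fun s => (L s)%:R * cwt s).
Proof. by apply: bmeasM; [exact: bmeas_bool|exact: bmeas_cwt]. Qed.

Lemma nbr_angle r u : - pi <= u <= pi ->
  pr mu (fun y : R * R => L y.1 && adj D (r, u) y) = mean F (fun s => (L s)%:R * conn r s).
Proof.
move=> hu; rewrite pr_prod; last exact: measurable_nbr.
congr (mean F _); apply/funext => s /=; rewrite -(unif_adj _ _ hu).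
case: (L s); rewrite ?mul1r ?mul0r//=.
by rewrite /pr (_ : [set x | _] = set0) ?measure0//; apply/seteqP; split.
Qed.

Lemma nbrE r : nbr r = mean F (fun s => (L s)%:R * conn r s).
Proof. by apply: nbr_angle; rewrite oppr_le0 pi_ge0. Qed.

Lemma nbr_angle0 r u : - pi <= u <= pi -> pr mu (fun y : R * R => L y.1 && adj D (r, u) y) = nbr r.
Proof. by move=> hu; rewrite nbr_angle// nbrE. Qed.

Lemma lweight_ge0 : 0 <= lweight.
Proof. by apply: mean_ge0 => s; rewrite mulr_ge0// cwt_ge0. Qed.

Lemma nbr_le r : 0 <= r -> r <= D -> nbr r <= 6 * (weight D r * expR (- (D / 2))) * lweight.
Proof.
move=> r0 rD; rewrite nbrE -meanZ//.
apply: (mean_le_ae msup (pr_radius_support hp FE)) => //; first by apply: bmeasM => //; exact: bmeas_cst.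
move=> s /andP[s0 sD]; rewrite cwt_id ?(ltW s0)//.
case: (L s); rewrite ?mul1r ?mul0r ?mulr0//.
by have := conn_le r0 rD (ltW s0) sD; rewrite mulrAC; lra.
Qed.

Context (M h : R).
Hypothesis MDr : [/\ 1 <= M, expR (- M) <= 1 / 16 & M <= D].
Hypothesis Mh : M <= h.
Hypothesis Lh : forall s, 0 < s <= D -> L s -> h <= s.

(** The increment of the sector width, integrated over the radius [s] of the random point; [V]
    factorises, so the integral over [s] leaves [lweight]. *)
Lemma nbr_increment x y : M <= x -> x <= y -> y <= D -> D + M <= x + h ->
  2 / pi * (1 - 8 * expR (- M)) * lweight * expR (- (D / 2)) * (weight D x - weight D y)
  <= nbr x - nbr y <=
  2 / pi * (1 + 20 * expR (- M)) * lweight * expR (- (D / 2)) * (weight D x - weight D y).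
Proof.
have Mh' := Mh; have [M1 eM MD] := MDr; move=> Mx xy yD xh.
rewrite !nbrE -meanB//.
have key s : 0 < s <= D -> L s ->
    2 / pi * (1 - 8 * expR (- M)) * (weight D s * expR (- (D / 2)) * (weight D x - weight D y))
    <= conn x s - conn y s <=
    2 / pi * (1 + 20 * expR (- M)) * (weight D s * expR (- (D / 2)) * (weight D x - weight D y)).
  move=> sD Ls; have hs := Lh sD Ls; move: sD => /andP[s0 sD].
  have := @ang_hav_increment R M D MDr x y s.
  rewrite -!conn_hav//; try lra.
  have e z : expR ((D - z - s) / 2) = weight D s * expR (- (D / 2)) * weight D z.
    by rewrite -!expRD; congr expR; field.
  rewrite !e -mulrBr; apply => //; try lra.
  - by rewrite ler_norml; apply/andP; split; lra.
  - by rewrite ler_norml; apply/andP; split; lra.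
have bd : bmeas (fun s => (L s)%:R * conn x s - (L s)%:R * conn y s) by apply: bmeasD => //; exact: bmeasN.
have bw c : bmeas (fun s => c * ((L s)%:R * cwt s)) by apply: bmeasM => //; exact: bmeas_cst.
apply/andP; split.
- have -> : 2 / pi * (1 - 8 * expR (- M)) * lweight * expR (- (D / 2)) * (weight D x - weight D y) =
      (2 / pi * (1 - 8 * expR (- M)) * expR (- (D / 2)) * (weight D x - weight D y)) * lweight by ring.
  rewrite -meanZ//; apply: (mean_le_ae msup (pr_radius_support hp FE)) => // s sD.
  have /andP[s0 sD'] := sD; rewrite cwt_id ?(ltW s0)// -mulrBr.
  case: (boolP (L s)) => Ls; rewrite ?mul0r ?mulr0//= !mul1r.
  have /andP[h1 _] := key s sD Ls; apply: le_trans h1.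
  by rewrite le_eqVlt; apply/orP; left; apply/eqP; ring.
- have -> : 2 / pi * (1 + 20 * expR (- M)) * lweight * expR (- (D / 2)) * (weight D x - weight D y) =
      (2 / pi * (1 + 20 * expR (- M)) * expR (- (D / 2)) * (weight D x - weight D y)) * lweight by ring.
  rewrite -meanZ//; apply: (mean_le_ae msup (pr_radius_support hp FE)) => // s sD.
  have /andP[s0 sD'] := sD; rewrite cwt_id ?(ltW s0)// -mulrBr.
  case: (boolP (L s)) => Ls; rewrite ?mul0r ?mulr0//= !mul1r.
  have /andP[_ h1] := key s sD Ls; apply: (le_trans h1).
  by rewrite le_eqVlt; apply/orP; left; apply/eqP; ring.
Qed.

Lemma nbr_value x : M <= x -> x <= D -> D + M <= x + h ->
  2 / pi * (1 - 8 * expR (- M)) * lweight * expR (- (D / 2)) * weight D x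
  <= nbr x <=
  2 / pi * (1 + 20 * expR (- M)) * lweight * expR (- (D / 2)) * weight D x.
Proof.
have Mh' := Mh; have [M1 eM MD] := MDr; move=> Mx xD xh.
rewrite !nbrE.
have key s : 0 < s <= D -> L s ->
    2 / pi * (1 - 8 * expR (- M)) * (weight D s * expR (- (D / 2)) * weight D x)
    <= conn x s <=
    2 / pi * (1 + 20 * expR (- M)) * (weight D s * expR (- (D / 2)) * weight D x).
  move=> sD Ls; have hs := Lh sD Ls; move: sD => /andP[s0 sD].
  have := @ang_hav_value R M D MDr x s.
  rewrite -!conn_hav//; try lra.
  have e z : expR ((D - z - s) / 2) = weight D s * expR (- (D / 2)) * weight D z.
    by rewrite -!expRD; congr expR; field.
  rewrite !e; apply => //; try lra.
  by rewrite ler_norml; apply/andP; split; lra.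
have bw c : bmeas (fun s => c * ((L s)%:R * cwt s)) by apply: bmeasM => //; exact: bmeas_cst.
apply/andP; split.
- have -> : 2 / pi * (1 - 8 * expR (- M)) * lweight * expR (- (D / 2)) * weight D x =
      (2 / pi * (1 - 8 * expR (- M)) * expR (- (D / 2)) * weight D x) * lweight by ring.
  rewrite -meanZ//; apply: (mean_le_ae msup (pr_radius_support hp FE)) => // s sD.
  have /andP[s0 sD'] := sD; rewrite cwt_id ?(ltW s0)//.
  case: (boolP (L s)) => Ls; rewrite ?mul0r ?mulr0//= !mul1r.
  have /andP[h1 _] := key s sD Ls; apply: le_trans h1.
  by rewrite le_eqVlt; apply/orP; left; apply/eqP; ring.
- have -> : 2 / pi * (1 + 20 * expR (- M)) * lweight * expR (- (D / 2)) * weight D x =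
      (2 / pi * (1 + 20 * expR (- M)) * expR (- (D / 2)) * weight D x) * lweight by ring.
  rewrite -meanZ//; apply: (mean_le_ae msup (pr_radius_support hp FE)) => // s sD.
  have /andP[s0 sD'] := sD; rewrite cwt_id ?(ltW s0)//.
  case: (boolP (L s)) => Ls; rewrite ?mul0r ?mulr0//= !mul1r.
  have /andP[_ h1] := key s sD Ls; apply: (le_trans h1).
  by rewrite le_eqVlt; apply/orP; left; apply/eqP; ring.
Qed.

End low.

(* Below [h] the adjacency probability has no pointwise increment bound; [ball_rel_shift] moves the mass instead. *)
Lemma nbr_high_increment M h x t : [/\ 1 <= M, expR (- M) <= 1 / 16 & M <= D] ->
  1 <= h -> h <= D - M -> M <= x -> 0 <= t -> x + t <= D - M ->
  nbr (fun s => s < h) x - nbr (fun s => s < h) (x + t) <= 12 * alpha * t * nbr (fun s => s < h) x.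
Proof.
move=> MDr; have [M1 eM MD] := MDr; move=> h1 hD Mx; rewrite le_eqVlt => /orP[/eqP <- _|t0 xtD].
  by rewrite addr0 subrr mulr0 mul0r.
have mh : measurable_fun setT (fun s : R => s < h) by exact: measurable_fun_ltr.
have mb z : measurable_fun setT (fun p : R * R => (p.1 < h) && adj D (z, 0) p) by exact: (measurable_nbr mh z 0).
have mF z v : measurable_fun setT (fun s : R => (s < h) && adj D (z, 0) (s, v)).
  by apply: measurable_and => //; exact: measurable_adj2.
have E z : nbr (fun s => s < h) z = mean unif (fun v => pr F (fun s => (s < h) && adj D (z, 0) (s, v))).
  by rewrite /nbr pr_prod// (pr_prodC _ _ (mb z)).
have bm z : bmeas (fun v => pr F (fun s => (s < h) && adj D (z, 0) (s, v))).
  have mb' : measurable_fun setT (fun p : R * R => (p.2 < h) && adj D (z, 0) (p.2, p.1)).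
    by apply: measurable_and; [exact: measurable_fun_ltr|exact: measurable_adj2].
  exact: (bmeas_pr F mb').
rewrite !E -meanB// -meanZ//; apply: mean_le.
- by apply: bmeasD => //; exact: bmeasN.
- by apply: bmeasM => //; exact: bmeas_cst.
move=> v /=; pose tau := thr D v (x, 0).
have adjE s : 0 <= s <= D -> adj D (x, 0) (s, v) = (s <= tau).
  by move=> sD; rewrite adjC /tau thrP.
have tau1 : 1 <= tau.
  rewrite -adjE; last by lra.
  by rewrite /adj /= !clamp_id; try lra; apply: ball_rel_small; rewrite ?cos_geN1//; lra.
(* At angle [v] the neighbours of [x] below [h] are, up to a null set, the radii at most [a]. *)
pose a := Num.min h tau.
have a1 : 1 <= a by rewrite le_min h1.
have aD : a <= D by rewrite ge_min; apply/orP; left; lra.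
have mle c : measurable_fun setT (fun s : R => s <= c) by exact: measurable_fun_ler.
have prmod (b1 b2 : R -> bool) : measurable_fun setT b1 -> measurable_fun setT b2 ->
    (forall s, 0 < s <= D -> b1 s -> b2 s) -> pr F b1 <= pr F b2.
  move=> m1 m2 b12; rewrite -!mean_bool//.
  apply: (mean_le_ae msup (pr_radius_support hp FE)); try exact: bmeas_bool.
  by move=> s sD; case: (boolP (b1 s)) => // /(b12 s sD) ->.
have Ex : pr F (fun s => (s < h) && adj D (x, 0) (s, v)) = rcdf alpha D a.
  apply/eqP; rewrite eq_le; apply/andP; split.
    rewrite -(pr_radius_le FE); apply: prmod => // s /andP[s0 sD] /andP[sh].
    by rewrite adjE ?(ltW s0)// /a le_min (ltW sh).
  have [th|th] := ltP tau h.
    have -> : a = tau by rewrite /a min_r// ltW.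
    rewrite -(pr_radius_le FE); apply: prmod => // s /andP[s0 sD] st.
    by rewrite (le_lt_trans st th) adjE ?(ltW s0).
  have -> : a = h by rewrite /a min_l.
  rewrite -(pr_radius_lt hp FE); [|lra|lra]; apply: prmod => // s /andP[s0 sD] sh.
  by rewrite sh adjE ?(ltW s0)//= (le_trans (ltW sh)).
have Ey : rcdf alpha D (a - 2 * t) <= pr F (fun s => (s < h) && adj D (x + t, 0) (s, v)).
  rewrite -(pr_radius_le FE); apply: prmod => // s /andP[s0 sD] sa.
  have ah : a <= h by rewrite /a ge_min lexx.
  (* If [s <= a - 2 t], then [s + 2 t] is adjacent to [x], and [ball_rel_shift] makes [s] adjacent
     to [x + t]. *)
  have atau : a <= tau by rewrite /a ge_min lexx orbT.
  apply/andP; split; first by lra.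
  have : adj D (x, 0) (s + 2 * t, v) by rewrite adjE; lra.
  rewrite /adj /= !clamp_id; try lra.
  have := @ball_rel_shift R M D MDr x (s + 2 * t) t (cos (0 - v)).
  by rewrite addrK; apply; lra.
have := rcdf_shift hp a1 aD (ltW t0); rewrite Ex; lra.
Qed.

End connection.

Section mean_products.
Context {R : realType}.

Lemma mean_swap d1 d2 (T1 : measurableType d1) (T2 : measurableType d2)
    (P : probability T1 R) (Q : probability T2 R) (K : T1 * T2 -> R) :
  bmeas K -> (forall z, 0 <= K z) ->
  mean P (fun x => mean Q (fun y => K (x, y))) = mean Q (fun y => mean P (fun x => K (x, y))).
Proof.
move=> [mK [B KB]] K0.
have b1 x : bmeas (fun y => K (x, y)).
  by split; [exact: (measurableT_comp mK (pair1_measurable x))|exists B => y].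
have b2 y : bmeas (fun x => K (x, y)).
  by split; [exact: (measurableT_comp mK (pair2_measurable y))|exists B => x].
have mKE : measurable_fun setT (fun z => (K z)%:E) by exact/measurable_EFinP.
have KE0 z : (0 <= (K z)%:E)%E by rewrite lee_fin.
have := fubini_tonelli (m1 := P) (m2 := Q) (fun z => (K z)%:E) mKE KE0.
rewrite /mean => h; congr fine.
under eq_integral do rewrite (meanE Q (b1 _)) in h *.
transitivity (\int[P]_x \int[Q]_y (K (x, y))%:E)%E.
  by apply: eq_integral => x _; rewrite (meanE Q (b1 x)).
by rewrite h; apply: eq_integral => y _; rewrite (meanE P (b2 y)).
Qed.

Lemma bmeas_tnth d (E : measurableType d) n (f : E -> R) i : bmeas f ->
  bmeas (fun z : n.-tuple E => f (tnth z i)).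
Proof.
move=> [mf [B fB]]; split; last by exists B => z.
by apply: measurableT_comp => //; exact: measurable_tnth.
Qed.

Lemma bmeas_prod d (T : measurableType d) (I : Type) (s : seq I) (f : I -> T -> R) :
  (forall i, bmeas (f i)) -> bmeas (fun x => \prod_(i <- s) f i x).
Proof.
move=> bf; elim: s => [|i s IH].
  by under eq_fun do rewrite big_nil; exact: bmeas_cst.
by under eq_fun do rewrite big_cons; exact: bmeasM.
Qed.

Lemma mean_prodn d (E : measurableType d) (P : probability E R) n (f : 'I_n -> E -> R) :
  (forall i, bmeas (f i)) -> (forall i x, 0 <= f i x) ->
  mean (prodn P n) (fun z => \prod_i f i (tnth z i)) = \prod_i mean P (f i).
Proof.
elim: n f => [|n IH] f bf f0.
  rewrite big_ord0 (_ : (fun z => _) = fun=> 1) ?mean_cst//.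
  by apply/funext => z; rewrite big_ord0.
have bF m (g : 'I_m -> E -> R) : (forall i, bmeas (g i)) ->
    bmeas (fun z : m.-tuple E => \prod_i g i (tnth z i)).
  by move=> bg; apply: bmeas_prod => i; exact: bmeas_tnth.
rewrite big_ord_recl -IH//.
have [mF _] := bF _ _ bf.
rewrite {1}/mean prodn_cons; [|exact/measurable_EFinP|by move=> z; rewrite lee_fin prodr_ge0].
pose g (i : 'I_n) := f (lift ord0 i).
have bg : bmeas (fun z : n.-tuple E => \prod_i g i (tnth z i)) by exact: (bF n g (fun i => bf _)).
rewrite (eq_integral (fun x => (mean (prodn P n) (fun z => \prod_i g i (tnth z i)) * f ord0 x)%:E)); last first.
  move=> x _; rewrite mulrC -meanZ// -(meanE (prodn P n)); last by apply: bmeasM => //; exact: bmeas_cst.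
  apply: eq_integral => z _; congr (_%:E); rewrite big_ord_recl tnth0; congr (_ * _).
  by apply: eq_bigr => i _; rewrite tnthS.
by rewrite mulrC -(meanZ P _ (bf ord0)).
Qed.

Definition ziptup m (r u : m.-tuple R) : m.-tuple (R * R) := [tuple (tnth r i, tnth u i) | i < m].

Lemma measurable_ziptup m : measurable_fun setT (fun p : m.-tuple R * m.-tuple R => ziptup p.2 p.1).
Proof.
apply/measurable_fun_tnthP => i.
rewrite (_ : _ \o _ = fun p => (tnth p.2 i, tnth p.1 i)); last first.
  by apply/funext => p /=; rewrite tnth_mktuple.
apply/measurable_fun_pairP; split.
  by apply: (measurableT_comp (measurable_tnth i)) => //; exact: measurable_snd.
by apply: (measurableT_comp (measurable_tnth i)) => //; exact: measurable_fst.
Qed.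

Context (F U : probability R R).
Local Notation mu := (F \x U)%E.

(** Angles and radii drawn as two separate blocks have the law of independent pairs; this allows
    fixing all angles before the radii. *)
Lemma iid_zip m : iid (prodn U m \x prodn F m)%E mu (fun i (p : m.-tuple R * m.-tuple R) => (tnth p.2 i, tnth p.1 i)).
Proof.
split=> [i|A mA].
  apply/measurable_fun_pairP; split.
    by apply: (measurableT_comp (measurable_tnth i)) => //; exact: measurable_snd.
  by apply: (measurableT_comp (measurable_tnth i)) => //; exact: measurable_fst.
have mb i : measurable_fun setT (fun z : R * R => z \in A i).
  apply: (measurable_fun_bool true).
  rewrite setTI (_ : _ @^-1` _ = A i)//.
  by apply/seteqP; split => z /=; [move/set_mem|move/mem_set].
have mb' i : measurable_fun setT (fun z : R * R => (z.2, z.1) \in A i).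
  by apply: (measurableT_comp (mb i)); apply/measurable_fun_pairP; split; [exact: measurable_snd|exact: measurable_fst].
have E i : mu (A i) = (mean U (fun u => pr F (fun r => (r, u) \in A i)))%:E.
  have := prE mu (mb i); rewrite (_ : [set x | _] = A i); last by apply/seteqP; split => z /=; rewrite inE.
  by move=> ->; rewrite pr_prod// (pr_prodC F U (mb i)).
have bi i : bmeas (fun u => pr F (fun r => (r, u) \in A i)).
  exact: (bmeas_pr F (mb' i)).
transitivity ((\prod_i mean U (fun u => pr F (fun r => (r, u) \in A i)))%:E); last first.
  congr (_%:E); apply: eq_bigr => i _; have := E i; rewrite /= => e.
  by rewrite [X in _ = fine X](_ : _ = (mean U (fun u => pr F (fun r => (r, u) \in A i)))%:E).
rewrite -mean_prodn//; last by move=> i x; exact: pr_ge0.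
pose Phi (p : m.-tuple R * m.-tuple R) := [forall i, (tnth p.2 i, tnth p.1 i) \in A i].
have mPhi : measurable_fun setT Phi.
  apply: (measurable_forallb R) => i; apply: (measurableT_comp (mb i)).
  apply/measurable_fun_pairP; split.
    by apply: (measurableT_comp (measurable_tnth i)) => //; exact: measurable_snd.
  by apply: (measurableT_comp (measurable_tnth i)) => //; exact: measurable_fst.
have := prE (prodn U m \x prodn F m)%E mPhi.
rewrite (_ : [set x | _] = [set w | forall i, A i (tnth w.2 i, tnth w.1 i)]); last first.
  apply/seteqP; split => w /=; first by move=> /forallP h i; have := h i; rewrite inE.
  by move=> h; apply/forallP => i; rewrite inE.
move=> ->; rewrite pr_prod//; congr (mean _ _)%:E; apply/funext => u /=.
rewrite /pr (_ : [set x | _] = rect (fun i => [set r | (r, tnth u i) \in A i])); last first.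
  by apply/seteqP; split => w /= => [/forallP|h]; [|apply/forallP].
rewrite prodn_rect//.
move=> i; apply: measurable_event.
exact: (measurableT_comp (mb i) (pair2_measurable _)).
Qed.

Lemma pr_zip m dT (T : measurableType dT) (Q : probability T R) (Phi : m.-tuple (R * R) * T -> bool) :
  measurable_fun setT Phi ->
  pr (prodn mu m \x Q)%E Phi =
  mean (prodn U m) (fun u => mean Q (fun w => pr (prodn F m) (fun r => Phi (ziptup r u, w)))).
Proof.
move=> mPhi; rewrite pr_prod// (pr_prodC _ _ mPhi).
have mz : measurable_fun setT (fun p : (T * m.-tuple R) * m.-tuple R => Phi (ziptup p.2 p.1.2, p.1.1)).
  apply: measurableT_comp => //; apply/measurable_fun_pairP; split.
    rewrite [X in measurable_fun _ X](_ : _ = (fun p : m.-tuple R * m.-tuple R => ziptup p.2 p.1) \o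
      (fun x : (T * m.-tuple R) * m.-tuple R => (x.1.2, x.2)))//.
    apply: (measurableT_comp (@measurable_ziptup m)).
    apply/measurable_fun_pairP; split; last exact: measurable_snd.
    exact: (measurableT_comp measurable_snd measurable_fst).
  exact: (measurableT_comp measurable_fst measurable_fst).
rewrite -(mean_swap Q (prodn U m) (K := fun p => pr (prodn F m) (fun r => Phi (ziptup r p.2, p.1)))); last 2 first.
- have := bmeas_pr (prodn F m) mz; apply.
- by move=> z; exact: pr_ge0.
congr (mean Q _); apply/funext => w.
have mw : measurable_fun setT (fun v => Phi (v, w)) by exact: (measurableT_comp mPhi (pair2_measurable w)).
have mzw : measurable_fun setT (fun p : m.-tuple R * m.-tuple R => Phi (ziptup p.2 p.1, w)).
  by apply: (measurableT_comp mw); exact: measurable_ziptup.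
rewrite -(pr_prod _ _ mzw) /pr; congr fine.
have := iid_law (iid_zip m) (measurable_event mw); rewrite /= => <-.
by [].
Qed.

End mean_products.

Section degrees.
Context {R : realType}.
Lemma mean_fst d1 d2 (T1 : measurableType d1) (T2 : measurableType d2)
    (P : probability T1 R) (Q : probability T2 R) (g : T1 -> R) :
  bmeas g -> (forall x, 0 <= g x) -> mean (P \x Q)%E (fun z => g z.1) = mean P g.
Proof.
move=> [mg _] g0; rewrite /mean; congr fine.
have m1 : measurable_fun setT (fun z : T1 * T2 => (g z.1)%:E).
  by apply/measurable_EFinP; exact: measurableT_comp.
have p1 (z : T1 * T2) : (0 <= (g z.1)%:E)%E by rewrite lee_fin.
rewrite (fubini_tonelli1 _ m1 p1).
apply: eq_integral => x _; rewrite /fubini_F /= integral_cst// [X in (_ * X)%E]probability_setT mule1//.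
Qed.

Context (alpha D : R) (F unif : probability R R).
Hypothesis hp : 1 / 2 < alpha /\ 0 < D.
Hypothesis FE : forall x, F `]-oo, x]%classic = (rcdf alpha D x)%:E.
Hypothesis unifU : forall A, measurable A -> unif A = uniform_prob (@ltNpi_pi R) A.
Local Notation mu := (F \x unif)%E.
Local Notation E := (R * R)%type.

Definition inrange (u : R) : bool := - pi <= u <= pi.

Lemma measurable_inrange : measurable_fun setT inrange.
Proof. by apply: measurable_and; exact: measurable_fun_ler. Qed.

Lemma pr_inrange : pr unif inrange = 1.
Proof.
have h := unif_ang unifU (u := 0) (S := 1); rewrite oppr_le0 pi_ge0 in h.
have pi0 := pi_gt0 R.
rewrite /pr (_ : [set x | inrange x] = `[- pi, pi]%classic); last first.
  by apply/seteqP; split => x /=; rewrite in_itv.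
rewrite unifU// /uniform_prob.
by rewrite (@integral_uniform_pdf1 _ _ _ _ (@ltNpi_pi R)).
Qed.

(** In a sample split into a block of [m] vertices and the rest, the degree of a block vertex is
    [ndeg] into the rest plus [ideg] within the block. *)
Definition ndeg (u : E) n (w : n.-tuple E) : nat := #|[pred j | adj D u (tnth w j)]|.

Definition ideg m (u : m.-tuple E) (i : 'I_m) : nat :=
  #|[pred j | (j != i) && adj D (tnth u i) (tnth u j)]|.

Lemma measurable_adj : measurable_fun setT (fun p : E * E => adj D p.1 p.2).
Proof.
rewrite (_ : (fun p => _) = fun p : E * E => adj D (p.1.1, p.1.2) (p.2.1, p.2.2)); last first.
  by apply/funext => -[[? ?] [? ?]].
by apply: measurable_adj2; (apply: measurableT_comp; [exact: measurable_fst || exact: measurable_snd|exact: measurable_fst || exact: measurable_snd]).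
Qed.

Lemma measurable_adjT d (T : measurableType d) (f g : T -> E) :
  measurable_fun setT f -> measurable_fun setT g -> measurable_fun setT (fun x => adj D (f x) (g x)).
Proof.
move=> mf mg; apply: (measurableT_comp (f := fun p : E * E => adj D p.1 p.2) (g := fun x => (f x, g x))).
  exact: measurable_adj.
exact/measurable_fun_pairP.
Qed.

Lemma measurable_adj1 (u : E) : measurable_fun setT (adj D u).
Proof. by apply: measurable_adjT => //; exact: measurable_id. Qed.

Lemma measurable_ndegT d (T : measurableType d) n (f : T -> E) (g : T -> n.-tuple E) :
  measurable_fun setT f -> measurable_fun setT g -> measurable_fun setT (fun x => ndeg (f x) (g x)).
Proof.
move=> mf mg; apply: (measurable_fun_card R) => j; apply: measurable_adjT => //.
by apply: (measurableT_comp (measurable_tnth j)).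
Qed.

Lemma measurable_idegT d (T : measurableType d) m (f : T -> m.-tuple E) i :
  measurable_fun setT f -> measurable_fun setT (fun x => ideg (f x) i).
Proof.
move=> mf; apply: (measurable_fun_card R) => j; apply: measurable_and => //.
by apply: measurable_adjT; [exact: (measurableT_comp (measurable_tnth i) mf)|exact: (measurableT_comp (measurable_tnth j) mf)].
Qed.

Definition conp (r : R) : R := nbr D F unif (fun=> true) r.

Lemma conpE r u : inrange u -> pr mu (adj D (r, u)) = conp r.
Proof. by move=> hu; rewrite /conp -(nbr_angle0 D F unifU (L := fun=> true) (measurable_cst _) r hu). Qed.

Lemma conp01 r : 0 <= conp r <= 1.
Proof. by rewrite pr_ge0 pr_le1//; exact: measurable_adj1. Qed.

Lemma bmeas_bin n (C : pred nat) : bmeas (fun r => bin_exp (conp r) n (fun a => (C a)%:R)).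
Proof.
have m1 : bmeas conp.
  have mb : measurable_fun setT (fun p : R * E => adj D (p.1, 0) p.2).
    apply: measurable_adjT; last exact: measurable_snd.
    by apply/measurable_fun_pairP; split; [exact: measurable_fst|exact: measurable_cst].
  exact: (bmeas_pr mu mb).
elim: n C => [|n IH] C /=; first exact: bmeas_cst.
apply: bmeasD; apply: bmeasM.
- exact: m1.
- exact: (IH (fun a => C a.+1)).
- by apply: bmeasD; [exact: bmeas_cst|exact: bmeasN].
- exact: IH.
Qed.

Lemma bin_exp01 (p : R) n (C : pred nat) : 0 <= p <= 1 -> 0 <= bin_exp p n (fun a => (C a)%:R : R) <= 1.
Proof.
move=> p01; apply/andP; split; first by apply: bin_exp_ge0.
rewrite -[leRHS](bin_exp_cst p n); apply: ler_bin_exp => // a.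
by case: (C a).
Qed.

Lemma pr_ndeg (u : E) n (C : pred nat) : pr (prodn mu n) (fun w => C (ndeg u w)) =
  bin_exp (pr mu (adj D u)) n (fun a => (C a)%:R).
Proof.
have mC : measurable_fun setT (fun w : n.-tuple E => C (ndeg u w)).
  by apply: (measurable_natcomp C); apply: measurable_ndegT => //; exact: measurable_id.
rewrite -(mean_bool _ mC) /mean /ndeg.
by rewrite (count_law mu n (h := fun a => (C a)%:R) (measurable_adj1 u)).
Qed.

(** Given the vertex, its neighbours among [n] independent points are binomial, with a parameter
    depending on its radius only. *)
Lemma pr_degree n (B : R -> bool) (C : pred nat) : measurable_fun setT B ->
  pr (mu \x prodn mu n)%E (fun p => B p.1.1 && C (ndeg p.1 p.2)) =
  mean F (fun r => (B r)%:R * bin_exp (conp r) n (fun a => (C a)%:R)).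
Proof.
move=> mB.
have mC : measurable_fun setT (fun p : E * n.-tuple E => B p.1.1 && C (ndeg p.1 p.2)).
  apply: measurable_and.
    by apply: measurableT_comp => //; exact: (measurableT_comp measurable_fst measurable_fst).
  by apply: (measurable_natcomp C); apply: measurable_ndegT; [exact: measurable_fst|exact: measurable_snd].
rewrite pr_prod//.
have bg : bmeas (fun r => (B r)%:R * bin_exp (conp r) n (fun a => (C a)%:R)).
  by apply: bmeasM; [exact: bmeas_bool|exact: bmeas_bin].
have mir : measurable_fun setT (fun z : E => inrange z.2).
  by apply: (measurableT_comp measurable_inrange); exact: measurable_snd.
rewrite -(mean_fst F unif bg); last first.
  by move=> r; rewrite mulr_ge0//; have /andP[] := bin_exp01 n C (conp01 r).
apply: (@mean_eq_ae _ _ _ _ _ _ (fun z => inrange z.2)) => //.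
- rewrite pr_prod// (_ : (fun x => _) = fun=> 1) ?mean_cst//.
  by apply/funext => x /=; exact: pr_inrange.
- by case: (bmeas_pr (prodn mu n) mC).
- by case: bg => mg _; apply: (measurableT_comp mg); exact: measurable_fst.
move=> [r u] /= hu; rewrite -(conpE _ hu) -pr_ndeg.
case: (B r); rewrite ?mul1r ?mul0r//=.
by rewrite /pr (_ : [set x | _] = set0) ?measure0//; apply/seteqP; split.
Qed.

Lemma thr_adj (u r : R) (w : E) : 0 <= r <= D -> (r <= thr D u w) = adj D (r, u) w.
Proof. by move=> rD; rewrite thrP//; have [_ /ltW] := hp. Qed.

Lemma measurable_thr1 u : measurable_fun setT (thr D u).
Proof.
have D0 : 0 <= D by have [_ /ltW] := hp.
exact: (measurableT_comp (measurable_thr D0) (pair1_measurable u)).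
Qed.

(** By [thr_adj], [nbr] is the survival function of the threshold, so threshold intervals become
    increments of [nbr]. *)
Lemma nbr_thr (L : R -> bool) u x y : measurable_fun setT L -> inrange u -> 0 <= x -> x <= y -> y <= D ->
  pr mu (fun w => L w.1 && (x <= thr D u w < y)) = nbr D F unif L x - nbr D F unif L y.
Proof.
move=> mL hu x0 xy yD.
have m1 z : measurable_fun setT (fun w : E => L w.1 && adj D (z, u) w) by exact: (measurable_nbr D mL z u).
rewrite -!(nbr_angle0 D F unifU mL _ hu); apply/eqP; rewrite eq_sym subr_eq; apply/eqP.
rewrite (pr_split mu (m1 x) (m1 y)) addrC; congr (_ + _).
  congr (pr mu _); apply/funext => w; rewrite -!thr_adj; try lra.
  rewrite ltNge; case: (L _) => //=; case: (leP y _) => h; rewrite ?andbF ?andbT//=.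
congr (pr mu _); apply/funext => w; rewrite -!thr_adj; try lra.
case: (L _) => //=; case: (leP y _) => h; rewrite ?andbF ?andbT// (le_trans xy h)//.
Qed.

End degrees.

(** * Joint degree probabilities *)

Section windows.
Context {R : realType}.
Context (alpha D : R) (F unif : probability R R).
Hypothesis hp : 1 / 2 < alpha /\ 0 < D.
Hypothesis FE : forall x, F `]-oo, x]%classic = (rcdf alpha D x)%:E.
Hypothesis unifU : forall A, measurable A -> unif A = uniform_prob (@ltNpi_pi R) A.
Local Notation mu := (F \x unif)%E.
Local Notation E := (R * R)%type.
Local Notation G := (rcdf alpha D).

Let Lip := alpha * sinh (alpha * D) / (cosh (alpha * D) - 1).

Let Lip0 : 0 <= Lip.
Proof.
have [a0 D0] := hp; rewrite divr_ge0 ?subr_ge0 ?cosh_ge1// mulr_ge0 ?sinh_ge0 ?mulr_ge0//; lra.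
Qed.

Lemma measurable_window n a b u (w : n.-tuple E) l :
  measurable_fun setT (fun r : R => (a < r <= b) && (ndeg D (r, u) w == l)).
Proof.
apply: measurable_and.
  by apply: measurable_and; [exact: measurable_fun_ltr|exact: measurable_fun_ler].
apply: (measurable_natcomp (fun j => j == l)); exact: measurable_ndegT.
Qed.

Lemma ndeg_thr n u r (w : n.-tuple E) : 0 <= r <= D ->
  ndeg D (r, u) w = #|[pred j | r <= thr D u (tnth w j)]|.
Proof. by move=> rD; apply: eq_card => j; rewrite !inE (thr_adj hp). Qed.

(** [rank_upper] at fixed angles, with the thresholds [thr] of the given angles; the hypothesis on
    [W] compares the radial law with the threshold law on intervals. *)
Lemma window_upper m n N (u : m.-tuple R) (L : R -> bool) (l : 'I_m -> nat) a b W c :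
  N = (m + n)%N -> (forall i, inrange (tnth u i)) -> measurable_fun setT L ->
  0 <= a -> b <= D -> 0 <= W ->
  (forall x y, a <= x -> x <= y -> y <= b -> G y - G x <= W * (nbr D F unif L x - nbr D F unif L y)) ->
  (forall (s : 'I_m -> E) i, (forall j, L (s j).1 && (a < thr D (tnth u j) (s j))) ->
    (#|[pred j | (thr D (tnth u i) (s i) <= thr D (tnth u i) (s j))%R]| <= c)%N) ->
  mean (prodn mu n) (fun w => pr (prodn F m) (fun r => [forall i, (a < tnth r i <= b) &&
    (ndeg D (tnth r i, tnth u i) w == l i)])) <= W ^+ m * (c ^ m)%:R / (N ^_ m)%:R.
Proof.
move=> Nmn hu mL a0 bD W0 HW sep.
have mt i : measurable_fun setT (thr D (tnth u i)) := measurable_thr1 hp _.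
have mlow : measurable_fun setT (fun v : E => L v.1) by exact: measurableT_comp.
have FW i x y : a <= x -> x < y -> y <= b ->
    (F [set r | (x < r <= y)%R] <= W%:E * mu [set v : E | L v.1 && (x < thr D (tnth u i) v < y)%R])%E.
  move=> ax xy yb.
  have mxy : measurable_fun setT (fun r : R => x < r <= y).
    by apply: measurable_and; [exact: measurable_fun_ltr|exact: measurable_fun_ler].
  have mq : measurable_fun setT (fun v : E => L v.1 && (x < thr D (tnth u i) v < y)).
    by apply: measurable_and => //; apply: measurable_and; exact: measurable_fun_ltr.
  have e1 := prE F mxy; have e2 := prE mu mq; rewrite /= in e1 e2.
  rewrite [X in (X <= _)%E]e1 [X in (_ <= _ * X)%E]e2 -EFinM lee_fin (pr_radius_oc FE (ltW xy)).
  (* The increment of [nbr] counts thresholds equal to its left end, which the open interval omits.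
     Start at [x + d] instead and pay at most [e] through the Lipschitz bound on [G]. *)
  apply/ler_addgt0Pr => e e0.
  have L1 : 0 < Lip + 1 by have := Lip0; lra.
  pose d := Num.min (y - x) (e / (Lip + 1)).
  have d0 : 0 < d by rewrite lt_min subr_gt0 xy divr_gt0.
  have dy : d <= y - x by rewrite ge_min lexx.
  have dL : Lip * d <= e.
    have : d <= e / (Lip + 1) by rewrite ge_min lexx orbT.
    by rewrite ler_pdivlMr//; have := Lip0; nra.
  have h2 : G (x + d) - G x <= Lip * (x + d - x).
    by apply: (rcdf_lipschitz hp); [lra|lra|lra].
  have xd : a <= x + d by lra.
  have xdy : x + d <= y by lra.
  have x0 : 0 <= x + d by lra.
  have yD : y <= D by lra.
  have h1 := HW _ _ xd xdy yb.
  have h3 : nbr D F unif L (x + d) - nbr D F unif L y <= pr mu (fun v : E => L v.1 && (x < thr D (tnth u i) v < y)).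
    rewrite -(nbr_thr F hp unifU mL (hu i))//.
    apply: le_pr => //.
      by apply: measurable_and => //; apply: measurable_and; [exact: measurable_fun_ler|exact: measurable_fun_ltr].
    by move=> v /and3P[-> h ->]; rewrite /= andbT; apply: lt_le_trans h; rewrite ltrDl.
  have := le_trans h1 (ler_wpM2l W0 h3); clear h1 h3; move: (W * _) => B h1; lra.
have := rank_upper Nmn l mt mlow W0 FW sep.
have mI (w : n.-tuple E) : measurable_fun setT (fun r : m.-tuple R => [forall i, (a < tnth r i <= b) &&
    (ndeg D (tnth r i, tnth u i) w == l i)]).
  apply: (measurable_forallb R) => i.
  exact: (measurableT_comp (measurable_window a b (tnth u i) w (l i)) (measurable_tnth i)).
move=> h; rewrite -lee_fin; apply: le_trans h; rewrite /mean fineK.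
  rewrite le_eqVlt; apply/orP; left; apply/eqP; apply: eq_integral => w _.
  have := prE (prodn F m) (mI w) => /= <-; congr (prodn F m _).
  apply/seteqP; split => r /= /forallP h; apply/forallP => i; have := h i => /andP[hr hl];
  rewrite hr /=; move: hl; rewrite ndeg_thr//; have := hp.2; move: hr => /andP[? ?]; lra.
have mz : measurable_fun setT (fun p : n.-tuple E * m.-tuple R => [forall i, (a < tnth p.2 i <= b) &&
    (ndeg D (tnth p.2 i, tnth u i) p.1 == l i)]).
  apply: (measurable_forallb R) => i.
  have m2 : measurable_fun setT (fun p : n.-tuple E * m.-tuple R => tnth p.2 i).
    by apply: (measurableT_comp (measurable_tnth i)); exact: measurable_snd.
  apply: measurable_and.
    by apply: measurable_and; [exact: measurable_fun_ltr|exact: measurable_fun_ler].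
  apply: (measurable_natcomp (fun j => j == l i)); apply: measurable_ndegT; last exact: measurable_fst.
  by apply/measurable_fun_pairP; split; [exact: m2|exact: measurable_cst].
have bz := bmeas_pr (prodn F m) mz.
by apply: integrable_fin_num => //; exact: (bmeas_integrable _ bz).
Qed.

(** The rank event fails only if more than [k] points reach beyond [b] or at most [k] reach [a];
    both are binomial tails. The comparison is assumed up to [b' > b] to leave room at the right
    end. *)
Lemma window_lower n k u a b b' W : (k <= n)%N -> inrange u ->
  0 <= a -> b < b' -> b' <= D -> 0 <= W -> a <= b ->
  (forall x y, a <= x -> x <= y -> y <= b' -> W * (conp D F unif x - conp D F unif y) <= G y - G x) ->
  W / n.+1%:R * (1 - bin_exp (conp D F unif b) n.+1 (fun j => (k < j)%N%:R)
                   - bin_exp (conp D F unif a) n.+1 (fun j => (j <= k)%N%:R))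
  <= mean (prodn mu n) (fun w => pr F (fun r => (a < r <= b) && (ndeg D (r, u) w == k))).
Proof.
move=> kn hu a0 bb' b'D W0 ab HW.
have mt : measurable_fun setT (thr D u) := measurable_thr1 hp _.
have FW x y : a <= x -> x <= y -> y <= b ->
    (W%:E * mu [set v | (x <= thr D u v <= y)%R] <= F [set r | (x < r <= y)%R])%E.
  move=> ax xy yb.
  have mxy : measurable_fun setT (fun r : R => x < r <= y).
    by apply: measurable_and; [exact: measurable_fun_ltr|exact: measurable_fun_ler].
  have mq : measurable_fun setT (fun v : E => x <= thr D u v <= y).
    by apply: measurable_and; exact: measurable_fun_ler.
  have e1 := prE F mxy; have e2 := prE mu mq; rewrite /= in e1 e2.
  rewrite [X in (_ <= X)%E]e1 [X in (_ * X <= _)%E]e2 -EFinM lee_fin (pr_radius_oc FE xy).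
  (* The closed interval is enlarged to [[x, y + d[], an increment of [conp]; the excess mass of [G]
     is at most [e]. *)
  apply/ler_addgt0Pr => e e0.
  have L1 : 0 < Lip + 1 by have := Lip0; lra.
  pose d := Num.min (b' - b) (e / (Lip + 1)).
  have d0 : 0 < d by rewrite lt_min subr_gt0 bb' divr_gt0.
  have dy : d <= b' - b by rewrite ge_min lexx.
  have dL : Lip * d <= e.
    have : d <= e / (Lip + 1) by rewrite ge_min lexx orbT.
    by rewrite ler_pdivlMr//; have := Lip0; nra.
  have h2 : G (y + d) - G y <= Lip * (y + d - y).
    by apply: (rcdf_lipschitz hp); [lra|lra|lra].
  have xyd : x <= y + d by lra.
  have ydb : y + d <= b' by lra.
  have x0 : 0 <= x by lra.
  have yD : y + d <= D by lra.
  have h1 := HW _ _ ax xyd ydb.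
  have h3 : pr mu (fun v : E => x <= thr D u v <= y) <= conp D F unif x - conp D F unif (y + d).
    rewrite -(nbr_thr F hp unifU (L := fun=> true) (measurable_cst _) hu)//.
    apply: le_pr => //.
      by apply: measurable_and => //; apply: measurable_and; [exact: measurable_fun_ler|exact: measurable_fun_ltr].
    by move=> v /andP[-> h] /=; apply: (le_lt_trans h); rewrite ltrDl.
  have := le_trans (ler_wpM2l W0 h3) h1; clear h1 h3; move: (W * _) => B h1; lra.
have mA N z C : measurable_fun setT (fun w : N.-tuple E => C (ndeg D (z, u) w) : bool).
  by apply: (measurable_natcomp C); apply: measurable_ndegT; [exact: measurable_cst|exact: measurable_id].
have mz : measurable_fun setT (fun p : n.-tuple E * R => (a < p.2 <= b) && (ndeg D (p.2, u) p.1 == k)).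
  apply: measurable_and.
    by apply: measurable_and; [apply: measurable_fun_ltr|apply: measurable_fun_ler] => //; exact: measurable_snd.
  apply: (measurable_natcomp (fun j => j == k)); apply: measurable_ndegT; last exact: measurable_fst.
  by apply/measurable_fun_pairP; split; [exact: measurable_snd|exact: measurable_cst].
have bz := bmeas_pr F mz.
have := rank_lower kn mt W0 FW => h; rewrite -lee_fin /mean fineK; last first.
  by apply: integrable_fin_num => //; exact: (bmeas_integrable _ bz).
have e3 : (\int[prodn mu n]_w F [set r | (a < r <= b)%R && (#|[pred j | (r <= thr D u (tnth w j))%R]| == k)]
   = \int[prodn mu n]_w (pr F (fun r => (a < r <= b)%R && (ndeg D (r, u) w == k)))%:E)%E.
  apply: eq_integral => w _.
  have := prE F (measurable_window a b u w k) => /= <-; congr (F _).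
  apply/seteqP; split => r /= /andP[hr hl]; rewrite hr /=; move: hl; rewrite ndeg_thr//;
  have := hp.2; move: hr => /andP[? ?]; lra.
rewrite e3 in h; apply: le_trans h.
have mev : measurable_fun setT (fun z : n.+1.-tuple E => ((#|[pred j | (b < thr D u (tnth z j))%R]| <= k) &&
      (k < #|[pred j | (a <= thr D u (tnth z j))%R]|))%N).
  have mth j : measurable_fun setT (fun z : n.+1.-tuple E => thr D u (tnth z j)).
    by apply: (measurableT_comp mt); exact: measurable_tnth.
  apply: measurable_and.
    apply: (measurable_natcomp (fun j => j <= k)%N); apply: (measurable_fun_card R) => j.
    exact: measurable_fun_ltr.
  apply: (measurable_natcomp (fun j => k < j)%N); apply: (measurable_fun_card R) => j.
  exact: measurable_fun_ler.
have e4 := prE (prodn mu n.+1) mev; rewrite /= in e4; rewrite [X in (_ <= _ * X)%E]e4.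
rewrite -EFinM lee_fin; apply: ler_wpM2l; first by rewrite divr_ge0.
move: n.+1 mev {e4 e3 bz mz} => N mev.
have Eb := pr_ndeg D F unif (b, u) N (fun j => k < j)%N.
have Ea := pr_ndeg D F unif (a, u) N (fun j => j <= k)%N.
rewrite (conpE D F unifU _ hu) in Ea; rewrite (conpE D F unifU _ hu) in Eb.
have key : 1 - pr (prodn mu N) (fun w => k < ndeg D (b, u) w)%N - pr (prodn mu N) (fun w => ndeg D (a, u) w <= k)%N <=
    pr (prodn mu N) (fun z : N.-tuple E => ((#|[pred j | (b < thr D u (tnth z j))%R]| <= k) &&
      (k < #|[pred j | (a <= thr D u (tnth z j))%R]|))%N); last first.
  apply: le_trans key; rewrite le_eqVlt; apply/orP; left; apply/eqP.
  by congr (1 - _ - _); symmetry; [exact: Eb|exact: Ea].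
have n1 := pr_neg (prodn mu N) (mA N b (fun j => k < j)%N).
have n2 := pr_or (prodn mu N) mev (mA N a (fun j => j <= k)%N).
clear Ea Eb; rewrite -n1 lerBlDr; apply: le_trans n2.
apply: le_pr.
- exact: (measurable_neg (mA N b (fun j => k < j)%N)).
- exact: (measurable_or mev (mA N a (fun j => j <= k)%N)).
move=> z; rewrite -leqNgt => h1; have [h2|h2] := leqP (ndeg D (a, u) z) k; first by rewrite orbT.
have aD : 0 <= a <= D by lra.
have bD : 0 <= b <= D by lra.
apply/orP; left; apply/andP; split; last by move: h2; rewrite ndeg_thr.
apply: leq_trans h1.
rewrite ndeg_thr//; apply: fintype.subset_leq_card; apply/fintype.subsetP => j; rewrite !inE.
exact: ltW.
Qed.

End windows.

Section joint.
Context {R : realType}.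
Context (alpha D : R) (F unif : probability R R).
Hypothesis hp : 1 / 2 < alpha /\ 0 < D.
Hypothesis FE : forall x, F `]-oo, x]%classic = (rcdf alpha D x)%:E.
Hypothesis unifU : forall A, measurable A -> unif A = uniform_prob (@ltNpi_pi R) A.
Local Notation mu := (F \x unif)%E.
Local Notation E := (R * R)%type.
Local Notation G := (rcdf alpha D).

Definition angles m (v : m.-tuple E) : m.-tuple R := [tuple (tnth v i).2 | i < m].

Lemma measurable_angles m : measurable_fun setT (@angles m).
Proof.
apply/measurable_fun_tnthP => i.
rewrite (_ : _ \o _ = fun v : m.-tuple E => (tnth v i).2); last first.
  by apply/funext => v /=; rewrite tnth_mktuple.
by apply: (measurableT_comp measurable_snd); exact: measurable_tnth.
Qed.

Lemma angles_zip m (r u : m.-tuple R) : angles (ziptup r u) = u.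
Proof. by apply: eq_from_tnth => i; rewrite !tnth_mktuple. Qed.

Lemma measurable_inranges m : measurable_fun setT (fun u : m.-tuple R => [forall i, inrange (tnth u i)]).
Proof.
apply: (measurable_forallb R) => i.
by apply: (measurableT_comp measurable_inrange); exact: measurable_tnth.
Qed.

Lemma pr_inranges m : pr (prodn unif m) (fun u => [forall i, inrange (tnth u i)]) = 1.
Proof.
rewrite /pr (_ : [set x | _] = rect (fun=> [set u | inrange u])); last first.
  by apply/seteqP; split => w /= => [/forallP|h]; [|apply/forallP].
rewrite prodn_rect/=; last by move=> i; apply: measurable_event; exact: measurable_inrange.
by rewrite big1// => i _; exact: (pr_inrange unifU).
Qed.

Definition window (a b : R) (v : E) : bool := a < v.1 <= b.

Lemma measurable_windowT d (T : measurableType d) a b (f : T -> E) : measurable_fun setT f ->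
  measurable_fun setT (fun x => window a b (f x)).
Proof.
move=> mf; have m1 := measurableT_comp measurable_fst mf.
by apply: measurable_and; [exact: measurable_fun_ltr|exact: measurable_fun_ler].
Qed.

Definition profile m n a b (l : 'I_m -> nat) (p : m.-tuple E * n.-tuple E) : bool :=
  [forall i, window a b (tnth p.1 i) && (ndeg D (tnth p.1 i) p.2 == l i)].

Lemma measurable_tnth1 m n i : measurable_fun setT (fun p : m.-tuple E * n.-tuple E => tnth p.1 i).
Proof. by apply: (measurableT_comp (measurable_tnth i)); exact: measurable_fst. Qed.

Lemma measurable_profile m n a b l : measurable_fun setT (@profile m n a b l).
Proof.
apply: (measurable_forallb R) => i; apply: measurable_and.
  by apply: measurable_windowT; exact: measurable_tnth1.
apply: (measurable_natcomp (fun j => j == l i)); apply: measurable_ndegT; last exact: measurable_snd.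
exact: measurable_tnth1.
Qed.

Context (a b W : R) (L : R -> bool).
Hypothesis mL : measurable_fun setT L.
Hypothesis abD : 0 <= a /\ b <= D.
Hypothesis W0 : 0 <= W.
Hypothesis HW : forall x y, a <= x -> x <= y -> y <= b ->
  G y - G x <= W * (nbr D F unif L x - nbr D F unif L y).

(** [window_upper] for each choice of angles in [S], then averaged over the angles: the competition
    bound [c] may depend on [S], and rare angles gain the factor [pr S]. *)
Lemma pr_profile m n N (S : pred (m.-tuple R)) (l : 'I_m -> nat) c : N = (m + n)%N ->
  measurable_fun setT S ->
  (forall u, S u -> [forall i, inrange (tnth u i)] -> forall (s : 'I_m -> E) i,
    (forall j, L (s j).1 && (a < thr D (tnth u j) (s j))) ->
    (#|[pred j | (thr D (tnth u i) (s i) <= thr D (tnth u i) (s j))%R]| <= c)%N) ->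
  pr (prodn mu m \x prodn mu n)%E (fun p => S (angles p.1) && profile a b l p) <=
  W ^+ m * (c ^ m)%:R / (N ^_ m)%:R * pr (prodn unif m) S.
Proof.
move=> Nmn mS sep; have [a0 bD] := abD.
have mPhi : measurable_fun setT (fun p : m.-tuple E * n.-tuple E => S (angles p.1) && profile a b l p).
  apply: measurable_and; last exact: measurable_profile.
  apply: (measurableT_comp mS); apply: (measurableT_comp (@measurable_angles m)); exact: measurable_fst.
rewrite pr_zip//.
set K := W ^+ m * _ / _.
have K0 : 0 <= K by rewrite divr_ge0// mulr_ge0// exprn_ge0.
have bS : bmeas (fun u => (S u)%:R : R) by exact: bmeas_bool.
rewrite -mean_bool// -meanZ//.
pose inner (z : m.-tuple R * (n.-tuple E * m.-tuple R)) := S z.1 && profile a b l (ziptup z.2.2 z.1, z.2.1).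
have mzip : measurable_fun setT (fun p : (m.-tuple R * n.-tuple E) * m.-tuple R => ziptup p.2 p.1.1).
  rewrite [X in measurable_fun _ X](_ : _ = (fun p : m.-tuple R * m.-tuple R => ziptup p.2 p.1) \o
    (fun x : (m.-tuple R * n.-tuple E) * m.-tuple R => (x.1.1, x.2)))//.
  apply: (measurableT_comp (@measurable_ziptup _ m)).
  apply/measurable_fun_pairP; split; last exact: measurable_snd.
  exact: (measurableT_comp measurable_fst measurable_fst).
pose Psi (z : (m.-tuple R * n.-tuple E) * m.-tuple R) := S z.1.1 && profile a b l (ziptup z.2 z.1.1, z.1.2).
have mPsi : measurable_fun setT Psi.
  apply: measurable_and.
    by apply: (measurableT_comp mS); exact: (measurableT_comp measurable_fst measurable_fst).
  apply: (measurableT_comp (@measurable_profile m n a b l)).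
  apply/measurable_fun_pairP; split; first exact: mzip.
  exact: (measurableT_comp measurable_snd measurable_fst).
have bKer : bmeas (fun z : m.-tuple R * n.-tuple E => pr (prodn F m) (fun r => Psi (z, r))).
  exact: (bmeas_pr (prodn F m) mPsi).
have bmean : bmeas (fun u : m.-tuple R => mean (prodn mu n) (fun w => pr (prodn F m) (fun r => Psi ((u, w), r)))).
  have m3 : measurable_fun setT (fun z : m.-tuple R * (n.-tuple E * m.-tuple R) => Psi ((z.1, z.2.1), z.2.2)).
    apply: (measurableT_comp mPsi); apply/measurable_fun_pairP; split.
      apply/measurable_fun_pairP; split; first exact: measurable_fst.
      exact: (measurableT_comp measurable_fst measurable_snd).
    exact: (measurableT_comp measurable_snd measurable_snd).
  have b3 := bmeas_pr (prodn mu n \x prodn F m)%E m3.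
  have e3 : (fun u : m.-tuple R => mean (prodn mu n) (fun w => pr (prodn F m) (fun r => Psi ((u, w), r)))) =
      (fun u => pr (prodn mu n \x prodn F m)%E (fun y => Psi ((u, y.1), y.2))).
    apply/funext => u; rewrite pr_prod//.
    exact: (measurableT_comp m3 (pair1_measurable u)).
  by rewrite e3; exact: b3.
have bSK : bmeas (fun u => K * ((S u)%:R : R)) by apply: bmeasM => //; exact: bmeas_cst.
have e1 u : mean (prodn mu n) (fun w => pr (prodn F m) (fun r => S (angles (ziptup r u)) && profile a b l (ziptup r u, w)))
   = mean (prodn mu n) (fun w => pr (prodn F m) (fun r => Psi ((u, w), r))).
  by congr (mean _ _); apply/funext => w; congr (pr _ _); apply/funext => r; rewrite /Psi /= angles_zip.
rewrite [X in mean _ X <= _](_ : _ = fun u => mean (prodn mu n) (fun w => pr (prodn F m) (fun r => Psi ((u, w), r)))); last first.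
  by apply/funext => u; exact: e1.
apply: (mean_le_ae (measurable_inranges (m := m)) (pr_inranges m)) => // u hu.
rewrite /Psi /=; case: (boolP (S u)) => Su; last first.
  rewrite mulr0 (_ : (fun w => _) = fun=> 0) ?mean_cst//.
  by apply/funext => w; rewrite /pr (_ : [set x | _] = set0) ?measure0//; apply/seteqP; split.
rewrite mulr1; have hu' i : inrange (tnth u i) by have /forallP := hu.
have := window_upper hp FE unifU l Nmn hu' mL a0 bD W0 HW (sep u Su hu).
apply: le_trans; rewrite le_eqVlt; apply/orP; left; apply/eqP.
congr (mean _ _); apply/funext => w; congr (pr _ _); apply/funext => r; rewrite /profile /=.
by apply: eq_forallb => i; rewrite /window !tnth_mktuple.
Qed.

Context (sigma : R).
Hypothesis La : forall r, a < r -> L r.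
Hypothesis Hsep : forall r u (v : E), a <= r -> r <= D -> L v.1 -> adj D (r, u) v ->
  1 - cos (u - v.2) <= 2 * sigma.

(** A point in the sectors [1 - cos <= 2 sigma] of two vertices puts their angles within
    [2 (2 sigma) + 2 (2 sigma) = 8 sigma], by [cos_triangle]. *)
Definition close m (u : m.-tuple R) : bool :=
  [exists i : 'I_m, [exists j : 'I_m, (i != j) && (1 - cos (tnth u i - tnth u j) <= 8 * sigma)]].

Lemma measurable_close m : measurable_fun setT (@close m).
Proof.
have -> : @close m = fun u => ~~ [forall i : 'I_m, [forall j : 'I_m, ~~ ((i != j) && (1 - cos (tnth u i - tnth u j) <= 8 * sigma))]].
  apply/funext => u; rewrite negb_forall; apply: eq_existsb => i; rewrite negb_forall.
  by apply: eq_existsb => j; rewrite negbK.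
apply: measurable_neg; apply: (measurable_forallb R) => i; apply: (measurable_forallb R) => j.
apply: measurable_neg; apply: measurable_and => //; apply: measurable_fun_ler => //.
apply: measurable_funB => //; apply: (measurableT_comp (f := cos)).
  by apply: continuous_measurable_fun => x; exact: continuous_cos.
by apply: measurable_funB; exact: measurable_tnth.
Qed.

(** With [z = exp (i x)] and [w] the conjugate of [exp (i y)] replaced by [exp (i y)] itself, this
    is [|z + w - 2|^2 >= 0] expanded. *)
Lemma cos_triangle (x y : R) : 1 - cos (x - y) <= 2 * (1 - cos x) + 2 * (1 - cos y).
Proof.
rewrite cosB; have h1 := cos2Dsin2 x; have h2 := cos2Dsin2 y.
have : 0 <= (cos x + cos y - 2) ^+ 2 + (sin x + sin y) ^+ 2 by rewrite addr_ge0 ?sqr_ge0.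
nra.
Qed.

(** If the point chosen for [j] reached the threshold order of [i], it would lie in the sectors of
    both, forcing their angles to be close. *)
Lemma separated m (u : m.-tuple R) : ~~ close u -> [forall i, inrange (tnth u i)] ->
  forall (s : 'I_m -> E) i, (forall j, L (s j).1 && (a < thr D (tnth u j) (s j))) ->
  (#|[pred j | (thr D (tnth u i) (s i) <= thr D (tnth u i) (s j))%R]| <= 1)%N.
Proof.
move=> ncl hu s i hs; have [a0 bD] := abD; have [_ D0] := hp.
have adjs k j : a < thr D (tnth u k) (s j) -> 1 - cos (tnth u k - (s j).2) <= 2 * sigma.
  move=> h; have aD : a <= D by rewrite (le_trans (ltW h))// thr_le// ltW.
  apply: (Hsep (r := a)) => //; first by have /andP[] := hs j.
  by rewrite -(thr_adj hp) ?a0// ltW.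
rewrite -(card1 i); apply: fintype.subset_leq_card; apply/fintype.subsetP => j; rewrite !inE => hj.
apply/negPn/negP => ji; move/negP: ncl; apply.
apply/existsP; exists i; apply/existsP; exists j; rewrite eq_sym ji /=.
have /andP[_ hj1] := hs j; have /andP[_ hi1] := hs i.
have h1 := adjs i j (lt_le_trans hi1 hj); have h2 := adjs j j hj1.
have := cos_triangle (tnth u i - (s j).2) (tnth u j - (s j).2).
have -> : tnth u i - (s j).2 - (tnth u j - (s j).2) = tnth u i - tnth u j by ring.
lra.
Qed.

Definition jointdeg m n k (p : m.-tuple E * n.-tuple E) : bool :=
  [forall i, (ndeg D (tnth p.1 i) p.2 + ideg D p.1 i)%N == k].

Lemma measurable_jointdeg m n k : measurable_fun setT (@jointdeg m n k).
Proof.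
apply: (measurable_forallb R) => i.
have m1 : measurable_fun setT (fun p : m.-tuple E * n.-tuple E => ndeg D (tnth p.1 i) p.2).
  by apply: measurable_ndegT; [exact: measurable_tnth1|exact: measurable_snd].
have m2 : measurable_fun setT (fun p : m.-tuple E * n.-tuple E => ideg D p.1 i).
  by apply: measurable_idegT; exact: measurable_fst.
have -> : (fun p : m.-tuple E * n.-tuple E => (ndeg D (tnth p.1 i) p.2 + ideg D p.1 i)%N == k) =
    fun p => (((ndeg D (tnth p.1 i) p.2 + ideg D p.1 i)%N == k)%:R : R) == 1.
  by apply/funext => p; case: (_ == k); rewrite ?eqxx// eq_sym oner_eq0.
apply: measurable_fun_eqr => //.
exact: (measurable_fun_nat2 (fun x y => ((x + y)%N == k)%:R) m1 m2).
Qed.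

Definition alldeg m n k (p : m.-tuple E * n.-tuple E) : bool :=
  [forall i, ndeg D (tnth p.1 i) p.2 == k].

Lemma measurable_alldeg m n k : measurable_fun setT (@alldeg m n k).
Proof.
apply: (measurable_forallb R) => i; apply: (measurable_natcomp (fun j => j == k)).
by apply: measurable_ndegT; [exact: measurable_tnth1|exact: measurable_snd].
Qed.

(** A vertex outside the radius window whose external degree could still give total degree [k], as
    at most [m] of its neighbours are internal. *)
Definition outlier n m k (p : E * n.-tuple E) : bool :=
  ~~ window a b p.1 && (k - m <= ndeg D p.1 p.2 <= k)%N.

Lemma measurable_outlier n m k : measurable_fun setT (@outlier n m k).
Proof.
apply: measurable_and; first by apply: measurable_neg; apply: measurable_windowT; exact: measurable_fst.
apply: (measurable_natcomp (fun j => k - m <= j <= k)%N).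
by apply: measurable_ndegT; [exact: measurable_fst|exact: measurable_snd].
Qed.

Lemma mean_tnth d (T : measurableType d) (P : probability T R) m (f : T -> R) (i : 'I_m) :
  bmeas f -> (forall x, 0 <= f x) -> mean (prodn P m) (fun z => f (tnth z i)) = mean P f.
Proof.
move=> bf f0; pose g j : T -> R := if j == i then f else fun=> 1.
have := mean_prodn P (f := g); rewrite (_ : (fun z => _) = fun z => f (tnth z i)); last first.
  apply/funext => z; rewrite (bigD1 i)//= big1 ?mulr1; first by rewrite /g eqxx.
  by move=> j /negbTE ji; rewrite /g ji.
move=> ->; last 2 first.
- by move=> j; rewrite /g; case: (j == i) => //; exact: bmeas_cst.
- by move=> j x; rewrite /g; case: (j == i).
rewrite (bigD1 i)//= big1 ?mulr1; first by rewrite /g eqxx.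
by move=> j /negbTE ji; rewrite /g ji mean_cst.
Qed.

Lemma pr_outlier m n k i :
  pr (prodn mu m \x prodn mu n)%E (fun p => outlier m k (tnth p.1 i, p.2)) =
  pr (mu \x prodn mu n)%E (@outlier n m k).
Proof.
have mo := @measurable_outlier n m k.
have m1 : measurable_fun setT (fun p : m.-tuple E * n.-tuple E => outlier m k (tnth p.1 i, p.2)).
  apply: (measurableT_comp mo); apply/measurable_fun_pairP; split; last exact: measurable_snd.
  exact: measurable_tnth1.
rewrite !pr_prod//.
exact: (mean_tnth mu i (bmeas_pr (prodn mu n) mo) (fun x => pr_ge0 _ _)).
Qed.

Lemma window_outlier m n k (p : m.-tuple E * n.-tuple E) i :
  (k - m <= ndeg D (tnth p.1 i) p.2 <= k)%N -> ~~ outlier m k (tnth p.1 i, p.2) -> window a b (tnth p.1 i).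
Proof. by move=> h; rewrite /outlier /= h andbT negbK. Qed.

Lemma ideg_lt m (u : m.-tuple E) i : (ideg D u i < m)%N.
Proof.
rewrite -[X in (_ < X)%N](card_ord m); apply: proper_card; apply/properP; split.
  exact/fintype.subsetP.
by exists i => //; rewrite inE eqxx.
Qed.

(** Window radii lie in [L], so adjacent window vertices have close angles. *)
Lemma isolated m (u : m.-tuple E) i : (forall j, window a b (tnth u j)) -> ~~ close (angles u) ->
  ideg D u i = 0%N.
Proof.
move=> hw ncl; have [a0 bD] := abD; apply: eq_card0 => j; rewrite !inE; apply/negP => /andP[ji hadj].
move/negP: ncl; apply; apply/existsP; exists i; apply/existsP; exists j; rewrite eq_sym ji /= !tnth_mktuple.
have /andP[ai bi] := hw i; have /andP[aj bj] := hw j.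
have h : 1 - cos ((tnth u i).2 - (tnth u j).2) <= 2 * sigma.
  apply: (Hsep (r := (tnth u i).1)); [exact: ltW|exact: le_trans bD|exact: La|].
  by rewrite -surjective_pairing.
have := cos_le1 ((tnth u i).2 - (tnth u j).2); lra.
Qed.

Section bounds.
Context (m n N k : nat) (Nmn : N = (m + n)%N).
Let PP := (prodn mu m \x prodn mu n)%E.
Let K c : R := W ^+ m * (c ^ m)%:R / (N ^_ m)%:R.
Let pcl := pr (prodn unif m) (@close m).
Let out := pr (mu \x prodn mu n)%E (@outlier n m k).

Let mclose : measurable_fun setT (fun p : m.-tuple E * n.-tuple E => close (angles p.1)).
Proof.
apply: (measurableT_comp (@measurable_close m)).
by apply: (measurableT_comp (@measurable_angles m)); exact: measurable_fst.
Qed.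

Let mouts i : measurable_fun setT (fun p : m.-tuple E * n.-tuple E => outlier m k (tnth p.1 i, p.2)).
Proof.
apply: (measurableT_comp (@measurable_outlier n m k)); apply/measurable_fun_pairP; split; last exact: measurable_snd.
exact: measurable_tnth1.
Qed.

Let cl l := pr PP (fun p => close (angles p.1) && profile a b l p).
Let sp := pr PP (fun p => ~~ close (angles p.1) && profile a b (fun=> k) p).

Let cl_le l : cl l <= K m * pcl.
Proof.
apply: (@pr_profile m n N (@close m) l m Nmn (@measurable_close m)) => u _ _ s i _.
by rewrite -[X in (_ <= X)%N](card_ord m); exact: max_card.
Qed.

Let sp_le : sp <= K 1%N.
Proof.
have mn : measurable_fun setT (fun u : m.-tuple R => ~~ close u) by apply: measurable_neg; exact: measurable_close.
have K0 : 0 <= K 1%N by rewrite divr_ge0// mulr_ge0// exprn_ge0.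
apply: (le_trans (@pr_profile m n N (fun u => ~~ close u) (fun=> k) 1%N Nmn mn _)).
  by move=> u ncl hu s i; exact: separated.
by rewrite ler_piMr// pr_le1.
Qed.

Let pr_sum3 (I : finType) (b1 : m.-tuple E * n.-tuple E -> bool) (b2 : I -> m.-tuple E * n.-tuple E -> bool)
    (b3 : 'I_m -> m.-tuple E * n.-tuple E -> bool) (c : m.-tuple E * n.-tuple E -> bool) :
  measurable_fun setT b1 -> (forall i, measurable_fun setT (b2 i)) -> (forall i, measurable_fun setT (b3 i)) ->
  measurable_fun setT c -> (forall p, c p -> [\/ b1 p, exists i, b2 i p | exists i, b3 i p]) ->
  pr PP c <= pr PP b1 + \sum_i pr PP (b2 i) + \sum_i pr PP (b3 i).
Proof.
move=> m1 m2 m3 mc hc.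
pose f (i : unit + (I + 'I_m)) := match i with inl _ => b1 | inr (inl i) => b2 i | inr (inr i) => b3 i end.
apply: (le_trans (pr_or_le PP (b := f) mc _ _)).
- by case=> [u|[i|i]]; [exact: m1|exact: m2|exact: m3].
- move=> p /hc[h|[i h]|[i h]]; [by exists (inl tt)|by exists (inr (inl i))|by exists (inr (inr i))].
rewrite big_sumType /= big_sumType /= addrA; apply: lerD => //; apply: lerD => //.
by rewrite (bigD1 tt)//= big1 ?addr0// => -[].
Qed.

(** Besides outliers there are two cases. Separated angles leave no internal edges, and the rank
    bound holds with [c = 1]. For close angles the external degrees are [k] minus the internal ones,
    at most [m ^ m] profiles, each bounded with [c = m]. *)
Lemma joint_upper : pr PP (@jointdeg m n k) <=
  K 1%N + (m ^ m)%:R * (K m * pcl) + m%:R * out.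
Proof.
have mprof l := @measurable_profile m n a b l.
apply: (le_trans (@pr_sum3 {ffun 'I_m -> 'I_m} (fun p => ~~ close (angles p.1) && profile a b (fun=> k) p)
  (fun l p => close (angles p.1) && profile a b (fun i => (k - l i)%N) p)
  (fun i p => outlier m k (tnth p.1 i, p.2)) _ _ _ _ (@measurable_jointdeg m n k) _)) => //.
- by apply: measurable_and; [exact: (measurable_neg mclose)|exact: mprof].
- by move=> l; apply: measurable_and; [exact: mclose|exact: mprof].
- move=> p /forallP hj.
  have hd i : (k - m <= ndeg D (tnth p.1 i) p.2 <= k)%N.
    have /eqP <- := hj i; rewrite leq_addr andbT leq_subLR addnC leq_add2r.
    exact: ltnW (ideg_lt _ _).
  have [/existsP hout|/existsPn nout] := boolP [exists i, outlier m k (tnth p.1 i, p.2)]; first exact: Or33.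
  have hw i := window_outlier (hd i) (nout i).
  have [cls|ncl] := boolP (close (angles p.1)).
    (* The internal degrees, all below [m], index the profile. *)
    apply: Or32; exists [ffun i => Ordinal (ideg_lt p.1 i)].
    by apply/andP; split => //; apply/forallP => i; rewrite hw ffunE /= -(eqP (hj i)) addnK /=.
  apply: Or31 => /=; apply/forallP => i; rewrite hw /=.
  by have := hj i; rewrite (isolated i hw ncl) addn0.
apply: lerD; first apply: lerD.
- exact: sp_le.
- apply: (le_trans (ler_sum _ (fun l _ => cl_le _))).
  by rewrite sumr_const card_ffun card_ord mulr_natl.
- rewrite (eq_bigr (fun=> out)); last by move=> i _; exact: pr_outlier.
  by rewrite sumr_const card_ord mulr_natl.
Qed.

(** External degree [k] for all block vertices is also total degree [k] unless angles are close or
    some vertex is an outlier. *)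
Lemma joint_lower : pr PP (@alldeg m n k) - K m * pcl - m%:R * out <= pr PP (@jointdeg m n k).
Proof.
have mprof l := @measurable_profile m n a b l.
have h := @pr_sum3 unit (@jointdeg m n k)
  (fun _ p => close (angles p.1) && profile a b (fun=> k) p)
  (fun i p => outlier m k (tnth p.1 i, p.2)) (@alldeg m n k).
have {}h : pr PP (@alldeg m n k) <= pr PP (@jointdeg m n k) + \sum_(i : unit) cl (fun=> k) + \sum_(i < m) pr PP (fun p => outlier m k (tnth p.1 i, p.2)).
  apply: h; [exact: measurable_jointdeg| |exact: mouts|exact: measurable_alldeg|].
    by move=> _; apply: measurable_and; [exact: mclose|exact: mprof].
  move=> p /forallP hj.
  have hd i : (k - m <= ndeg D (tnth p.1 i) p.2 <= k)%N by have /eqP -> := hj i; rewrite leqnn andbT leq_subr.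
  have [/existsP hout|/existsPn nout] := boolP [exists i, outlier m k (tnth p.1 i, p.2)]; first exact: Or33.
  have hw i := window_outlier (hd i) (nout i).
  have [cls|ncl] := boolP (close (angles p.1)).
    apply: Or32; exists tt => /=.
    by apply/forallP => i; rewrite hw /= (eqP (hj i)).
  apply: Or31; apply/forallP => i.
  by rewrite (isolated i hw ncl) addn0.
have e1 : \sum_(i : unit) cl (fun=> k) = cl (fun=> k) by rewrite (bigD1 tt)//= big1 ?addr0// => -[].
have e2 : \sum_(i < m) pr PP (fun p => outlier m k (tnth p.1 i, p.2)) = m%:R * out.
  rewrite (eq_bigr (fun=> out)); last by move=> i _; exact: pr_outlier.
  by rewrite sumr_const card_ord mulr_natl.
rewrite e1 e2 in h; have := cl_le (fun=> k); lra.
Qed.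

End bounds.

End joint.

Section close_angles.
Context {R : realType}.
Context (unif : probability R R).
Hypothesis unifU : forall A, measurable A -> unif A = uniform_prob (@ltNpi_pi R) A.

Lemma pr_tnth2 d (T : measurableType d) (P : probability T R) m (i j : 'I_m) (g : T * T -> bool) : i != j ->
  measurable_fun setT g ->
  pr (prodn P m) (fun u => g (tnth u i, tnth u j)) = mean P (fun x => pr P (fun y => g (x, y))).
Proof.
move=> ij mg.
have mt k1 : measurable_fun setT (fun u : m.-tuple T => tnth u k1) by exact: measurable_tnth.
have m1 : measurable_fun setT (fun u : m.-tuple T => g (tnth u i, tnth u j)).
  by apply: (measurableT_comp mg); apply/measurable_fun_pairP; split; exact: mt.
pose f (p : 1.-tuple T * 1.-tuple T) : \bar R := ((g (tnth p.1 ord0, tnth p.2 ord0))%:R)%:E.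
have mgf : measurable_fun setT (fun p : 1.-tuple T * 1.-tuple T => g (tnth p.1 ord0, tnth p.2 ord0)).
  apply: (measurableT_comp mg); apply/measurable_fun_pairP; split.
    by apply: (measurableT_comp (measurable_tnth ord0)); exact: measurable_fst.
  by apply: (measurableT_comp (measurable_tnth ord0)); exact: measurable_snd.
have iI : injective (fun _ : 'I_1 => i) by move=> x y _; rewrite !ord1.
have jI : injective (fun _ : 'I_1 => j) by move=> x y _; rewrite !ord1.
have f0 z : (0 <= f z)%E by rewrite lee_fin.
have := iid_split iI jI (fun _ _ => ij) (iid_tnth P m) (measurable_fun_eventE mgf) f0.
move=> h; rewrite -(mean_bool _ m1) /mean; congr fine.
have -> : (\int[prodn P m]_x ((g (tnth x i, tnth x j))%:R)%:E =
  \int[prodn P m]_w f ([tuple tnth w i | _ < 1], [tuple tnth w j | _ < 1]))%E.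
  by apply: eq_integral => w _; rewrite /f !tnth_mktuple.
rewrite h; have bx := bmeas_pr P mg.
have mgx x : measurable_fun setT (fun y => g (x, y)) by exact: (measurableT_comp mg (pair1_measurable x)).
have b1 := bmeas_tnth (ord0 : 'I_1) bx.
rewrite (meanE _ bx) -(mean_tnth P (m := 1) (ord0 : 'I_1) bx (fun x => pr_ge0 _ _)) -(meanE _ b1).
apply: eq_integral => v _; rewrite /f /=.
have mw : measurable_fun setT (fun w : 1.-tuple T => g (tnth v ord0, tnth w ord0)).
  exact: (measurableT_comp (mgx _) (measurable_tnth ord0)).
rewrite (meanE _ (bmeas_bool mw)) -(mean_bool P (mgx _)).
rewrite -(mean_tnth P (m := 1) (ord0 : 'I_1) (bmeas_bool (mgx (tnth v ord0))))//.
Qed.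

(** For one pair the probability is [ang (4 sigma) <= 2 sqrt (4 sigma)]; then sum over pairs. *)
Lemma pr_close m sigma : 0 <= sigma ->
  pr (prodn unif m) (@close R sigma m) <= (m * m)%:R * (4 * Num.sqrt sigma).
Proof.
move=> s0.
have mg : measurable_fun setT (fun p : R * R => 1 - cos (p.1 - p.2) <= 8 * sigma).
  apply: measurable_fun_ler => //; apply: measurable_funB => //; apply: (measurableT_comp (f := cos)).
    by apply: continuous_measurable_fun => x; exact: continuous_cos.
  by apply: measurable_funB; [exact: measurable_fst|exact: measurable_snd].
pose b (ij : 'I_m * 'I_m) (u : m.-tuple R) := (ij.1 != ij.2) && (1 - cos (tnth u ij.1 - tnth u ij.2) <= 8 * sigma).
have mb ij : measurable_fun setT (b ij).
  apply: measurable_and => //; apply: (measurableT_comp mg (g := fun u : m.-tuple R => (tnth u ij.1, tnth u ij.2))).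
  by apply/measurable_fun_pairP; split; exact: measurable_tnth.
apply: (le_trans (pr_or_le (b := b) (prodn unif m) (measurable_close sigma (m := m)) mb _)).
  by move=> u /existsP[i /existsP[j h]]; exists (i, j).
have hb ij : pr (prodn unif m) (b ij) <= 4 * Num.sqrt sigma.
  have q0 : 0 <= 4 * Num.sqrt sigma by rewrite mulr_ge0// sqrtr_ge0.
  case: ij => i j; rewrite /b /=; have [->|ij] := eqVneq i j.
    rewrite /= (_ : pr _ _ = 0)// /pr (_ : [set x | _] = set0) ?measure0//.
    by apply/seteqP; split.
  rewrite (pr_tnth2 unif ij mg) -[leRHS](mean_cst unif).
  apply: (mean_le_ae measurable_inrange (pr_inrange unifU) (bmeas_pr unif mg) (bmeas_cst _ _)) => x hx /=.
  rewrite (_ : (fun y => _) = fun y => (1 - cos (x - y)) / 2 <= 4 * sigma); last first.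
    by apply/funext => y; apply/idP/idP; lra.
  have s4 : 0 <= 4 * sigma by rewrite mulr_ge0.
  rewrite (unif_ang unifU hx s4); apply: (le_trans (ang_le_sqrt s4)).
  rewrite sqrtrM// (_ : 4 = 2 ^+ 2); last by ring.
  by rewrite sqrtr_sqr ger0_norm//; have := sqrtr_ge0 sigma; lra.
apply: (le_trans (ler_sum _ (fun ij _ => hb ij))).
by rewrite sumr_const card_prod card_ord [leRHS]mulr_natl.
Qed.

End close_angles.

(** * Limits of the total weights of the two halves of the disk *)

Section local.
Context {R : realType}.
Context (alpha nu : R) (F : nat -> probability R R) (unif : probability R R).
Hypothesis par : 1 / 2 < alpha /\ 0 < nu.
Hypothesis unifU : forall A, measurable A -> unif A = uniform_prob (@ltNpi_pi R) A.
Local Notation Dn := (disk_radius nu).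
Local Notation xi := (kpkvb_xi alpha nu).
Hypothesis FE : forall n, nu < n%:R -> forall x, F n `]-oo, x]%classic = (rcdf alpha (Dn n) x)%:E.

Lemma xi_gt0 : 0 < xi.
Proof.
have [a0 n0] := par; rewrite /kpkvb_xi divr_gt0// ?mulr_gt0 ?pi_gt0//; lra.
Qed.

Lemma exp_radius n : nu < n%:R -> expR (Dn n / 2) = n%:R / nu.
Proof.
have [a0 n0] := par; move=> nn; rewrite /disk_radius mulrAC divff ?mul1r// lnK// posrE divr_gt0//.
exact: lt_trans nn.
Qed.

Lemma radius_gt0 n : nu < n%:R -> 0 < Dn n.
Proof.
have [a0 n0] := par; move=> nn; rewrite mulr_gt0// ln_gt0// ltr_pdivlMr// mul1r//.
Qed.

Lemma cvg_radius : Dn n @[n --> \oo] --> +oo.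
Proof.
have [a0 n0] := par; apply/cvgryPge => A.
near=> n.
have nn : nu < n%:R by near: n; exact: nbhs_infty_gtr.
have h : expR (A / 2) * nu <= n%:R by near: n; exact: nbhs_infty_ger.
have : expR (A / 2) <= expR (Dn n / 2) by rewrite exp_radius// ler_pdivlMr.
by rewrite ler_expR; lra.
Unshelve. all: by end_near. Qed.

Lemma near_FE : \forall n \near \oo, forall x, F n `]-oo, x]%classic = (rcdf alpha (Dn n) x)%:E.
Proof.
near=> n; apply: FE; near: n; exact: nbhs_infty_gtr.
Unshelve. all: by end_near. Qed.

(** Limit of the mean weight: [xi * w0] is the mean of the density [pdens]. *)
Let w0 : R := 2 * alpha / (2 * alpha - 1).

Let mhalf n : measurable_fun setT (fun s : R => Dn n / 2 <= s).
Proof. exact: measurable_fun_ler. Qed.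

Let mhalf' n : measurable_fun setT (fun s : R => s < Dn n / 2).
Proof. exact: measurable_fun_ltr. Qed.

Let near_rad t : xi <= t -> \forall n \near \oo, Dn n / 2 <= rad (Dn n) xi t /\ 0 <= rad (Dn n) xi t <= Dn n.
Proof.
move=> xt; have xi0 := xi_gt0; have t0 : 0 < t by exact: lt_le_trans xt.
near=> n.
have h : 4 * (ln t - ln xi) <= Dn n by near: n; move/cvgryPge: cvg_radius; apply.
have l0 : 0 <= ln t - ln xi by rewrite subr_ge0 ler_ln.
by rewrite /rad; split; [lra|apply/andP; split; lra].
Unshelve. all: by end_near. Qed.

(** At a fixed expected degree [t] the radius eventually exceeds [D / 2], so the outer half carries
    the whole limiting weight. *)
Lemma cvg_lweight_low : lweight (Dn n) (F n) (fun s => Dn n / 2 <= s) @[n --> \oo] --> w0.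
Proof.
have [a0 n0] := par; have xi0 := xi_gt0.
have c0 : 0 < 2 * alpha - 1 by lra.
pose h (n : nat) (s : R) : R := ((Dn n / 2 <= s)%R)%:R * cwt (Dn n) s.
have bh n : 0 < Dn n -> bmeas (h n).
  by move=> D0; apply: bmeasM; [exact: bmeas_bool|exact: (bmeas_cwt (alpha := alpha))].
have := @radial_limit R alpha xi (conj a0 xi0) (fun n => Dn n) F h (fun t => t / xi) 1 cvg_radius near_FE.
have mh n : measurable_fun setT (h n).
  have mc : measurable_fun setT (cwt (Dn n)).
    apply: (measurableT_comp (f := @expR R)) => //; apply: measurable_funM => //.
    by apply: measurable_funB => //; exact: measurable_clamp.
  have [m1 _] := @bmeas_bool R _ _ _ (mhalf n); exact: (measurable_funM m1 mc).
have h0 n r : 0 <= h n r by rewrite mulr_ge0// expR_ge0.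
have hC : \forall n \near \oo, forall r, 0 <= r <= Dn n -> h n r <= 1 * weight (Dn n) r.
  apply: nearW => n r /andP[r0 rD]; rewrite /h cwt_id// mul1r ler_piMl ?expR_ge0//.
  by rewrite lern1 leq_b1.
have hl t : xi <= t -> h n (rad (Dn n) xi t) @[n --> \oo] --> t / xi.
  move=> xt; have t0 : 0 < t by exact: lt_le_trans xt.
  apply: (@cvg_trans _ ((fun=> t / xi) @ \oo)); last exact: cvg_cst.
  apply: near_eq_cvg; near=> n; have [h1 /andP[h2 h3]] : Dn n / 2 <= rad (Dn n) xi t /\ 0 <= rad (Dn n) xi t <= Dn n.
    by near: n; exact: near_rad.
  rewrite /h h1 mul1r cwt_id// -{1}(weight_rad (Dn n) xi0 t0) [_ / xi]mulrC mulKf ?gt_eqF//.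
move=> /(_ mh h0 hC hl).
have -> : (\int[lebesgue_measure]_(t in `[xi, +oo[) (t / xi * pdens alpha xi t)%:E = (w0)%:E)%E.
  transitivity (\int[lebesgue_measure]_(t in `[xi, +oo[) ((xi^-1)%:E * (t * pdens alpha xi t)%:E))%E.
    by apply: eq_integral => t _; rewrite -EFinM; congr (_%:E); ring.
  have mI : measurable_fun `[xi, +oo[%classic (fun t => (t * pdens alpha xi t)%:E).
    apply/measurable_EFinP; apply: measurable_funTS; apply: measurable_funM => //; exact: measurable_pdens.
  rewrite ge0_integralZl//; last 2 first.
  - by move=> t; rewrite /= in_itv /= andbT => xt; rewrite lee_fin mulr_ge0 ?pdens_ge0// (le_trans (ltW xi0)).
  - by rewrite lee_fin invr_ge0 ltW.
  rewrite (integral_pareto_mean (conj a0 xi0)) -EFinM; congr (_%:E); rewrite /w0; field.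
  by rewrite (gt_eqF xi0) gt_eqF.
move=> h1; apply: fine_cvg; apply: cvg_trans h1; apply: near_eq_cvg; near=> n.
have D0 : 0 < Dn n by apply: radius_gt0; near: n; exact: nbhs_infty_gtr.
by rewrite (meanE _ (bh n D0)).
Unshelve. all: by end_near. Qed.

Lemma cvg_lweight_high : lweight (Dn n) (F n) (fun s => s < Dn n / 2) @[n --> \oo] --> (0 : R).
Proof.
have [a0 n0] := par; have xi0 := xi_gt0.
pose h (n : nat) (s : R) : R := ((s < Dn n / 2)%R)%:R * cwt (Dn n) s.
have bh n : 0 < Dn n -> bmeas (h n).
  by move=> D0; apply: bmeasM; [exact: bmeas_bool|exact: (bmeas_cwt (alpha := alpha))].
have := @radial_limit R alpha xi (conj a0 xi0) (fun n => Dn n) F h (fun t => 0) 1 cvg_radius near_FE.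
have mh n : measurable_fun setT (h n).
  have mc : measurable_fun setT (cwt (Dn n)).
    apply: (measurableT_comp (f := @expR R)) => //; apply: measurable_funM => //.
    by apply: measurable_funB => //; exact: measurable_clamp.
  have [m1 _] := @bmeas_bool R _ _ _ (mhalf' n); exact: (measurable_funM m1 mc).
have h0 n r : 0 <= h n r by rewrite mulr_ge0// expR_ge0.
have hC : \forall n \near \oo, forall r, 0 <= r <= Dn n -> h n r <= 1 * weight (Dn n) r.
  apply: nearW => n r /andP[r0 rD]; rewrite /h cwt_id// mul1r ler_piMl ?expR_ge0//.
  by rewrite lern1 leq_b1.
have hl t : xi <= t -> h n (rad (Dn n) xi t) @[n --> \oo] --> (0 : R).
  move=> xt; have t0 : 0 < t by exact: lt_le_trans xt.
  apply: (@cvg_trans _ ((fun=> 0) @ \oo)); last exact: cvg_cst.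
  apply: near_eq_cvg; near=> n; have [h1 _] : Dn n / 2 <= rad (Dn n) xi t /\ 0 <= rad (Dn n) xi t <= Dn n.
    by near: n; exact: near_rad.
  by rewrite /h ltNge h1 mul0r.
move=> /(_ mh h0 hC hl).
rewrite (eq_integral (fun=> 0%E)); last by move=> t _; rewrite mul0r.
rewrite integral0 => h1; apply: fine_cvg; apply: cvg_trans h1; apply: near_eq_cvg; near=> n.
have D0 : 0 < Dn n by apply: radius_gt0; near: n; exact: nbhs_infty_gtr.
by rewrite (meanE _ (bh n D0)).
Unshelve. all: by end_near. Qed.

End local.

(** * Uniform estimates in the range of the rank comparison *)

Section regime.
Context {R : realType}.
Context (alpha nu : R) (F : nat -> probability R R) (unif : probability R R).
Hypothesis par : 1 / 2 < alpha /\ 0 < nu.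
Hypothesis unifU : forall A, measurable A -> unif A = uniform_prob (@ltNpi_pi R) A.
Local Notation Dn := (disk_radius nu).
Local Notation xi := (kpkvb_xi alpha nu).
Hypothesis FE : forall n, nu < n%:R -> forall x, F n `]-oo, x]%classic = (rcdf alpha (Dn n) x)%:E.

Local Notation pd := (pdens alpha xi).
Local Notation T n r := (xi * weight (Dn n) r).
Local Notation G n := (rcdf alpha (Dn n)).
Local Notation low n := (nbr (Dn n) (F n) unif (fun s => Dn n / 2 <= s)).
Local Notation high n := (nbr (Dn n) (F n) unif (fun s => s < Dn n / 2)).
Local Notation con n := (conp (Dn n) (F n) unif).
Local Notation rd n t := (rad (Dn n) xi t).

Let xi0 : 0 < xi. Proof. exact: xi_gt0 par. Qed.

Lemma pdens_exp A : 0 < A -> pd A = 2 * alpha / xi * expR (- ((2 * alpha + 1) * (ln A - ln xi))).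
Proof.
move=> A0; rewrite /pdens /powR (gt_eqF A0) (gt_eqF xi0) -[X in _ / X](lnK xi0) -expRN -!mulrA -!expRD.
by congr (_ * (_ * expR _)); ring.
Qed.

(** [rcdf_increment_le] in terms of expected degrees: [pd] is decreasing, so its value at a lower
    bound [A] of the degrees on the interval dominates. *)
Lemma G_upper n x y A : nu < n%:R -> 0 <= x -> x <= y -> y <= Dn n -> 0 < A -> A <= T n y ->
  (1 - 2 * expR (- (alpha * Dn n))) * (G n y - G n x) <= pd A * (T n x - T n y).
Proof.
have [a0 n0] := par; have x0' := xi0; move=> nn x0 xy yD A0 Ay.
have D0 := radius_gt0 par nn.
apply: (le_trans (rcdf_increment_le (conj a0 D0) x0 xy yD)).
have dw : 0 <= weight (Dn n) x - weight (Dn n) y by rewrite subr_ge0 ler_expR; lra.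
rewrite pdens_exp// -mulrBr.
have -> : 2 * alpha / xi * expR (- ((2 * alpha + 1) * (ln A - ln xi))) * (xi * (weight (Dn n) x - weight (Dn n) y)) =
  2 * alpha * expR (- ((2 * alpha + 1) * (ln A - ln xi))) * (weight (Dn n) x - weight (Dn n) y).
  by field; rewrite gt_eqF.
apply: ler_wpM2r => //; rewrite -[leLHS]mulrA; apply: ler_wpM2l; first by lra.
rewrite /weight -expRN -expRD ler_expR.
have : ln A <= ln (T n y) by rewrite ler_ln ?posrE// mulr_gt0// expR_gt0.
rewrite lnM ?posrE ?expR_gt0// expRK.
set lA := ln A; set lx := ln xi; move=> h.
have h1 : (2 * alpha + 1) * (lA - lx) <= (2 * alpha + 1) * ((Dn n - y) / 2) by apply: ler_wpM2l; lra.
lra.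
Qed.

Lemma G_lower n x y B : nu < n%:R -> 0 <= x -> x <= y -> y <= Dn n -> 0 < B -> T n x <= B ->
  (1 - expR (- (2 * alpha * x))) * (pd B * (T n x - T n y)) <= G n y - G n x.
Proof.
have [a0 n0] := par; have x0' := xi0; move=> nn x0 xy yD B0 xB.
have D0 := radius_gt0 par nn.
apply: le_trans (rcdf_increment_ge (conj a0 D0) x0 xy yD).
have dw : 0 <= weight (Dn n) x - weight (Dn n) y by rewrite subr_ge0 ler_expR; lra.
apply: ler_wpM2l.
  by rewrite subr_ge0 -[leRHS]expR0 ler_expR oppr_le0; apply: mulr_ge0 => //; lra.
rewrite pdens_exp// -mulrBr.
have -> : 2 * alpha / xi * expR (- ((2 * alpha + 1) * (ln B - ln xi))) * (xi * (weight (Dn n) x - weight (Dn n) y)) =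
  2 * alpha * expR (- ((2 * alpha + 1) * (ln B - ln xi))) * (weight (Dn n) x - weight (Dn n) y).
  by field; rewrite gt_eqF.
apply: ler_wpM2r => //; rewrite -[leRHS]mulrA; apply: ler_wpM2l; first by lra.
rewrite /weight -expRN -expRD ler_expR.
have : ln (T n x) <= ln B by rewrite ler_ln ?posrE// mulr_gt0// expR_gt0.
rewrite lnM ?posrE ?expR_gt0// expRK.
set lB := ln B; set lx := ln xi; move=> h.
have h1 : (2 * alpha + 1) * ((Dn n - x) / 2) <= (2 * alpha + 1) * (lB - lx) by apply: ler_wpM2l; lra.
lra.
Qed.

Lemma conp_split n r : con n r = low n r + high n r.
Proof.
have m1 : measurable_fun setT (fun s : R => Dn n / 2 <= s) by exact: measurable_fun_ler.
have mt : measurable_fun setT (fun s : R => true) by exact: measurable_cst.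
have m2 : measurable_fun setT (fun y : R * R => Dn n / 2 <= y.1) by exact: (measurableT_comp m1 measurable_fst).
have m3 := measurable_nbr (Dn n) mt r 0.
rewrite /conp /nbr (pr_split (F n \x unif)%E m3 m2); congr (_ + _); congr (pr _ _); apply/funext => y /=.
  by rewrite andbC.
by rewrite -ltNge andbC.
Qed.

(* Throughout the radii whose limiting expected degree lies between [k / 2] and [2 * k], every estimate
   used below holds up to a relative error [delta]. *)
Definition regular (delta : R) (n k : nat) : Prop :=
  [/\ nu < n%:R /\ Dn n / 2 <= rd n (2 * k%:R), rd n (k%:R / 2) <= Dn n /\ (0 < k)%N,
      [/\ (forall x, rd n (2 * k%:R) <= x -> x <= rd n (k%:R / 2) ->
        `|n%:R * con n x - T n x| <= delta * T n x),
      (forall x y, rd n (2 * k%:R) <= x -> x <= y -> y <= rd n (k%:R / 2) ->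
        (1 - delta) * (T n x - T n y) <= n%:R * (low n x - low n y)) &
      (forall x y, rd n (2 * k%:R) <= x -> x <= y -> y <= rd n (k%:R / 2) ->
        n%:R * (con n x - con n y) <= (1 + delta) * (T n x - T n y))],
      (forall x y A, rd n (2 * k%:R) <= x -> x <= y -> y <= rd n (k%:R / 2) -> 0 < A -> A <= T n y ->
        (1 - delta) * (G n y - G n x) <= pd A * (T n x - T n y)) /\
      (forall x y B, rd n (2 * k%:R) <= x -> x <= y -> y <= rd n (k%:R / 2) -> 0 < B -> T n x <= B ->
        (1 - delta) * (pd B * (T n x - T n y)) <= G n y - G n x) &
      forall r u (v : R * R), rd n (2 * k%:R) <= r -> r <= Dn n -> Dn n / 2 <= v.1 -> adj (Dn n) (r, u) v ->
        1 - cos (u - v.2) <= 2 * delta].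

Let w0 : R := 2 * alpha / (2 * alpha - 1).

Let high_aux1 (t e z : R) : 1 + z / 2 <= e -> 0 < t -> z * t <= 2 * (t * e - t).
Proof. nra. Qed.

(** The constant is [12 * 6 * 8 = 576]. *)
Let high_aux2 (a z g tx ty : R) : 0 <= a * g -> z * ty <= 2 * (tx - ty) -> tx <= 4 * ty -> 0 <= z ->
  12 * a * z * (6 * g * tx) <= 576 * (a * g) * (tx - ty).
Proof.
move=> ag h1 h2 z0; have : z * tx <= 8 * (tx - ty) by have := ler_wpM2l z0 h2; lra.
by move/(ler_wpM2l ag); lra.
Qed.

Let high_aux3 (a g delta : R) : 1 / 2 < a -> 0 <= g -> 1000 * a * g <= delta / 10 -> 0 < delta ->
  [/\ 576 * (a * g) <= delta / 2, 6 * g <= delta / 2 & 0 <= a * g].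
Proof.
move=> a0 g0 h d0; have ag : 0 <= (a - 1 / 2) * g by rewrite mulr_ge0//; lra.
by split; lra.
Qed.

Let high_aux4 (t c : R) : c / 2 <= t -> 2 * c <= 4 * t. Proof. lra. Qed.

Let high_aux5 (N l h t delta : R) : (1 - delta) * t <= N * l <= (1 + delta / 2) * t ->
  0 <= N * h <= delta / 2 * t -> `|N * (l + h) - t| <= delta * t.
Proof. by move=> /andP[v1 v2] /andP[v3 v4]; rewrite ler_norml mulrDr; apply/andP; split; lra. Qed.

Let high_aux6 (N lx ly hx hy u delta : R) : N * (lx - ly) <= (1 + delta / 2) * u ->
  N * (hx - hy) <= delta / 2 * u -> N * (lx + hx - (ly + hy)) <= (1 + delta) * u.
Proof. lra. Qed.

Let high_aux7 (e delta : R) : e <= delta / 2 -> 1 - delta <= 1 - 2 * e. Proof. lra. Qed.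

Let high_aux8 (e delta : R) : 0 < delta -> e <= delta / 2 -> 1 - delta <= 1 - e. Proof. lra. Qed.

Let high_aux9 (D M x : R) : 1 <= M -> D + M <= x + D / 2 -> D <= 2 * x. Proof. lra. Qed.

Let high_aux10 (e r delta : R) : 100 * e <= delta -> 0 <= e -> 0 < delta -> delta <= 1 ->
  1 - delta / 10 <= r <= 1 + delta / 10 ->
  (1 + 20 * e) * r <= 1 + delta / 2 /\ 1 - delta <= (1 - 8 * e) * r.
Proof. by move=> ed e0 d0 d1 /andP[r1 r2]; split; nra. Qed.

Let high_aux11 (M : R) : 1600 <= M -> 1 <= M. Proof. lra. Qed.

Let high_aux12 (e delta : R) : delta <= 1 -> 0 <= e -> 1600 * e <= delta ->
  [/\ e <= 1 / 16, 100 * e <= delta & e <= delta / 2].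
Proof. by move=> *; split; lra. Qed.

Let high_aux13 (D M : R) : 2 * M <= D -> M <= 1 / 2 * D. Proof. lra. Qed.

Let high_aux14 (u v w M : R) : u + u + M - (v + v) <= w -> 2 * w / 2 + M <= 2 * w - 2 * (u - v).
Proof. lra. Qed.

Let high_aux15 (u v D M : R) : v + M / 2 <= u -> D - 2 * (u - v) <= D - M. Proof. lra. Qed.

(** Beyond [D / 2 + M] a point of the outer half is reached only through a sector of haversine at
    most [2 exp (- M)]. *)
Lemma adjacent_angle D M delta r u (v : R * R) : [/\ 1 <= M, expR (- M) <= 1 / 16 & M <= D] ->
  2 * M <= D -> 100 * expR (- M) <= delta -> D / 2 + M <= r -> r <= D -> D / 2 <= v.1 ->
  adj D (r, u) v -> 1 - cos (u - v.2) <= 2 * delta.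
Proof.
move=> MDr MD eMd h1 h2 h3; have [M1 _ _] := MDr; rewrite /adj /=.
set s := clamp _ v.1.
have s1 : D / 2 <= s by rewrite /s /clamp le_max le_min h3 orbC /=; apply/orP; left; lra.
have s2 : s <= D by rewrite /s /clamp ge_max ge_min lexx orbT andbT; lra.
rewrite clamp_id; last by apply/andP; split; lra.
rewrite ball_rel_hav; [|by lra|by lra] => h.
have hs : hav D r s <= 2 * expR (- M).
  by apply: (hav_small MDr); rewrite ?ler_norml; try (apply/andP; split); lra.
by have := expR_ge0 (- M); lra.
Qed.

(** The outer half supplies the main terms through [nbr_value] and [nbr_increment]; the inner half
    enters only through its small total weight. *)
Lemma regular_of delta M n k : 0 < delta -> (0 < k)%N -> nu < n%:R ->
  1 <= M -> expR (- M) <= 1 / 16 -> 100 * expR (- M) <= delta -> 2 * M <= Dn n ->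
  expR (- (alpha * Dn n)) <= delta / 2 ->
  Dn n / 2 + M <= rd n (2 * k%:R) -> rd n (k%:R / 2) <= Dn n - M ->
  `|lweight (Dn n) (F n) (fun s => Dn n / 2 <= s) / w0 - 1| <= delta / 10 -> delta <= 1 ->
  (1000 * alpha * nu / xi) * lweight (Dn n) (F n) (fun s => s < Dn n / 2) <= delta / 10 ->
  regular delta n k.
Proof.
have [a0 n0] := par; have x0' := xi0.
move=> d0 k0 nn M1 eM eMd MD eaD r1 r2 hlw d1 hhi.
have D0 := radius_gt0 par nn.
have hp : 1 / 2 < alpha /\ 0 < Dn n by [].
have nR : 0 < n%:R :> R by exact: lt_trans nn.
have rng (x y : R) : rd n (2 * k%:R) <= x -> x <= y -> y <= rd n (k%:R / 2) ->
    [/\ M <= x, 0 <= x, y <= Dn n, Dn n + M <= x + Dn n / 2 & y <= Dn n - M].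
  by move: (rd n _) (rd n (k%:R / 2)) r1 r2 => p1 p2 *; split; lra.
have w00 : 0 < w0 by rewrite /w0 divr_gt0; lra.
have rD1 : Dn n / 2 <= rd n (2 * k%:R) by lra.
have rD2 : rd n (k%:R / 2) <= Dn n by lra.
have hM1 : 1 <= Dn n / 2 by lra.
have hM2 : Dn n / 2 <= Dn n - M by lra.
have MDr : [/\ 1 <= M, expR (- M) <= 1 / 16 & M <= Dn n] by split => //; lra.
have ex := exp_radius par nn.
have eD : expR (- (Dn n / 2)) = nu / n%:R by rewrite expRN ex invf_div.
have ml : measurable_fun setT (fun s : R => Dn n / 2 <= s) by exact: measurable_fun_ler.
have mh : measurable_fun setT (fun s : R => s < Dn n / 2) by exact: measurable_fun_ltr.
have Lh s : 0 < s <= Dn n -> Dn n / 2 <= s -> Dn n / 2 <= s by [].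
have Mh : M <= Dn n / 2 by lra.
set lw := lweight _ _ (fun s => Dn n / 2 <= s) in hlw.
set hw := lweight _ _ (fun s => s < Dn n / 2) in hhi.
have hw0 : 0 <= hw by exact: lweight_ge0.
(* This identity explains the constant [xi]: [n (2 / pi) w0 exp (- D / 2) = xi]. *)
have cst : 2 / pi * lw * expR (- (Dn n / 2)) = lw / w0 * (xi / n%:R).
  have z1 : 2 * alpha - 1 != 0 by rewrite gt_eqF//; lra.
  have z2 : alpha != 0 by rewrite gt_eqF//; lra.
  have z3 : pi != 0 :> R by rewrite gt_eqF// pi_gt0.
  have z4 : n%:R != 0 :> R by rewrite gt_eqF.
  have aux (p l a v N : R) : p != 0 -> a != 0 -> N != 0 -> 2 * a - 1 != 0 ->
      2 / p * l * (v / N) = l / (2 * a / (2 * a - 1)) * (4 * a * v / (p * (2 * a - 1)) / N).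
    by move=> y1 y2 y3 y4; field; rewrite y1 y2 y3 y4.
  by rewrite eD /w0 /kpkvb_xi; exact: aux.
have q : 0 < xi / n%:R by rewrite divr_gt0.
pose rho := lw / w0.
have r_ : 1 - delta / 10 <= rho <= 1 + delta / 10.
  by move: hlw; rewrite -/rho ler_norml lerBrDr lerBlDr [1 + delta / 10]addrC [1 - delta / 10]addrC.
have e0 : 0 <= expR (- M) by exact: expR_ge0.
have [c1 c2] := high_aux10 eMd e0 d0 d1 r_.
have cl w : 2 / pi * (1 - 8 * expR (- M)) * lw * expR (- (Dn n / 2)) * w = (1 - 8 * expR (- M)) * rho * (xi / n%:R) * w.
  by rewrite -[in RHS](mulrA _ rho) -cst; ring.
have cu w : 2 / pi * (1 + 20 * expR (- M)) * lw * expR (- (Dn n / 2)) * w = (1 + 20 * expR (- M)) * rho * (xi / n%:R) * w.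
  by rewrite -[in RHS](mulrA _ rho) -cst; ring.
have nz : n%:R != 0 :> R by rewrite gt_eqF.
have sc c w1 w2 : n%:R * (c * (xi / n%:R) * (w1 - w2)) = c * (xi * w1 - xi * w2) by field.
have sc1 c w1 : n%:R * (c * (xi / n%:R) * w1) = c * (xi * w1) by field.
have dT0 x y : x <= y -> 0 <= T n x - T n y.
  by move=> xy; rewrite -mulrBr mulr_ge0 ?(ltW xi0)// subr_ge0 ler_expR; lra.
have T0 x : 0 < T n x by rewrite mulr_gt0// expR_gt0.
have Tle x : rd n (2 * k%:R) <= x -> T n x <= 2 * k%:R.
  move=> h; have k2 : 0 < 2 * k%:R :> R by rewrite mulr_gt0// ltr0n.
  rewrite -[leRHS](weight_rad (Dn n) x0' k2) ler_wpM2l ?(ltW xi0)// ler_expR; lra.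
have Tge x : x <= rd n (k%:R / 2) -> k%:R / 2 <= T n x.
  move=> h; have k2 : 0 < k%:R / 2 :> R by rewrite divr_gt0// ltr0n.
  rewrite -[leLHS](weight_rad (Dn n) x0' k2) ler_wpM2l ?(ltW xi0)// ler_expR; lra.
have hb x : 0 <= x -> x <= Dn n -> n%:R * high n x <= 6 * nu * hw / xi * T n x.
  move=> hx0 hxD; have := nbr_le hp (FE nn) unifU mh hx0 hxD.
  rewrite -/hw eD => /(ler_wpM2l (ltW nR)) => h; apply: (le_trans h).
  by rewrite le_eqVlt; apply/orP; left; apply/eqP; field; rewrite nz gt_eqF.
have hhi' : 1000 * alpha * (nu * hw / xi) <= delta / 10.
  by move: hhi; rewrite (_ : _ * hw = 1000 * alpha * (nu * hw / xi))//; field; rewrite gt_eqF.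
pose g := nu * hw / xi.
have g0 : 0 <= g by rewrite divr_ge0 ?(ltW xi0)// mulr_ge0// ltW.
rewrite -/g in hhi'; have [g576 g6 ag0] := high_aux3 a0 g0 hhi' d0.
have a00 : 0 <= alpha by exact: le_trans (ltW a0).
have incr x y : rd n (2 * k%:R) <= x -> x <= y -> y <= rd n (k%:R / 2) ->
   n%:R * (low n x - low n y) <= (1 + delta / 2) * (T n x - T n y) /\
   (1 - delta) * (T n x - T n y) <= n%:R * (low n x - low n y).
  move=> h1 h2 h3; have dT := dT0 x y h2; have [q1 q2 q3 q4 q5] := rng x y h1 h2 h3.
  have /andP[] := @nbr_increment R alpha (Dn n) (F n) unif hp (FE nn) unifU _ ml M (Dn n / 2) MDr Mh Lh x y q1 h2 q3 q4.
  rewrite -/lw cl cu; move/(ler_wpM2l (ltW nR)) => i1 /(ler_wpM2l (ltW nR)) i2; split.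
    by apply: (le_trans i2); rewrite sc; apply: ler_wpM2r.
  by apply: le_trans i1; rewrite sc; apply: ler_wpM2r.
(* [nbr_high_increment] is proportional to [y - x]. Within the window [T n x <= 4 * T n y], so
   [y - x] is controlled by the increment of [T]. *)
have hig x y : rd n (2 * k%:R) <= x -> x <= y -> y <= rd n (k%:R / 2) ->
   n%:R * (high n x - high n y) <= (delta / 2) * (T n x - T n y).
  move=> h1 h2 h3; have dT := dT0 x y h2; have [q1 q2 q3 q4 q5] := rng x y h1 h2 h3.
  have hM4 : 0 <= y - x by rewrite subr_ge0.
  have hM5 : x + (y - x) <= Dn n - M by rewrite subrKC.
  have := nbr_high_increment unif hp (FE nn) MDr hM1 hM2 q1 hM4 hM5.
  rewrite subrKC.
  move=> /(ler_wpM2l (ltW nR)) h; apply: (le_trans h).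
  have -> : n%:R * (12 * alpha * (y - x) * high n x) = 12 * alpha * (y - x) * (n%:R * high n x) by ring.
  have hbx := hb x q2 (le_trans h2 q3).
  have tq : (y - x) * T n y <= 2 * (T n x - T n y).
    have -> : T n x = T n y * expR ((y - x) / 2) by rewrite -mulrA -expRD; congr (_ * expR _); field.
    exact: (high_aux1 (expR_ge1Dx _) (T0 y)).
  have T4 : T n x <= 4 * T n y.
    apply: (le_trans (Tle x h1)); exact: high_aux4 (Tge y h3).
  apply: (@le_trans _ _ (12 * alpha * (y - x) * (6 * g * T n x))).
    by apply: ler_wpM2l; [exact: mulr_ge0 (mulr_ge0 _ a00) hM4|apply: (le_trans hbx); rewrite /g !mulrA].
  apply: (le_trans (high_aux2 ag0 tq T4 hM4)).
  by apply: ler_wpM2r.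
have val x : rd n (2 * k%:R) <= x -> x <= rd n (k%:R / 2) ->
   (1 - delta) * T n x <= n%:R * low n x <= (1 + delta / 2) * T n x.
  move=> h1 h2; have dT := ltW (T0 x); have [q1 q2 q3 q4 q5] := rng x x h1 (lexx _) h2.
  have /andP[] := @nbr_value R alpha (Dn n) (F n) unif hp (FE nn) unifU _ ml M (Dn n / 2) MDr Mh Lh x q1 q3 q4.
  rewrite -/lw cl cu; move/(ler_wpM2l (ltW nR)) => i1 /(ler_wpM2l (ltW nR)) i2; apply/andP; split.
    by apply: le_trans i1; rewrite sc1; apply: ler_wpM2r.
  by apply: (le_trans i2); rewrite sc1; apply: ler_wpM2r.
have valh x : rd n (2 * k%:R) <= x -> x <= rd n (k%:R / 2) ->
   0 <= n%:R * high n x <= (delta / 2) * T n x.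
  move=> h1 h2; apply/andP; split; first by apply: mulr_ge0 => //; exact: pr_ge0.
  have [q1 q2 q3 q4 q5] := rng x x h1 (lexx _) h2; have hbx := hb x q2 q3; apply: (le_trans hbx).
  rewrite (_ : 6 * nu * hw / xi = 6 * g); last by rewrite /g; ring.
  by apply: ler_wpM2r; first exact: ltW (T0 x).
split.
- by split.
- by split.
- split.
  + move=> x h1 h2; rewrite conp_split.
    exact: high_aux5 (val x h1 h2) (valh x h1 h2).
  + by move=> x y h1 h2 h3; have [] := incr x y h1 h2 h3.
  + move=> x y h1 h2 h3; rewrite !conp_split.
    have [i1 _] := incr x y h1 h2 h3; exact: high_aux6 i1 (hig x y h1 h2 h3).
- split.
  + move=> x y A h1 h2 h3 A0 Ay; have [q1 q2 q3 _ _] := rng x y h1 h2 h3.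
    apply: le_trans (G_upper nn q2 h2 q3 A0 Ay).
    apply: ler_wpM2r.
      rewrite subr_ge0 -(pr_radius_le (FE nn)) -(pr_radius_le (FE nn)); apply: le_pr; [exact: measurable_fun_ler..|].
      by move=> z zx; apply: le_trans h2.
    exact: high_aux7.
  + move=> x y B h1 h2 h3 B0 Bx; have [q1 q2 q3 q4 _] := rng x y h1 h2 h3.
    apply: le_trans (G_lower nn q2 h2 q3 B0 Bx).
    apply: ler_wpM2r.
      by apply: mulr_ge0; [exact: (pdens_ge0 (conj a0 xi0))|exact: dT0].
    suff h : expR (- (2 * alpha * x)) <= expR (- (alpha * Dn n)) by exact: high_aux8 d0 (le_trans h eaD).
    rewrite ler_expR lerN2 (mulrC 2) -mulrA; apply: ler_wpM2l => //.
    exact: high_aux9 M1 q4.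
- by move=> r u v h1 h2 h3; apply: (adjacent_angle MDr) => //; exact: le_trans h1.
Qed.

(** A margin [M] with [exp (- M)] small against [delta] is fixed first; [K] then absorbs the
    convergence of the weights and the two conditions placing the window between [D / 2 + M] and
    [D - M]. *)
Lemma regular_ex delta : 0 < delta -> delta <= 1 ->
  exists2 K : nat, (0 < K)%N & forall n k, (K <= k)%N -> (K * k ^ 2 <= n)%N -> regular delta n k.
Proof.
have [a0 n0] := par; have x0' := xi0; move=> d0 d1.
(* With [M = c / delta] one has [exp (- M) <= 1 / M = delta / c]; 1600 leaves room for every
   constant above. *)
have [c ce] : exists c : R, c = 1600 by eexists.
have c0 : 0 < c by lra.
pose M := c / delta.
have Mc : c <= M by rewrite /M ler_pdivlMr// ler_piMr// ltW.
have eM : expR (- M) <= delta / c.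
  rewrite expRN -[leRHS]invrK lef_pV2 ?posrE ?invr_gt0 ?divr_gt0 ?expR_gt0// invf_div -/M.
  by apply: (le_trans _ (expR_ge1Dx M)); rewrite lerDr.
have eM2 : 1600 * expR (- M) <= delta by rewrite -ce mulrC -ler_pdivlMr.
have M1 : 1600 <= M by rewrite -ce.
move: M Mc eM eM2 M1 => M _ _ eM M1; clear c ce c0.
have w00 : 0 < w0 by rewrite /w0 divr_gt0; lra.
have [N0 _ hN0] : \forall n \near \oo, [/\ nu < n%:R, 2 * M <= Dn n,
    `|lweight (Dn n) (F n) (fun s => Dn n / 2 <= s) / w0 - 1| <= delta / 10 &
    (1000 * alpha * nu / xi) * lweight (Dn n) (F n) (fun s => s < Dn n / 2) <= delta / 10].
  near=> n; split.
  - by near: n; exact: nbhs_infty_gtr.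
  - by near: n; move/cvgryPge: (cvg_radius par); apply.
  - near: n.
    have h : lweight (Dn n) (F n) (fun s => Dn n / 2 <= s) / w0 @[n --> \oo] --> (1 : R).
      rewrite -[X in _ --> X](@divff _ w0) ?gt_eqF//; apply: cvgMl; exact: cvg_lweight_low.
    have d10 : 0 < delta / 10 by rewrite divr_gt0.
    have /cvgrPdist_le/(_ _ d10) := h.
    by apply: filterS => n; rewrite distrC.
  - near: n.
    have h : (1000 * alpha * nu / xi) * lweight (Dn n) (F n) (fun s => s < Dn n / 2) @[n --> \oo] --> (0 : R).
      rewrite -[X in _ --> X](mulr0 (1000 * alpha * nu / xi)); by apply: cvgM; [exact: cvg_cst|exact: (cvg_lweight_high par FE)].
    have d10 : 0 < delta / 10 by rewrite divr_gt0.
    have /cvgrPdist_le/(_ _ d10) := h.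
    by apply: filterS => n; rewrite sub0r normrN; apply: le_trans; exact: ler_norm.
(* [A1 * k^2 <= n] places the inner end, of expected degree [2 k], beyond [D / 2 + M]; this is where
   [k^2 << n] enters. [A2 <= k] places the outer end below [D - M]. *)
pose A1 := nu * (4 * expR M / xi ^+ 2); pose A2 := 2 * (xi * expR (M / 2)).
have A10 : 0 <= A1 by rewrite !mulr_ge0 ?invr_ge0 ?sqr_ge0 ?expR_ge0// ltW.
have A20 : 0 <= A2 by apply: mulr_ge0 => //; apply: mulr_ge0; [exact: ltW|exact: expR_ge0].
exists (N0 + Num.bound A1 + Num.bound A2).+1 => // n k Kk Kn.
have k0 : (0 < k)%N by exact: leq_ltn_trans Kk.
have Kn' : (N0 + Num.bound A1 + Num.bound A2 <= n)%N.
  by apply: leq_trans Kn; apply: leq_trans (leqnSn _) (leq_pmulr _ _); rewrite expn_gt0 k0.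
have [nn MD hl hh] : _ := hN0 n (leq_trans (leq_trans (leq_addr _ _) (leq_addr _ _)) Kn').
have kR : 0 < k%:R :> R by rewrite ltr0n.
have nR : 0 < n%:R :> R by exact: lt_trans nn.
have aD : expR (- (alpha * Dn n)) <= expR (- M).
  rewrite ler_expR lerN2; have h : 1 / 2 * Dn n <= alpha * Dn n by apply: ler_wpM2r; [exact: ltW (radius_gt0 par nn)|exact: ltW].
  apply: le_trans h; exact: high_aux13.
have M16 : 1 <= M by exact: high_aux11 M1.
have [eM16 eM100 eM2] := high_aux12 d1 (expR_ge0 (- M)) eM.
apply: (@regular_of delta M) => //; first exact: le_trans eM2.
- have h : A1 * k%:R ^+ 2 <= n%:R.
    apply: (@le_trans _ _ ((N0 + Num.bound A1 + Num.bound A2).+1 * k ^ 2)%:R); last by rewrite ler_nat.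
    rewrite natrM natrX ler_wpM2r ?sqr_ge0//; apply: (le_trans (ltW (archi_boundP A10))).
    by rewrite ler_nat (leq_trans (leq_addl N0 _))// (leq_trans (leq_addr _ _) (leqnSn _)).
  have h2 : (2 * k%:R) ^+ 2 * expR M / xi ^+ 2 <= n%:R / nu.
    rewrite ler_pdivlMr//; apply: le_trans h; rewrite le_eqVlt; apply/orP; left; apply/eqP.
    by rewrite /A1; field; rewrite gt_eqF.
  have k2 : 0 < 2 * k%:R :> R by exact: mulr_gt0.
  have p1 : 0 < (2 * k%:R) ^+ 2 :> R by exact: exprn_gt0.
  have p2 : 0 < xi ^+ 2 by exact: exprn_gt0.
  have p3 : 0 < (2 * k%:R) ^+ 2 * expR M by apply: mulr_gt0 => //; exact: expR_gt0.
  have : ln ((2 * k%:R) ^+ 2 * expR M / xi ^+ 2) <= ln (n%:R / nu).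
    by rewrite ler_ln// posrE; [exact: divr_gt0 p3 p2|exact: divr_gt0].
  rewrite ln_div ?posrE// lnM ?posrE ?expR_gt0//.
  rewrite expRK !lnXn// !mulr2n /rad /disk_radius.
  exact: high_aux14.
- have h : xi * expR (M / 2) <= k%:R / 2.
    rewrite ler_pdivlMr// mulrC; apply: (le_trans (ltW (archi_boundP A20))).
    by rewrite ler_nat (leq_trans _ Kk)// (leq_trans (leq_addl _ _) (leqnSn _)).
  have : ln (xi * expR (M / 2)) <= ln (k%:R / 2).
    by rewrite ler_ln// posrE; [apply: mulr_gt0 => //; exact: expR_gt0|exact: divr_gt0].
  rewrite lnM ?posrE ?expR_gt0// expRK /rad.
  exact: high_aux15.
Unshelve. all: by end_near. Qed.

End regime.

(** * Chernoff tails of binomial counts *)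

Section tails.
Context {R : realType}.
Implicit Types (p h : R) (N k m : nat).

(** Chernoff with [s = 1 / (1 + h)], the optimal choice when the mean is [(1 + h) k]. *)
Lemma tail_low p N k h : 0 <= p <= 1 -> 0 < h -> (1 + h) * k%:R <= N%:R * p ->
  bin_exp p N (fun a => (a <= k)%N%:R) <= ((1 + h) * expR (- h)) ^+ k.
Proof.
move=> p01 h0 hk; have h1 : 0 < 1 + h by rewrite addr_gt0.
have s0 : 0 <= (1 + h)^-1 by rewrite invr_ge0 ltW.
have c0 : 0 <= (1 + h) ^+ k by rewrite exprn_ge0 ?ltW.
apply: (le_trans (bin_exp_chernoff N (h := fun a => (a <= k)%N%:R) p01 s0 c0 _)).
  move=> a; case: (leqP a k) => ak; last by rewrite mulr_ge0// exprn_ge0.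
  rewrite -(subnK ak) exprD -mulrA -exprMn divff ?gt_eqF// expr1n mulr1; apply: exprn_ege1; rewrite lerDl; exact: ltW.
rewrite exprMn ler_wpM2l// -expRM_natl ler_expR.
have -> : (1 + h)^-1 - 1 = - (h / (1 + h)) by field; rewrite gt_eqF.
rewrite !mulrN lerN2; have := ler_wpM2r (divr_ge0 (ltW h0) (ltW h1)) hk.
by rewrite (_ : (1 + h) * k%:R * (h / (1 + h)) = k%:R * h)//; field; rewrite gt_eqF.
Qed.

(** Chernoff with [s = 1 / (1 - h)]; tolerating counts down to [k - m] costs the factor [s ^ m]. *)
Lemma tail_high p N k m h : 0 <= p <= 1 -> 0 < h -> h < 1 -> N%:R * p <= (1 - h) * k%:R ->
  bin_exp p N (fun a => (k - m <= a)%N%:R) <= (1 - h)^-1 ^+ m * ((1 - h) * expR h) ^+ k.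
Proof.
move=> p01 h0 hl1 hk; have h1 : 0 < 1 - h by rewrite subr_gt0.
have s0 : 0 <= (1 - h)^-1 by rewrite invr_ge0 ltW.
have c0 : 0 <= (1 - h)^-1 ^+ m * (1 - h) ^+ k by rewrite mulr_ge0// exprn_ge0// ltW.
apply: (le_trans (bin_exp_chernoff N (h := fun a => (k - m <= a)%N%:R) p01 s0 c0 _)).
  move=> a; case: (leqP (k - m)%N a) => ak; last by rewrite mulr_ge0// exprn_ge0.
  have km : (k <= m + a)%N by rewrite -leq_subLR.
  rewrite mulrAC -exprD -(subnK km) exprD -mulrA -exprMn mulVf ?gt_eqF// expr1n mulr1 exprn_ege1//.
  by rewrite -[leLHS]invr1 lef_pV2 ?posrE// gerBl ltW.
rewrite exprMn mulrA ler_wpM2l// -expRM_natl ler_expR.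
have -> : (1 - h)^-1 - 1 = h / (1 - h) by field; rewrite gt_eqF.
have := ler_wpM2r (divr_ge0 (ltW h0) (ltW h1)) hk.
by rewrite (_ : (1 - h) * k%:R * (h / (1 - h)) = k%:R * h)//; field; rewrite gt_eqF.
Qed.

(** A common rate for the two tails, below 1 for [0 < h < 1]. *)
Definition tailq h : R := Num.max ((1 + h) * expR (- h)) ((1 - h) * expR h).

Lemma tailq_lt1 h : 0 < h -> h < 1 -> 0 < tailq h < 1.
Proof.
move=> h0 h1; have e0 := expR_gt0 h.
have i1 : (1 + h) * expR (- h) < 1 by rewrite expRN ltr_pdivrMr// mul1r expR_gt1Dx// gt_eqF.
have i2 : (1 - h) * expR h < 1.
  rewrite -[X in _ * X]invrK -expRN ltr_pdivrMr ?expR_gt0// mul1r.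
  have -> : - h = - (h / 2) + - (h / 2) by field.
  rewrite expRD -expr2; have := expR_ge1Dx (- (h / 2)); have := expR_gt0 (- (h / 2)).
  by move: (expR _) => z z0 hz; nra.
by rewrite lt_max gt_max i1 i2 !andbT; apply/orP; right; rewrite mulr_gt0// subr_gt0.
Qed.

End tails.

(** The regularity error [e^2] and the loss of a fraction [e / 8] of the points are absorbed,
    leaving half of the margin [e]. *)
Lemma poly_low {R : realType} (e : R) : 0 < e -> e <= 1 / 8 -> 1 + e / 2 <= (1 - e / 8) * ((1 - e ^+ 2) * (1 + e)).
Proof.
move=> e0 e8; have h2 : e ^+ 2 <= e / 8 by rewrite expr2; nra.
have h3 : e * e ^+ 2 <= e / 64 by have := sqr_ge0 e; nra.
have h4 : 0 <= e * (e * e ^+ 2) by rewrite !mulr_ge0 ?sqr_ge0 ?ltW.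
have -> : (1 - e / 8) * ((1 - e ^+ 2) * (1 + e)) = 1 + e * (7 / 8) - e ^+ 2 * (9 / 8) - e * e ^+ 2 * (7 / 8) + e * (e * e ^+ 2) / 8 by field.
lra.
Qed.

Lemma poly_high {R : realType} (e : R) : 0 < e -> e <= 1 / 8 -> (1 + e ^+ 2) * (1 - e) <= 1 - e / 2.
Proof.
move=> e0 e8; have h2 : e ^+ 2 <= e / 8 by rewrite expr2; nra.
have h3 : 0 <= e * e ^+ 2 by rewrite !mulr_ge0 ?sqr_ge0 ?ltW.
have -> : (1 + e ^+ 2) * (1 - e) = 1 - e + e ^+ 2 - e * e ^+ 2 by ring.
lra.
Qed.

Lemma gen_low {R : realType} (e k n N c cr : R) : 0 < e -> e <= 1 / 8 -> 0 <= k ->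
  (1 - e ^+ 2) * ((1 + e) * k) <= n * c -> c <= cr -> 0 <= c -> 0 <= N -> (1 - e / 8) * n <= N ->
  (1 + e / 2) * k <= N * cr.
Proof.
move=> e0 e8 k0 v1 cm c0 N0 nN; have e1 : 0 <= 1 - e / 8 by lra.
have h : (1 - e / 8) * n * c <= N * cr by apply: le_trans (ler_wpM2l N0 cm); exact: ler_wpM2r.
apply: le_trans h; rewrite -mulrA; apply: le_trans (ler_wpM2l e1 v1).
by rewrite [(1 - e ^+ 2) * _]mulrA [leRHS]mulrA ler_wpM2r//; exact: poly_low.
Qed.

Lemma gen_high {R : realType} (e k n N c cr : R) : 0 < e -> e <= 1 / 8 -> 0 <= k ->
  n * c <= (1 + e ^+ 2) * ((1 - e) * k) -> cr <= c -> 0 <= cr -> 0 <= N -> N <= n ->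
  N * cr <= (1 - e / 2) * k.
Proof.
move=> e0 e8 k0 v1 cm c0 N0 nN; apply: (@le_trans _ _ (n * c)); first exact: ler_pM.
by apply: (le_trans v1); rewrite mulrA ler_wpM2r//; exact: poly_high.
Qed.

(* Given the shared points, the degrees in question are independent with equal probabilities, so
   Jensen's inequality bounds the joint probability from below by a power of the single one. *)
Lemma jensen_pow {R : realType} d (E : measurableType d) (P : probability E R) (X : E -> R) m :
  bmeas X -> (forall x, 0 <= X x) -> mean P X ^+ m <= mean P (fun x => X x ^+ m).
Proof.
move=> bX X0; set y := mean P X; have y0 : 0 <= y by exact: mean_ge0.
have key (x : R) : 0 <= x -> y ^+ m + m%:R * y ^+ m.-1 * (x - y) <= x ^+ m.
  move=> x0; elim: m => [|m IH]; first by rewrite !mul0r addr0.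
  rewrite !exprS; apply: le_trans (ler_wpM2l x0 IH); rewrite -subr_ge0.
  case: m {IH} => [|m] /=; first by rewrite le_eqVlt; apply/orP; left; apply/eqP; rewrite !expr0; ring.
  have -> : x * (y ^+ m.+1 + m.+1%:R * y ^+ m * (x - y)) - (y * y ^+ m.+1 + m.+2%:R * y ^+ m.+1 * (x - y)) =
      m.+1%:R * y ^+ m * (x - y) ^+ 2.
    by rewrite -[m.+2]addn1 natrD exprS; ring.
  by rewrite mulr_ge0 ?sqr_ge0// mulr_ge0// exprn_ge0.
have b1 : bmeas (fun x => y ^+ m + m%:R * y ^+ m.-1 * (X x - y)).
  apply: bmeasD; first exact: bmeas_cst.
  by apply: bmeasM; [exact: bmeas_cst|apply: bmeasD => //; exact: bmeas_cst].
apply: le_trans (mean_le P b1 (bmeasX m bX) (fun x => key _ (X0 x))).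
rewrite meanD; [|exact: bmeas_cst|by apply: bmeasM; [exact: bmeas_cst|apply: bmeasD => //; exact: bmeas_cst]].
rewrite meanZ; last by apply: bmeasD => //; exact: bmeas_cst.
by rewrite meanD//; [rewrite !mean_cst subrr mulr0 addr0|exact: bmeas_cst].
Qed.

Lemma one_sub_sqr_gt0 {R : realType} (e : R) : 0 < e -> e <= 1 / 8 -> 0 < 1 - e ^+ 2.
Proof. by move=> e0 e8; rewrite expr2; nra. Qed.

Lemma chain_le {R : realType} (g l p t N E : R) : 0 < E -> p * (E * t) <= p * (N * l) ->
  E * g <= p * t -> g <= N * p / E ^+ 2 * l.
Proof.
move=> E0 h1 h2; rewrite mulrAC ler_pdivlMr ?exprn_gt0// expr2 mulrA.
have -> : g * E * E = E * (E * g) by ring.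
apply: (le_trans (ler_wpM2l (ltW E0) h2)); rewrite [leLHS]mulrCA; apply: (le_trans h1).
by rewrite le_eqVlt; apply/orP; left; apply/eqP; ring.
Qed.

Lemma cup_aux {R : realType} (N X P z1 z2 : R) : z1 != 0 -> z2 != 0 ->
  N * (X * P) / z1 ^+ 2 = X / (z1 ^+ 2 * z2) * P * (z2 * N).
Proof. by move=> h1 h2; field; rewrite h1 h2. Qed.

(** * Joint degree probabilities with explicit errors *)

Section uniform.
Context {R : realType}.
Context (alpha nu : R) (F : nat -> probability R R) (unif : probability R R).
Hypothesis par : 1 / 2 < alpha /\ 0 < nu.
Hypothesis unifU : forall A, measurable A -> unif A = uniform_prob (@ltNpi_pi R) A.
Local Notation Dn := (disk_radius nu).
Local Notation xi := (kpkvb_xi alpha nu).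
Hypothesis FE : forall n, nu < n%:R -> forall x, F n `]-oo, x]%classic = (rcdf alpha (Dn n) x)%:E.

Local Notation pd := (pdens alpha xi).
Local Notation T n r := (xi * weight (Dn n) r).
Local Notation G n := (rcdf alpha (Dn n)).
Local Notation low n := (nbr (Dn n) (F n) unif (fun s => Dn n / 2 <= s)).
Local Notation con n := (conp (Dn n) (F n) unif).
Local Notation rd n t := (rad (Dn n) xi t).
Local Notation regular := (regular alpha nu F unif).

Let xi0 : 0 < xi. Proof. exact: xi_gt0 par. Qed.

Lemma conp_mono n x y : nu < n%:R -> 0 <= x -> x <= y -> y <= Dn n -> con n y <= con n x.
Proof.
move=> nn x0 xy yD; rewrite -subr_ge0.
have hu : @inrange R 0 by rewrite /inrange oppr_le0 pi_ge0.
have [a0 n0] := par.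
have mt : measurable_fun setT (fun _ : R => true) by exact: measurable_cst.
have hp := conj a0 (radius_gt0 par nn).
rewrite /conp -(nbr_thr (F n) hp unifU mt hu x0 xy yD).
exact: pr_ge0.
Qed.

(** The window covers expected degrees within a fraction [e] of [k]. Regularity is taken at
    [e ^+ 2]: its errors are negligible against the width of the window, and the closeness bound
    [4 sqrt (e^2)] becomes [4 e]. *)
Context (e : R) (n k m n' : nat).
Hypothesis e08 : 0 < e /\ e <= 1 / 8.
Hypothesis reg : regular (e ^+ 2) n k.
Hypothesis nmn : n = (m + n')%N.
Hypothesis mn : m%:R <= e / 8 * n%:R.
Hypothesis m0 : (0 < m)%N.

(** [rad] is decreasing, so the larger expected degree marks the inner end [a]. *)
Let a := rd n ((1 + e) * k%:R).
Let b := rd n ((1 - e) * k%:R).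

Let k0 : 0 < k%:R :> R.
Proof. by have [_ [_ kk] _ _ _] := reg; rewrite ltr0n. Qed.

Let nn : nu < n%:R. Proof. by have [[]] := reg. Qed.

Let nR : 0 < n%:R :> R. Proof. by have [_ n0] := par; exact: lt_trans nn. Qed.

Let D0 : 0 < Dn n. Proof. have h := radius_gt0 par nn; exact: h. Qed.

(** The range goes down to [1 - 2 e] to include the auxiliary point [b'] of the lower bound;
    [e <= 1/8] keeps [t] between 1/2 and 2. *)
Let ord t : 1 - 2 * e <= t -> t <= 1 + e -> [/\ rd n (2 * k%:R) <= rd n (t * k%:R),
  rd n (t * k%:R) <= rd n (k%:R / 2), 0 <= rd n (t * k%:R), rd n (t * k%:R) <= Dn n & 0 < t * k%:R].
Proof.
have [e0 e8] := e08; have k0' := k0; move=> t1 t2.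
have t0 : 0 < t by lra.
have tk : 0 < t * k%:R by rewrite mulr_gt0.
have [[_ r1] [r2 _] _ _ _] := reg.
have u1 : t * k%:R <= 2 * k%:R by apply: ler_wpM2r; [exact: ltW|lra].
have u2 : k%:R / 2 <= t * k%:R by rewrite mulrC; apply: ler_wpM2r; [exact: ltW|lra].
have k2 : 0 < 2 * k%:R :> R by rewrite mulr_gt0.
have k2' : 0 < k%:R / 2 :> R by rewrite divr_gt0.
have h1 : rd n (2 * k%:R) <= rd n (t * k%:R) by rewrite ler_rad.
have h2 : rd n (t * k%:R) <= rd n (k%:R / 2) by rewrite ler_rad.
split => //; last exact: le_trans r2.
by apply: (le_trans _ h1); apply: (le_trans _ r1); apply: divr_ge0 => //; exact: ltW D0.
Qed.

Let conval t : 1 - 2 * e <= t -> t <= 1 + e ->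
  (1 - e ^+ 2) * (t * k%:R) <= n%:R * con n (rd n (t * k%:R)) <= (1 + e ^+ 2) * (t * k%:R).
Proof.
move=> t1 t2; have [h1 h2 h3 h4 h5] := ord t1 t2.
have [_ _ [hv _ _] _ _] := reg.
have := hv _ h1 h2; rewrite weight_rad// ler_norml => /andP[].
by rewrite lerBrDr lerBlDr => v1 v2; apply/andP; rewrite !mulrDl mul1r mulNr addrC; split => //; rewrite addrC.
Qed.

Let n'n : (1 - e / 8) * n%:R <= n'%:R.
Proof. by have := mn; rewrite mulrBl mul1r {2}nmn natrD => h; rewrite lerBlDl lerD2r. Qed.

Let con01 r : 0 <= con n r <= 1. Proof. exact: conp01. Qed.

Let pa_low (N : nat) r : (n' <= N)%N -> 0 <= r -> r <= a -> (1 + e / 2) * k%:R <= N%:R * con n r.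
Proof.
have [e0 e8] := e08; have k0' := k0; have nR' := nR; move=> nN r0 ra.
have e1 : 1 - 2 * e <= 1 + e by lra.
have [h1 h2 h3 h4 h5] := ord e1 (lexx _).
have cm : con n a <= con n r := conp_mono nn r0 ra h4.
have v1 : (1 - e ^+ 2) * ((1 + e) * k%:R) <= n%:R * con n a by case/andP: (conval e1 (lexx _)).
have /andP[c0 _] := con01 a.
by apply: (gen_low e0 e8 (ltW k0') v1 cm c0 (ler0n _ N)); apply: (le_trans n'n); rewrite ler_nat.
Qed.

Let pb_high (N : nat) r : (N <= n)%N -> b <= r -> r <= Dn n -> N%:R * con n r <= (1 - e / 2) * k%:R.
Proof.
have [e0 e8] := e08; have k0' := k0; move=> nN br rD.
have e1 : 1 - 2 * e <= 1 - e by lra.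
have e2 : 1 - e <= 1 + e by lra.
have [h1 h2 h3 h4 h5] := ord e1 e2.
have cm : con n r <= con n b := conp_mono nn h3 br rD.
have v1 : n%:R * con n b <= (1 + e ^+ 2) * ((1 - e) * k%:R) by case/andP: (conval e1 e2).
have /andP[c0 _] := con01 r.
by apply: (gen_high e0 e8 (ltW k0') v1 cm c0 (ler0n _ N)); rewrite ler_nat.
Qed.

Let q := tailq (e / 2).
Let q01 : 0 < q < 1.
Proof. by have [e0 e8] := e08; apply: tailq_lt1; lra. Qed.
Let A := (1 - e / 2)^-1 ^+ m.
Let A1 : 1 <= A.
Proof.
have [e0 e8] := e08; rewrite /A exprn_ege1// -[leLHS]invr1 lef_pV2 ?posrE//; lra.
Qed.

Lemma tail_low_window (N j : nat) r : (n' <= N)%N -> 0 <= r -> r <= a ->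
  bin_exp (con n r) N (fun l => (l <= k)%N%:R) <= q ^+ k.
Proof.
have [e0 e8] := e08; move=> nN r0 ra.
have e2 : 0 < e / 2 by lra.
apply: (le_trans (tail_low (con01 r) e2 (pa_low nN r0 ra))).
rewrite lerXn2r// ?nnegrE ?mulr_ge0 ?expR_ge0 ?addr_ge0 ?(ltW e2)//; first by case/andP: q01 => /ltW.
by rewrite /q le_max lexx.
Qed.

Lemma tail_high_window (N j : nat) r : (N <= n)%N -> (j <= m)%N -> b <= r -> r <= Dn n ->
  bin_exp (con n r) N (fun l => (k - j <= l)%N%:R) <= A * q ^+ k.
Proof.
have [e0 e8] := e08; move=> nN jm br rD.
have e2 : 0 < e / 2 by lra.
have e3 : e / 2 < 1 by lra.
apply: (@le_trans _ _ (bin_exp (con n r) N (fun l => (k - m <= l)%N%:R))).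
  apply: ler_bin_exp => // l; rewrite ler_nat; case: (leqP (k - j)%N l) => // h.
  by rewrite (leq_trans (leq_sub2l k jm) h).
apply: (le_trans (tail_high m (con01 r) e2 e3 (pb_high nN br rD))).
rewrite ler_wpM2l ?(le_trans ler01 A1)// lerXn2r// ?nnegrE ?mulr_ge0 ?expR_ge0 ?subr_ge0 ?(ltW e3)//.
  by case/andP: q01 => /ltW.
by rewrite /q le_max lexx orbT.
Qed.

(** An inner vertex has too large and an outer vertex too small a mean degree; each side is a
    Chernoff tail. *)
Lemma out_le : pr ((F n \x unif) \x prodn (F n \x unif) n')%E (@outlier R (Dn n) a b n' m k) <= A * q ^+ k.
Proof.
have [a0 n0] := par; have hp := conj a0 D0.
have mB : measurable_fun setT (fun r : R => ~~ (a < r <= b)).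
  by apply: measurable_neg; apply: measurable_and; [exact: measurable_fun_ltr|exact: measurable_fun_ler].
have /= := pr_degree (Dn n) (F n) unifU n' (fun j => (k - m <= j <= k)%N) mB.
rewrite /outlier /window => ->.
rewrite -[leRHS](mean_cst (F n)).
have b1 : bmeas (fun r : R => (~~ (a < r <= b))%:R * bin_exp (con n r) n' (fun j => (k - m <= j <= k)%N%:R)).
  apply: bmeasM; first exact: bmeas_bool.
  exact: (bmeas_bin (Dn n) (F n) unif n' (fun j => (k - m <= j <= k)%N)).
have ms : measurable_fun setT (fun s : R => 0 < s <= Dn n).
  by apply: measurable_and; [exact: measurable_fun_ltr|exact: measurable_fun_ler].
apply: (mean_le_ae ms (pr_radius_support hp (FE nn)) b1 (bmeas_cst _ _)) => r /andP[r0 rD].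
have q0 : 0 <= q ^+ k by rewrite exprn_ge0//; case/andP: q01 => /ltW.
case: (boolP (a < r <= b)) => /= h; first by rewrite mul0r mulr_ge0// (le_trans ler01 A1).
rewrite mul1r; move: h; rewrite negb_and -!leNgt -ltNge => /orP[ra|br].
- apply: (@le_trans _ _ (q ^+ k)); last by rewrite ler_peMl.
  apply: le_trans (tail_low_window 0 (leqnn n') (ltW r0) ra).
  by apply: ler_bin_exp => // j; rewrite ler_nat; case: (leqP j k); rewrite ?andbF ?andbT ?leq_b1.
- have n'n' : (n' <= n)%N by rewrite nmn leq_addl.
  apply: le_trans (tail_high_window n'n' (leqnn m) (ltW br) rD).
  by apply: ler_bin_exp => // j; rewrite ler_nat; case: (leqP (k - m)%N j); rewrite ?leq_b1.
Qed.

Let E0 : 0 < 1 - e ^+ 2.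
Proof. by have [e0 e8] := e08; exact: one_sub_sqr_gt0. Qed.

Let pd0 t : 0 <= pd t. Proof. by have [a0 _] := par; exact: (pdens_ge0 (conj a0 xi0)). Qed.

Let La r : a < r -> Dn n / 2 <= r.
Proof.
have [e0 e8] := e08; have e1 : 1 - 2 * e <= 1 + e by lra.
have [h1 _ _ _ _] := ord e1 (lexx _); have [[_ r1] _ _ _ _] := reg.
by move=> /ltW ar; apply: (le_trans r1); apply: (le_trans h1).
Qed.

Let Hsep r u (v : R * R) : a <= r -> r <= Dn n -> Dn n / 2 <= v.1 -> adj (Dn n) (r, u) v ->
  1 - cos (u - v.2) <= 2 * e ^+ 2.
Proof.
have [e0 e8] := e08; have e1 : 1 - 2 * e <= 1 + e by lra.
have [h1 _ _ _ _] := ord e1 (lexx _); have [_ _ _ _ h] := reg.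
by move=> ar; apply: h; apply: le_trans ar.
Qed.

Let abD : 0 <= a /\ b <= Dn n.
Proof.
have [e0 e8] := e08; have e1 : 1 - 2 * e <= 1 + e by lra.
have e2 : 1 - 2 * e <= 1 - e by lra.
have e3 : 1 - e <= 1 + e by lra.
by have [_ _ h1 _ _] := ord e1 (lexx _); have [_ _ _ h2 _] := ord e2 e3.
Qed.

(** Bound on the ratio of the radial law to the threshold law: [n] times the density at the smallest
    expected degree of the window, with one factor [1 - e^2] lost on each law. *)
Let Wup : R := n%:R * pd ((1 - e) * k%:R) / (1 - e ^+ 2) ^+ 2.

Let Wup0 : 0 <= Wup.
Proof. by rewrite divr_ge0 ?exprn_ge0 ?(ltW E0)// mulr_ge0. Qed.

Let HWup x y : a <= x -> x <= y -> y <= b -> G n y - G n x <= Wup * (low n x - low n y).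
Proof.
have [e0 e8] := e08; have e1 : 1 - 2 * e <= 1 + e by lra.
have e2 : 1 - 2 * e <= 1 - e by lra.
have e3 : 1 - e <= 1 + e by lra.
move=> ax xy yb.
have [h1 _ _ _ _] := ord e1 (lexx _); have [_ h2 _ _ p2] := ord e2 e3.
have [_ _ [_ hl _] [hG _] _] := reg.
have x1 := le_trans h1 ax; have y1 := le_trans yb h2.
have yT : (1 - e) * k%:R <= T n y.
  by rewrite -[leLHS](weight_rad (Dn n) xi0 p2) ler_wpM2l ?(ltW xi0)// ler_expR ler_wpM2r// lerD2l lerN2.
have := hG x y _ x1 xy y1 p2 yT.
have := ler_wpM2l (pd0 ((1 - e) * k%:R)) (hl x y x1 xy y1).
rewrite /Wup; move: (G n y - G n x) (T n x - T n y) (low n x - low n y) (pd _) => g t l p i1 i2.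
exact: chain_le E0 i1 i2.
Qed.

Let mu := (F n \x unif)%E.
Let PP := (prodn mu m \x prodn mu n')%E.

Let ml : measurable_fun setT (fun s : R => Dn n / 2 <= s).
Proof. exact: measurable_fun_ler. Qed.

Let n'pos : (0 : R) < n'%:R.
Proof. by have [e0 e8] := e08; apply: lt_le_trans n'n; rewrite mulr_gt0//; lra. Qed.

Let ffact_ge : ((1 - e / 8) * n%:R) ^+ m <= (n ^_ m)%:R :> R.
Proof.
have [e0 e8] := e08.
apply: (@le_trans _ _ (n'%:R ^+ m)).
  by rewrite lerXn2r// nnegrE// mulr_ge0//; lra.
rewrite -natrX ler_nat ffact_prod -[X in (_ ^ X)%N](card_ord m) -prod_nat_const.
apply: leq_prod => i _; rewrite nmn -(addnBAC n' (ltnW (ltn_ord i))); exact: leq_addl.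
Qed.

(** Gathers the losses of the upper bound: moving the density from [(1 - e) k] to [k], regularity,
    and [n ^_ m] against [n ^ m]. It tends to 1 with [e] tending to 0. *)
Definition cup : R := (1 - e) `^ (- (2 * alpha + 1)) / ((1 - e ^+ 2) ^+ 2 * (1 - e / 8)).

Let pdM t : 0 < t -> pd (t * k%:R) = t `^ (- (2 * alpha + 1)) * pd k%:R.
Proof. by move=> t0; rewrite /pdens (@powRM _ t k%:R _ (ltW t0) (ler0n R k)) mulrCA. Qed.

Let K1 : Wup ^+ m / (n ^_ m)%:R <= (cup * pd k%:R) ^+ m.
Proof.
have [e0 e8] := e08; have e9 : 0 < 1 - e / 8 by lra.
have z0 : 0 < ((1 - e / 8) * n%:R) ^+ m by rewrite exprn_gt0// mulr_gt0.
rewrite ler_pdivrMr ?(lt_le_trans z0)//.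
apply: (@le_trans _ _ ((cup * pd k%:R) ^+ m * ((1 - e / 8) * n%:R) ^+ m)).
  rewrite -exprMn le_eqVlt; apply/orP; left; apply/eqP; congr (_ ^+ m).
  rewrite /Wup /cup pdM ?subr_gt0//; last by lra.
  by apply: cup_aux; rewrite gt_eqF.
by apply: ler_wpM2l => //; rewrite exprn_ge0// mulr_ge0// divr_ge0 ?powR_ge0// mulr_ge0 ?exprn_ge0// ltW.
Qed.

Let pcl_le : pr (prodn unif m) (@close R (e ^+ 2) m) <= (m * m)%:R * (4 * e).
Proof.
have [e0 e8] := e08; have := pr_close unifU m (sqr_ge0 e).
by rewrite sqrtr_sqr ger0_norm// ltW.
Qed.

Lemma joint_le : pr PP (@jointdeg R (Dn n) m n' k) <=
  (cup * pd k%:R) ^+ m * (1 + ((m ^ m) * (m ^ m) * (m * m))%:R * (4 * e)) + m%:R * (A * q ^+ k).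
Proof.
have [e0 e8] := e08; have [a0 n0] := par; have hp := conj a0 D0.
apply: (le_trans (joint_upper hp (FE nn) unifU ml abD Wup0 HWup La Hsep k nmn)).
have m0' : (0 : R) <= m%:R by [].
apply: lerD; last exact: ler_wpM2l out_le.
rewrite exp1n mulr1 mulrDr mulr1; apply: lerD; first exact: K1.
have -> : (m ^ m)%:R * (Wup ^+ m * (m ^ m)%:R / (n ^_ m)%:R * pr (prodn unif m) (@close R (e ^+ 2) m)) =
  Wup ^+ m / (n ^_ m)%:R * (((m ^ m) * (m ^ m))%:R * pr (prodn unif m) (@close R (e ^+ 2) m)).
  by rewrite natrM; ring.
apply: ler_pM; [by rewrite divr_ge0// exprn_ge0|by rewrite mulr_ge0// pr_ge0|exact: K1|].
by rewrite (natrM _ (m ^ m * m ^ m)) -mulrA; apply: ler_wpM2l.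
Qed.

(** The counterpart of [cup] for the lower bound, with the density at [(1 + e) k]. *)
Definition clow : R := (1 + e) `^ (- (2 * alpha + 1)) * (1 - e ^+ 2) / (1 + e ^+ 2).
Hypothesis kn' : (k <= n')%N.

Let Wlow : R := n%:R * pd ((1 + e) * k%:R) * (1 - e ^+ 2) / (1 + e ^+ 2).

Let b' := rd n ((1 - 2 * e) * k%:R).

Let HWlow x y : a <= x -> x <= y -> y <= b' -> Wlow * (con n x - con n y) <= G n y - G n x.
Proof.
have [e0 e8] := e08; have e1 : 1 - 2 * e <= 1 + e by lra.
move=> ax xy yb.
have [h1 _ _ _ p1] := ord e1 (lexx _); have [_ h2 _ _ _] := ord (lexx _) e1.
have [_ _ [_ _ hc] [_ hG] _] := reg.
have x1 := le_trans h1 ax; have y1 := le_trans yb h2.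
have xT : T n x <= (1 + e) * k%:R.
  by rewrite -[leRHS](weight_rad (Dn n) xi0 p1) ler_wpM2l ?(ltW xi0)// ler_expR ler_wpM2r// lerD2l lerN2.
have := hG x y _ x1 xy y1 p1 xT.
have := ler_wpM2l (mulr_ge0 (pd0 ((1 + e) * k%:R)) (ltW E0)) (hc x y x1 xy y1).
have s0 : 0 < 1 + e ^+ 2 by rewrite ltr_wpDr// sqr_ge0.
rewrite /Wlow; move: (G n y - G n x) (T n x - T n y) (con n x - con n y) (pd _) => g t l p i1 i2.
apply: le_trans i2; rewrite mulrAC ler_pdivrMr//.
have -> : n%:R * p * (1 - e ^+ 2) * l = p * (1 - e ^+ 2) * (n%:R * l) by ring.
by apply: (le_trans i1); rewrite le_eqVlt; apply/orP; left; apply/eqP; ring.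
Qed.

Let nd (x : (R * R) * n'.-tuple (R * R)) : bool := ndeg (Dn n) x.1 x.2 == k.
Let mnd : measurable_fun setT nd.
Proof.
apply: (measurable_natcomp (fun j => j == k)).
by apply: measurable_ndegT; [exact: measurable_fst|exact: measurable_snd].
Qed.

(** [window_lower] averaged over the angle of the vertex; each tail is at most [A * q ^+ k]. *)
Lemma single_ge : clow * pd k%:R * (1 - 2 * A * q ^+ k) <= pr (mu \x prodn mu n')%E nd.
Proof.
have [e0 e8] := e08; have [a0 n0] := par; have hp := conj a0 D0.
have s0 : 0 < 1 + e ^+ 2 by rewrite ltr_wpDr// sqr_ge0.
have cl0 : 0 <= clow by rewrite divr_ge0 ?(ltW s0)// mulr_ge0 ?powR_ge0// ltW.
have [neg|pos] := leP (1 - 2 * A * q ^+ k) 0.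
  by apply: (le_trans _ (pr_ge0 _ _)); apply: mulr_ge0_le0 => //; rewrite mulr_ge0.
have e1 : 1 - 2 * e <= 1 + e by lra.
have e2 : 1 - 2 * e <= 1 - e by lra.
have e3 : 1 - e <= 1 + e by lra.
have [_ _ a00 aD p1] := ord e1 (lexx _); have [_ _ b0 bD p2] := ord e2 e3; have [_ _ _ b'D p3] := ord (lexx _) e1.
have ab : a <= b by rewrite ler_rad// ler_wpM2r ?(ltW k0).
have bb' : b < b' by rewrite ltNge ler_rad// -ltNge ltr_pM2r//; lra.
have W0 : 0 <= Wlow by rewrite divr_ge0 ?(ltW s0)// mulr_ge0 ?(ltW E0)// mulr_ge0.
pose g (y : (R * n'.-tuple (R * R)) * R) : bool := (a < y.2 <= b) && (ndeg (Dn n) (y.2, y.1.1) y.1.2 == k).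
have mg : measurable_fun setT g.
  apply: measurable_and.
    by apply: measurable_and; [apply: measurable_fun_ltr|apply: measurable_fun_ler] => //; exact: measurable_snd.
  apply: (measurable_natcomp (fun j => j == k)); apply: measurable_ndegT.
    apply/measurable_fun_pairP; split; first exact: measurable_snd.
    exact: (measurableT_comp measurable_fst measurable_fst).
  exact: (measurableT_comp measurable_snd measurable_fst).
have bg := bmeas_pr (F n) mg.
pose nw (x : (R * R) * n'.-tuple (R * R)) : bool := (a < x.1.1 <= b) && nd x.
have mnw : measurable_fun setT nw.
  apply: measurable_and => //; apply: measurable_windowT; exact: measurable_fst.
apply: (@le_trans _ _ (pr (mu \x prodn mu n')%E nw)); last by apply: le_pr => // x /andP[].
have -> : pr (mu \x prodn mu n')%E nw = mean unif (fun u => mean (prodn mu n') (fun w => pr (F n) (fun r => g ((u, w), r)))).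
  rewrite (mean_swap unif (prodn mu n') bg (fun z => pr_ge0 _ _)) pr_prod// pr_prodC//.
  congr (mean _ _); apply/funext => w.
  have mw : measurable_fun setT (fun x : R * R => nw (x, w)) by exact: (measurableT_comp mnw (pair2_measurable w)).
  transitivity (mean (F n) (fun r => pr unif (fun u => nw ((r, u), w)))); first exact: pr_prod.
  exact: (pr_prodC (F n) unif mw).
rewrite -[leLHS](mean_cst unif).
apply: (mean_le_ae measurable_inrange (pr_inrange unifU) (bmeas_cst _ _)) => [|u hu].
  pose g3 (y : R * (n'.-tuple (R * R) * R)) := g ((y.1, y.2.1), y.2.2).
  have m3 : measurable_fun setT g3.
    apply: (measurableT_comp mg (g := fun y : R * (n'.-tuple (R * R) * R) => ((y.1, y.2.1), y.2.2))).
    apply/measurable_fun_pairP; split.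
      apply/measurable_fun_pairP; split; first exact: measurable_fst.
      exact: (measurableT_comp measurable_fst measurable_snd).
    exact: (measurableT_comp measurable_snd measurable_snd).
  have -> : (fun u => mean (prodn mu n') (fun w => pr (F n) (fun r => g (u, w, r)))) =
      fun u => pr (prodn mu n' \x F n)%E (fun y => g3 (u, y)).
    apply/funext => u; rewrite pr_prod//.
    exact: (measurableT_comp m3 (pair1_measurable u)).
  exact: bmeas_pr.
apply: le_trans (window_lower hp (FE nn) unifU kn' hu a00 bb' b'D W0 ab HWlow).
have n'1 : (n'.+1 <= n)%N by rewrite nmn -add1n leq_add2r.
have t1 : bin_exp (con n b) n'.+1 (fun j => (k < j)%N%:R) <= A * q ^+ k.
  apply: le_trans (tail_high_window n'1 (leq0n m) (lexx b) bD).
  by apply: ler_bin_exp => // l; rewrite ler_nat subn0; case: (ltnP k l) => // /ltnW ->.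
have t2 : bin_exp (con n a) n'.+1 (fun j => (j <= k)%N%:R) <= A * q ^+ k.
  apply: (le_trans (tail_low_window 0 (leqnSn n') a00 (lexx a))).
  by rewrite ler_peMl// exprn_ge0//; case/andP: q01 => /ltW.
apply: ler_pM; [by rewrite mulr_ge0|exact: ltW| |by rewrite -mulrA; move: t1 t2; lra].
rewrite ler_pdivlMr ?ltr0n//.
apply: (@le_trans _ _ (clow * pd k%:R * n%:R)).
  by apply: ler_wpM2l; [rewrite mulr_ge0|rewrite ler_nat].
rewrite /Wlow /clow pdM; last by lra.
by rewrite le_eqVlt; apply/orP; left; apply/eqP; field; rewrite gt_eqF.
Qed.

(** Given the other points the external degrees of the block vertices are independent, so
    [jensen_pow] reduces to [single_ge]. The maximum with 0 keeps the base nonnegative before the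
    power is taken. *)
Lemma joint_ge : (clow * pd k%:R * Num.max 0 (1 - 2 * A * q ^+ k)) ^+ m -
  (cup * pd k%:R) ^+ m * ((m ^ m * (m * m))%:R * (4 * e)) - m%:R * (A * q ^+ k)
  <= pr PP (@jointdeg R (Dn n) m n' k).
Proof.
have [e0 e8] := e08; have [a0 n0] := par; have hp := conj a0 D0.
have s0 : 0 < 1 + e ^+ 2 by rewrite ltr_wpDr// sqr_ge0.
have cl0 : 0 <= clow by rewrite divr_ge0 ?(ltW s0)// mulr_ge0 ?powR_ge0// ltW.
apply: le_trans (joint_lower hp (FE nn) unifU ml abD Wup0 HWup La Hsep k nmn).
apply: lerB; last exact: ler_wpM2l out_le.
apply: lerB; last first.
  have -> : Wup ^+ m * (m ^ m)%:R / (n ^_ m)%:R * pr (prodn unif m) (@close R (e ^+ 2) m) =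
    Wup ^+ m / (n ^_ m)%:R * ((m ^ m)%:R * pr (prodn unif m) (@close R (e ^+ 2) m)) by ring.
  apply: ler_pM; [by rewrite divr_ge0// exprn_ge0|by rewrite mulr_ge0// pr_ge0|exact: K1|].
  by rewrite natrM -mulrA; apply: ler_wpM2l.
pose Q (w : n'.-tuple (R * R)) := pr mu (fun v => nd (v, w)).
have Q0 w : 0 <= Q w by exact: pr_ge0.
pose swp (x : n'.-tuple (R * R) * (R * R)) := (x.2, x.1).
have mswp : measurable_fun setT swp by apply/measurable_fun_pairP; split; [exact: measurable_snd|exact: measurable_fst].
have bQ : bmeas Q by exact: (bmeas_pr mu (measurableT_comp mnd mswp)).
have -> : pr PP (@alldeg R (Dn n) m n' k) = mean (prodn mu n') (fun w => Q w ^+ m).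
  rewrite pr_prod; last exact: measurable_alldeg.
  rewrite pr_prodC; last exact: measurable_alldeg.
  congr (mean _ _); apply/funext => w.
  have mw : measurable_fun setT (fun x : R * R => nd (x, w)) by exact: (measurableT_comp mnd (pair2_measurable w)).
  rewrite /Q /pr (_ : [set x | _] = rect (fun=> [set v | nd (v, w)])); last first.
    by apply/seteqP; split => v /= => [/forallP|h]; [|apply/forallP].
  rewrite prodn_rect; last by move=> i; exact: measurable_event.
  by rewrite /= big_const_ord iter_mulr_1.
apply: le_trans (jensen_pow (prodn mu n') m bQ Q0).
have -> : mean (prodn mu n') Q = pr (mu \x prodn mu n')%E nd by rewrite pr_prod// pr_prodC.
have p0 : 0 <= clow * pd k%:R * Num.max 0 (1 - 2 * A * q ^+ k).
  by apply: mulr_ge0; [exact: mulr_ge0|rewrite le_max lexx].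
apply: lerXn2r; rewrite ?nnegrE ?pr_ge0//.
have [h|h] := leP 0 (1 - 2 * A * q ^+ k); first exact: single_ge.
by rewrite mulr0 pr_ge0.
Qed.

End uniform.

(** * Joint degree probabilities, uniformly in large [k] *)

Section uniform_limit.
Context {R : realType}.

Lemma cvg_powR1 (f : nat -> R) p : f j @[j --> \oo] --> (1 : R) -> f j `^ p @[j --> \oo] --> (1 : R).
Proof.
move=> f1.
have h : expR (p * ln (f j)) @[j --> \oo] --> (1 : R).
  rewrite -[X in _ --> X]expR0 -(mulr0 p) -(@ln1 R); apply: cvg_expR; apply: cvgM; first exact: cvg_cst.
  exact: (cvg_comp _ _ f1 (continuous_ln ltr01)).
apply: cvg_trans h; apply: near_eq_cvg; near=> j.
have f0 : 0 < f j by near: j; exact: (cvgr_gt _ f1 _ ltr01).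
by rewrite /powR gt_eqF.
Unshelve. all: by end_near. Qed.

Context (alpha nu : R) (F : nat -> probability R R) (unif : probability R R).
Hypothesis par : 1 / 2 < alpha /\ 0 < nu.
Hypothesis unifU : forall A, measurable A -> unif A = uniform_prob (@ltNpi_pi R) A.
Local Notation Dn := (disk_radius nu).
Local Notation xi := (kpkvb_xi alpha nu).
Hypothesis FE : forall n, nu < n%:R -> forall x, F n `]-oo, x]%classic = (rcdf alpha (Dn n) x)%:E.
Local Notation pd := (pdens alpha xi).

Let xi0 : 0 < xi. Proof. exact: xi_gt0 par. Qed.

Let geometric_aux (lC lq la lx ls lk p k m t s c : R) :
  lC - m * (la + t * lx) + p * (1 - ls) - p <= k * c / 2 -> p * lk <= p * (k * s - 1 - ls) ->
  0 < p -> p * (k * s) = k * c / 2 -> p * lk = m * (t * lk) + lk -> k * c = - (k * lq) -> 0 <= lk ->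
  lC + k * lq <= m * (la - t * (lk - lx)).
Proof. lra. Qed.

(** Geometric decay beats the power law [k^(- m (2 alpha + 1))]; Chernoff errors are thus
    negligible. *)
Lemma geometric_pdens (q C : R) m : 0 < q < 1 -> 0 < C ->
  exists K : nat, forall k, (K <= k)%N -> C * q ^+ k <= pd k%:R ^+ m.
Proof.
move=> /andP[q0 q1] C0; have [a0 n0] := par; have x0 := xi0.
(* The exponent of the power law, increased by 1 so that it is positive even for [m = 0]. *)
pose p := m%:R * (2 * alpha + 1) + 1.
pose c := - ln q.
have c0 : 0 < c by rewrite oppr_gt0 ln_lt0// q0.
have p0 : 0 < p by rewrite /p ltr_wpDl// mulr_ge0//; lra.
pose s := c / (2 * p).
have s0 : 0 < s by rewrite divr_gt0// mulr_gt0.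
have ax : 0 < 2 * alpha / xi by rewrite divr_gt0//; lra.
pose B := ln C - m%:R * (ln (2 * alpha / xi) + (2 * alpha + 1) * ln xi) + p * (1 - ln s) - p.
exists (Num.bound (2 * `|B| / c)).+1 => k kk.
have k0 : 0 < k%:R :> R by rewrite ltr0n (leq_ltn_trans _ kk).
have hB : 2 * `|B| / c <= k%:R.
  apply: (le_trans (ltW (archi_boundP _))); first by rewrite !mulr_ge0// invr_ge0 ltW.
  by rewrite ler_nat ltnW.
have {hB}hB : B <= k%:R * c / 2.
  by apply: (le_trans (ler_norm _)); rewrite ler_pdivlMr// mulrC -ler_pdivrMr.
rewrite pdens_exp// -[C](lnK (C0 : C \is Num.pos)) -[q](lnK (q0 : q \is Num.pos)) -(lnK (ax : 2 * alpha / xi \is Num.pos)).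
rewrite -expRD -!expRM_natl -expRD ler_expR.
(* The tangent line of [ln] with slope [s = c / (2 p)] spends half of the exponential decay. *)
have lk : ln k%:R <= k%:R * s - 1 - ln s.
  have ks : 0 < k%:R * s by rewrite mulr_gt0.
  have : ln (1 + (k%:R * s - 1)) <= k%:R * s - 1 by apply: le_ln1Dx; lra.
  by rewrite (addrC 1) subrK lnM ?posrE//; lra.
have l1 : 0 <= ln k%:R :> R by rewrite ln_ge0// ler1n (leq_ltn_trans _ kk).
have h1 : p * ln k%:R <= p * (k%:R * s - 1 - ln s) by rewrite ler_pM2l.
have h2 : p * (k%:R * s) = k%:R * c / 2 by rewrite /s; field; rewrite gt_eqF.
have h3 : p * ln k%:R = m%:R * ((2 * alpha + 1) * ln k%:R) + ln k%:R by rewrite /p; ring.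
have h4 : k%:R * c = - (k%:R * ln q) by rewrite /c mulrN.
exact: geometric_aux hB h1 p0 h2 h3 h4 l1.
Qed.

(** A sequence of admissible [e], at most 1/8, tending to 0. *)
Let e_ (j : nat) : R := (j + 8)%:R^-1.

Let e_0 : e_ j @[j --> \oo] --> (0 : R).
Proof.
apply/cvgrPdist_le => eps eps0; near=> j.
have j8 : (0 < j + 8)%N by rewrite addnS.
rewrite sub0r normrN ger0_norm ?invr_ge0// invf_ple ?posrE ?ltr0n//.
have h : eps^-1 <= j%:R by near: j; exact: nbhs_infty_ger.
by apply: (le_trans h); rewrite ler_nat leq_addr.
Unshelve. all: by end_near. Qed.

Let e_in j : 0 < e_ j /\ e_ j <= 1 / 8.
Proof.
split; first by rewrite invr_gt0 ltr0n addnS.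
have j8 : (0 < j + 8)%N by rewrite addnS.
by rewrite div1r lef_pV2 ?posrE ?ltr0n// ler_nat leq_addl.
Qed.

Let c1 (f g : nat -> R) : f j @[j --> \oo] --> (1 : R) -> g j @[j --> \oo] --> (1 : R) ->
  f j * g j @[j --> \oo] --> (1 : R).
Proof. by move=> fa gb; rewrite -[X in _ --> X](mulr1 (1 : R)); exact: cvgM. Qed.

Let cB (f : nat -> R) : f j @[j --> \oo] --> (0 : R) -> 1 - f j @[j --> \oo] --> (1 : R).
Proof. by move=> f0; rewrite -[X in _ --> X](subr0 (1 : R)); apply: cvgB => //; exact: cvg_cst. Qed.

Let cD (f : nat -> R) : f j @[j --> \oo] --> (0 : R) -> 1 + f j @[j --> \oo] --> (1 : R).
Proof. by move=> f0; rewrite -[X in _ --> X](addr0 (1 : R)); apply: cvgD => //; exact: cvg_cst. Qed.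

Let cV (f : nat -> R) : f j @[j --> \oo] --> (1 : R) -> (f j)^-1 @[j --> \oo] --> (1 : R).
Proof. by move=> f1; rewrite -[X in _ --> X]invr1; apply: cvgV => //; exact: oner_neq0. Qed.

Let cX (f : nat -> R) m : f j @[j --> \oo] --> (1 : R) -> f j ^+ m @[j --> \oo] --> (1 : R).
Proof.
move=> f1; elim: m => [|m IH]; first exact: cvg_cst.
have h := c1 f1 IH; apply: cvg_trans h; apply: near_eq_cvg; by apply: nearW => j; rewrite exprS.
Qed.

Let c0 (f : nat -> R) (c : R) : f j @[j --> \oo] --> (0 : R) -> c * f j @[j --> \oo] --> (0 : R).
Proof. by move=> f0; rewrite -[X in _ --> X](mulr0 c); apply: cvgM => //; exact: cvg_cst. Qed.

Let sq0 : e_ j ^+ 2 @[j --> \oo] --> (0 : R).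
Proof. have h := cvgM e_0 e_0; rewrite mulr0 in h; exact: h. Qed.

Let cvg_cup : cup alpha (e_ j) @[j --> \oo] --> (1 : R).
Proof.
have e8 : e_ j / 8 @[j --> \oo] --> (0 : R).
  by have h := cvgM e_0 (cvg_cst (8^-1 : R)); rewrite mul0r in h; exact: h.
exact: (c1 (cvg_powR1 _ (cB e_0)) (cV (c1 (cX 2 (cB sq0)) (cB e8)))).
Qed.

Let cvg_clow : clow alpha (e_ j) @[j --> \oo] --> (1 : R).
Proof. exact: (c1 (c1 (cvg_powR1 _ (cD e_0)) (cB sq0)) (cV (cD sq0))). Qed.

(** [e] is fixed first, so that the constants [cup] and [clow] with the closeness terms are within
    [eps / 2] of 1; [K] then makes the Chernoff terms at most [eps / 2] of the main term. *)
Lemma uniform_joint m eps : (0 < m)%N -> 0 < eps ->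
  exists K : nat, forall n k, (K <= k)%N -> (K * k ^ 2 <= n)%N ->
  [/\ (m <= n)%N, nu < n%:R &
  (1 - eps) * pd k%:R ^+ m <=
    pr (prodn (F n \x unif)%E m \x prodn (F n \x unif)%E (n - m))%E (@jointdeg R (Dn n) m (n - m) k) <=
  (1 + eps) * pd k%:R ^+ m].
Proof.
move=> m0 eps0; have [a0 n0] := par.
pose k1 : R := ((m ^ m) * (m ^ m) * (m * m))%:R.
pose k2 : R := (m ^ m * (m * m))%:R.
have [j [hU hL]] : exists j, cup alpha (e_ j) ^+ m * (1 + k1 * (4 * e_ j)) <= 1 + eps / 2 /\
   1 - eps / 2 <= (clow alpha (e_ j) * (1 - e_ j)) ^+ m - cup alpha (e_ j) ^+ m * (k2 * (4 * e_ j)).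
  have h1 : cup alpha (e_ j) ^+ m * (1 + k1 * (4 * e_ j)) @[j --> \oo] --> (1 : R).
    exact: (c1 (cX m cvg_cup) (cD (c0 k1 (c0 4 e_0)))).
  have h2 : (clow alpha (e_ j) * (1 - e_ j)) ^+ m - cup alpha (e_ j) ^+ m * (k2 * (4 * e_ j)) @[j --> \oo] --> (1 : R).
    have h := cvgB (cX m (c1 cvg_clow (cB e_0))) (cvgM (cX m cvg_cup) (c0 k2 (c0 4 e_0))).
    by rewrite mulr0 subr0 in h; exact: h.
  have ep : 0 < eps / 2 by rewrite divr_gt0.
  have u1 : (1 : R) < 1 + eps / 2 by rewrite ltrDl.
  have u2 : 1 - eps / 2 < (1 : R) by rewrite gtrBl.
  have n1 := cvgr_le _ h1 _ u1; have n2 := cvgr_ge _ h2 _ u2.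
  by have [j [j1 j2]] := filter_ex (filterI (n1 _) (n2 _)); exists j.
have [e0 e8] := e_in j; move: (e_ j) hU hL e0 e8 => e hU hL e0 e8.
have se0 : 0 < e ^+ 2 by rewrite exprn_gt0.
have se1 : e ^+ 2 <= 1 by rewrite expr2; nra.
have [K0 K00 hK0] := regular_ex par unifU FE se0 se1.
have q01 : 0 < tailq (e / 2) < 1 by apply: tailq_lt1; lra.
pose A := (1 - e / 2)^-1 ^+ m.
have A0 : 0 < A by rewrite exprn_gt0// invr_gt0; lra.
have mA : 0 < m%:R * A by rewrite mulr_gt0// ltr0n.
have [K1 hK1] : exists K : nat, forall k, (K <= k)%N -> (m%:R * A) / (eps / 2) * tailq (e / 2) ^+ k <= pd k%:R ^+ m.
  by apply: geometric_pdens => //; rewrite divr_gt0// divr_gt0.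
have [K2 hK2] : exists K : nat, forall k, (K <= k)%N -> 2 * A / e * tailq (e / 2) ^+ k <= pd k%:R ^+ 0.
  by apply: geometric_pdens => //; rewrite divr_gt0// mulr_gt0.
pose K3 := Num.bound (m%:R / (e / 8)).
exists (K0 + K1 + K2 + K3 + m.+2)%N => n k Kk Kn.
have kK0 : (K0 <= k)%N by apply: leq_trans Kk; rewrite -!addnA leq_addr.
have kK1 : (K1 <= k)%N by apply: leq_trans Kk; rewrite -!addnA (leq_trans (leq_addr _ _) (leq_addl K0 _)).
have kK2 : (K2 <= k)%N by apply: leq_trans Kk; rewrite -(addnA _ K3) (leq_trans (leq_addl _ K2) (leq_addr _ _)).
have km : (m.+2 <= k)%N by apply: leq_trans Kk; rewrite leq_addl.
have k0 : (0 < k)%N by exact: leq_trans km.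
have kk : (k <= k ^ 2)%N by rewrite expnS expn1 leq_pmulr.
have Kn0 : (K0 * k ^ 2 <= n)%N by apply: leq_trans Kn; rewrite leq_mul2r -!addnA leq_addr orbT.
have nk : (k + m <= n)%N.
  apply: leq_trans Kn; apply: (@leq_trans (m.+2 * k)); last by apply: leq_mul => //; exact: leq_addl.
  by rewrite !mulSn leq_add2l (leq_trans (leq_pmulr m k0) (leq_addl _ _)).
have nK3 : (K3 <= n)%N.
  apply: leq_trans Kn; apply: (@leq_trans (K3 * k ^ 2)); first by rewrite leq_pmulr// expn_gt0 k0.
  by rewrite leq_mul2r (leq_trans (leq_addl _ K3) (leq_addr _ _)) orbT.
have mn : (m <= n)%N by apply: leq_trans nk; rewrite leq_addl.
have reg := hK0 n k kK0 Kn0.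
have nmn : n = (m + (n - m))%N by rewrite subnKC.
have mR : m%:R <= e / 8 * n%:R.
  rewrite mulrC -ler_pdivrMr ?divr_gt0//; apply: (le_trans (ltW (archi_boundP _))); last by rewrite ler_nat.
  by rewrite divr_ge0// divr_ge0// ltW.
have e08 : 0 < e /\ e <= 1 / 8 by [].
have kn' : (k <= n - m)%N by rewrite -(leq_add2r m) subnK.
have pd0 : 0 <= pd k%:R ^+ m by rewrite exprn_ge0// (pdens_ge0 (conj a0 xi0)).
have t1 : m%:R * (A * tailq (e / 2) ^+ k) <= eps / 2 * pd k%:R ^+ m.
  have ep : 0 < eps / 2 by rewrite divr_gt0.
  have h := ler_wpM2l (ltW ep) (hK1 k kK1); apply: le_trans h.
  by rewrite le_eqVlt; apply/orP; left; apply/eqP; field; rewrite gt_eqF.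
have t2 : 2 * A * tailq (e / 2) ^+ k <= e.
  by have := hK2 k kK2; rewrite expr0 mulrAC ler_pdivrMr// mul1r.
split => //; first by have [[]] := reg.
apply/andP; split.
- have jg := joint_ge par unifU FE e08 reg nmn mR m0 kn'.
  apply: le_trans jg; rewrite -/A.
  have cl0 : 0 <= clow alpha e.
    by rewrite divr_ge0 ?addr_ge0 ?sqr_ge0// mulr_ge0 ?powR_ge0// subr_ge0.
  have e1 : 0 <= 1 - e by lra.
  have f1 : (clow alpha e * (1 - e)) ^+ m * pd k%:R ^+ m <=
      (clow alpha e * pd k%:R * Num.max 0 (1 - 2 * A * tailq (e / 2) ^+ k)) ^+ m.
    rewrite -exprMn mulrAC; have pdk := pdens_ge0 (conj a0 xi0) k%:R.
    apply: lerXn2r; rewrite ?nnegrE; [exact: mulr_ge0 (mulr_ge0 _ _) _|by apply: mulr_ge0; [exact: mulr_ge0|rewrite le_max lexx]|].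
    by apply: ler_wpM2l; [rewrite mulr_ge0|rewrite le_max; apply/orP; right; rewrite lerD2l lerN2].
  apply: le_trans (lerB (lerB f1 (lexx _)) t1).
  rewrite -/k2 (_ : (cup alpha e * pd k%:R) ^+ m * _ = cup alpha e ^+ m * (k2 * (4 * e)) * pd k%:R ^+ m); last by rewrite exprMn mulrAC.
  have := ler_wpM2r pd0 hL; move: ((_ * (1 - e)) ^+ m) (cup alpha e ^+ m * _) (pd k%:R ^+ m) => u v w; lra.
- have jl := joint_le par unifU FE e08 reg nmn mR.
  apply: (le_trans jl); rewrite -/A -/k1 (_ : (cup alpha e * pd k%:R) ^+ m * _ = cup alpha e ^+ m * (1 + k1 * (4 * e)) * pd k%:R ^+ m); last by rewrite exprMn mulrAC.
  have := ler_wpM2r pd0 hU; move: (cup alpha e ^+ m * _) (pd k%:R ^+ m) t1 => u w t1; lra.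
Qed.

End uniform_limit.

(** * Bounded and very large degrees *)

Section fixed_degree.
Context {R : realType}.
Local Notation leb := (@lebesgue_measure R).
Context (alpha nu : R) (F : nat -> probability R R) (unif : probability R R).
Hypothesis par : 1 / 2 < alpha /\ 0 < nu.
Hypothesis unifU : forall A, measurable A -> unif A = uniform_prob (@ltNpi_pi R) A.
Local Notation Dn := (disk_radius nu).
Local Notation xi := (kpkvb_xi alpha nu).
Hypothesis FE : forall n, nu < n%:R -> forall x, F n `]-oo, x]%classic = (rcdf alpha (Dn n) x)%:E.
Local Notation pd := (pdens alpha xi).
Local Notation low n := (nbr (Dn n) (F n) unif (fun s => Dn n / 2 <= s)).
Local Notation high n := (nbr (Dn n) (F n) unif (fun s => s < Dn n / 2)).
Local Notation con n := (conp (Dn n) (F n) unif).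
Local Notation rd n t := (rad (Dn n) xi t).

Let xi0 : 0 < xi. Proof. exact: xi_gt0 par. Qed.
Let hp : 1 / 2 < alpha /\ 0 < xi. Proof. by have [] := par. Qed.
Let w0 : R := 2 * alpha / (2 * alpha - 1).
Let w00 : 0 < w0. Proof. by have [a0 _] := par; rewrite divr_gt0; lra. Qed.

Lemma seq_cvgM (f g : nat -> R) (a b : R) : f n @[n --> \oo] --> a -> g n @[n --> \oo] --> b ->
  f n * g n @[n --> \oo] --> a * b.
Proof. by move=> fa gb; exact: cvgM. Qed.

Lemma seq_cvgD (f g : nat -> R) (a b : R) : f n @[n --> \oo] --> a -> g n @[n --> \oo] --> b ->
  f n + g n @[n --> \oo] --> a + b.
Proof. by move=> fa gb; exact: cvgD. Qed.

Lemma seq_cvgB (f g : nat -> R) (a b : R) : f n @[n --> \oo] --> a -> g n @[n --> \oo] --> b ->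
  f n - g n @[n --> \oo] --> a - b.
Proof. by move=> fa gb; exact: cvgB. Qed.

Lemma ex_expN (c : R) : 0 < c -> exists M : R, [/\ 1 <= M, expR (- M) <= 1 / 16 & expR (- M) <= c].
Proof.
move=> c0; have ci : 0 <= c^-1 by rewrite invr_ge0 ltW.
exists (16 + c^-1).
have h : 16 + c^-1 <= expR (16 + c^-1) by apply: (le_trans _ (expR_ge1Dx _)); lra.
split; first by lra.
- by rewrite div1r expRN lef_pV2 ?posrE ?expR_gt0//; lra.
- by rewrite expRN -[leRHS]invrK lef_pV2 ?posrE ?expR_gt0 ?invr_gt0//; lra.
Qed.

Lemma cvg_invn : n%:R^-1 @[n --> \oo] --> (0 : R).
Proof.
apply/cvgrPdist_le => eps eps0; near=> j.
have j0 : 0 < j%:R :> R by near: j; exact: nbhs_infty_gtr.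
rewrite sub0r normrN ger0_norm ?invr_ge0// invf_ple ?posrE//.
by near: j; exact: nbhs_infty_ger.
Unshelve. all: by end_near. Qed.

Let value_aux (d e r u v T H : R) : 0 < d -> 0 <= e -> e <= d / 200 -> `|r - 1| <= d / 8 -> `|r - 1| <= 1 -> 0 <= T ->
  u = (1 - 8 * e) * r * T -> v = (1 + 20 * e) * r * T -> 0 <= H -> H <= d / 4 * T ->
  forall l, u <= l <= v -> `|T - (l + H)| <= d * T.
Proof.
move=> d0 e0 ed; rewrite !ler_norml => /andP[r1 r2] /andP[r3 r4] T0 -> -> H0 HT l /andP[l1 l2].
have er : e * r <= 2 * e by nra.
have er0 : 0 <= e * r by nra.
have i1 : (e * r) * T <= (2 * e) * T by rewrite ler_wpM2r.
have i0 : 0 <= (e * r) * T by rewrite mulr_ge0.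
have i2 : e * T <= d / 200 * T by rewrite ler_wpM2r.
have i3 : (r - 1) * T <= d / 8 * T by rewrite ler_wpM2r.
have i4 : - (d / 8) * T <= (r - 1) * T by rewrite ler_wpM2r.
by rewrite ler_norml; apply/andP; split; lra.
Qed.

(** At radius [rad t] the outer half contributes [t] up to relative error of order [exp (- M)] for
    every fixed [M], and the inner half vanishes with its weight. *)
Lemma cvg_con t : xi <= t -> n%:R * con n (rd n t) @[n --> \oo] --> t.
Proof.
have [a0 n0] := par; have x0 := xi0; move=> xt; have t0 : 0 < t by exact: lt_le_trans xt.
apply/cvgrPdist_le => eps eps0; pose d := eps / t.
have d0 : 0 < d by rewrite divr_gt0.
have d200 : 0 < d / 200 by rewrite divr_gt0.
have [M [M1 M16 Md]] := ex_expN d200.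
pose C1 := M + 2 * (ln t - ln xi).
have hl : lweight (Dn n) (F n) (fun s => Dn n / 2 <= s) / w0 @[n --> \oo] --> (1 : R).
  by rewrite -[X in _ --> X](@divff _ w0) ?gt_eqF//; apply: cvgMl; exact: cvg_lweight_low.
have hh : (6 * nu / xi) * lweight (Dn n) (F n) (fun s => s < Dn n / 2) @[n --> \oo] --> (0 : R).
  rewrite -[X in _ --> X](mulr0 (6 * nu / xi)).
  by apply: cvgM; [exact: cvg_cst|exact: (cvg_lweight_high par FE)].
have d8 : 0 < d / 8 by rewrite divr_gt0.
have d4 : 0 < d / 4 by rewrite divr_gt0.
have near1 c : 0 < c -> \forall n \near \oo, `|lweight (Dn n) (F n) (fun s => Dn n / 2 <= s) / w0 - 1| <= c.
  by move=> c0; have /cvgrPdist_le/(_ _ c0) := hl; apply: filterS => n; rewrite distrC.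
have n1 := near1 _ d8; have n2 := near1 _ ltr01.
have n3 : \forall n \near \oo, (6 * nu / xi) * lweight (Dn n) (F n) (fun s => s < Dn n / 2) <= d / 4.
  have /cvgrPdist_le/(_ _ d4) := hh; apply: filterS => n.
  by rewrite sub0r normrN; apply: le_trans; exact: ler_norm.
have lt0 : 0 <= ln t - ln xi by rewrite subr_ge0 ler_ln.
near=> n.
have nn : nu < n%:R by near: n; exact: nbhs_infty_gtr.
have D2 : 2 * C1 <= Dn n by near: n; move/cvgryPge: (cvg_radius par); apply.
have rh1 : `|lweight (Dn n) (F n) (fun s => Dn n / 2 <= s) / w0 - 1| <= d / 8.
  by near: n; exact: n1.
have rh2 : `|lweight (Dn n) (F n) (fun s => Dn n / 2 <= s) / w0 - 1| <= 1.
  by near: n; exact: n2.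
have hh1 : (6 * nu / xi) * lweight (Dn n) (F n) (fun s => s < Dn n / 2) <= d / 4.
  by near: n; exact: n3.
have D0 := radius_gt0 par nn.
have nR : 0 < n%:R :> R by exact: lt_trans nn.
have hp' : 1 / 2 < alpha /\ 0 < Dn n by [].
have eD : expR (- (Dn n / 2)) = nu / n%:R by rewrite expRN (exp_radius par nn) invf_div.
have ml : measurable_fun setT (fun s : R => Dn n / 2 <= s) by exact: measurable_fun_ler.
have mh : measurable_fun setT (fun s : R => s < Dn n / 2) by exact: measurable_fun_ltr.
have x0' : 0 <= rd n t by rewrite /rad; move: D2; rewrite /C1; move: (Dn n) (ln t - ln xi) lt0 => D l *; lra.
have xD : rd n t <= Dn n by rewrite /rad; lra.
have xM : Dn n + M <= rd n t + Dn n / 2 by rewrite /rad; move: D2; rewrite /C1; move: (Dn n) (ln t - ln xi) lt0 => D l *; lra.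
have Mx : M <= rd n t by rewrite /rad; move: D2; rewrite /C1; move: (Dn n) (ln t - ln xi) lt0 => D l *; lra.
have Mh : M <= Dn n / 2 by move: D2; rewrite /C1; move: (Dn n) (ln t - ln xi) lt0 => D l *; lra.
have MDr : [/\ 1 <= M, expR (- M) <= 1 / 16 & M <= Dn n] by split => //; move: Mh; move: (Dn n) D0 => D *; lra.
have Lh s : 0 < s <= Dn n -> Dn n / 2 <= s -> Dn n / 2 <= s by [].
have wT := weight_rad (Dn n) x0 t0.
have vl := nbr_value hp' (FE nn) unifU ml MDr Mh Lh Mx xD xM.
have vh := nbr_le hp' (FE nn) unifU mh x0' xD.
have vh0 : 0 <= high n (rd n t) by exact: pr_ge0.
have -> : eps = d * t by rewrite /d; field; rewrite gt_eqF.
rewrite conp_split mulrDr.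
apply: (value_aux d0 (expR_ge0 (- M)) Md rh1 rh2 (ltW t0) erefl erefl).
- by rewrite mulr_ge0.
- apply: (le_trans (ler_wpM2l (ltW nR) vh)); apply: le_trans (ler_wpM2r (ltW t0) hh1).
  rewrite eD -{2}wT le_eqVlt; apply/orP; left; apply/eqP; field; rewrite gt_eqF// gt_eqF//.
- have cst lw c : n%:R * (2 / pi * c * lw * expR (- (Dn n / 2)) * weight (Dn n) (rd n t)) = c * (lw / w0) * t.
    rewrite eD -{2}wT /w0 /kpkvb_xi.
    have z3 : pi != 0 :> R by rewrite gt_eqF// pi_gt0.
    have aux (p l a v N c' w : R) : p != 0 -> a != 0 -> N != 0 -> 2 * a - 1 != 0 ->
        N * (2 / p * c' * l * (v / N) * w) = c' * (l / (2 * a / (2 * a - 1))) * (4 * a * v / (p * (2 * a - 1)) * w).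
      by move=> y1 y2 y3 y4; field; rewrite y1 y2 y3 y4.
    have z1 : 2 * alpha - 1 != 0 by rewrite gt_eqF// subr_gt0 -ltr_pdivrMl// mulrC.
    have z2 : alpha != 0 by rewrite gt_eqF// (lt_trans _ a0).
    by apply: aux => //; rewrite gt_eqF.
  by rewrite -!cst !ler_pM2l.
Unshelve. all: by end_near. Qed.

Lemma cvg_con0 t : xi <= t -> con n (rd n t) @[n --> \oo] --> (0 : R).
Proof.
move=> xt; have h := seq_cvgM cvg_invn (cvg_con xt); rewrite mul0r in h.
apply: cvg_trans h; apply: near_eq_cvg; near=> n.
have n0 : 0 < n%:R :> R by near: n; exact: nbhs_infty_gtr.
by rewrite mulKf// gt_eqF.
Unshelve. all: by end_near. Qed.

(** The crude constant 6 of [nbr_le], with total weight eventually at most [w0 + 1]. *)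
Let C0 : R := 6 * nu * (w0 + 1).

Lemma near_con_le : \forall n \near \oo, forall r, 0 <= r <= Dn n ->
  n%:R * con n r <= C0 * weight (Dn n) r.
Proof.
have [a0 n0] := par.
near=> n => r /andP[r0 rD].
have nn : nu < n%:R by near: n; exact: nbhs_infty_gtr.
have nR : 0 < n%:R :> R by exact: lt_trans nn.
have hl : lweight (Dn n) (F n) (fun s => Dn n / 2 <= s) + lweight (Dn n) (F n) (fun s => s < Dn n / 2) <= w0 + 1.
  near: n; have h := seq_cvgD (cvg_lweight_low par FE) (cvg_lweight_high par FE).
  rewrite addr0 in h; apply: (cvgr_le _ h _); rewrite -/w0; have := w00; lra.
have D0 := radius_gt0 par nn; have hp' : 1 / 2 < alpha /\ 0 < Dn n by [].
have ml : measurable_fun setT (fun s : R => Dn n / 2 <= s) by exact: measurable_fun_ler.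
have mh : measurable_fun setT (fun s : R => s < Dn n / 2) by exact: measurable_fun_ltr.
have vl := nbr_le hp' (FE nn) unifU ml r0 rD.
have vh := nbr_le hp' (FE nn) unifU mh r0 rD.
have eD : expR (- (Dn n / 2)) = nu / n%:R by rewrite expRN (exp_radius par nn) invf_div.
rewrite conp_split; apply: (le_trans (ler_wpM2l (ltW nR) (lerD vl vh))).
rewrite -mulrDr eD.
have -> : n%:R * (6 * (weight (Dn n) r * (nu / n%:R)) * (lweight (Dn n) (F n) (fun s => Dn n / 2 <= s) + lweight (Dn n) (F n) (fun s => s < Dn n / 2))) =
   6 * nu * (lweight (Dn n) (F n) (fun s => Dn n / 2 <= s) + lweight (Dn n) (F n) (fun s => s < Dn n / 2)) * weight (Dn n) r.
  by field; rewrite gt_eqF.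
apply: ler_wpM2r; first exact: expR_ge0.
by apply: ler_wpM2l => //; rewrite mulr_ge0// ltW.
Unshelve. all: by end_near. Qed.

Let weight_ge1 (D r : R) : r <= D -> 1 <= weight D r.
Proof. by move=> rD; rewrite -[leLHS]expR0 ler_expR; lra. Qed.

Let pois k t : R := t ^+ k / k`!%:R * expR (- t).

(** Given the radius the degree is binomial with mean tending to [t]: Poisson limit inside,
    dominated convergence outside. *)
Let single_cvg m k : (mean (F n) (fun r => bin_exp (con n r) (n - m) (fun a => (a == k)%:R)))%:E
  @[n --> \oo] --> (\int[leb]_(t in `[xi, +oo[) (pois k t * pd t)%:E)%E.
Proof.
pose h (n : nat) r := bin_exp (con n r) (n - m) (fun a => (a == k)%:R).
have bh n : bmeas (h n) := bmeas_bin (Dn n) (F n) unif (n - m) (pred1 k).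
have h01 n r : 0 <= h n r <= 1 := bin_exp01 (n - m) (pred1 k) (conp01 (Dn n) (F n) unif r).
have near_F : \forall n \near \oo, forall x, F n `]-oo, x]%classic = (rcdf alpha (Dn n) x)%:E.
  by near=> n; apply: FE; near: n; exact: nbhs_infty_gtr.
have := @radial_limit R alpha xi hp (fun n => Dn n) F h (pois k) 1 (cvg_radius par) near_F.
move=> /(_ (fun n => proj1 (bh n)) (fun n r => proj1 (andP (h01 n r)))).
have hC : \forall n \near \oo, forall r, 0 <= r <= Dn n -> h n r <= 1 * weight (Dn n) r.
  apply: nearW => n r /andP[_ rD]; rewrite mul1r; apply: le_trans (weight_ge1 rD).
  by case/andP: (h01 n r).
have hl t : xi <= t -> h n (rd n t) @[n --> \oo] --> pois k t.
  move=> xt; apply: (bin_exp_poisson (p := fun n => con n (rd n t)) (n := fun n => (n - m)%N)).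
  - by move=> n; exact: conp01.
  - by apply/cvgnyPge => N; near=> n; rewrite leq_subRL; near: n; exact: nbhs_infty_ge.
  have hc : (fun _ : nat => m%:R : R) n @[n --> \oo] --> (m%:R : R) by exact: cvg_cst.
  have h1 := seq_cvgB (cvg_con xt) (seq_cvgM hc (cvg_con0 xt)); rewrite mulr0 subr0 in h1; 
  apply: cvg_trans h1; apply: near_eq_cvg; near=> n.
  rewrite natrB; last by near: n; exact: nbhs_infty_ge.
  by rewrite mulrBl.
move=> /(_ hC hl) hcv; apply: cvg_trans hcv; apply: near_eq_cvg; apply: nearW => n.
exact: meanE (bh n).
Unshelve. all: by end_near. Qed.

Let pois_ge0 k t : 0 <= t -> 0 <= pois k t.
Proof. by move=> t0; rewrite mulr_ge0 ?expR_ge0// divr_ge0// exprn_ge0. Qed.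

Let PI k := (\int[leb]_(t in `[xi, +oo[) (pois k t * pd t)%:E)%E.

Let mpois k : measurable_fun setT (fun t => pois k t * pd t).
Proof.
apply: measurable_funM; last exact: measurable_pdens.
apply: measurable_funM; first by apply: measurable_funM => //; exact: measurable_funX.
by apply: measurableT_comp => //; exact: measurableT_comp.
Qed.

Let PI_ge0 k : (0 <= PI k)%E.
Proof.
apply: integral_ge0 => t; rewrite /= in_itv /= andbT => xt; rewrite lee_fin mulr_ge0 ?(pdens_ge0 hp)//.
by apply: pois_ge0; apply: le_trans xt; exact: ltW.
Qed.

(** At most 1, as a limit of probabilities. *)
Let PI_fin k : PI k \is a fin_num.
Proof.
have h := @single_cvg 0 k.
rewrite ge0_fin_numE//; apply: (@le_lt_trans _ _ 1%E); last exact: ltry.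
rewrite /PI -(cvg_lim _ h)//; apply: lime_le; first by apply/cvg_ex; exists (PI k).
apply: nearW => n; rewrite lee_fin -[leRHS](mean_cst (F n) 1).
apply: mean_le; [exact: (bmeas_bin (Dn n) (F n) unif (n - 0) (pred1 k))|exact: bmeas_cst|move=> r].
by case/andP: (bin_exp01 (n - 0) (pred1 k) (conp01 (Dn n) (F n) unif r)).
Qed.

(** Mixing the Poisson weights [t^k exp (- t) / k!] over the Pareto density leaves the integrand of
    the incomplete gamma function. *)
Lemma limit_degree_pmfE k : limit_degree_pmf alpha nu k = fine (PI k).
Proof.
have [a0 n0] := par.
pose c := 2 * alpha * xi `^ (2 * alpha) / k`!%:R.
have f0 : 0 < k`!%:R :> R by rewrite ltr0n fact_gt0.
have c0 : 0 < c by rewrite divr_gt0// !mulr_gt0 ?powR_gt0//; lra.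
pose g t := t `^ (k%:R - 2 * alpha - 1) * expR (- t).
have mg : measurable_fun setT g.
  apply: measurable_funM; first exact: measurable_powR.
  by apply: measurableT_comp => //; exact: measurableT_comp.
have e : PI k = (c%:E * \int[leb]_(t in `[xi, +oo[) (g t)%:E)%E.
  rewrite -ge0_integralZl//; last 3 first.
  - by apply/measurable_EFinP; exact: measurable_funTS.
  - by move=> t _; rewrite lee_fin mulr_ge0 ?powR_ge0 ?expR_ge0.
  - by rewrite lee_fin ltW.
  apply: eq_integral => t; rewrite inE /= in_itv /= andbT => xt; rewrite -EFinM; congr (_%:E).
  have t0 : 0 < t by exact: lt_le_trans xt.
  rewrite /pois /pdens /c /g -powR_mulrn ?(ltW t0)//.
  have -> : k%:R - 2 * alpha - 1 = k%:R + (- (2 * alpha + 1)) :> R by ring.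
  rewrite powRD; last by apply/implyP => _; rewrite gt_eqF.
  by field; rewrite gt_eqF.
rewrite e /limit_degree_pmf /upper_gamma /Rintegral -/(g _).
have I0 : (0 <= \int[leb]_(t in `[xi, +oo[) (g t)%:E)%E.
  by apply: integral_ge0 => t _; rewrite lee_fin mulr_ge0 ?powR_ge0 ?expR_ge0.
have Ifin : (\int[leb]_(t in `[xi, +oo[) (g t)%:E)%E \is a fin_num.
  have := PI_fin k; rewrite e; case: (\int[leb]_(t in `[xi, +oo[) (g t)%:E)%E I0 => //= _.
  by rewrite mulry gtr0_sg// mul1e.
rewrite -{2}(fineK Ifin) -EFinM /=.
by rewrite /c mulrAC.
Qed.

(** On [[xi, xi + 1]] the integrand is at least a positive constant. *)
Lemma limit_degree_pmf_gt0 k : 0 < limit_degree_pmf alpha nu k.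
Proof.
have [a0 n0] := par; have x0 := xi0.
rewrite limit_degree_pmfE -lte_fin fineK//.
have [y yE] : exists y, y = xi + 1 by exists (xi + 1).
have xy : xi < y by rewrite yE ltrDl.
pose c := xi ^+ k / k`!%:R * expR (- y) * pd y.
have x1 : 0 < y by exact: lt_trans xy.
have f0 : 0 < k`!%:R :> R by rewrite ltr0n fact_gt0.
have c0 : 0 < c.
  rewrite mulr_gt0//; first by rewrite mulr_gt0 ?expR_gt0// divr_gt0// exprn_gt0.
  by rewrite pdens_exp// mulr_gt0 ?expR_gt0// divr_gt0//; lra.
have mI : measurable (`[xi, y]%classic : set R) by exact: measurable_itv.
have sI : (`[xi, y]%classic `<=` `[xi, +oo[)%classic.
  by move=> t; rewrite /= !in_itv /= andbT => /andP[].
apply: (@lt_le_trans _ _ (\int[leb]_(t in `[xi, y]) c%:E)%E).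
  rewrite integral_cst//= lebesgue_measure_itv /= lte_fin xy -EFinD.
  by rewrite -EFinM lte_fin mulr_gt0// subr_gt0.
apply: (@le_trans _ _ (\int[leb]_(t in `[xi, y]) (pois k t * pd t)%:E)%E).
  apply: ge0_le_integral => //.
  - by move=> t _; rewrite lee_fin ltW.
  - by apply/measurable_EFinP; exact: (measurable_funTS (@mpois k)).
  - move=> t; rewrite /= in_itv /= => /andP[xt tx]; rewrite lee_fin.
    have t0 : 0 < t by exact: lt_le_trans xt.
    apply: ler_pM; [by rewrite mulr_ge0 ?expR_ge0// divr_ge0// exprn_ge0// ltW|exact: (pdens_ge0 hp)| |].
      apply: ler_pM; [by rewrite divr_ge0// exprn_ge0// ltW|exact: expR_ge0| |by rewrite ler_expR lerN2].
      by rewrite ler_pM2r ?invr_gt0// lerXn2r// nnegrE ltW.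
    rewrite !pdens_exp// ler_wpM2l//; first by rewrite divr_ge0 ?(ltW x0)//; lra.
    rewrite ler_expR lerN2 ler_wpM2l//; first by lra.
    by rewrite lerD2r ler_ln.
apply: ge0_subset_integral => //.
- by apply/measurable_EFinP; exact: (measurable_funTS (@mpois k)).
- move=> t; rewrite /= in_itv /= andbT => xt; rewrite lee_fin mulr_ge0 ?(pdens_ge0 hp)//.
  by apply: pois_ge0; apply: le_trans xt; exact: ltW.
Qed.

Lemma cvg_single m k : mean (F n) (fun r => bin_exp (con n r) (n - m) (fun a => (a == k)%:R))
  @[n --> \oo] --> limit_degree_pmf alpha nu k.
Proof.
rewrite limit_degree_pmfE; have := @single_cvg m k.
by rewrite -/(PI k) -(fineK (PI_fin k)) => /fine_cvg; rewrite fineK.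
Qed.

(** At a fixed expected degree [n con^2] tends to 0, and [con <= 1] lets it inherit the dominating
    function of [n con]. It measures the expected number of common neighbours of two vertices. *)
Lemma cvg_mean_con2 : n%:R * mean (F n) (fun r => con n r ^+ 2) @[n --> \oo] --> (0 : R).
Proof.
have near_F : \forall n \near \oo, forall x, F n `]-oo, x]%classic = (rcdf alpha (Dn n) x)%:E.
  by near=> n; apply: FE; near: n; exact: nbhs_infty_gtr.
pose h (n : nat) r := n%:R * con n r ^+ 2.
have bc n : bmeas (con n).
  have mb : measurable_fun setT (fun p : R * (R * R) => adj (Dn n) (p.1, 0) p.2).
    apply: measurable_adjT; last exact: measurable_snd.
    by apply/measurable_fun_pairP; split; [exact: measurable_fst|exact: measurable_cst].
  exact: (bmeas_pr (F n \x unif)%E mb).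
have bh n : bmeas (h n) by apply: bmeasM; [exact: bmeas_cst|exact: bmeasX].
have h0 n r : 0 <= h n r by rewrite mulr_ge0// sqr_ge0.
have hC : \forall n \near \oo, forall r, 0 <= r <= Dn n -> h n r <= C0 * weight (Dn n) r.
  have := near_con_le; apply: filterS => n hn r hr; apply: le_trans (hn r hr).
  rewrite /h ler_wpM2l// expr2; have /andP[p0 p1] := conp01 (Dn n) (F n) unif r.
  by rewrite ler_piMl.
have hl t : xi <= t -> h n (rd n t) @[n --> \oo] --> (0 : R).
  move=> xt; have := seq_cvgM (cvg_con xt) (cvg_con0 xt); rewrite mulr0.
  by under eq_fun do rewrite -mulrA -expr2.
have := @radial_limit R alpha xi hp (fun n => Dn n) F h (fun=> 0) C0 (cvg_radius par) near_F (fun n => proj1 (bh n)) h0 hC hl.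
rewrite (eq_integral (fun=> 0%E)); last by move=> t _; rewrite mul0r.
rewrite integral0 => h1.
have -> : (fun n => n%:R * mean (F n) (fun r => con n r ^+ 2)) = fun n => mean (F n) (h n).
  by apply/funext => n; rewrite meanZ//; exact: bmeasX.
apply: fine_cvg; apply: cvg_trans h1; apply: near_eq_cvg; apply: nearW => n.
by [].
Unshelve. all: by end_near. Qed.

Section pair.
Context (n' : nat) (D : R) (G : probability R R).
Let mu := (G \x unif)%E.
Let PP := (prodn mu 2 \x prodn mu n')%E.
Local Notation cn := (conp D G unif).
Let E := (R * R)%type.

Lemma pr_joint1 k : pr (prodn mu 1 \x prodn mu n')%E (@jointdeg R D 1 n' k) =
  mean G (fun r => bin_exp (cn r) n' (fun a => (a == k)%:R)).
Proof.
have mT : measurable_fun setT (fun _ : R => true) by exact: measurable_cst.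
have h := pr_degree D G unifU n' (pred1 k) mT.
have -> : mean G (fun r => bin_exp (cn r) n' (fun a => (a == k)%:R)) =
    pr (mu \x prodn mu n')%E (fun p => ndeg D p.1 p.2 == k).
  by rewrite h; congr (mean _ _); apply/funext => r; rewrite mul1r.
have mnd : measurable_fun setT (fun p : E * n'.-tuple E => ndeg D p.1 p.2 == k).
  apply: (measurable_natcomp (fun j => j == k)).
  by apply: measurable_ndegT; [exact: measurable_fst|exact: measurable_snd].
rewrite !pr_prod//; last exact: measurable_jointdeg.
rewrite -(mean_tnth mu (m := 1) (ord0 : 'I_1) (bmeas_pr (prodn mu n') mnd) (fun x => pr_ge0 _ _)).
congr (mean _ _); apply/funext => v; congr (pr _ _); apply/funext => w /=.
have i0 : ideg D v ord0 = 0%N.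
  by apply: eq_card0 => j; rewrite !inE (ord1 j) eqxx.
by apply/forallP/idP => [/(_ ord0)|h1 i]; rewrite ?(ord1 i) i0 addn0.
Qed.

Lemma bmeas_conp : bmeas cn.
Proof.
have mb : measurable_fun setT (fun p : R * E => adj D (p.1, 0) p.2).
  apply: measurable_adjT; last exact: measurable_snd.
  by apply/measurable_fun_pairP; split; [exact: measurable_fst|exact: measurable_cst].
exact: (bmeas_pr mu mb).
Qed.

Let q (v : 2.-tuple E) : R := pr mu (fun w => adj D (tnth v ord0) w && adj D (tnth v ord_max) w).

Let p (v : 2.-tuple E) i : R := cn (tnth v i).1.

Let m_in : measurable_fun setT (fun v : 2.-tuple E => [forall i, inrange (tnth v i).2]).
Proof.
apply: (measurable_forallb R) => i; apply: (measurableT_comp measurable_inrange).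
by apply: (measurableT_comp measurable_snd); exact: measurable_tnth.
Qed.

Let pr_in : pr (prodn mu 2) (fun v : 2.-tuple E => [forall i, inrange (tnth v i).2]) = 1.
Proof.
rewrite /pr (_ : [set x | _] = rect (fun=> [set v | inrange v.2])); last first.
  by apply/seteqP; split => w /= => [/forallP|h]; [|apply/forallP].
have mi2 : measurable_fun setT (fun v : E => inrange v.2) by exact: (measurableT_comp measurable_inrange measurable_snd).
rewrite prodn_rect/=; last by move=> i; exact: measurable_event.
have h1 : fine (mu [set v | inrange v.2]) = 1.
  transitivity (pr mu (fun v => inrange v.2)) => //.
  rewrite pr_prod//= (_ : (fun x => _) = fun=> 1) ?mean_cst//.
  by apply/funext => x; exact: pr_inrange.
by rewrite big1// => i _.
Qed.

(** Both [r] and [p0 * p1] are admissible joint probabilities, so [bin_exp2_dist] replaces the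
    correlated pair by an independent one. *)
Let pair_bound (p0 p1 r : R) k : 0 <= p0 -> p0 <= 1 -> 0 <= p1 -> p1 <= 1 -> 0 <= r -> r <= p0 -> r <= p1 ->
  0 <= 1 - p0 - p1 + r ->
  bin_exp2 p0 p1 r n' (fun a b => (a == k)%:R * (b == k)%:R) <=
  bin_exp p0 n' (fun a => (a == k)%:R) * bin_exp p1 n' (fun a => (a == k)%:R) + n'%:R * 4 * (r + p0 * p1).
Proof.
move=> p00 p01 p10 p11 q0 qp0 qp1 qq.
have r0 : 0 <= p0 * p1 by rewrite mulr_ge0.
have r1 : p0 * p1 <= p0 by rewrite ler_piMr.
have r2 : p0 * p1 <= p1 by rewrite ler_piMl.
have r3 : 0 <= 1 - p0 - p1 + p0 * p1.
  have -> : 1 - p0 - p1 + p0 * p1 = (1 - p0) * (1 - p1) by ring.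
  by rewrite mulr_ge0 ?subr_ge0.
have hb a b : 0 <= ((a == k)%:R * (b == k)%:R : R) <= 1.
  by case: (a == k); case: (b == k); rewrite ?mul0r ?mulr0 ?mulr1 ?lexx ?ler01.
have := bin_exp2_dist n' q0 qp0 qp1 qq r0 r1 r2 r3 hb.
rewrite (bin_exp2_prod p0 p1 n' (fun a => (a == k)%:R) (fun b => (b == k)%:R)).
move=> /(le_trans (ler_norm _)); rewrite lerBlDl => h; apply: (le_trans h).
rewrite lerD2l -mulrA ler_wpM2l// ler_wpM2l//.
by apply: (le_trans (ler_normB _ _)); rewrite !ger0_norm.
Qed.

Let complement_aux (p0 p1 r x y : R) : 1 - p0 = x + y -> p1 = r + x -> 0 <= y -> 0 <= 1 - p0 - p1 + r.
Proof. lra. Qed.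

Let pair_aux (n x y : R) : n * 4 * y <= n * 4 * x -> n * 4 * (x + y) <= n * (8 * x).
Proof. lra. Qed.

(** The three terms are the probability that the two vertices are adjacent, the product for
    independent degrees, and the cost of the correlation through common neighbours. *)
Lemma joint2_le k :
  pr PP (@jointdeg R D 2 n' k) <=
  mean G cn + mean G (fun r => bin_exp (cn r) n' (fun a => (a == k)%:R)) ^+ 2
  + n'%:R * (8 * mean G (fun r => cn r ^+ 2)).
Proof.
have bc := bmeas_conp.
pose ad (pp : 2.-tuple E * n'.-tuple E) := adj D (tnth pp.1 ord0) (tnth pp.1 ord_max).
have mad : measurable_fun setT ad by apply: measurable_adjT; exact: measurable_tnth1.
have md := @measurable_alldeg R D 2 n' k.
have mi2 : measurable_fun setT (fun v : E => inrange v.2) by exact: (measurableT_comp measurable_inrange measurable_snd).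
have pi2 : pr mu (fun v => inrange v.2) = 1.
  rewrite pr_prod//= (_ : (fun x => _) = fun=> 1) ?mean_cst//.
  by apply/funext => x; exact: pr_inrange.
(* Either the two vertices are adjacent, or both degrees are purely external. *)
apply: (@le_trans _ _ (pr PP ad + pr PP (@alldeg R D 2 n' k))).
  apply: le_trans (pr_or _ mad md); apply: le_pr; [exact: measurable_jointdeg|exact: measurable_or|].
  move=> pp /forallP hj; case: (boolP (ad pp)) => //= nad; apply/forallP => i.
  have := hj i; rewrite (_ : ideg D pp.1 i = 0%N) ?addn0//.
  apply: eq_card0 => j; rewrite !inE; apply/negP => /andP[ji hadj]; move/negP: nad; apply.
  case: i j ji hadj {hj} => [[|[|//]] i2] [[|[|//]] j2] //= ji; rewrite /ad.
    by rewrite (_ : Ordinal i2 = ord0) 1?(_ : Ordinal j2 = ord_max)//; exact: val_inj.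
  by rewrite (_ : Ordinal j2 = ord0) 1?(_ : Ordinal i2 = ord_max) 1?adjC//; exact: val_inj.
rewrite -addrA; apply: lerD.
  rewrite pr_prod// (_ : (fun x => _) = fun v => ((adj D (tnth v ord0) (tnth v ord_max))%:R : R)); last first.
    apply/funext => v; rewrite /ad /pr /=; case: (adj _ _ _).
      by rewrite (_ : [set x | _] = setT) ?probability_setT//; apply/seteqP; split.
    by rewrite (_ : [set x | _] = set0) ?measure0//; apply/seteqP; split.
  have ma : measurable_fun setT (fun x : E * E => adj D x.1 x.2) by exact: measurable_adj.
  rewrite mean_bool; last by apply: measurable_adjT; exact: measurable_tnth.
  have h := @pr_tnth2 R _ _ mu 2 ord0 ord_max (fun x => adj D x.1 x.2) (erefl _) ma.
  rewrite /= in h; rewrite h.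
  rewrite -(mean_fst G unif bc (fun x => proj1 (andP (conp01 D G unif x)))).
  apply: (mean_le_ae mi2 pi2 (bmeas_pr mu ma)).
    by have [mc [B hB]] := bc; split; [exact: (measurableT_comp mc measurable_fst)|exists B => x; exact: hB].
  by move=> [r u] /= hu; rewrite (conpE D G unifU r hu).
have p01 v i : 0 <= p v i <= 1 by exact: conp01.
pose bn x := bin_exp x n' (fun a => (a == k)%:R) : R.
have mq : measurable_fun setT (fun z : 2.-tuple E * E => adj D (tnth z.1 ord0) z.2 && adj D (tnth z.1 ord_max) z.2).
  apply: measurable_and; apply: measurable_adjT; try exact: measurable_snd.
    by apply: (measurableT_comp (measurable_tnth ord0)); exact: measurable_fst.
  by apply: (measurableT_comp (measurable_tnth ord_max)); exact: measurable_fst.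
have bq : bmeas q := bmeas_pr mu mq.
have bp i : bmeas (fun v => p v i).
  have [mc [B hB]] := bc; split; last by exists B => v; exact: hB.
  apply: (measurableT_comp mc); apply: (measurableT_comp measurable_fst); exact: measurable_tnth.
have bbn : bmeas (fun r => bn (cn r)) := bmeas_bin D G unif n' (pred1 k).
have bbp i : bmeas (fun v : 2.-tuple E => bn (p v i)).
  have [mc [B hB]] := bbn; split; last by exists B => v; exact: hB.
  apply: (measurableT_comp mc); apply: (measurableT_comp measurable_fst); exact: measurable_tnth.
have bpp := bmeasM (bp ord0) (bp ord_max).
have bb2 := bmeasM (bbp ord0) (bbp ord_max).
have bqp := bmeasD bq bpp.
have bq4 : bmeas (fun v : 2.-tuple E => n'%:R * 4 * (q v + p v ord0 * p v ord_max)).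
  by have bcst : bmeas (fun _ : 2.-tuple E => n'%:R * 4 : R) := bmeas_cst _ _; exact: (bmeasM bcst bqp).
rewrite pr_prod//.
apply: (@le_trans _ _ (mean (prodn mu 2) (fun v => bn (p v ord0) * bn (p v ord_max) + n'%:R * 4 * (q v + p v ord0 * p v ord_max)))).
  apply: (mean_le_ae m_in pr_in (bmeas_pr (prodn mu n') md)).
    exact: (bmeasD bb2 bq4).
  move=> v /forallP hv.
  have a0 : pr mu (adj D (tnth v ord0)) = p v ord0.
    by have := hv ord0; rewrite /p; case: (tnth v ord0) => r u /= hu; exact: conpE.
  have a1 : pr mu (adj D (tnth v ord_max)) = p v ord_max.
    by have := hv ord_max; rewrite /p; case: (tnth v ord_max) => r u /= hu; exact: conpE.
  have m0 := measurable_adj1 D (tnth v ord0); have m1 := measurable_adj1 D (tnth v ord_max).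
  have hh a b : 0 <= ((a == k)%:R * (b == k)%:R : R) by [].
  have := count_law2 mu m0 m1 n' hh; rewrite a0 a1 -/(q v) => hc.
  have -> : pr (prodn mu n') (fun w => alldeg D k (v, w)) = bin_exp2 (p v ord0) (p v ord_max) (q v) n' (fun a b => (a == k)%:R * (b == k)%:R).
    rewrite -mean_bool; last exact: (measurableT_comp md (pair1_measurable v)).
    rewrite /mean -[RHS]/(fine (_%:E)) -hc; congr fine; apply: eq_integral => w _; congr (_%:E).
    rewrite -natrM mulnb; congr (_%:R); congr nat_of_bool; rewrite /alldeg /=.
    apply/forallP/andP => [h|[h0 h1] i]; first by split; exact: h.
    case: i => [[|[|//]] i2]; first by rewrite (_ : Ordinal i2 = ord0)//; exact: val_inj.
    by rewrite (_ : Ordinal i2 = ord_max)//; exact: val_inj.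
  have /andP[p00 p01'] := p01 v ord0; have /andP[p10 p11] := p01 v ord_max.
  have q0 : 0 <= q v by exact: pr_ge0.
  have qp0 : q v <= p v ord0 by rewrite -a0; apply: le_pr => [||x /andP[]//]; [exact: measurable_and|exact: m0].
  have qp1 : q v <= p v ord_max by rewrite -a1; apply: le_pr => [||x /andP[]//]; [exact: measurable_and|exact: m1].
  have qq : 0 <= 1 - p v ord0 - p v ord_max + q v.
    have := pr_split mu (measurable_neg m0) m1.
    rewrite (pr_neg mu m0) a0 => e1.
    have := pr_split mu m1 m0; rewrite a1 => e2.
    have e3 : pr mu (fun x => adj D (tnth v ord_max) x && adj D (tnth v ord0) x) = q v by congr (pr _ _); apply/funext => x; rewrite andbC.
    have e4 : pr mu (fun x => ~~ adj D (tnth v ord0) x && adj D (tnth v ord_max) x) = pr mu (fun x => adj D (tnth v ord_max) x && ~~ adj D (tnth v ord0) x) by congr (pr _ _); apply/funext => x; rewrite andbC.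
    have := pr_ge0 mu (fun x => ~~ adj D (tnth v ord0) x && ~~ adj D (tnth v ord_max) x).
    rewrite e3 in e2; rewrite e4 in e1; exact: complement_aux e1 e2.
  exact: pair_bound.
rewrite (meanD _ bb2 bq4) (meanZ _ _ bqp) (meanD _ bq bpp).
have prod2 (f : R -> R) : bmeas f -> (forall x, 0 <= f x) ->
    mean (prodn mu 2) (fun v => f (tnth v ord0).1 * f (tnth v ord_max).1) = mean G f ^+ 2.
  move=> [mf [B hB]] f0.
  have bf : bmeas (fun x : E => f x.1) by split; [exact: (measurableT_comp mf measurable_fst)|exists B => x; exact: hB].
  have bf' : bmeas f by split => //; exists B.
  have := mean_prodn mu (n := 2) (f := fun _ (x : E) => f x.1) (fun _ => bf) (fun _ x => f0 x.1).
  rewrite big_const_ord /= mulr1 (mean_fst G unif bf' f0) -expr2 => <-; congr (mean _ _).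
  by apply/funext => v; rewrite big_ord_recr big_ord1 /=; congr (f (tnth v _).1 * f (tnth v _).1); exact: val_inj.
have c0 x : 0 <= cn x by case/andP: (conp01 D G unif x).
have -> : mean (prodn mu 2) (fun v => bn (p v ord0) * bn (p v ord_max)) = mean G (fun r => bn (cn r)) ^+ 2.
  by apply: (prod2 (fun r => bn (cn r))) => // x; case/andP: (bin_exp01 n' (pred1 k) (conp01 D G unif x)).
have -> : mean (prodn mu 2) (fun v => p v ord0 * p v ord_max) = mean G cn ^+ 2 by exact: prod2.
(* Integrate over the common neighbour last: given it, the two adjacencies are independent. *)
have -> : mean (prodn mu 2) q = mean G (fun r => cn r ^+ 2).
  transitivity (mean mu (fun w => pr (prodn mu 2) (fun v => adj D (tnth v ord0) w && adj D (tnth v ord_max) w))).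
    exact: (pr_prodC _ _ mq).
  rewrite -(mean_fst G unif (bmeasX 2 bc) (fun x => sqr_ge0 _)).
  pose swp (z : E * 2.-tuple E) := (z.2, z.1).
  have mswp : measurable_fun setT swp by apply/measurable_fun_pairP; split; [exact: measurable_snd|exact: measurable_fst].
  have [msw _] := bmeas_pr (prodn mu 2) (measurableT_comp mq mswp).
  have [mc2 _] := bmeasX 2 bc.
  apply: (mean_eq_ae mi2 pi2 msw (measurableT_comp mc2 measurable_fst)) => -[s u] hu /=.
  rewrite /pr (_ : [set x | _] = rect (fun=> [set v | adj D (s, u) v])); last first.
    apply/seteqP; split => v /=; rewrite ![adj D _ (s, u)]adjC; last by move=> h; rewrite !h.
    move=> /andP[h0 h1] [[|[|//]] i2]; first by rewrite (_ : Ordinal i2 = ord0)//; exact: val_inj.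
    by rewrite (_ : Ordinal i2 = ord_max)//; exact: val_inj.
  rewrite prodn_rect; last by move=> i; apply: measurable_event; exact: measurable_adj1.
  by rewrite /= big_const_ord iter_mulr_1 -(conpE D G unifU s hu).
rewrite lerD2l.
have j2 := @jensen_pow R _ _ G cn 2 bc c0.
have : n'%:R * 4 * mean G cn ^+ 2 <= n'%:R * 4 * mean G (fun x => cn x ^+ 2) by rewrite ler_wpM2l.
exact: pair_aux.
Qed.

End pair.

End fixed_degree.

(** * Degrees beyond the critical scale *)

Section large_degree.
Context {R : realType}.
Context (alpha nu : R) (F : nat -> probability R R) (unif : probability R R).
Hypothesis par : 1 / 2 < alpha /\ 0 < nu.
Hypothesis unifU : forall A, measurable A -> unif A = uniform_prob (@ltNpi_pi R) A.
Local Notation Dn := (disk_radius nu).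
Local Notation xi := (kpkvb_xi alpha nu).
Hypothesis FE : forall n, nu < n%:R -> forall x, F n `]-oo, x]%classic = (rcdf alpha (Dn n) x)%:E.
Local Notation pd := (pdens alpha xi).
Local Notation con n := (conp (Dn n) (F n) unif).
Local Notation rd n t := (rad (Dn n) xi t).
Local Notation G n := (rcdf alpha (Dn n)).
Local Notation T n r := (xi * weight (Dn n) r).

Let xi0 : 0 < xi. Proof. exact: xi_gt0 par. Qed.
Let w0 : R := 2 * alpha / (2 * alpha - 1).
Let C0 : R := 6 * nu * (w0 + 1).
Let C00 : 0 < C0.
Proof.
have [a0 n0] := par; rewrite /C0 mulr_gt0// ?mulr_gt0// addr_gt0// divr_gt0; lra.
Qed.
(** Expected degree below [c k] in the limiting scale forces the true mean degree below [k / 8], by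
    [near_con_le]. *)
Let c : R := xi / (8 * C0).
Let c0 : 0 < c. Proof. by rewrite divr_gt0// mulr_gt0. Qed.

Let exp_half_gt1 : 1 < expR (1 / 2) :> R.
Proof. by rewrite -[ltLHS]expR0 ltr_expR divr_gt0. Qed.

Let strip_pos : 0 < 2 * alpha * expR (- alpha) * (expR (1 / 2) - 1).
Proof.
have [a0 _] := par; have h := exp_half_gt1.
by apply: mulr_gt0; [apply: mulr_gt0; [lra|exact: expR_gt0]|rewrite subr_gt0].
Qed.

Lemma cvg_expN_radius (c1 : R) : 0 < c1 -> expR (- (c1 * Dn n)) @[n --> \oo] --> (0 : R).
Proof.
move=> c10; apply/cvgrPdist_le => eps eps0; near=> n.
have h : eps^-1 / c1 <= Dn n by near: n; move/cvgryPge: (cvg_radius par); apply.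
rewrite sub0r normrN ger0_norm ?expR_ge0// expRN -[leRHS]invrK lef_pV2 ?posrE ?expR_gt0 ?invr_gt0//.
apply: le_trans (expR_ge1Dx _); rewrite ler_wpDl//; by rewrite mulrC -ler_pdivrMr.
Unshelve. all: by end_near. Qed.

(** The expected number of vertices within a fixed radius is of order [n exp (- alpha D)], that is
    [n^(1 - 2 alpha)]. *)
Lemma cvg_low_radius (a : R) : 0 <= a -> n%:R * G n a @[n --> \oo] --> (0 : R).
Proof.
have [a0 n0] := par; move=> a00.
have h0 := cvg_expN_radius (_ : 0 < alpha - 1 / 2); rewrite subr_gt0 in h0; have {}h0 := h0 a0.
have hc : (fun _ : nat => 4 * cosh (alpha * a) * nu) n @[n --> \oo] --> 4 * cosh (alpha * a) * nu by exact: cvg_cst.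
have := seq_cvgM hc h0; rewrite mulr0 => h1.
apply: (squeeze_cvgr _ (cvg_cst (0 : R)) h1); near=> n.
have nn : nu < n%:R by near: n; exact: nbhs_infty_gtr.
have aD : a <= Dn n by near: n; move/cvgryPge: (cvg_radius par); apply.
have D4 : 4 / alpha <= Dn n by near: n; move/cvgryPge: (cvg_radius par); apply.
have D0 := radius_gt0 par nn; have nR : 0 < n%:R :> R by exact: lt_trans nn.
have ch : 1 <= cosh (alpha * a) by exact: cosh_ge1.
rewrite (rcdf_in _ a00 aD).
have aD4 : 4 <= alpha * Dn n by rewrite mulrC -ler_pdivrMr//; lra.
have den : expR (alpha * Dn n) / 4 <= cosh (alpha * Dn n) - 1.
  rewrite /cosh; have := expR_gt0 (- (alpha * Dn n)); have := expR_ge1Dx (alpha * Dn n); lra.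
have den0 : 0 < cosh (alpha * Dn n) - 1 by apply: lt_le_trans den; rewrite divr_gt0 ?expR_gt0.
apply/andP; split; first by rewrite mulr_ge0// divr_ge0 ?(ltW den0)// subr_ge0.
have -> : 4 * cosh (alpha * a) * nu * expR (- ((alpha - 1 / 2) * Dn n)) = n%:R * (cosh (alpha * a) / (expR (alpha * Dn n) / 4)).
  have -> : - ((alpha - 1 / 2) * Dn n) = Dn n / 2 - alpha * Dn n by field.
  have z1 : expR (alpha * Dn n) != 0 by rewrite gt_eqF// expR_gt0.
  have z2 : nu != 0 by rewrite gt_eqF.
  by rewrite expRD expRN (exp_radius par nn); move: (expR _) (cosh _) z1 => e C z1; field; rewrite z1 z2.
rewrite ler_pM2l//; apply: ler_pM; [lra|by rewrite invr_ge0 ltW|lra|].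
by rewrite lef_pV2// ?posrE// divr_gt0 ?expR_gt0.
Unshelve. all: by end_near. Qed.

(** The outermost strip of width 1 has mass bounded below, and weights there are at least 1. *)
Lemma strip_mass n : nu < n%:R -> 2 <= Dn n ->
  (1 - expR (- (2 * alpha))) * (2 * alpha * expR (- alpha) * (expR (1 / 2) - 1)) <=
  lweight (Dn n) (F n) (fun s => Dn n - 1 <= s).
Proof.
have [a0 n0] := par; move=> nn D2; have D0 := radius_gt0 par nn.
have hp : 1 / 2 < alpha /\ 0 < Dn n by [].
have x0 : 0 <= Dn n - 1 by lra.
have xy : Dn n - 1 <= Dn n by lra.
have := rcdf_increment_ge hp x0 xy (lexx _).
have -> : alpha * (Dn n - 1 - Dn n) = - alpha by ring.
rewrite /weight subrr mul0r expR0 divr1 (_ : Dn n - (Dn n - 1) = 1); last by ring.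
move=> h.
have e1 : expR (- (2 * alpha * (Dn n - 1))) <= expR (- (2 * alpha)).
  rewrite ler_expR lerN2; have : 2 * alpha * 1 <= 2 * alpha * (Dn n - 1) by apply: ler_wpM2l; lra.
  lra.
have K0 : 0 <= 2 * alpha * expR (- alpha) * (expR (1 / 2) - 1).
  exact: ltW strip_pos.
apply: (@le_trans _ _ (G n (Dn n) - G n (Dn n - 1))).
  by apply: le_trans h; apply: ler_wpM2r => //; lra.
rewrite -(pr_radius_oc (FE nn) xy).
have m1 : measurable_fun setT (fun s : R => Dn n - 1 < s <= Dn n).
  by apply: measurable_and; [exact: measurable_fun_ltr|exact: measurable_fun_ler].
have mL : measurable_fun setT (fun s : R => Dn n - 1 <= s) by exact: measurable_fun_ler.
have bL : bmeas (fun s => (Dn n - 1 <= s)%R%:R * cwt (Dn n) s).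
  by apply: bmeasM; [exact: bmeas_bool|exact: (bmeas_cwt hp)].
rewrite -(mean_bool _ m1); apply: (mean_le _ (bmeas_bool m1) bL) => s.
case: (boolP (_ && _)) => [/andP[s1 s2]|_]; last by rewrite mulr_ge0// expR_ge0.
rewrite (ltW s1) mul1r cwt_id//; last by apply: ltW; apply: le_lt_trans s1.
by rewrite -[leLHS]expR0 ler_expR; lra.
Qed.

Let large_aux1 (e : R) : e <= 1 / 4 -> 1 <= 2 * (1 - 2 * e). Proof. lra. Qed.

Let large_aux2 (e : R) : e <= 1 / 16 -> 1 / 2 <= 1 - 8 * e. Proof. lra. Qed.

Let large_aux3 (m q' p u C : R) : m * q' <= m * p -> C * (m * p) + (u + m * (8 * q')) <= u + (8 + C) * (m * p).
Proof. lra. Qed.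

Let pi_aux1 (l v p m : R) : p != 0 -> m != 0 -> l * v / (p * m) = 2 / p * (1 / 2) * l * (v / m).
Proof. by move=> h1 h2; field; rewrite h1 h2. Qed.

Let pi_aux2 (m p x l v y w : R) : p != 0 -> m != 0 -> l != 0 -> v != 0 ->
  2 * (y * (x * w)) = m * (2 * p * x / (l * v)) * y * (l * v / (p * m) * w).
Proof. by move=> h1 h2 h3 h4; field; rewrite h1 h2 h3 h4. Qed.

Let pi_aux3 (m C' u y : R) : m != 0 -> m * (m * C' * (u * y) / m) = u * C' * (m * y).
Proof. by move=> h; field. Qed.

Let large_aux4 : [/\ (0 : R) < 7 / 8, (7 / 8 : R) < 1, 0 <= (1 - 7 / 8 : R) & (1 - 7 / 8 : R) = 8^-1].
Proof. by split; lra. Qed.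

(** Radii below [a] carry no vertices in the limit, radii above [b] fall to Chernoff. Between them
    the rank comparison is used for one vertex, with thresholds of the outermost strip only: this
    costs a constant factor but works at all radii above [a], and the bound still vanishes because
    [n pd (k n)] does. *)
Lemma degree_large (k : nat -> nat) : k n @[n --> \oo] --> \oo ->
  n%:R * pd (k n)%:R @[n --> \oo] --> (0 : R) ->
  n%:R * pr (prodn (F n \x unif)%E 1 \x prodn (F n \x unif)%E (n - 1))%E (@jointdeg R (Dn n) 1 (n - 1) (k n))
    @[n --> \oo] --> (0 : R).
Proof.
have [a0 n0] := par; have xi0' := xi0; move=> koo npd.
have z0 : 0 < (16 : R)^-1 by rewrite invr_gt0.
have [M [M1 M16 _]] := ex_expN z0.
(* With [h = D - 1], the condition [D + M <= x + h] of [nbr_increment] reads [x >= M + 1]. *)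
pose a := M + 1.
have a00 : 0 <= a by rewrite /a; lra.
pose ls := (1 - expR (- (2 * alpha))) * (2 * alpha * expR (- alpha) * (expR (1 / 2) - 1)).
have ls0 : 0 < ls.
  have : expR (- (2 * alpha)) < 1 by rewrite -[ltRHS]expR0 ltr_expR; lra.
  by move=> h; apply: mulr_gt0; [rewrite subr_gt0|exact: strip_pos].
pose q : R := tailq (7 / 8).
have q01 : 0 < q < 1 by apply: tailq_lt1; lra.
have [K hK] := geometric_pdens par 1 q01 ltr01.
pose C1 := c `^ (- (2 * alpha + 1)) * (2 * pi * xi / (ls * nu)).
have cvg0 : n%:R * G n a + (8 + C1) * (n%:R * pd (k n)%:R) @[n --> \oo] --> (0 : R).
  have hc : (fun _ : nat => 8 + C1) n @[n --> \oo] --> 8 + C1 by exact: cvg_cst.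
  by have := seq_cvgD (cvg_low_radius a00) (seq_cvgM hc npd); rewrite mulr0 addr0.
have nDa : \forall n \near \oo, expR (- (alpha * Dn n)) <= 1 / 4.
  have al0 : 0 < alpha by lra.
  have q4 : 0 < (1 / 4 : R) by rewrite divr_gt0.
  have /cvgrPdist_le/(_ _ q4) := cvg_expN_radius al0; apply: filterS => n.
  by rewrite sub0r normrN; apply: le_trans; exact: ler_norm.
apply: (squeeze_cvgr _ (cvg_cst (0 : R)) cvg0); near=> n.
have nn : nu < n%:R by near: n; exact: nbhs_infty_gtr.
have nR : 0 < n%:R :> R by exact: lt_trans nn.
have D0 := radius_gt0 par nn; have hp : 1 / 2 < alpha /\ 0 < Dn n by [].
have D2 : 2 <= Dn n by near: n; move/cvgryPge: (cvg_radius par); apply.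
have DM : M + 1 <= Dn n by near: n; move/cvgryPge: (cvg_radius par); apply.
have Da : expR (- (alpha * Dn n)) <= 1 / 4.
  by near: n; exact: nDa.
have hcon : forall r, 0 <= r <= Dn n -> n%:R * con n r <= C0 * weight (Dn n) r.
  by near: n; exact: near_con_le par unifU FE.
have kK : (K <= k n)%N by near: n; move/cvgnyPge: koo; apply.
have kx : (Num.bound (xi / c) < k n)%N by near: n; move/cvgnyPge: koo; apply.
have k0 : 0 < (k n)%:R :> R by rewrite ltr0n (leq_ltn_trans _ kx).
apply/andP; split; first by rewrite mulr_ge0// pr_ge0.
pose A := c * (k n)%:R; pose b := rd n A.
have A0 : 0 < A by rewrite mulr_gt0.
have bD : b <= Dn n.
  rewrite -(rad_xi (Dn n) xi) ler_rad// /A mulrC -ler_pdivrMr//.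
  apply: (le_trans (ltW (archi_boundP _))); first by rewrite divr_ge0// ltW.
  by rewrite ler_nat ltnW.
pose L (s : R) := Dn n - 1 <= s.
have mL : measurable_fun setT L by exact: measurable_fun_ler.
pose W := n%:R * (2 * pi * xi / (ls * nu)) * pd A.
have pA0 : 0 <= pd A := pdens_ge0 (conj a0 xi0) A.
have W0 : 0 <= W.
  apply: mulr_ge0 => //; apply: mulr_ge0 => //; apply: divr_ge0; last by rewrite ltW// mulr_gt0.
  by apply: mulr_ge0; [apply: mulr_ge0 => //; exact: pi_ge0|exact: ltW].
have MDr : [/\ 1 <= M, expR (- M) <= 1 / 16 & M <= Dn n] by split => //; lra.
have HW x y : a <= x -> x <= y -> y <= b ->
    G n y - G n x <= W * (nbr (Dn n) (F n) unif L x - nbr (Dn n) (F n) unif L y).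
  move=> ax xy yb.
  have x0 : 0 <= x by exact: le_trans ax.
  have yD : y <= Dn n by exact: le_trans bD.
  have AT : A <= T n y.
    by rewrite -[leLHS](weight_rad (Dn n) xi0 A0) ler_wpM2l ?(ltW xi0)// ler_expR ler_wpM2r// lerD2l lerN2.
  have gu := G_upper par nn x0 xy yD A0 AT.
  have Mx : M <= x by apply: le_trans ax; rewrite /a lerDl.
  have Mh : M <= Dn n - 1 by lra.
  have Lh s : 0 < s <= Dn n -> L s -> Dn n - 1 <= s by [].
  have xh : Dn n + M <= x + (Dn n - 1) by move: ax; rewrite /a; lra.
  have /andP[ni _] := nbr_increment hp (FE nn) unifU mL MDr Mh Lh Mx xy yD xh.
  have dw : 0 <= weight (Dn n) x - weight (Dn n) y by rewrite subr_ge0 ler_expR ler_wpM2r// lerD2l lerN2.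
  have lsn := strip_mass nn D2.
  have eD : expR (- (Dn n / 2)) = nu / n%:R by rewrite expRN (exp_radius par nn) invf_div.
  have p0 := pi_gt0 R.
  set dG := G n y - G n x in gu *; set dn := nbr _ _ _ _ x - _ in ni *.
  have h1 : dG <= 2 * (pd A * (T n x - T n y)).
    have g0 : 0 <= dG.
      rewrite /dG subr_ge0 -(pr_radius_le (FE nn)) -(pr_radius_le (FE nn)); apply: le_pr; [exact: measurable_fun_ler..|].
      by move=> z zx; apply: le_trans xy.
    apply: (@le_trans _ _ (2 * ((1 - 2 * expR (- (alpha * Dn n))) * dG))); last by rewrite ler_pM2l.
    rewrite mulrA ler_peMl//; exact: large_aux1.
  apply: (le_trans h1).
  have h2 : ls * nu / (pi * n%:R) * (weight (Dn n) x - weight (Dn n) y) <= dn.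
    apply: le_trans ni; apply: ler_wpM2r => //; rewrite eD.
    have -> : ls * nu / (pi * n%:R) = 2 / pi * (1 / 2) * ls * (nu / n%:R) by apply: pi_aux1; rewrite gt_eqF.
    apply: ler_wpM2r; first by rewrite divr_ge0// ltW.
    apply: ler_pM; [by rewrite mulr_ge0// divr_ge0// ltW|exact: ltW| |exact: lsn].
    by apply: ler_wpM2l; [rewrite divr_ge0// ltW|exact: large_aux2].
  apply: le_trans (ler_wpM2l W0 h2); rewrite /W -mulrBr le_eqVlt; apply/orP; left; apply/eqP.
  by apply: pi_aux2; rewrite gt_eqF.
have mt : measurable_fun setT (fun _ : 1.-tuple R => true) by exact: measurable_cst.
have nmn : n = (1 + (n - 1))%N by rewrite subnKC// -(ltr0n R).
have hpro := pr_profile hp (FE nn) unifU mL (conj a00 bD) W0 HW (fun=> k n) (c := 1) nmn mt.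
have {}hpro := hpro (fun u _ _ s i _ => leq_trans (max_card _) (eq_leq (card_ord 1))).
have mo := @measurable_outlier R (Dn n) a b (n - 1) 1 (k n).
have mo1 : measurable_fun setT (fun p : 1.-tuple (R * R) * (n - 1).-tuple (R * R) => outlier (Dn n) a b 1 (k n) (tnth p.1 ord0, p.2)).
  apply: (measurableT_comp mo (g := fun p : 1.-tuple (R * R) * (n - 1).-tuple (R * R) => (tnth p.1 ord0, p.2))).
  apply/measurable_fun_pairP; split; last exact: measurable_snd.
  exact: measurable_tnth1.
have mp : measurable_fun setT (fun p : 1.-tuple (R * R) * (n - 1).-tuple (R * R) => true && profile (Dn n) a b (fun=> k n) p).
  exact: measurable_profile.
have hout := pr_outlier (Dn n) (F n) unif a b (n - 1) (k n) (ord0 : 'I_1).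
have spl : pr (prodn (F n \x unif)%E 1 \x prodn (F n \x unif)%E (n - 1))%E (@jointdeg R (Dn n) 1 (n - 1) (k n)) <=
    W / n%:R + (G n a + 8 * q ^+ k n).
  apply: (@le_trans _ _ (pr (prodn (F n \x unif)%E 1 \x prodn (F n \x unif)%E (n - 1))%E
      (fun p => (true && profile (Dn n) a b (fun=> k n) p) || outlier (Dn n) a b 1 (k n) (tnth p.1 ord0, p.2)))).
    apply: le_pr; [exact: measurable_jointdeg|exact: measurable_or|].
    move=> p /forallP /(_ ord0) hj; apply/orP.
    have i0 : ideg (Dn n) p.1 ord0 = 0%N by apply: eq_card0 => j; rewrite !inE (ord1 j) eqxx.
    rewrite i0 addn0 in hj.
    case: (boolP (window a b (tnth p.1 ord0))) => hw; last first.
      by right; rewrite /outlier /= hw /= (eqP hj) leqnn leq_subr.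
    by left; apply/forallP => i; rewrite (ord1 i) hw.
  apply: (le_trans (pr_or _ mp mo1)); apply: lerD.
    apply: (le_trans hpro); rewrite expr1 exp1n mulr1 ffactn1 ler_piMr ?pr_le1//.
    by rewrite divr_ge0.
  rewrite hout.
  have mB : measurable_fun setT (fun r : R => ~~ (a < r <= b)).
    by apply: measurable_neg; apply: measurable_and; [exact: measurable_fun_ltr|exact: measurable_fun_ler].
  have /= := pr_degree (Dn n) (F n) unifU (n - 1) (fun j => (k n - 1 <= j <= k n)%N) mB.
  rewrite /outlier /window => ->.
  have mr : measurable_fun setT (fun r : R => r <= a) by exact: measurable_fun_ler.
  have -> : G n a + 8 * q ^+ k n = mean (F n) (fun r => (r <= a)%R%:R + 8 * q ^+ k n).
    by rewrite meanD ?mean_cst ?mean_bool ?(pr_radius_le (FE nn))//; [exact: bmeas_bool|exact: bmeas_cst].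
  have b1 : bmeas (fun r : R => (~~ (a < r <= b))%:R * bin_exp (con n r) (n - 1) (fun j => (k n - 1 <= j <= k n)%N%:R)).
    apply: bmeasM; first exact: bmeas_bool.
    exact: (bmeas_bin (Dn n) (F n) unif (n - 1) (fun j => (k n - 1 <= j <= k n)%N)).
  have b2 : bmeas (fun r : R => (r <= a)%R%:R + 8 * q ^+ k n).
    by apply: bmeasD; [exact: bmeas_bool|exact: bmeas_cst].
  have ms : measurable_fun setT (fun s : R => 0 < s <= Dn n).
    by apply: measurable_and; [exact: measurable_fun_ltr|exact: measurable_fun_ler].
  apply: (mean_le_ae ms (pr_radius_support hp (FE nn)) b1 b2) => r /andP[r0 rD].
  have q0 : 0 <= 8 * q ^+ k n by rewrite mulr_ge0// exprn_ge0//; case/andP: q01 => /ltW.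
  have bin01 := bin_exp01 (n - 1) (fun j => (k n - 1 <= j <= k n)%N) (conp01 (Dn n) (F n) unif r).
  case: (leP r a) => ra /=.
    by rewrite mul1r ler_wpDr//; case/andP: bin01.
  case: (leP r b) => rb /=; first by rewrite mul0r add0r.
  rewrite mul1r add0r.
  have [h78 h781 h780 h788] := large_aux4.
  (* Beyond [b] the mean degree is at most [k / 8], so the upper tail applies with [h = 7/8]. *)
  have np : (n - 1)%:R * con n r <= (1 - 7 / 8) * (k n)%:R.
    apply: (@le_trans _ _ (n%:R * con n r)).
      by apply: ler_wpM2r; [case/andP: (conp01 (Dn n) (F n) unif r)|rewrite ler_nat leq_subr].
    have r0D : 0 <= r <= Dn n by rewrite (ltW r0).
    apply: (le_trans (hcon r r0D)).
    have wr : T n r <= A.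
      by rewrite -[leRHS](weight_rad (Dn n) xi0 A0) ler_wpM2l ?(ltW xi0)// ler_expR ler_wpM2r// lerD2l lerN2 ltW.
    rewrite h788; have -> : 8^-1 * (k n)%:R = C0 / xi * A by rewrite /A /c; move: (gt_eqF C00) (gt_eqF xi0); move: C0 (k n)%:R => u v /negbT u0 /negbT x0; field; rewrite u0 x0.
    have -> : C0 * weight (Dn n) r = C0 / xi * T n r by field; rewrite gt_eqF.
    by apply: ler_wpM2l => //; rewrite divr_ge0// ltW.
  have th := tail_high 1 (conp01 (Dn n) (F n) unif r) h78 h781 np.
  apply: (@le_trans _ _ (bin_exp (con n r) (n - 1) (fun l => (k n - 1 <= l)%N%:R))).
    apply: ler_bin_exp => [|l]; first exact: conp01.
    by rewrite ler_nat; case: (leqP (k n - 1)%N l); rewrite ?leq_b1.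
  apply: (le_trans th); apply: ler_pM.
  - by rewrite expr1 invr_ge0.
  - by apply: exprn_ge0; apply: mulr_ge0; [exact: h780|exact: expR_ge0].
  - by rewrite expr1 h788 invrK.
  - apply: lerXn2r; rewrite ?nnegrE.
    + by apply: mulr_ge0; [exact: h780|exact: expR_ge0].
    + by case/andP: q01 => /ltW.
    + by rewrite /q le_max lexx orbT.
apply: (le_trans (ler_wpM2l (ltW nR) spl)).
have hq := hK _ kK; rewrite mul1r expr1 in hq.
have eW : n%:R * (W / n%:R) = C1 * (n%:R * pd (k n)%:R).
  have eA : pd A = c `^ (- (2 * alpha + 1)) * pd (k n)%:R.
    by rewrite /A /pdens (@powRM _ c (k n)%:R _ (ltW c0) (ler0n R (k n))) mulrCA.
  by rewrite /W /C1 eA; apply: pi_aux3; rewrite gt_eqF.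
rewrite !mulrDr eW; exact: large_aux3 (ler_wpM2l (ltW nR) hq).
Unshelve. all: by end_near. Qed.

End large_degree.

(** Left half-lines give right half-lines by complement, and those form a generating pi-system. *)
Lemma prob_ext {R : realType} (m1 m2 : probability R R) :
  (forall x, m1 `]-oo, x]%classic = m2 `]-oo, x]%classic) -> forall A, measurable A -> m1 A = m2 A.
Proof.
move=> m12 A mA.
apply: (measure_unique (@RGenOInfty.G R) (fun n : nat => `]- n%:R, +oo[%classic)) => //.
- exact: (RGenOInfty.measurableE R).
- move=> _ _ [x ->] [y ->]; exists (Num.max x y).
  apply/seteqP; split => z /=; rewrite !in_itv /= !andbT gt_max; first by move=> [-> ->].
  by move=> /andP[].
- by move=> n; exists (- n%:R).
- apply/seteqP; split => // x _; exists (Num.bound `|x|) => //=; rewrite in_itv /= andbT ltrNl.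
  apply: (le_lt_trans (ler_norm _)); rewrite normrN.
  exact: archi_boundP (normr_ge0 x).
- move=> _ [x ->]; rewrite -setCitvl.
  have mx : measurable (`]-oo, x]%classic : set R) by exact: measurable_itv.
  have e1 := probability_setC m1 mx; have e2 := probability_setC m2 mx.
  transitivity (1 - m1 `]-oo, x]%classic)%E; first exact: e1.
  by rewrite m12; exact: (esym e2).
- by move=> n; apply: (le_lt_trans (probability_le1 m1 _)); rewrite ?ltry.
Qed.

(** * From the random graph to independent points *)

Section graph_law.
Context {R : realType} (alpha nu : R) (n : nat) d (T : measurableType d) (P : probability T R).
Context (r theta : 'I_n -> {RV P >-> R}) (F unif : probability R R).
Hypothesis par : 1 / 2 < alpha /\ 0 < nu.
Hypothesis nn : nu < n%:R.
Hypothesis S : kpkvb_sample alpha nu r theta.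
Hypothesis FE : forall x, F `]-oo, x]%classic = (rcdf alpha (disk_radius nu n) x)%:E.
Hypothesis unifU : forall A, measurable A -> unif A = uniform_prob (@ltNpi_pi R) A.
Local Notation D := (disk_radius nu n).
Local Notation mu := (F \x unif)%E.

Let D0 : 0 < D. Proof. have h := radius_gt0 par nn; exact: h. Qed.

Definition point i w : R * R := (r i w, theta i w).

Let mpoint i : measurable_fun setT (point i).
Proof. by apply/measurable_fun_pairP; split. Qed.

Lemma iid_sample : iid P mu point.
Proof.
have [mi ind cdfE thE] := S; split => // A mA.
have lawr i B : measurable B -> P (r i @^-1` B) = F B.
  move=> mB; apply: (prob_ext (m1 := distribution P (r i))) => // x.
  by rewrite FE; exact: (cdfE i x).
have lawt i B : measurable B -> P (theta i @^-1` B) = unif B.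
  by move=> mB; rewrite unifU// -(thE i B mB).
have law i B : measurable B -> P (point i @^-1` B) = mu B.
  move=> mB.
  pose c : {mfun T >-> (R * R)%type} := HB.pack (point i) (isMeasurableFun.Build _ _ _ _ _ (mpoint i)).
  apply/esym; apply: (product_measure_unique (m' := distribution P c)) => // B1 B2 mB1 mB2.
  transitivity (P (r i @^-1` B1 `&` theta i @^-1` B2)); first by [].
  by rewrite ind// lawr// lawt.
have := mi [set: 'I_n]%SET A mA.
have -> : \bigcap_(i in [set` [set: 'I_n]%SET]) ((fun w => (r i w, theta i w)) @^-1` A i) = [set w | forall i, A i (point i w)].
  apply/seteqP; split => w /= h i; last by move=> _; exact: h.
  by apply: (h i); rewrite /= finset.in_setT.
move=> ->; rewrite (eq_bigl predT); last by move=> i; rewrite finset.in_setT.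
by congr (_%:E); apply: eq_bigr => i _; rewrite law.
Qed.

(** Degrees for the clamped adjacency; almost surely they are those of the graph. *)
Definition deg w i : nat := #|[pred j | (j != i) && adj D (point i w) (point j w)]|.

Definition cnt k w : nat := #|[pred i | deg w i == k]|.

Lemma measurable_cnt k : measurable_fun setT (cnt k).
Proof.
apply: (measurable_fun_card R) => i; apply: (measurable_natcomp (fun l => l == k)).
apply: (measurable_fun_card R) => j; apply: measurable_and => //.
by apply: measurable_adjT; exact: mpoint.
Qed.

Let good w := [forall i, 0 < r i w <= D].

Let mgood : measurable_fun setT good.
Proof.
apply: (measurable_forallb R) => i; apply: measurable_and.
  by apply: measurable_fun_ltr => //.
by apply: measurable_fun_ler.
Qed.

Let pr_good : pr P good = 1.
Proof.
have [a0 n0] := par; have hp : 1 / 2 < alpha /\ 0 < D by [].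
have [mX iX] := iid_sample.
have ms : measurable_fun setT (fun v : R * R => 0 < v.1 <= D).
  by apply: measurable_and; [apply: measurable_fun_ltr|apply: measurable_fun_ler] => //; exact: measurable_fst.
have := iX (fun=> [set v : R * R | 0 < v.1 <= D]) (fun _ => measurable_event ms).
have -> : [set w | forall i : 'I_n, [set v : R * R | 0 < v.1 <= D] (point i w)] = [set w | good w].
  by apply/seteqP; split => w /= h; [apply/forallP|move/forallP: h].
rewrite /pr => -> /=; apply: big1 => i _.
rewrite -[LHS]/(pr mu (fun v : R * R => 0 < v.1 <= D)) pr_prod//.
pose ind (x : R) : R := (0 < x <= D)%R%:R.
rewrite (_ : (fun x => _) = ind).
  rewrite mean_bool; first exact: (pr_radius_support hp FE).
  by apply: measurable_and; [exact: measurable_fun_ltr|exact: measurable_fun_ler].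
apply/funext => x; rewrite /pr /ind /=; case: (0 < x <= D).
  by rewrite (_ : [set _ | _] = setT) ?probability_setT//; apply/seteqP; split.
by rewrite (_ : [set _ | _] = set0) ?measure0//; apply/seteqP; split.
Qed.

Let good_cnt w k : good w -> nb_degree nu r theta k w = cnt k w.
Proof.
move=> /forallP hg; apply: eq_card => i; rewrite !inE; congr (_ == _).
apply: eq_card => j; rewrite !inE /kpkvb_adj eq_sym; congr (_ && _).
have cl l : clamp D (r l w) = r l w.
  by apply: clamp_id; have /andP[r0 rD] := hg l; rewrite (ltW r0).
by rewrite within_distanceE /adj /= !cl.
Qed.

Lemma nb_degree_law k (C : pred nat) :
  P [set w | C (nb_degree nu r theta k w)] = (pr P (fun w => C (cnt k w)))%:E.
Proof.
have m1 : measurable_fun setT (fun w => C (cnt k w)).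
  by apply: measurable_natcomp; exact: measurable_cnt.
have m2 : measurable_fun setT (fun w => C (nb_degree nu r theta k w)).
  apply: measurable_natcomp.
  have h := measurable_nb_degree_real nu r theta k.
  apply: (measurable_fun_card R) => i; apply: (measurable_natcomp (fun l => l == k)).
  by apply: (measurable_fun_card R) => j; exact: measurable_kpkvb_adj.
rewrite (prE P m2); congr (_%:E); rewrite -(mean_bool P m1) -(mean_bool P m2).
have [b1 _] := @bmeas_bool R _ _ _ m1; have [b2 _] := @bmeas_bool R _ _ _ m2.
by apply: (mean_eq_ae mgood pr_good b2 b1) => w hw; rewrite good_cnt.
Qed.

(** The falling factorial counts injections of [m] labels into the vertices of degree [k];
    [exchange] evaluates its expectation. *)
Lemma cnt_moment m k : (m <= n)%N ->
  (\int[P]_w ((cnt k w ^_ m)%:R)%:E = ((n ^_ m)%:R * pr (prodn mu m \x prodn mu (n - m))%E (@jointdeg R D m (n - m) k))%:E)%E.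
Proof.
move=> mn; have nmn : n = (m + (n - m))%N by rewrite subnKC.
have mj := @measurable_jointdeg R D m (n - m) k.
have := exchange nmn iid_sample mj.
have -> : (\int[prodn mu m]_v \int[prodn mu (n - m)]_w ((jointdeg D k (v, w))%:R)%:E = (pr (prodn mu m \x prodn mu (n - m))%E (@jointdeg R D m (n - m) k))%:E)%E.
  have bj := bmeas_pr (prodn mu (n - m)) mj.
  rewrite pr_prod// -(meanE _ bj); apply: eq_integral => v _.
  have mv : measurable_fun setT (fun w : (n - m).-tuple (R * R) => @jointdeg R D m (n - m) k (v, w)) by exact: (measurableT_comp mj (pair1_measurable v)).
  by rewrite integral_event// (prE _ mv).
rewrite -EFinM => ->; apply: eq_integral => w _; congr ((_%:R)%:E).
rewrite /cnt -[X in _ ^_ X](card_ord m) -card_inj_ffuns_on.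
apply: eq_card => s; rewrite !inE andbC; case: (boolP (injectiveb s)) => sI //=. have sI' : injective s by exact/injectiveP.
(* The degree splits into neighbours outside and inside the chosen block. *)
have key i : (ndeg D (point (s i) w) [tuple point (cotuple nmn s j) w | j < n - m] +
    ideg D [tuple point (s i0) w | i0 < m] i)%N = deg w (s i).
  rewrite /deg (card_split_cotuple nmn (fun j => (j != s i) && adj D (point (s i) w) (point j w)) sI').
  congr (_ + _)%N; apply: eq_card => j; rewrite !inE !tnth_mktuple.
    suff -> : cotuple nmn s j != s i by [].
    apply/eqP => e; have := codom_cotuple nmn (s i) sI'.
    by rewrite -{1}e codom_f codom_f.
  by rewrite (inj_eq sI').
apply/ffun_onP/forallP => [h i|h i].
  by rewrite /= tnth_mktuple key; have := h i; rewrite inE.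
by rewrite inE -key; have := h i; rewrite /= tnth_mktuple.
Qed.

End graph_law.

(** * The three regimes *)

Section scaling.
Context {R : realType}.

Lemma cvg_natr_powRN (p : R) : p < 0 -> n%:R `^ p @[n --> \oo] --> (0 : R).
Proof. by move=> p0; exact: (cvg_comp _ _ (@cvgr_idn R) (powR_cvgy p0)). Qed.

Lemma powR_le_id (v p : R) : 0 <= v -> v <= 1 -> 1 <= p -> v `^ p <= v.
Proof.
move=> v0 v1 p1; have [->|v00] := eqVneq v 0; first by rewrite powR0// gt_eqF// (lt_le_trans ltr01).
have vp : 0 < v by rewrite lt_neqAle eq_sym v00.
rewrite /powR (negbTE v00) -[leRHS](lnK (vp : v \is Num.pos)) ler_expR.
have l0 : ln v <= 0 by rewrite ln_le0.
by have := ler_wpM2r (_ : 0 <= - ln v) p1; rewrite oppr_ge0 => /(_ l0); lra.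
Qed.

Lemma cvg_powR0 (v : nat -> R) p : 1 <= p -> (\forall n \near \oo, 0 <= v n) ->
  v n @[n --> \oo] --> (0 : R) -> v n `^ p @[n --> \oo] --> (0 : R).
Proof.
move=> p1 v0 vc; apply: (squeeze_cvgr _ (cvg_cst (0 : R)) vc); near=> n.
rewrite powR_ge0 /=; apply: powR_le_id => //; first by near: n; exact: v0.
by near: n; exact: (cvgr_le _ vc _ ltr01).
Unshelve. all: by end_near. Qed.

Context (alpha xi : R).
Hypothesis hp : 1 / 2 < alpha /\ 0 < xi.
Local Notation pd := (pdens alpha xi).
Local Notation scale n := (n%:R `^ (1 / (2 * alpha + 1))).
Let A : R := 2 * alpha * xi `^ (2 * alpha).

Let b0 : 1 < 2 * alpha + 1. Proof. by have [a0 _] := hp; lra. Qed.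

Lemma scale_gt0 n : (0 < n)%N -> 0 < scale n.
Proof. by move=> n0; rewrite powR_gt0// ltr0n. Qed.

(** The scale is the one at which the expected number [n pd k] is of order 1. *)
Lemma mul_pdens_scale n k : (0 < n)%N -> n%:R * pd k%:R = A * (k%:R / scale n) `^ (- (2 * alpha + 1)).
Proof.
move=> n0; have nR : 0 <= n%:R :> R by [].
rewrite powRM ?invr_ge0 ?powR_ge0// -powRN -powRrM.
have b := b0; have -> : - (1 / (2 * alpha + 1)) * - (2 * alpha + 1) = 1 by field; rewrite gt_eqF//; lra.
by rewrite powRr1// /pdens -/A; ring.
Qed.

Lemma scale_large (K : R) : \forall n \near \oo, K <= scale n.
Proof.
have g0 : - (1 / (2 * alpha + 1)) < 0 by rewrite oppr_lt0 divr_gt0// (lt_trans ltr01).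
have h := cvg_natr_powRN g0.
have K0 : 0 < (`|K| + 1)^-1 by rewrite invr_gt0 ltr_wpDl.
near=> n.
have n0 : (0 < n)%N by near: n; exact: nbhs_infty_gt.
have : n%:R `^ (- (1 / (2 * alpha + 1))) <= (`|K| + 1)^-1 by near: n; exact: (cvgr_le _ h _ K0).
rewrite powRN lef_pV2 ?posrE ?scale_gt0 ?ltr_wpDl// => h1.
by apply: le_trans h1; rewrite ler_wpDr// ler_norm.
Unshelve. all: by end_near. Qed.

(** The square of the scale has exponent [2 / (2 alpha + 1)], below 1 as [alpha > 1/2]. *)
Lemma sqr_scale (k : nat -> nat) (C : R) : (\forall n \near \oo, (k n)%:R <= C * scale n) ->
  forall K : nat, \forall n \near \oo, (K * k n ^ 2 <= n)%N.
Proof.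
move=> kC K; have b := b0.
have g0 : 2 / (2 * alpha + 1) - 1 < 0.
  by rewrite subr_lt0 ltr_pdivrMr ?(lt_trans ltr01)// mul1r; have [a0 _] := hp; lra.
have h := cvg_natr_powRN g0.
have K0 : 0 < (K%:R * C ^+ 2 + 1)^-1 by rewrite invr_gt0 ltr_wpDl// mulr_ge0// sqr_ge0.
near=> n.
have n0 : (0 < n)%N by near: n; exact: nbhs_infty_gt.
have nR : 0 < n%:R :> R by rewrite ltr0n.
have kn : (k n)%:R <= C * scale n by near: n; exact: kC.
have : n%:R `^ (2 / (2 * alpha + 1) - 1) <= (K%:R * C ^+ 2 + 1)^-1 by near: n; exact: (cvgr_le _ h _ K0).
have -> : n%:R `^ (2 / (2 * alpha + 1) - 1) = scale n ^+ 2 / n%:R :> R.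
  rewrite powRD; last by apply/implyP => _; rewrite gt_eqF.
  rewrite powRN powRr1// -powR_mulrn ?powR_ge0// -powRrM; congr (_ `^ _ / _).
  by field; rewrite gt_eqF// (lt_trans ltr01).
rewrite -(ler_nat R) natrM natrX ler_pdivrMr// => h1.
have h2 : (k n)%:R ^+ 2 <= C ^+ 2 * scale n ^+ 2 by rewrite -exprMn lerXn2r// nnegrE// (le_trans _ kn).
have Kp : 0 < K%:R * C ^+ 2 + 1 by rewrite -invr_gt0.
rewrite ler_pdivlMl// in h1.
apply: (le_trans (ler_wpM2l (ler0n R K) h2)); apply: le_trans h1.
by rewrite mulrA; apply: ler_wpM2r; [exact: sqr_ge0|rewrite lerDl].
Unshelve. all: by end_near. Qed.

Lemma cvg_infty_scale (k : nat -> nat) (c : R) : 0 < c -> (\forall n \near \oo, c * scale n <= (k n)%:R) ->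
  k n @[n --> \oo] --> \oo.
Proof.
move=> c0 hk; apply/cvgnyPge => N; near=> n.
have h1 : N%:R / c <= scale n by near: n; exact: scale_large.
have h2 : c * scale n <= (k n)%:R by near: n; exact: hk.
by rewrite -(ler_nat R); apply: le_trans h2; rewrite mulrC -ler_pdivrMr.
Unshelve. all: by end_near. Qed.

End scaling.

Section moments.
Context {R : realType}.
Context (alpha nu : R) (F : nat -> probability R R) (unif : probability R R).
Hypothesis par : 1 / 2 < alpha /\ 0 < nu.
Hypothesis unifU : forall A, measurable A -> unif A = uniform_prob (@ltNpi_pi R) A.
Local Notation Dn := (disk_radius nu).
Local Notation xi := (kpkvb_xi alpha nu).
Hypothesis FE : forall n, nu < n%:R -> forall x, F n `]-oo, x]%classic = (rcdf alpha (Dn n) x)%:E.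
Local Notation pd := (pdens alpha xi).
Local Notation con n := (conp (Dn n) (F n) unif).
Local Notation Pi := (limit_degree_pmf alpha nu).

Let xi0 : 0 < xi. Proof. exact: xi_gt0 par. Qed.
Let hp : 1 / 2 < alpha /\ 0 < xi. Proof. by have [] := par. Qed.

Definition joint_pr m n k : R :=
  pr (prodn (F n \x unif)%E m \x prodn (F n \x unif)%E (n - m))%E (@jointdeg R (Dn n) m (n - m) k).

Lemma pdens_gt0 k : (0 < k)%N -> 0 < pd k%:R.
Proof.
by move=> k0; have [a0 _] := par; rewrite pdens_exp ?ltr0n// mulr_gt0 ?expR_gt0// divr_gt0//; lra.
Qed.

Lemma joint_pr1_cvg k : joint_pr 1 n k @[n --> \oo] --> Pi k.
Proof.
rewrite /joint_pr; under eq_fun do rewrite pr_joint1//.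
exact: cvg_single.
Qed.

(** In [joint2_le] the adjacency term vanishes by Jensen from [n E[con^2]] tending to 0, and so does
    the correlation term. *)
Lemma joint_pr2_limsup k (e : R) : 0 < e -> \forall n \near \oo, joint_pr 2 n k <= Pi k ^+ 2 + e.
Proof.
move=> e0.
have c2 := cvg_mean_con2 par unifU FE.
have c1 : mean (F n) (con n) @[n --> \oo] --> (0 : R).
  apply/cvgrPdist_le => d d0; have d2 : 0 < d ^+ 2 by rewrite exprn_gt0.
  near=> n.
  have h : n%:R * mean (F n) (fun r => con n r ^+ 2) <= d ^+ 2 by near: n; exact: (cvgr_le _ c2 _ d2).
  have n1 : 1 <= n%:R :> R by near: n; exact: nbhs_infty_ger.
  have m0 : 0 <= mean (F n) (con n) by apply: mean_ge0 => r; case/andP: (conp01 (Dn n) (F n) unif r).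
  rewrite sub0r normrN ger0_norm//.
  rewrite -(@ler_pXn2r _ 2)// ?nnegrE ?(ltW d0)//; apply: le_trans h.
  have bc := bmeas_conp unif (Dn n) (F n).
  have c0 r : 0 <= con n r by case/andP: (conp01 (Dn n) (F n) unif r).
  apply: (le_trans (jensen_pow (F n) 2 bc c0)).
  by rewrite ler_peMl// mean_ge0// => r; exact: sqr_ge0.
have c3 := cvg_single par unifU FE 2 (k := k).
have h8 : (fun _ : nat => 8 : R) n @[n --> \oo] --> (8 : R) by exact: cvg_cst.
have := seq_cvgD (seq_cvgD c1 (seq_cvgM c3 c3)) (seq_cvgM h8 c2).
rewrite mulr0 addr0 add0r -expr2 => h.
have lt : Pi k ^+ 2 < Pi k ^+ 2 + e by rewrite ltrDl.
near=> n.
have hn : mean (F n) (con n) + mean (F n) (fun r => bin_exp (con n r) (n - 2) (fun a => (a == k)%:R)) *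
    mean (F n) (fun r => bin_exp (con n r) (n - 2) (fun a => (a == k)%:R)) +
    8 * (n%:R * mean (F n) (fun r => con n r ^+ 2)) <= Pi k ^+ 2 + e by near: n; exact: (cvgr_le _ h _ lt).
apply: (le_trans (joint2_le unifU (n - 2) (Dn n) (F n) k)); apply: le_trans hn.
rewrite -expr2 lerD2l mulrCA ler_wpM2l// ler_wpM2r ?ler_nat ?leq_subr//.
by apply: mean_ge0 => r; exact: sqr_ge0.
Unshelve. all: by end_near. Qed.

Lemma joint_pr_ratio m (k : nat -> nat) : k n @[n --> \oo] --> \oo ->
  (forall K : nat, \forall n \near \oo, (K * k n ^ 2 <= n)%N) ->
  joint_pr m n (k n) / pd (k n)%:R ^+ m @[n --> \oo] --> (1 : R).
Proof.
case: m => [|m] koo ksq.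
  have h1 : (fun _ : nat => 1 : R) n @[n --> \oo] --> (1 : R) by exact: cvg_cst.
  apply: cvg_trans h1; apply: near_eq_cvg; apply: nearW => n.
  rewrite expr0 divr1 /joint_pr /pr (_ : [set x | _] = setT) ?probability_setT//.
  by apply/seteqP; split => // p _; apply/forallP => -[].
apply/cvgrPdist_le => e e0.
have [K hK] := uniform_joint par unifU FE (ltn0Sn m) e0.
near=> n.
have kK : (K <= k n)%N by near: n; move/cvgnyPge: koo; apply.
have k0 : (0 < k n)%N by near: n; move/cvgnyPge: koo; apply.
have kn : (K * k n ^ 2 <= n)%N by near: n; exact: ksq.
have [_ _ /andP[h1 h2]] := hK n (k n) kK kn.
have p0 : 0 < pd (k n)%:R ^+ m.+1 by rewrite exprn_gt0// pdens_gt0.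
rewrite distrC ler_norml lerBrDr lerBlDr ler_pdivlMr// ler_pdivrMr//.
by rewrite addrC h1 addrC h2.
Unshelve. all: by end_near. Qed.

Lemma cvg_ffact m : (n ^_ m)%:R / n%:R ^+ m @[n --> \oo] --> (1 : R).
Proof.
elim: m => [|m IH].
  have h1 : (fun _ : nat => 1 : R) n @[n --> \oo] --> (1 : R) by exact: cvg_cst.
  by apply: cvg_trans h1; apply: near_eq_cvg; apply: nearW => n; rewrite ffactn0 expr0 divr1.
have hm : (fun _ : nat => m%:R : R) n @[n --> \oo] --> (m%:R : R) by exact: cvg_cst.
have h1 : (fun _ : nat => 1 : R) n @[n --> \oo] --> (1 : R) by exact: cvg_cst.
have := seq_cvgM IH (seq_cvgB h1 (seq_cvgM hm (@cvg_invn R))).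
rewrite mulr0 subr0 mulr1 => h; apply: cvg_trans h; apply: near_eq_cvg; near=> n.
have n0 : 0 < n%:R :> R by near: n; exact: nbhs_infty_gtr.
have mn : (m <= n)%N by near: n; exact: nbhs_infty_ge.
rewrite ffactnSr natrM natrB// exprSr; field.
by rewrite gt_eqF// expf_neq0// gt_eqF.
Unshelve. all: by end_near. Qed.

Let cancel_aux (u y N p : R) : N != 0 -> p != 0 -> u / N * (y / p) * (N * p) = u * y.
Proof. by move=> h1 h2; field; rewrite h1 h2. Qed.

Lemma factorial_moment_limit m (k : nat -> nat) (lam : R) : k n @[n --> \oo] --> \oo ->
  (forall K : nat, \forall n \near \oo, (K * k n ^ 2 <= n)%N) ->
  n%:R * pd (k n)%:R @[n --> \oo] --> lam ->
  (n ^_ m)%:R * joint_pr m n (k n) @[n --> \oo] --> lam ^+ m.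
Proof.
move=> koo ksq hl.
have hX j : (n%:R * pd (k n)%:R) ^+ j @[n --> \oo] --> lam ^+ j.
  elim: j => [|j IH]; first exact: cvg_cst.
  have := seq_cvgM hl IH; rewrite -exprS => h; apply: cvg_trans h; apply: near_eq_cvg.
  by apply: nearW => n; rewrite exprS.
have := seq_cvgM (seq_cvgM (cvg_ffact m) (joint_pr_ratio m koo ksq)) (hX m).
rewrite !mul1r => h; apply: cvg_trans h; apply: near_eq_cvg; near=> n.
have k0 : (0 < k n)%N by near: n; move/cvgnyPge: koo; apply.
have n0 : 0 < n%:R :> R by near: n; exact: nbhs_infty_gtr.
by rewrite (exprMn m n%:R (pd (k n)%:R)); apply: cancel_aux; rewrite expf_neq0// gt_eqF// pdens_gt0.
Unshelve. all: by end_near. Qed.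

Let ratio_aux (e p x y : R) : 0 < e -> e <= 1 -> 0 < p -> (1 - e / 8) * p <= x -> x <= (1 + e / 8) * p ->
  (1 - e / 8) * p <= y -> y <= (1 + e / 8) * p -> `|x / y - 1| <= e.
Proof.
move=> e0 e1 p0 x1 x2 y1 y2.
have e8 : 0 < 1 - e / 8 by lra.
have y0 : 0 < y by apply: lt_le_trans y1; rewrite mulr_gt0.
have py : (1 - e / 8) * p * e <= y * e by rewrite ler_pM2r.
have ep : e * (e * p) <= e * p by rewrite ler_piMl// mulr_ge0// ltW.
rewrite -[X in _ / _ - X](@divff _ y) ?gt_eqF// -mulrBl normrM normfV (ger0_norm (ltW y0)) ler_pdivrMr//.
by rewrite ler_norml; apply/andP; split; lra.
Qed.

Let sq_aux (e p x y : R) : 0 < e -> e <= 1 -> 0 < p -> x <= (1 + e / 8) * p ^+ 2 ->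
  (1 - e / 8) * p <= y -> x <= (1 + e) * y ^+ 2.
Proof.
move=> e0 e1 p0 x1 y1; have e8 : 0 < 1 - e / 8 by lra.
apply: (le_trans x1); apply: (@le_trans _ _ ((1 + e) * ((1 - e / 8) * p) ^+ 2)); last first.
  rewrite ler_wpM2l//; first by lra.
  by rewrite lerXn2r// nnegrE ?mulr_ge0// ?(ltW e8) ?(ltW p0)// (le_trans _ y1)// mulr_ge0// ltW.
have -> : (1 + e) * ((1 - e / 8) * p) ^+ 2 = ((1 + e) * ((1 - e / 8) * (1 - e / 8))) * p ^+ 2 by ring.
by rewrite ler_wpM2r ?sqr_ge0//; nra.
Qed.

(** The sequence [k n] may alternate between small and large values. Beyond a fixed [K] the
    estimates of [uniform_joint] apply; the finitely many smaller degrees are treated by convergence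
    at fixed degree. *)
Lemma chebyshev_inputs (k : nat -> nat) (e : R) : 0 < e -> e <= 1 ->
  (forall K : nat, \forall n \near \oo, (K * k n ^ 2 <= n)%N) ->
  (forall C : R, \forall n \near \oo, (0 < k n)%N -> C <= n%:R * pd (k n)%:R) ->
  \forall n \near \oo, [/\ `|joint_pr 1 n (k n) / Pi (k n) - 1| <= e, joint_pr 2 n (k n) <= (1 + e) * Pi (k n) ^+ 2 &
    e^-1 <= n%:R * Pi (k n)].
Proof.
move=> e0 e1 ksq npd; have e8 : 0 < e / 8 by rewrite divr_gt0.
have [K1 hK1] := uniform_joint par unifU FE (ltn0Sn 0) e8.
have [K2 hK2] := uniform_joint par unifU FE (ltn0Sn 1) e8.
have e81 : 0 < 1 - e / 8 by lra.
(* Letting [n] grow at fixed [j] in the uniform bound compares [Pi j] with [pd j], without any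
   asymptotics of the incomplete gamma function. *)
have pi_pd j : (K1 <= j)%N -> (1 - e / 8) * pd j%:R <= Pi j /\ Pi j <= (1 + e / 8) * pd j%:R.
  move=> jK; have h := @joint_pr1_cvg j.
  have nb : \forall n \near \oo, (1 - e / 8) * pd j%:R <= joint_pr 1 n j <= (1 + e / 8) * pd j%:R.
    near=> n; have Kn : (K1 * j ^ 2 <= n)%N by near: n; exact: nbhs_infty_ge.
    have [_ _] := hK1 n j jK Kn.
    by rewrite expr1.
  have hc : cvg (joint_pr 1 n j @[n --> \oo]) by apply/cvg_ex; exists (Pi j).
  rewrite -(cvg_lim _ h)//; split; [apply: limr_ge => //|apply: limr_le => //].
    by apply: filterS nb => n /andP[].
  by apply: filterS nb => n /andP[].
pose K := (maxn (maxn K1 K2) 1).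
have small : \forall n \near \oo, forall j : 'I_K, [/\ `|joint_pr 1 n j / Pi j - 1| <= e, joint_pr 2 n j <= (1 + e) * Pi j ^+ 2 &
    e^-1 <= n%:R * Pi j].
  apply: filter_forall => j; have p0 := limit_degree_pmf_gt0 par unifU FE j.
  have hc : (fun _ : nat => (Pi j)^-1 : R) n @[n --> \oo] --> (Pi j)^-1 by exact: cvg_cst.
  have h1 := seq_cvgM (@joint_pr1_cvg j) hc; rewrite divff ?gt_eqF// in h1.
  have ep : 0 < e * Pi j ^+ 2 by rewrite mulr_gt0// exprn_gt0.
  have n1 : \forall n \near \oo, `|joint_pr 1 n j / Pi j - 1| <= e.
    by have /cvgrPdist_le/(_ _ e0) := h1; apply: filterS => n; rewrite distrC.
  have n2 := @joint_pr2_limsup j _ ep.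
  near=> n; split; [by near: n; exact: n1| |].
    by rewrite mulrDl mul1r; near: n; exact: n2.
  by rewrite -ler_pdivrMr//; near: n; exact: nbhs_infty_ger.
have nK1 := ksq K1; have nK2 := ksq K2; have nC := npd (e^-1 / (1 - e / 8)).
near=> n.
have hs : forall j : 'I_K, [/\ `|joint_pr 1 n j / Pi j - 1| <= e, joint_pr 2 n j <= (1 + e) * Pi j ^+ 2 &
    e^-1 <= n%:R * Pi j] by near: n; exact: small.
have [kK|kK] := ltnP (k n) K; first exact: (hs (Ordinal kK)).
have k1 : (K1 <= k n)%N by apply: leq_trans kK; rewrite /K !leq_max leqnn.
have k2 : (K2 <= k n)%N by apply: leq_trans kK; rewrite /K !leq_max leqnn orbT.
have k0 : (0 < k n)%N by apply: leq_trans kK; rewrite /K leq_max leqnn orbT.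
have p0 := pdens_gt0 k0.
have Kn1 : (K1 * k n ^ 2 <= n)%N by near: n; exact: nK1.
have Kn2 : (K2 * k n ^ 2 <= n)%N by near: n; exact: nK2.
have [_ _ /andP[a1 a2]] := hK1 n (k n) k1 Kn1.
have [_ _ /andP[a3 a4]] := hK2 n (k n) k2 Kn2.
have [b1 b2] := pi_pd _ k1.
rewrite expr1 in a1 a2.
split; [exact: ratio_aux e0 e1 p0 a1 a2 b1 b2|exact: sq_aux e0 e1 p0 a4 b1|].
have nc : e^-1 / (1 - e / 8) <= n%:R * pd (k n)%:R by move: k0; near: n; exact: nC.
apply: le_trans (ler_wpM2l (ler0n R n) b1); rewrite mulrCA mulrC -ler_pdivrMr//.
Unshelve. all: by end_near. Qed.

End moments.

Section natural_valued.
Context {R : realType}.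

Lemma pr_lt_sum d (T : measurableType d) (P : probability T R) (f : T -> nat) n : measurable_fun setT f ->
  pr P (fun w => (f w < n)%N) = \sum_(j < n) pr P (fun w => f w == j).
Proof.
move=> mf; elim: n => [|n IH].
  rewrite big_ord0 /pr (_ : [set x | _] = set0) ?measure0//.
  by apply/seteqP; split.
have ml : measurable_fun setT (fun w => (f w < n.+1)%N) by exact: (measurable_natcomp (fun j => (j < n.+1)%N)).
have me : measurable_fun setT (fun w => f w == n) by exact: (measurable_natcomp (fun j => j == n)).
rewrite big_ord_recr /= -IH (pr_split P ml me) addrC; congr (_ + _); congr (pr _ _); apply/funext => w.
  by case: eqVneq => [->|_]; rewrite ?ltnSn ?andbT ?andbF.
by rewrite ltnS [in RHS]ltn_neqAle andbC.
Qed.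

Lemma nat_le_real (x : R) : exists n, forall j : nat, (j%:R <= x) = (j < n)%N.
Proof.
have ex : exists n : nat, x < n%:R.
  exists (Num.bound `|x|); apply: (le_lt_trans (ler_norm _)); exact: archi_boundP (normr_ge0 x).
exists (ex_minn ex) => j; case: ex_minnP => n xn mn.
apply/idP/idP => [jx|jn]; first by rewrite -(ltr_nat R); exact: le_lt_trans xn.
by rewrite leNgt; apply/negP => /mn; rewrite leqNgt jn.
Qed.

Lemma mean_natr_le d (T : measurableType d) (P : probability T R) (f : T -> nat) (M : R) : measurable_fun setT f ->
  (\int[P]_w ((f w)%:R)%:E = M%:E)%E -> pr P (fun w => f w != 0%N) <= M.
Proof.
move=> mf hM; have mb : measurable_fun setT (fun w => f w != 0%N) by exact: (measurable_natcomp (fun j => j != 0%N)).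
rewrite -lee_fin -hM -(prE P mb) -(integral_event P mb); apply: ge0_le_integral => //.
- exact: measurable_fun_eventE.
- by apply/measurable_EFinP; exact: (measurable_natcomp (fun j => j%:R : R)).
- by move=> w _; rewrite lee_fin ler_nat; case: (f w).
Qed.

(** Chebyshev's inequality, with the variance expressed by the first two factorial moments. *)
Lemma chebyshev_nat d (T : measurableType d) (P : probability T R) (f : T -> nat) (B : nat) (n : nat) (p1 p2 q e eps : R) :
  measurable_fun setT f -> (forall w, (f w <= B)%N) -> (0 < n)%N -> 0 < q -> 0 < e -> e <= 1 -> 0 < eps -> 0 <= p2 ->
  (\int[P]_w ((f w ^_ 1)%:R)%:E = ((n ^_ 1)%:R * p1)%:E)%E ->
  (\int[P]_w ((f w ^_ 2)%:R)%:E = ((n ^_ 2)%:R * p2)%:E)%E ->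
  `|p1 / q - 1| <= e -> p2 <= (1 + e) * q ^+ 2 -> e^-1 <= n%:R * q ->
  pr P (fun w => eps < `|(f w)%:R / (n%:R * q) - 1|) <= 5 * e / eps ^+ 2.
Proof.
move=> mf fB n0 q0 e0 e1 eps0 p20 m1 m2 h1 h2 h3.
have nR : 0 < n%:R :> R by rewrite ltr0n.
have nq : 0 < n%:R * q by rewrite mulr_gt0.
have bf (g : nat -> R) : bmeas (fun w => g (f w)).
  split; first exact: (measurable_natcomp g mf).
  exists (\sum_(j < B.+1) `|g j|) => w.
  have wB : (f w < B.+1)%N by rewrite ltnS.
  by rewrite (bigD1 (Ordinal wB))//= lerDl sumr_ge0.
have mE (g : nat -> R) c : (\int[P]_w (g (f w))%:E = c%:E)%E -> mean P (fun w => g (f w)) = c.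
  by rewrite /mean => ->.
have M1 := mE (fun j => (j ^_ 1)%:R) _ m1; have M2 := mE (fun j => (j ^_ 2)%:R) _ m2.
pose c := (n%:R * q)^-1.
have c0 : 0 < c by rewrite invr_gt0.
(* The squared relative deviation, expanded in falling factorials. *)
pose V w : R := c ^+ 2 * (f w ^_ 2)%:R + ((c ^+ 2 - 2 * c) * (f w ^_ 1)%:R + 1).
have VE w : V w = ((f w)%:R / (n%:R * q) - 1) ^+ 2.
  rewrite /V -/c ffactn1 ffactnS ffactn1; case: (f w) => [|j]; first by rewrite mul0n !mulr0 !mul0r; ring.
  by rewrite natrM /= -natr1; ring.
have bV1 := bmeasM (bmeas_cst _ (c ^+ 2)) (bf (fun j => (j ^_ 2)%:R)).
have bV2 := bmeasM (bmeas_cst _ (c ^+ 2 - 2 * c)) (bf (fun j => (j ^_ 1)%:R)).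
have bV3 := bmeasD bV2 (bmeas_cst T 1).
have bV : bmeas V := bmeasD bV1 bV3.
have mb : measurable_fun setT (fun w => eps < `|(f w)%:R / (n%:R * q) - 1|).
  exact: (measurable_natcomp (fun j => eps < `|j%:R / (n%:R * q) - 1|) mf).
apply: (@le_trans _ _ (mean P V / eps ^+ 2)).
  have -> : mean P V / eps ^+ 2 = mean P (fun w => (eps ^+ 2)^-1 * V w) by rewrite (meanZ P _ bV) mulrC.
  rewrite -(mean_bool P mb).
  apply: mean_le; [exact: bmeas_bool|exact: (bmeasM (bmeas_cst _ _) bV)|] => w.
  rewrite VE; case: ltP => h; last by rewrite mulr_ge0// ?invr_ge0 sqr_ge0.
  rewrite mulrC ler_pdivlMr ?exprn_gt0// mul1r -[leRHS]real_normK ?num_real//.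
  by rewrite lerXn2r// ?nnegrE ?(ltW eps0)// ltW.
apply: ler_wpM2r; first by rewrite invr_ge0 sqr_ge0.
rewrite (meanD P bV1 bV3) (meanD P bV2 (bmeas_cst T 1)) (meanZ P _ (bf (fun j => (j ^_ 2)%:R))) (meanZ P _ (bf (fun j => (j ^_ 1)%:R))).
rewrite M1 M2 mean_cst ffactn1.
have t2 : c ^+ 2 * ((n ^_ 2)%:R * p2) <= 1 + e.
  have q2 : 0 < q ^+ 2 by rewrite exprn_gt0.
  apply: (@le_trans _ _ (c ^+ 2 * (n%:R ^+ 2 * ((1 + e) * q ^+ 2)))).
    apply: ler_wpM2l; first exact: sqr_ge0.
    apply: ler_pM => //; rewrite ffactnS ffactn1 natrM expr2 ler_wpM2l// ler_nat leq_pred//.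
  by rewrite /c le_eqVlt; apply/orP; left; apply/eqP; field; rewrite !gt_eqF.
pose x := p1 / q.
have xE : c * (n%:R * p1) = x by rewrite /c /x; field; rewrite !gt_eqF.
have ce : c <= e by rewrite /c -[leRHS]invrK lef_pV2 ?posrE ?invr_gt0.
have -> : (c ^+ 2 - 2 * c) * (n%:R * p1) = c * (c * (n%:R * p1)) - 2 * (c * (n%:R * p1)) by ring.
(* With [x] within [e] of 1 and [c x <= 2 e], the expansion [(1 + e) + c x - 2 x + 1] is at most
   [5 e]. *)
rewrite xE; move: h1; rewrite -/x ler_norml => /andP[x1 x2].
have x0 : x <= 2 by lra.
have xp : 0 <= x by lra.
have cx : c * x <= e * 2 by apply: ler_pM => //; exact: ltW.
lra.
Qed.

End natural_valued.

Section limits.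
Context {R : realType}.

Lemma cvg_EFin_near (u : nat -> \bar R) (v : nat -> R) (l : R) :
  (\forall n \near \oo, u n = (v n)%:E) -> v n @[n --> \oo] --> l -> u n @[n --> \oo] --> l%:E.
Proof.
move=> uv vl; have h : (v n)%:E @[n --> \oo] --> l%:E by apply/fine_cvgP; split => //; exact: nearW.
by apply: cvg_trans h; apply: near_eq_cvg; apply: filterS uv => n ->.
Qed.

End limits.

(** * Assembly of the three statements *)

Section degree_counts.
Context {R : realType}.
Context (alpha nu : R) (d : nat -> measure_display) (T : forall n, measurableType (d n))
  (P : forall n, probability (T n) R) (r theta : forall n, 'I_n -> {RV (P n) >-> R}) (k : nat -> nat).
Hypothesis par : 1 / 2 < alpha /\ 0 < nu.
Hypothesis smp : forall n, nu < n%:R -> kpkvb_sample alpha nu (@r n) (@theta n).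

Local Notation xi := (kpkvb_xi alpha nu).
Local Notation Pi := (limit_degree_pmf alpha nu).
Local Notation pd := (pdens alpha xi).
Local Notation scale n := (n%:R `^ (1 / (2 * alpha + 1))).
Local Notation N n := (cnt nu (@r n) (@theta n) (k n)).
Local Notation nb n := (nb_degree nu (@r n) (@theta n) (k n)).

Let hp : 1 / 2 < alpha /\ 0 < xi.
Proof. by have [a0 _] := par; split=> //; exact: xi_gt0. Qed.

(** One law serves for all [n]; it is read off a single vertex of some sample. *)
Lemma angular_law : exists unif : probability R R,
  forall A, measurable A -> unif A = uniform_prob (@ltNpi_pi R) A.
Proof.
have [_ n0] := par; pose n := Num.bound nu.
have nn : nu < n%:R by exact: archi_boundP (ltW n0).
have [_ _ _ hu] := smp nn.
have np : (0 < n)%N by rewrite -(ltr_nat R); exact: lt_trans nn.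
by exists (distribution (P n) (theta (Ordinal np))) => A; exact: hu.
Qed.

Lemma radial_laws : exists F : nat -> probability R R,
  forall n, nu < n%:R -> forall x, F n `]-oo, x]%classic = (rcdf alpha (disk_radius nu n) x)%:E.
Proof.
have [|F hF] := @choice nat (probability R R)
  (fun n F => nu < n%:R -> forall x, F `]-oo, x]%classic = (rcdf alpha (disk_radius nu n) x)%:E); last by exists F.
(* Below [nu] there is no sample, and an arbitrary law is chosen. *)
move=> n; have [nn|nn] := boolP (nu < n%:R); last by have [unif _] := angular_law; exists unif.
have [_ _ hc _] := smp nn.
have n0 : (0 < n)%N by rewrite -(ltr_nat R); apply: lt_trans nn; case: par.
by exists (distribution (P n) (r (Ordinal n0))) => _ x; exact: hc.
Qed.

Context (F : nat -> probability R R) (unif : probability R R).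
Hypothesis unifU : forall A, measurable A -> unif A = uniform_prob (@ltNpi_pi R) A.
Hypothesis FE : forall n, nu < n%:R -> forall x, F n `]-oo, x]%classic = (rcdf alpha (disk_radius nu n) x)%:E.
Local Notation joint_pr := (joint_pr nu F unif).

Lemma nb_law n (C : pred nat) : nu < n%:R -> P n [set w | C (nb n w)] = (pr (P n) (fun w => C (N n w)))%:E.
Proof. by move=> nn; exact: (nb_degree_law par nn (smp nn) (FE nn) unifU). Qed.

Lemma moment n m : nu < n%:R -> (m <= n)%N ->
  (\int[P n]_w ((N n w ^_ m)%:R)%:E = ((n ^_ m)%:R * joint_pr m n (k n))%:E)%E.
Proof. by move=> nn mn; exact: (cnt_moment (smp nn) (FE nn) unifU). Qed.

Let nbhs_nu : \forall n \near \oo, nu < n%:R.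
Proof. exact: nbhs_infty_gtr. Qed.

Lemma cnt_le n w : (N n w <= n)%N.
Proof. by apply: leq_trans (max_card _) _; rewrite card_ord. Qed.

(** Below the critical scale [n pd (k n)] tends to infinity, so the inputs of Chebyshev's inequality
    hold with arbitrarily small [e]. *)
Lemma degree_small : much_less (fun n => (k n)%:R) (fun n => scale n) ->
  cvg_in_probability P (fun n w => (nb n w)%:R / (n%:R * Pi (k n))) 1.
Proof.
have [a0 n0] := par; have xi0 := xi_gt0 par.
move=> [s0 sc] eps eps0.
have kle : \forall n \near \oo, (k n)%:R <= 1 * scale n.
  near=> n; have sn : 0 < scale n by near: n; exact: s0.
  rewrite -ler_pdivrMr//; near: n; exact: (cvgr_le _ sc _ ltr01).
have ksq := sqr_scale hp kle.
have A0 : 0 < 2 * alpha * xi `^ (2 * alpha) by rewrite mulr_gt0 ?powR_gt0// mulr_gt0//; lra.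
have b1 : 1 <= 2 * alpha + 1 by lra.
have v0 : \forall n \near \oo, 0 <= (k n)%:R / scale n by apply: nearW => n; rewrite divr_ge0// powR_ge0.
have vb := cvg_powR0 b1 v0 sc.
(* [pd 0] is 0 by the convention for powers of 0, whence the guard [0 < k n]; bounded degrees are
   handled inside [chebyshev_inputs]. *)
have npd C : \forall n \near \oo, (0 < k n)%N -> C <= n%:R * pd (k n)%:R.
  have C0 : 0 < 2 * alpha * xi `^ (2 * alpha) / (`|C| + 1) by rewrite divr_gt0// ltr_wpDl.
  near=> n => k0.
  have n1 : (0 < n)%N by near: n; exact: nbhs_infty_gt.
  have sn : 0 < scale n by near: n; exact: s0.
  have w0 : 0 < ((k n)%:R / scale n) `^ (2 * alpha + 1) by rewrite powR_gt0// divr_gt0// ltr0n.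
  have : ((k n)%:R / scale n) `^ (2 * alpha + 1) <= 2 * alpha * xi `^ (2 * alpha) / (`|C| + 1).
    by near: n; exact: (cvgr_le _ vb _ C0).
  rewrite (mul_pdens_scale hp _ n1) powRN ler_pdivlMr ?ltr_wpDl// mulrC -ler_pdivlMr// => h.
  by apply: le_trans h; rewrite ler_wpDr// ler_norm.
have N0 : pr (P n) (fun w => eps < `|(N n w)%:R / (n%:R * Pi (k n)) - 1|) @[n --> \oo] --> (0 : R).
  apply/cvgrPdist_le => dd dd0.
  pose e := Num.min 1 (dd * eps ^+ 2 / 5).
  have e0 : 0 < e by rewrite lt_min ltr01 divr_gt0// mulr_gt0// exprn_gt0.
  have e1 : e <= 1 by rewrite ge_min lexx.
  have e2 : 5 * e / eps ^+ 2 <= dd.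
    rewrite ler_pdivrMr ?exprn_gt0// mulrC -ler_pdivlMr//.
    by rewrite ge_min lexx orbT.
  have ci := chebyshev_inputs par unifU FE e0 e1 ksq npd.
  near=> n.
  have nn : nu < n%:R by near: n; exact: nbhs_nu.
  have n2 : (2 <= n)%N by near: n; exact: nbhs_infty_ge.
  have [h1 h2 h3] : [/\ `|joint_pr 1 n (k n) / Pi (k n) - 1| <= e, joint_pr 2 n (k n) <= (1 + e) * Pi (k n) ^+ 2 &
    e^-1 <= n%:R * Pi (k n)] by near: n; exact: ci.
  rewrite sub0r normrN ger0_norm; last exact: pr_ge0.
  apply: le_trans e2.
  apply: (@chebyshev_nat R _ _ (P n) (N n) n n (joint_pr 1 n (k n)) (joint_pr 2 n (k n)) (Pi (k n)) e eps) => //.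
  - exact: measurable_cnt.
  - exact: cnt_le.
  - exact: leq_trans n2.
  - exact: (limit_degree_pmf_gt0 par unifU FE).
  - exact: pr_ge0.
  - by apply: moment => //; exact: leq_trans n2.
  - exact: moment.
apply: (cvg_EFin_near _ N0); near=> n.
have nn : nu < n%:R by near: n; exact: nbhs_nu.
exact: (nb_law (fun j => eps < `|j%:R / (n%:R * Pi (k n)) - 1|) nn).
Unshelve. all: by end_near. Qed.

(** At the critical scale [n pd (k n)] tends to [lam], and the factorial moments to the powers of
    [lam]. *)
Lemma degree_critical c : 0 < c -> (k n)%:R / (c * scale n) @[n --> \oo] --> (1 : R) ->
  cvg_in_distribution (fun n => nb_degree_real nu (@r n) (@theta n) (k n) : {RV (P n) >-> R})
    (poisson_rv (2 * alpha * xi `^ (2 * alpha) * c `^ (- (2 * alpha + 1)))).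
Proof.
have [a0 n0] := par; have xi0 := xi_gt0 par.
move=> c0 kc; set lam := (X in poisson_rv X).
have lam0 : 0 < lam by rewrite /lam !mulr_gt0 ?powR_gt0//; lra.
have wE n : (0 < n)%N -> (k n)%:R = (k n)%:R / (c * scale n) * (c * scale n).
  by move=> n1; rewrite divfK// gt_eqF// mulr_gt0// scale_gt0.
have c2 : 0 < c / 2 by rewrite divr_gt0.
have koo : k n @[n --> \oo] --> \oo.
  have l2 : (1 / 2 : R) < 1 by lra.
  apply: (cvg_infty_scale hp c2); near=> n.
  have n1 : (0 < n)%N by near: n; exact: nbhs_infty_gt.
  have h : 1 / 2 <= (k n)%:R / (c * scale n) by near: n; exact: (cvgr_ge _ kc _ l2).
  rewrite wE//; apply: (@le_trans _ _ (1 / 2 * (c * scale n))); first by rewrite le_eqVlt; apply/orP; left; apply/eqP; ring.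
  by rewrite ler_pM2r// mulr_gt0// scale_gt0.
have kle : \forall n \near \oo, (k n)%:R <= (2 * c) * scale n.
  have l2 : 1 < 2 :> R by lra.
  near=> n.
  have n1 : (0 < n)%N by near: n; exact: nbhs_infty_gt.
  have h : (k n)%:R / (c * scale n) <= 2 by near: n; exact: (cvgr_le _ kc _ l2).
  rewrite wE// -[leRHS]mulrA; apply: ler_wpM2r => //.
  by rewrite mulr_ge0// ltW// scale_gt0.
have ksq := sqr_scale hp kle.
have npd : n%:R * pd (k n)%:R @[n --> \oo] --> lam.
  have hc : (fun _ : nat => lam) n @[n --> \oo] --> lam by exact: cvg_cst.
  have := seq_cvgM hc (cvg_powR1 (- (2 * alpha + 1)) kc); rewrite mulr1 => h.
  apply: cvg_trans h; apply: near_eq_cvg; near=> n.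
  have n1 : (0 < n)%N by near: n; exact: nbhs_infty_gt.
  rewrite (mul_pdens_scale hp _ n1).
  have sn := @scale_gt0 R alpha n n1.
  have -> : (k n)%:R / scale n = c * ((k n)%:R / (c * scale n)).
    by field; rewrite !gt_eqF.
  rewrite (@powRM _ c ((k n)%:R / (c * scale n))) ?(ltW c0) ?divr_ge0 ?mulr_ge0 ?(ltW c0) ?(ltW sn)//.
  by rewrite /lam mulrA.
have bN m n : bmeas (fun w => (N n w ^_ m)%:R : R).
  split; first exact: (measurable_natcomp (fun j => (j ^_ m)%:R : R) (measurable_cnt _ _ _ _)).
  exists (\sum_(j < n.+1) `|(j ^_ m)%:R|) => w.
  have wB : (N n w < n.+1)%N by rewrite ltnS; exact: cnt_le.
  by rewrite (bigD1 (Ordinal wB))//= lerDl sumr_ge0.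
have NM m n : (\int[P n]_w ((N n w ^_ m)%:R)%:E = (mean (P n) (fun w => (N n w ^_ m)%:R))%:E)%E.
  by rewrite /mean /Rintegral fineK//; apply: integrable_fin_num => //; exact: bmeas_integrable.
have Mlam m : mean (P n) (fun w => (N n w ^_ m)%:R) @[n --> \oo] --> lam ^+ m.
  have h := factorial_moment_limit par unifU FE (m := m) koo ksq npd.
  apply: cvg_trans h; apply: near_eq_cvg; near=> n.
  have nn : nu < n%:R by near: n; exact: nbhs_nu.
  have mn : (m <= n)%N by near: n; exact: nbhs_infty_ge.
  by apply/EFin_inj; rewrite -NM moment.
have hN j := @factorial_moments_poisson R d T P (fun n => N n) (fun n => measurable_cnt _ _ _ _) _ lam NM Mlam j.
move=> x _; have [K hK] := nat_le_real x.
(* At any [x] the distribution function is a finite sum of point masses, so their convergence is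
   enough. *)
have pE : cdf (poisson_rv lam) x = (\sum_(j < K) lam ^+ j / j`!%:R * expR (- lam))%:E.
  have pj j : pr (poisson_law lam) (fun i : nat => i == j) = lam ^+ j / j`!%:R * expR (- lam).
    rewrite /pr (_ : [set i | i == j] = [set j]); last by apply/seteqP; split => i /= => [/eqP|->].
    rewrite (_ : poisson_law lam [set j] = if 0 < lam then \esum_(i in [set j]) (poisson_pmf lam i)%:E else \d_0%N [set j])//.
    rewrite lam0 esum_set1 ?lee_fin ?poisson_pmf_ge0//.
    by rewrite /poisson_pmf lam0.
  under eq_bigr do rewrite -pj.
  rewrite -(@pr_lt_sum R _ _ (poisson_law lam) id K)// -prE//.
  congr (poisson_law lam _); apply/seteqP; split => j /=;
    by rewrite /poisson_rv /nat_to_real /= in_itv /= hK.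
rewrite pE.
have sl : \sum_(j < K) pr (P n) (fun w => N n w == j) @[n --> \oo] -->
    \sum_(j < K) lam ^+ j / j`!%:R * expR (- lam).
  by apply: cvg_sumr => j; exact: hN.
apply: (cvg_EFin_near _ sl); near=> n.
have nn : nu < n%:R by near: n; exact: nbhs_nu.
rewrite -pr_lt_sum; last exact: measurable_cnt.
rewrite -(nb_law (fun j => (j < K)%N) nn).
by congr (P n _); apply/seteqP; split => w /=; rewrite /nb_degree_real /= in_itv /= hK.
Unshelve. all: by end_near. Qed.

(** First moment method: the probability of a vertex of degree [k n] is at most the expected number
    of such vertices, which vanishes by [degree_large]. *)
Lemma degree_supercritical : much_less (fun n => scale n) (fun n => (k n)%:R) ->
  aas P (fun n => [set w | nb n w = 0%N]).
Proof.
have [a0 n0] := par; have xi0 := xi_gt0 par.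
move=> [k0 sc].
have koo : k n @[n --> \oo] --> \oo.
  apply: (cvg_infty_scale hp ltr01); near=> n.
  have kn : 0 < (k n)%:R :> R by near: n; exact: k0.
  by rewrite [leLHS]mul1r -[leRHS]mul1r -ler_pdivrMr//; near: n; exact: (cvgr_le _ sc _ ltr01).
have b1 : 1 <= 2 * alpha + 1 by lra.
have v0 : \forall n \near \oo, 0 <= scale n / (k n)%:R by apply: nearW => n; rewrite divr_ge0// powR_ge0.
have vb := cvg_powR0 b1 v0 sc.
have npd : n%:R * pd (k n)%:R @[n --> \oo] --> (0 : R).
  have hc : (fun _ : nat => 2 * alpha * xi `^ (2 * alpha)) n @[n --> \oo] --> 2 * alpha * xi `^ (2 * alpha).
    exact: cvg_cst.
  have := seq_cvgM hc vb; rewrite mulr0 => h.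
  apply: cvg_trans h; apply: near_eq_cvg; near=> n.
  have n1 : (0 < n)%N by near: n; exact: nbhs_infty_gt.
  rewrite (mul_pdens_scale hp _ n1); congr (_ * _).
  have vn : 0 <= scale n / (k n)%:R by rewrite divr_ge0// powR_ge0.
  rewrite -[(k n)%:R / scale n]invf_div -(powR_inv1 vn) -powRrM.
  by congr (_ `^ _); ring.
have dl := degree_large par unifU FE koo npd.
have m0 : \forall n \near \oo, pr (P n) (fun w => N n w != 0%N) <= n%:R * joint_pr 1 n (k n).
  near=> n.
  have nn : nu < n%:R by near: n; exact: nbhs_nu.
  have n1 : (1 <= n)%N by near: n; exact: nbhs_infty_ge.
  apply: mean_natr_le; first exact: measurable_cnt.
  have := moment nn n1; rewrite ffactn1 => <-; by apply: eq_integral => w _; rewrite ffactn1.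
have p0 : pr (P n) (fun w => N n w != 0%N) @[n --> \oo] --> (0 : R).
  apply: (squeeze_cvgr _ (cvg_cst (0 : R)) dl).
  by apply: filterS m0 => n h; rewrite pr_ge0.
have h1 : (fun _ : nat => 1 : R) n @[n --> \oo] --> (1 : R) by exact: cvg_cst.
have := seq_cvgB h1 p0; rewrite subr0 => h.
apply: (cvg_EFin_near _ h); near=> n.
have nn : nu < n%:R by near: n; exact: nbhs_nu.
have mb (b : pred nat) : measurable_fun setT (fun w => b (N n w)).
  by exact: (measurable_natcomp b (measurable_cnt _ _ _ _)).
rewrite (_ : [set w | _] = [set w | nb n w == 0%N]); last by apply/seteqP; split => w /= => [->|/eqP].
rewrite (nb_law (fun j => j == 0%N) nn); congr _%:E.
have e1 := pr_split (P n) (mb predT) (mb (fun j => j == 0%N)).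
have e2 : pr (P n) (fun w => predT (N n w)) = 1 by rewrite /pr (_ : [set w | _] = setT) ?probability_setT//; apply/seteqP; split.
have e3 : 1 = pr (P n) (fun w => N n w == 0%N) + pr (P n) (fun w => N n w != 0%N) by rewrite -e2; exact: e1.
by apply/eqP; rewrite eq_sym subr_eq -e3.
Unshelve. all: by end_near. Qed.

End degree_counts.
Theorem theorem1p5 (R : realType) (alpha nu : R)
    (d : nat -> measure_display) (T : forall n, measurableType (d n))
    (P : forall n, probability (T n) R)
    (r theta : forall n, 'I_n -> {RV (P n) >-> R})
    (k : nat -> nat) :
  1 / 2 < alpha -> 0 < nu ->
  (* below this threshold the disk radius is not positive *)
  (forall n, nu < n%:R -> kpkvb_sample alpha nu (@r n) (@theta n)) ->
  (forall n, (0 < n)%N -> (k n <= n - 1)%N) ->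
  let N n : {RV (P n) >-> R} := nb_degree_real nu (@r n) (@theta n) (k n) in
  let kR n : R := (k n)%:R in
  let scale n : R := n%:R `^ (1 / (2 * alpha + 1)) in
  [/\ much_less kR scale ->
        cvg_in_probability P
          (fun n w => N n w / (n%:R * limit_degree_pmf alpha nu (k n))) 1,
      forall c : R, 0 < c ->
        kR n / (c * scale n) @[n --> \oo] --> (1 : R) ->
        cvg_in_distribution N
          (poisson_rv (2 * alpha * kpkvb_xi alpha nu `^ (2 * alpha)
                       * c `^ (- (2 * alpha + 1)))) &
      much_less scale kR ->
        aas P (fun n => [set w | nb_degree nu (@r n) (@theta n) (k n) w = 0%N])].

Proof.
move=> a0 n0 smp _ N kR scale; have par := conj a0 n0.
have [F FE] := radial_laws par smp; have [unif unifU] := angular_law par smp.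
split; [exact: (degree_small par smp unifU FE)|exact: (degree_critical par smp unifU FE)|exact: (degree_supercritical par smp unifU FE)].
Qed.
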